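(* Let $\xi$ be a real random variable with mean zero, variance one, and such that for some $T_0>0$, $\mathbf{P}(|\xi|\ge t)=O(\exp(-t^2/T_0))$ for all $t>0$. Then there exist positive constants $K_0\ge1$ and $c_0$ with $0<c_0<1$, and a sufficiently small constant $\varepsilon_0>0$, all depending only on $\xi$, such that for all sufficiently large $n$, all integers $d$ with $2\le d\le n^{\varepsilon_0}$ and all $\varepsilon>0$, if $a^{(l)}_{i_1\dots i_d}$ ($1\le i_1,\dots,i_d\le n$, $1\le l\le n-1$) are iid copies of $\xi$ and $\mathbf f=(f_1,\dots,f_{n-1})$ with $f_l(\mathbf x)=\sum_{1\le i_1,\dots,i_d\le n}a^{(l)}_{i_1\dots i_d}x_{i_1}\cdots x_{i_d}$, the following hold. (1) (Non-existence of double roots) $$\mathbf{P}\left(\exists\,\mathbf x,\mathbf y\in S^{n-1}:\ \mathbf x\perp\mathbf y,\ \mathbf f(\mathbf x)=0,\ D_{\mathbf x}(\mathbf y)=0\right)\le c_0^n .$$ (2) (Regularity at roots and non-vanishing at critical points) $$\max\Big\{\mathbf{P}\big(\exists\,\mathbf x,\mathbf y\in S^{n-1}:\ \mathbf x\perp\mathbf y,\ \mathbf f(\mathbf x)=0,\ \|D_{\mathbf x}(\mathbf y)\|_2\le d^{9/4}\sqrt n\,\varepsilon\big),$$ $$\mathbf{P}\big(\exists\,\mathbf x,\mathbf y\in S^{n-1}:\ \mathbf x\perp\mathbf y,\ D_{\mathbf x}(\mathbf y)=0,\ \|\mathbf f(\mathbf x)\|_2\le d^{9/8}n^{1/4}\varepsilon^2\big)\Big\}\le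 K_0^nd^{9n/4}\varepsilon+c_0^n .$$ (3) (Simultaneous vanishing) $$\mathbf{P}\left(\exists\,\mathbf x,\mathbf y\in S^{n-1}:\ \mathbf x\perp\mathbf y,\ \|\mathbf f(\mathbf x)\|_2\le(d^{9/2}n)^{1/4}\varepsilon,\ \|\mathbf f(\mathbf y)\|_2\le(d^{9/2}n)^{1/4}\varepsilon\right)\le K_0^nd^{9n/4}\varepsilon^{1/2}+c_0^n .$$
   Context: $S^{n-1}$ is the Euclidean unit sphere of $\mathbf{R}^n$. $D_{\mathbf x}=\left(\frac{\partial f_l(\mathbf x)}{\partial x_j}\right)_{1\le l\le n-1,\,1\le j\le n}$ is the Jacobian matrix of $\mathbf f$ at $\mathbf x$, and $D_{\mathbf x}(\mathbf y)=D_{\mathbf x}\mathbf y\in\mathbf{R}^{n-1}$. *)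

(* Defs.v *)
From HB Require Import structures.
From mathcomp Require Import all_boot all_order all_algebra.
From mathcomp Require Import all_classical all_reals all_analysis.

Set Implicit Arguments.
Unset Strict Implicit.
Unset Printing Implicit Defensive.

Import Order.TTheory GRing.Theory Num.Theory.
Import numFieldNormedType.Exports.

Local Open Scope classical_set_scope.
Local Open Scope ring_scope.

(* Vectors of R^n are columns. The norm that MathComp-Analysis puts on matrices
   is the sup norm, so the Euclidean structure is defined here. *)
Definition dotp (R : realType) (n : nat) (x y : 'cV[R]_n) : R :=
  \sum_(i < n) x i 0 * y i 0.

Definition norm2 (R : realType) (n : nat) (x : 'cV[R]_n) : R :=
  Num.sqrt (\sum_(i < n) x i 0 ^+ 2).

Definition unit_sphere (R : realType) (n : nat) : set 'cV[R]_n :=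
  [set x | norm2 x = 1].

Definition jacobian_mx (R : realType) (m n : nat)
    (f : 'cV[R]_n -> 'cV[R]_m) (x : 'cV[R]_n) : 'M[R]_(m, n) :=
  \matrix_(l < m, j < n)
    ('D_(delta_mx j 0) (fun z : 'cV[R]_n => f z l 0) x : R).

(* A (l, (i_1, ..., i_d)) is the coefficient of x_{i_1} ... x_{i_d} in f_l; no
   symmetry in (i_1, ..., i_d) is imposed. *)
Definition poly_system (R : realType) (m n d : nat)
    (A : 'I_m * d.-tuple 'I_n -> R) (x : 'cV[R]_n) : 'cV[R]_m :=
  \col_(l < m) \sum_(i : d.-tuple 'I_n) A (l, i) * \prod_(k < d) x (tnth i k) 0.

Definition subgaussian_tail (R : realType) (disp : measure_display)
    (T : measurableType disp) (P : probability T R) (X : {RV P >-> R}) : Prop :=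
  exists2 T0 : R, 0 < T0 &
    exists C : R, forall t : R, 0 < t ->
      (P [set w | (t <= `|X w|)%R] <= (C * expR (- (t ^+ 2 / T0)))%:E)%E.

Definition mutually_independent (R : realType) (disp : measure_display)
    (T : measurableType disp) (P : probability T R) (I : finType)
    (X : I -> {RV P >-> R}) : Prop :=
  forall (J : {set I}) (B : I -> set R),
    (forall i, i \in J -> measurable (B i)) ->
    P [set w | forall i, i \in J -> B i (X i w)] =
    (\prod_(i in J) P (X i @^-1` B i))%E.

Definition identically_distributed (R : realType) (disp disp' : measure_display)
    (T : measurableType disp) (T' : measurableType disp')
    (P : probability T R) (P' : probability T' R)
    (X : {RV P >-> R}) (Y : {RV P' >-> R}) : Prop :=
  forall B : set R, measurable B -> distribution P X B = distribution P' Y B.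

Definition iid_copies (R : realType) (disp disp' : measure_display)
    (T : measurableType disp) (T' : measurableType disp')
    (P : probability T R) (P' : probability T' R) (xi : {RV P >-> R})
    (I : finType) (a : I -> {RV P' >-> R}) : Prop :=
  mutually_independent a /\ forall i, identically_distributed (a i) xi.

(* Main.v *)
Require Import Defs.
From HB Require Import structures.
From mathcomp Require Import all_boot all_order all_algebra.
From mathcomp Require Import all_classical all_reals all_analysis.
From mathcomp Require Import measurable_realfun ring lra zify.

Set Implicit Arguments.
Unset Strict Implicit.
Unset Printing Implicit Defensive.

Import Order.TTheory GRing.Theory Num.Theory.
Import numFieldNormedType.Exports.

Local Open Scope classical_set_scope.
Local Open Scope ring_scope.

(* For each part the right-hand side exceeds 1 unless eps is at most
   (K0 d^(9/4))^(-n), so it is enough to bound the probability that, for some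
   orthonormal x and y, both f(x) and D_x(y) / sqrt d (for the third part f(x)
   and f(y)) have norm at most sqrt n d^3 (K0 d^(9/4))^(-n). These are the
   images of the unit tensor U = x (x) ... (x) x and of a second unit tensor V.

   The rows of the system are independent. If g = 1 - |phi|^2, with phi the
   characteristic function of xi, then a Fourier estimate bounds the
   probability that a row is within (s1, s2) of a given value on (U, V) by
   O (s1 s2) times a double sum, over integers below 1 / s1 and 1 / s2, of
   exp (- sum_t g (k1 U_t + k2 V_t) / 2). There are three cases.
   - x (or y) has almost all its mass on few coordinates: few such vectors
     exist up to approximation, and any nontrivial bound per row suffices.
   - The sum over t is too small for some (k1, k2). Then a multiple of
     k1 U + k2 V is close to an integer tensor. Its slices are combinations of
     x and y, so that some unit vector of their plane is close to the direction
     of a short integer vector. At the scale given by the smallest such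
     (k1, k2), the net of these pairs is small enough for a union bound.
   - Otherwise the small ball probability is O (s1 s2) down to scale h. A net
     of orthonormal pairs of precision h for x and d^2 h for y needs about
     h^(1-n) (d^2 h)^(2-n) points, since n - 1 and n - 2 coordinates determine
     x and y; the n - 1 rows contribute (C d^(17/4) h^2)^(n-1), so a factor h
     is gained.

   Notation: lam is d^(1/24), and s is n^(1/16). *)

(** * Outer bounds for probabilities, expectations *)

(** Factors C^n are free, but the power of d per row is not: the exponent 9/4 must come out exactly.
    Nets whose precision is a power of 1/d have entropy of order n log d, so the norm bounds carry a
    factor of order sqrt (log d). It is replaced by [lam], and the exponent 1/24 is such that the
    six factors [lam] lost in the end make d^(1/4): two come from the product s1 s2 of the box
    sizes, four from the square of the spread constant r = r0 / (d lam^2).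

    The remaining power d^2 rests on two savings. On orthonormal pairs D_x(u) has norm of order sqrt
    (n d) lam, a factor d below what the norm of the d-linear map gives. And moving x by h moves
    f(x) by sqrt (n d) lam h, but can move D_x(y) / sqrt d by d^2 times more; so y is needed only to
    precision d^2 h, and the net shrinks by d^(2n) at no cost.

    Only one factor h is gained in total, so a net with one factor 1 / h too many would be useless:
    this is why the three coordinates fixed by orthonormality must really be omitted from it. *)

Section Outer.
Context (R : realType) (disp : measure_display) (Om : measurableType disp)
  (P : probability Om R).

(** The intermediate events quantify over uncountably many vectors, and their measurability is not
    established; a measurable superset of small probability is enough. Only the events of the
    theorem are shown to be measurable. *)
Definition outer_le (A : set Om) (p : R) : Prop :=
  exists B : set Om, [/\ measurable B, A `<=` B & (P B <= p%:E)%E].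

Lemma outer_leS (A A' : set Om) (p p' : R) :
  A `<=` A' -> p' <= p -> outer_le A' p' -> outer_le A p.
Proof.
move=> AA' pp' [B [mB A'B PB]]; exists B; split => //.
  exact: (subset_trans AA').
by apply: (le_trans PB); rewrite lee_fin.
Qed.

Lemma outer_leU (A A' : set Om) (p p' : R) :
  outer_le A p -> outer_le A' p' -> outer_le (A `|` A') (p + p').
Proof.
move=> [B [mB AB PB]] [B' [mB' AB' PB']]; exists (B `|` B'); split.
- exact: measurableU.
- exact: setUSS.
- apply: (le_trans (measureU2 P mB mB')).
  by rewrite EFinD leeD.
Qed.

Lemma outer_le_set0 (p : R) : 0 <= p -> outer_le set0 p.
Proof. by move=> p0; exists set0; split => //; rewrite measure0 lee_fin. Qed.

Lemma outer_le_seq (T : Type) (r : seq T) (E : T -> set Om) (p : R) :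
  0 <= p ->
  (forall g, List.In g r -> outer_le (E g) p) ->
  outer_le [set w | exists2 g, List.In g r & E g w] ((size r)%:R * p).
Proof.
move=> p0; elim: r => [|g r IH] H.
  rewrite /= mul0r; apply: (@outer_leS _ set0 _ 0) => //.
    by move=> w [].
  exact: outer_le_set0.
have H1 : outer_le (E g) p by apply: H; left.
have H2 := IH (fun g' i => H g' (or_intror i)).
apply: (outer_leS _ _ (outer_leU H1 H2)).
  move=> w [g' [<-|i] Ew]; first by left.
  by right; exists g'.
by rewrite /= -natr1; lra.
Qed.

Lemma outer_leP (A : set Om) (p : R) :
  measurable A -> outer_le A p -> (P A <= p%:E)%E.
Proof.
move=> mA [B [mB AB PB]]; apply: le_trans PB.
by apply: le_measure => //; rewrite inE.
Qed.

End Outer.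

Section Expect.
Context (R : realType) (disp : measure_display) (Om : measurableType disp)
  (P : probability Om R).

(** A class closed under sums and products and contained in the integrable functions, so that
    integrability needs no separate check in the Fourier computations. *)
Definition bmf (f : Om -> R) : Prop :=
  measurable_fun setT f /\ exists M : R, forall w, `|f w| <= M.

Definition Ex (f : Om -> R) : R := Rintegral P setT f.

Lemma bmf_integrable (f : Om -> R) : bmf f -> P.-integrable setT (EFin \o f).
Proof.
move=> [mf [M HM]]; apply: measurable_bounded_integrable => //.
  by rewrite ltey_eq fin_num_measure.
exists M; split; first exact: num_real.
by move=> x Mx t _; apply: (le_trans (HM t)); exact: ltW.
Qed.

Lemma bmfD f g : bmf f -> bmf g -> bmf (fun w => f w + g w).
Proof.
move=> [mf [M HM]] [mg [N HN]]; split; first exact: measurable_funD.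
exists (M + N) => w; apply: (le_trans (ler_normD _ _)); exact: lerD.
Qed.

Lemma bmfM f g : bmf f -> bmf g -> bmf (fun w => f w * g w).
Proof.
move=> [mf [M HM]] [mg [N HN]]; split; first exact: measurable_funM.
by exists (M * N) => w; rewrite normrM ler_pM.
Qed.

Lemma bmf_cst (c : R) : bmf (fun=> c).
Proof. by split => //; exists `|c|. Qed.

Lemma bmfZ c f : bmf f -> bmf (fun w => c * f w).
Proof. by move=> hf; apply: bmfM => //; exact: bmf_cst. Qed.

Lemma bmfN f : bmf f -> bmf (fun w => - f w).
Proof. by move=> [mf [M HM]]; split; [exact: measurableT_comp|exists M => w; rewrite normrN]. Qed.

Lemma bmfB f g : bmf f -> bmf g -> bmf (fun w => f w - g w).
Proof. by move=> hf hg; apply: bmfD => //; exact: bmfN. Qed.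

Lemma bmf_sum (I : Type) (r : seq I) (Q : pred I) (F : I -> Om -> R) :
  (forall i, bmf (F i)) -> bmf (fun w => \sum_(i <- r | Q i) F i w).
Proof.
move=> hF; elim: r => [|i r IH].
  under eq_fun do rewrite big_nil; exact: bmf_cst.
under eq_fun do rewrite big_cons.
by case: (Q i) => //; apply: bmfD.
Qed.

Lemma ExD f g : bmf f -> bmf g -> Ex (fun w => f w + g w) = Ex f + Ex g.
Proof. by move=> hf hg; rewrite /Ex RintegralD//; exact: bmf_integrable. Qed.

Lemma ExZ c f : bmf f -> Ex (fun w => c * f w) = c * Ex f.
Proof. by move=> hf; rewrite /Ex RintegralZl//; exact: bmf_integrable. Qed.

Lemma ExB f g : bmf f -> bmf g -> Ex (fun w => f w - g w) = Ex f - Ex g.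
Proof. by move=> hf hg; rewrite /Ex RintegralB//; exact: bmf_integrable. Qed.

Lemma Ex_cst c : Ex (fun=> c) = c.
Proof. by rewrite /Ex Rintegral_cst//= probability_setT mulr1. Qed.

Lemma Ex_le f g : bmf f -> bmf g -> (forall w, f w <= g w) -> Ex f <= Ex g.
Proof. by move=> hf hg h; apply: le_Rintegral => //; exact: bmf_integrable. Qed.

Lemma Ex_sum (I : Type) (r : seq I) (Q : pred I) (F : I -> Om -> R) :
  (forall i, bmf (F i)) ->
  Ex (fun w => \sum_(i <- r | Q i) F i w) = \sum_(i <- r | Q i) Ex (F i).
Proof.
move=> hF; elim: r => [|i r IH].
  by under eq_fun do rewrite big_nil; rewrite big_nil Ex_cst.
under eq_fun do rewrite big_cons.
by rewrite big_cons; case: (Q i) => //; rewrite ExD// ?IH//; exact: bmf_sum.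
Qed.

Lemma bmf_indic (A : set Om) : measurable A -> bmf (\1_A : Om -> R).
Proof.
move=> mA; split; first exact: measurable_indic.
by exists 1 => w; rewrite indicE; case: (_ \in _); rewrite ?normr1 ?normr0.
Qed.

Lemma Ex_indic (A : set Om) : measurable A -> (P A = (Ex (\1_A : Om -> R))%:E)%E.
Proof.
move=> mA; rewrite /Ex /Rintegral integral_indic// setIT fineK//.
exact: fin_num_measure.
Qed.

End Expect.

(** * Independence *)

Section PairLaw.
Context (R : realType) (disp d1 d2 : measure_display)
  (Om : measurableType disp) (T1 : measurableType d1) (T2 : measurableType d2)
  (P : probability Om R).

Definition indep2 (X : Om -> T1) (Y : Om -> T2) : Prop :=
  forall A B, measurable A -> measurable B ->
  P (X @^-1` A `&` Y @^-1` B) = (P (X @^-1` A) * P (Y @^-1` B))%E.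

(** The joint law and the product of the laws agree on rectangles, hence everywhere; Tonelli does
    the rest. *)
Lemma indep2_integral (X : {mfun Om >-> T1}) (Y : {mfun Om >-> T2})
    (f : T1 * T2 -> \bar R) :
  indep2 X Y -> measurable_fun setT f -> (forall z, 0 <= f z)%E ->
  (\int[P]_w f (X w, Y w) =
   \int[distribution P X]_x \int[distribution P Y]_y f (x, y))%E.
Proof.
move=> iXY mf f0.
have mXY : measurable_fun setT (fun w => (X w, Y w)).
  by apply: measurable_fun_pair; exact: measurable_funPT.
pose XY : {mfun Om >-> (T1 * T2)%type} := mfun_Sub (mem_set mXY).
have E1 : (\int[P]_w f (X w, Y w) = \int[distribution P XY]_z f z)%E.
  by rewrite ge0_integral_distribution.
have E2 : (\int[distribution P XY]_z f z =
    \int[distribution P X \x distribution P Y]_z f z)%E.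
  apply: eq_measure_integral => A mA _.
  by apply: esym; apply: product_measure_unique => // B C mB mC; exact: iXY.
by rewrite E1 E2 fubini_tonelli1.
Qed.

Lemma indep2_ge0_prod (X : {mfun Om >-> T1}) (Y : {mfun Om >-> T2})
    (g : T1 -> R) (h : T2 -> R) :
  indep2 X Y -> measurable_fun setT g -> measurable_fun setT h ->
  (forall x, 0 <= g x) -> (forall y, 0 <= h y) ->
  (\int[P]_w (g (X w) * h (Y w))%:E =
   (\int[P]_w (g (X w))%:E) * (\int[P]_w (h (Y w))%:E))%E.
Proof.
move=> iXY mg mh g0 h0.
have mf : measurable_fun setT (fun z : T1 * T2 => (g z.1 * h z.2)%:E).
  apply/measurable_EFinP; apply: measurable_funM.
    exact: (measurableT_comp mg measurable_fst).
  exact: (measurableT_comp mh measurable_snd).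
have f0 z : (0 <= (g z.1 * h z.2)%:E)%E by rewrite lee_fin mulr_ge0.
rewrite (@indep2_integral X Y (fun z => (g z.1 * h z.2)%:E) iXY mf f0)/=.
have mgE : measurable_fun setT (EFin \o g) by apply/measurable_EFinP.
have mhE : measurable_fun setT (EFin \o h) by apply/measurable_EFinP.
have EZ x : (\int[distribution P Y]_y (g x * h y)%:E =
    (g x)%:E * \int[distribution P Y]_y (h y)%:E)%E.
  under eq_integral do rewrite EFinM.
  by apply: ge0_integralZl => //; rewrite ?lee_fin// => y _; rewrite lee_fin.
under eq_integral do rewrite EZ.
have h00 : (0 <= \int[distribution P Y]_y (h y)%:E)%E.
  by apply: integral_ge0 => y _; rewrite lee_fin.
transitivity ((\int[distribution P X]_x (g x)%:E) *
    (\int[distribution P Y]_y (h y)%:E))%E.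
  under eq_integral do rewrite muleC.
  rewrite muleC.
  have [hoo|hoo] := eqVneq (\int[distribution P Y]_y (h y)%:E)%E +oo%E.
    rewrite hoo.
    apply: (@ge0_integralZl _ _ _ _ _ measurableT (EFin \o g)) => //.
    by move=> y _; rewrite lee_fin.
  apply: (@ge0_integralZl _ _ _ _ _ measurableT (EFin \o g)) => //.
  by move=> y _; rewrite lee_fin.
congr (_ * _)%E.
  by rewrite (ge0_integral_distribution _ mgE)// => y; rewrite lee_fin.
by rewrite (ge0_integral_distribution _ mhE)// => y; rewrite lee_fin.
Qed.

(** The nonnegative case applies to 1 + g and 1 + h; expanding both sides isolates the mixed
    term. *)
Lemma indep2_Ex (X : {mfun Om >-> T1}) (Y : {mfun Om >-> T2})
    (g : T1 -> R) (h : T2 -> R) :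
  indep2 X Y -> measurable_fun setT g -> measurable_fun setT h ->
  (forall x, `|g x| <= 1) -> (forall y, `|h y| <= 1) ->
  Ex P (fun w => g (X w) * h (Y w)) =
  Ex P (fun w => g (X w)) * Ex P (fun w => h (Y w)).
Proof.
move=> iXY mg mh g1 h1.
have bg : bmf (fun w => g (X w)).
  split; last by exists 1.
  by apply: (measurableT_comp mg); exact: measurable_funPT.
have bh : bmf (fun w => h (Y w)).
  split; last by exists 1.
  by apply: (measurableT_comp mh); exact: measurable_funPT.
have b1 := @bmf_cst R _ Om 1.
have := @indep2_ge0_prod X Y (fun x => 1 + g x) (fun y => 1 + h y) iXY
  (measurable_funD (measurable_cst _) mg) (measurable_funD (measurable_cst _) mh).
have g0 x : 0 <= 1 + g x by have := g1 x; rewrite ler_norml => /andP[]; lra.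
have h0 x : 0 <= 1 + h x by have := h1 x; rewrite ler_norml => /andP[]; lra.
move=> /(_ g0 h0) /(congr1 fine).
have bg1 := bmfD b1 bg; have bh1 := bmfD b1 bh.
have fing : (\int[P]_w (1 + g (X w))%:E)%E \is a fin_num.
  by apply: integrable_fin_num => //; exact: (bmf_integrable P bg1).
have finh : (\int[P]_w (1 + h (Y w))%:E)%E \is a fin_num.
  by apply: integrable_fin_num => //; exact: (bmf_integrable P bh1).
rewrite fineM//.
rewrite -[LHS]/(Ex P (fun w => (1 + g (X w)) * (1 + h (Y w)))).
rewrite -[X in _ = X * _]/(Ex P (fun w => 1 + g (X w))).
rewrite -[X in _ = _ * X]/(Ex P (fun w => 1 + h (Y w))).
have -> : (fun w => (1 + g (X w)) * (1 + h (Y w))) =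
   (fun w => (1 + g (X w)) + (h (Y w) + g (X w) * h (Y w))).
  by apply/funext => w; ring.
have e1 : Ex P (fun w => 1 + g (X w)) = 1 + Ex P (fun w => g (X w)).
  by rewrite (@ExD _ _ _ P (fun=> 1) _ b1 bg) Ex_cst.
have e2 : Ex P (fun w => 1 + h (Y w)) = 1 + Ex P (fun w => h (Y w)).
  by rewrite (@ExD _ _ _ P (fun=> 1) _ b1 bh) Ex_cst.
rewrite (@ExD _ _ _ P (fun w => 1 + g (X w)) _ bg1 (bmfD bh (bmfM bg bh))).
rewrite (@ExD _ _ _ P (fun w => h (Y w)) _ bh (bmfM bg bh)) e1 e2.
set u := Ex _ _; set v := Ex _ _; set z := Ex _ _; lra.
Qed.

End PairLaw.

Section LinearForms.
Context (R : realType) (disp : measure_display)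
  (Om : measurableType disp) (P : probability Om R)
  (J : finType) (a : J -> {RV P >-> R}).
Hypothesis ind : mutually_independent a.

Definition linf2 (u v : J -> R) (r : seq J) (w : Om) : R * R :=
  (\sum_(j <- r) u j * a j w, \sum_(j <- r) v j * a j w).

Lemma measurable_linf (u : J -> R) (r : seq J) :
  measurable_fun setT (fun w => \sum_(j <- r) u j * a j w).
Proof.
elim: r => [|j r IH].
  by under eq_fun do rewrite big_nil; exact: measurable_cst.
under eq_fun do rewrite big_cons.
apply: measurable_funD => //; apply: measurable_funM => //.
Qed.

Lemma measurable_linf2 u v r : measurable_fun setT (linf2 u v r).
Proof. by apply: measurable_fun_pair; exact: measurable_linf. Qed.

Definition cylinder (r : seq J) (B : J -> set R) : set Om :=
  [set w | forall j, j \in r -> B j (a j w)].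

Lemma cylinder_nil B : cylinder [::] B = setT.
Proof. by apply/seteqP; split. Qed.

Lemma cylinder_cons j r B :
  cylinder (j :: r) B = (a j @^-1` B j) `&` cylinder r B.
Proof.
apply/seteqP; split => w /=.
  move=> H; split; first by apply: H; rewrite inE eqxx.
  by move=> i ir; apply: H; rewrite inE ir orbT.
by move=> [H1 H2] i; rewrite inE => /orP[/eqP->//|]; exact: H2.
Qed.

Lemma measurable_preim j A : measurable A -> measurable (a j @^-1` A).
Proof. by move=> mA; apply: measurable_funPTI. Qed.

Lemma measurable_cylinder r B :
  (forall j, measurable (B j)) -> measurable (cylinder r B).
Proof.
move=> mB; elim: r => [|j r IH]; first by rewrite cylinder_nil.
by rewrite cylinder_cons; apply: measurableI => //; exact: measurable_preim.
Qed.

(** Independence of E from the sigma-algebra generated by the variables in [r], tested on cylinders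
    only: in this form it follows from [mutually_independent] and variables can be moved into E one
    at a time. *)
Definition indep_of (E : set Om) (r : seq J) : Prop :=
  forall B : J -> set R, (forall j, measurable (B j)) ->
  P (E `&` cylinder r B) = (P E * \prod_(j <- r) P (a j @^-1` B j))%E.

Lemma indep_ofT (r : seq J) : uniq r -> indep_of setT r.
Proof.
move=> ur B mB; rewrite setTI probability_setT mul1e.
have := @ind [set j in r] B (fun j _ => mB j).
have -> : [set w | forall i, i \in [set j in r]%SET -> B i (a i w)] =
    cylinder r B.
  by apply/seteqP; split => w /= H i; [move=> ir; apply: H|move/[!inE] => ir; apply: H]; rewrite ?inE.
move=> ->; rewrite big_uniq//=.
by apply: eq_bigl => j; rewrite inE.
Qed.

Lemma indep_of_cons E j r A : measurable A -> uniq (j :: r) ->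
  indep_of E (j :: r) ->
  P (E `&` (a j @^-1` A)) = (P E * P (a j @^-1` A))%E /\
  indep_of (E `&` (a j @^-1` A)) r.
Proof.
move=> mA /= /andP[jr ur] H.
have key B : (forall i, measurable (B i)) ->
   P (E `&` (a j @^-1` A) `&` cylinder r B) =
   (P E * P (a j @^-1` A) * \prod_(i <- r) P (a i @^-1` B i))%E.
  move=> mB.
  have := H (fun i => if i == j then A else B i).
  rewrite cylinder_cons eqxx big_cons eqxx.
  have -> : cylinder r (fun i => if i == j then A else B i) = cylinder r B.
    apply/seteqP; split => w /= Hw i ir; have := Hw i ir.
      by case: eqP => // ij; move: jr; rewrite -ij ir.
    by case: eqP => // ij; move: jr; rewrite -ij ir.
  have -> : (\prod_(i <- r) P (a i @^-1` (if i == j then A else B i)) =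
     \prod_(i <- r) P (a i @^-1` B i))%E.
    apply: eq_big_seq => i ir; case: eqP => // ij.
    by move: jr; rewrite -ij ir.
  rewrite setIA muleA => -> // i; by case: eqP.
have E1 : P (E `&` (a j @^-1` A)) = (P E * P (a j @^-1` A))%E.
  have := key (fun=> setT) (fun=> measurableT).
  have -> : cylinder r (fun=> setT) = setT by apply/seteqP; split.
  rewrite setIT => ->; rewrite big1 ?mule1// => i _.
  by rewrite preimage_setT probability_setT.
split => // B mB.
by rewrite key// E1.
Qed.

(** Induction on the list. The vector formed by a j and the remaining forms is treated by uniqueness
    of finite measures on rectangles; the event that a j lies in A is absorbed into E before the
    induction hypothesis is used. *)
Lemma indep_linf2 (u v : J -> R) (E : set Om) (r : seq J) (C : set (R * R)) :
  measurable E -> uniq r -> indep_of E r -> measurable C ->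
  P (E `&` linf2 u v r @^-1` C) = (P E * P (linf2 u v r @^-1` C))%E.
Proof.
elim: r E C => [|j r IH] E C mE ur iE mC.
  have -> : linf2 u v [::] = fun=> (0, 0).
    by apply/funext => w; rewrite /linf2 !big_nil.
  have [C0|C0] := pselect (C (0, 0)).
    have -> : (fun _ : Om => (0, 0)) @^-1` C = setT by apply/seteqP; split.
    by rewrite setIT probability_setT mule1.
  have -> : (fun _ : Om => (0, 0)) @^-1` C = set0 by apply/seteqP; split.
  by rewrite setI0 measure0 mule0.
pose h (z : R * (R * R)) : R * R := (u j * z.1 + z.2.1, v j * z.1 + z.2.2).
have mh : measurable_fun setT h.
  apply: measurable_fun_pair; apply: measurable_funD; rewrite /=.
  - by apply: measurable_funM => //; exact: measurable_fst.
  - exact: (measurableT_comp measurable_fst measurable_snd).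
  - by apply: measurable_funM => //; exact: measurable_fst.
  - exact: (measurableT_comp measurable_snd measurable_snd).
pose XY w := (a j w, linf2 u v r w).
have mXY : measurable_fun setT XY.
  apply: measurable_fun_pair; first exact: measurable_funPT.
  exact: measurable_linf2.
have linfE : linf2 u v (j :: r) = h \o XY.
  by apply/funext => w; rewrite /linf2 /h /XY /= !big_cons.
rewrite linfE comp_preimage.
pose D := h @^-1` C.
have mD : measurable D by rewrite -[D]setTI; apply: mh.
rewrite -/D.
pose XYf : {mfun Om >-> (R * (R * R))%type} := mfun_Sub (mem_set mXY).
have PE0 : 0 <= fine (P E) by apply: fine_ge0.
have mXYf : measurable_fun setT XYf by [].
pose m1F : {measure set (R * (R * R))%type -> \bar R} :=
  pushforward (mrestr P mE) XYf.
pose m1 := m1F mXYf.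
pose m2 : {measure set (R * (R * R))%type -> \bar R} :=
  mscale (NngNum PE0) (distribution P XYf).
have m1E X : m1 X = P (XY @^-1` X `&` E) by [].
have m2E X : m2 X = (P E * P (XY @^-1` X))%E.
  by rewrite -[P E]fineK ?fin_num_measure.
rewrite setIC -m1E -m2E.
pose G : set (set (R * (R * R))%type) :=
  [set C | exists A, measurable A /\ exists B, measurable B /\ C = A `*` B].
apply: (measure_unique G (fun=> setT)) => //.
- rewrite measurable_prod_measurableType; congr (<<s _ >>).
  rewrite predeqE; split => [[A mA [B mB <-]]|[A [mA [B [mB ->]]]]].
    by exists A; split => //; exists B.
  by exists A => //; exists B.
- move=> _ _ [X1 [mX1 [X2 [mX2 ->]]]] [Y1 [mY1 [Y2 [mY2 ->]]]].
  rewrite -setXI; exists (X1 `&` Y1); split; first exact: measurableI.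
  by exists (X2 `&` Y2); split => //; exact: measurableI.
- by move=> n; exists setT; split => //; exists setT; split => //; rewrite setXTT.
- by rewrite -subTset => x _; exists 0%N.
- move=> _ [A [mA [B [mB ->]]]].
  rewrite m1E m2E.
  have -> : XY @^-1` (A `*` B) = a j @^-1` A `&` linf2 u v r @^-1` B by [].
  have [e1 e2] := indep_of_cons mA ur iE.
  have [f1 f2] := indep_of_cons mA ur (indep_ofT ur).
  have ur' : uniq r by case/andP: ur.
  have mjA := measurable_preim j mA.
  rewrite setIC setIA IH//; last exact: measurableI.
  rewrite e1 -muleA; congr (_ * _)%E.
  rewrite setTI in f2.
  by rewrite IH.
- move=> n; apply: (@le_lt_trans _ _ 1%E); last exact: ltry.
  by apply: probability_le1; rewrite preimage_setT setTI.
Qed.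

End LinearForms.

(** * Subgaussian variables *)

Section Elementary.
Context (R : realType).
Implicit Types x u v : R.

(** Convexity of exp on the segment from 0 to x, from the tangent line at th x. *)
Lemma expR_weighted (th x : R) : 0 <= th <= 1 ->
  expR (th * x) <= 1 - th + th * expR x.
Proof.
move=> /andP[t0 t1].
have e1 : expR (th * x) * (1 + (1 - th) * x) <= expR x.
  have -> : expR x = expR (th * x) * expR ((1 - th) * x).
    by rewrite -expRD; congr expR; ring.
  by rewrite ler_wpM2l ?expR_ge0// expR_ge1Dx.
have e2 : expR (th * x) * (1 - th * x) <= 1.
  have h : expR (th * x) * expR (- (th * x)) = 1 by rewrite -expRD subrr expR0.
  by rewrite -[leRHS]h ler_wpM2l ?expR_ge0// expR_ge1Dx.
have e3 : (1 - th) * (expR (th * x) * (1 - th * x)) <= (1 - th) * 1.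
  by apply: ler_wpM2l => //; lra.
have e4 := ler_wpM2l t0 e1.
set E := expR (th * x) in e3 e4 *.
have -> : E = (1 - th) * (E * (1 - th * x)) + th * (E * (1 + (1 - th) * x)).
  by ring.
lra.
Qed.

Lemma expR_le_inv x : x < 1 -> expR x <= (1 - x)^-1.
Proof.
move=> x1; have := expR_ge1Dx (- x); rewrite expRN => h.
have h1 : 0 < 1 - x by lra.
rewrite -[leLHS]invrK lef_pV2 ?posrE// invr_gt0; exact: expR_gt0.
Qed.

(** Used with x = t xi: the linear term has mean zero and the rest involves xi only through its
    square. *)
Lemma expR_le_id_sq x : expR x <= x + expR (2 * x ^+ 2).
Proof.
have h2 := expR_ge1Dx (2 * x ^+ 2).
have [x0|x0] := leP x 0.
  have h := @expR_le_inv x (le_lt_trans x0 ltr01).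
  have : (1 - x)^-1 - x <= 1 + 2 * x ^+ 2; last by lra.
  rewrite lerBlDr -[leLHS]mul1r ler_pdivrMr; last by lra.
  nra.
have [xh|xh] := leP x (2^-1).
  have h : expR x <= (1 - x)^-1 by apply: expR_le_inv; lra.
  suff : (1 - x)^-1 <= 1 + x + 2 * x ^+ 2 by lra.
  rewrite -[leLHS]mul1r ler_pdivrMr; last by lra.
  nra.
have : expR x <= expR (2 * x ^+ 2) by rewrite ler_expR; nra.
lra.
Qed.

Lemma sin_le_id x : 0 <= x -> sin x <= x.
Proof.
rewrite le_eqVlt => /orP[/eqP<-|x0]; first by rewrite sin0.
have [c _] := @MVT R sin cos 0 x x0 (fun z _ => is_derive_sin z)
   (continuous_subspaceT (@continuous_sin R)).
by rewrite sin0 !subr0 => ->; rewrite ler_piMl ?cos_le1// ltW.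
Qed.

Lemma norm_sin_le x : `|sin x| <= `|x|.
Proof.
have [x0|x0] := leP 0 x.
  have h := sin_le_id x0; rewrite [`|x|]ger0_norm// ler_norml h andbT.
  have [x1|x1] := leP x 1; last by have := sin_geN1 x; lra.
  suff : 0 <= sin x by lra.
  by apply: sin_ge0_pi; rewrite x0/=; have := @pi_ge2 R; lra.
have x0' : 0 <= - x by lra.
rewrite -normrN -sinN -[`|x|]normrN; have h := sin_le_id x0'.
rewrite [`|- x|]ger0_norm// ler_norml h andbT.
have [x1|x1] := leP (- x) 1; last by have := sin_geN1 (- x); lra.
suff : 0 <= sin (- x) by lra.
by apply: sin_ge0_pi; rewrite x0'/=; have := @pi_ge2 R; lra.
Qed.

Lemma one_sub_cosE x : 1 - cos x = 2 * sin (x / 2) ^+ 2.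
Proof.
have -> : cos x = cos ((x / 2) *+ 2) by congr cos; rewrite mulr2n; lra.
by rewrite cos_mulr2n sin2cos2 mulr2n; ring.
Qed.

Lemma cos_ge_quad x : 1 - x ^+ 2 / 2 <= cos x.
Proof.
have := one_sub_cosE x; have := norm_sin_le (x / 2).
rewrite -(@ler_sqr R) ?nnegrE// => h.
have h' : sin (x / 2) ^+ 2 <= (x / 2) ^+ 2.
  by move: h; rewrite !real_normK ?num_real.
nra.
Qed.

Lemma sin_lower x : 0 <= x <= pi / 2 -> cos 1 / 2 * x <= sin x.
Proof.
have p1 := @pihalf_lt2 R; have p2 := @pihalf_ge1 R.
have c1 := @cos1_gt0 R.
have key (y : R) : 0 <= y <= 1 -> cos 1 * y <= sin y.
  move=> /andP[y0 y1]; move: y0; rewrite le_eqVlt => /orP[/eqP<-|y0].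
    by rewrite sin0 mulr0.
  have [c] := @MVT R sin cos 0 y y0 (fun z _ => is_derive_sin z)
     (continuous_subspaceT (@continuous_sin R)).
  rewrite in_itv/= => /andP[c0 cy].
  rewrite sin0 !subr0 => ->; rewrite ler_wpM2r// ?ltW//.
  rewrite ltr_cos ?in_itv/= ?ler01//=; lra.
move=> /andP[x0 x1].
have [xl|xl] := leP x 1.
  by have := key x; rewrite x0 xl => /(_ isT); nra.
have h1 : sin 1 <= sin x.
  apply: ltW; rewrite ltr_sin ?in_itv/=//; lra.
have := key 1; rewrite ler01 lexx => /(_ isT); nra.
Qed.

Lemma one_sub_cos_lower x : `|x| <= pi -> cos 1 ^+ 2 / 8 * x ^+ 2 <= 1 - cos x.
Proof.
move=> xp; rewrite -[cos x]cos_norm -[x ^+ 2]real_normK ?num_real//.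
have [y yE] : exists y : R, `|x| = y by exists `|x|.
rewrite yE; have y0 : 0 <= y by rewrite -yE normr_ge0.
rewrite one_sub_cosE.
have h : cos 1 / 2 * (y / 2) <= sin (y / 2) by apply: sin_lower; rewrite yE in xp; lra.
have c1 := @cos1_gt0 R.
have h0 : 0 <= cos 1 / 2 * (y / 2) by apply: mulr_ge0; [lra|lra].
have : (cos 1 / 2 * (y / 2)) ^+ 2 <= sin (y / 2) ^+ 2.
  by rewrite ler_sqr ?nnegrE// (le_trans h0).
lra.
Qed.

Lemma cosD2piz x (p : int) : cos (x + p%:~R * (pi *+ 2)) = cos x.
Proof.
have key (y : R) (k : nat) : cos (y + k%:R * (pi *+ 2)) = cos y.
  by rewrite mulr_natl; rewrite (@periodicn _ _ cos _ (@cosD2pi R)).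
case: p => k; first exact: key.
rewrite -(key _ k.+1); congr cos.
by rewrite NegzE mulrNz -pmulrn; ring.
Qed.

(** The integer nearest to u / (2 pi) reduces u to [-pi, pi], where 1 - cos has a quadratic lower
    bound. *)
Lemma near_int_of_cos u : exists p : int,
  cos 1 ^+ 2 / 8 * (2 * pi) ^+ 2 * (u / (2 * pi) - p%:~R) ^+ 2 <= 1 - cos u.
Proof.
have pi0 := @pi_gt0 R.
pose y := u / (2 * pi).
pose p := Num.floor (y + 2^-1); exists p.
have hp : `|y - p%:~R| <= 2^-1.
  have := floor_itv (y + 2^-1); rewrite -/p intrD => /andP[h1 h2].
  rewrite ler_norml; lra.
have -> : cos u = cos ((y - p%:~R) * (2 * pi)).
  rewrite -[RHS](cosD2piz _ p); congr cos; rewrite mulrBl /y divfK ?gt_eqF//; last by lra.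
  by rewrite -[pi *+ 2]mulr_natl; ring.
rewrite -/y -mulrA -exprMn [2 * pi * _]mulrC.
apply: one_sub_cos_lower.
rewrite normrM [`|2 * pi|]ger0_norm; last by lra.
have := hp; nra.
Qed.

End Elementary.

Lemma measurable_set_le (R : realType) (disp : measure_display)
    (Om : measurableType disp) (f g : Om -> R) :
  measurable_fun setT f -> measurable_fun setT g ->
  measurable [set w | f w <= g w].
Proof.
move=> mf mg; have := measurable_fun_ler mf mg measurableT.
move=> /(_ [set true]); rewrite setTI.
rewrite (_ : _ @^-1` [set true] = [set w | f w <= g w]); last by apply/seteqP; split.
by apply.
Qed.

Section Subgaussian.
Context (R : realType) (disp : measure_display) (Om : measurableType disp)
  (P : probability Om R) (xi : {RV P >-> R}).

Lemma measurable_RV : measurable_fun setT xi.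
Proof. exact: measurable_funPT. Qed.

Lemma subgaussian_exp_sq : subgaussian_tail xi ->
  exists2 a : R, 0 < a & exists K : R,
    (\int[P]_w (expR (a * xi w ^+ 2))%:E <= K%:E)%E.
Proof.
move=> [T0 T00 [C HC]].
(* On the shell k <= |xi| < k + 1 with k >= 1, (k + 1)^2 <= 4 k^2 gives a (k + 1)^2 - k^2 / T0 <= -
   k^2 / (2 T0), so that the shells are summed by a geometric series of ratio q. *)
pose a := (8 * T0)^-1; have a0 : 0 < a by rewrite invr_gt0; lra.
exists a => //.
pose C' := Num.max C 0.
pose q := expR (- (2 * T0)^-1).
have iT : 0 < (2 * T0)^-1 by rewrite invr_gt0; lra.
have q1 : q < 1 by rewrite expR_lt1; lra.
have q0 : 0 < q by exact: expR_gt0.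
exists (expR a + C' / (1 - q)).
pose A k := [set w | k%:R <= `|xi w|].
have mA k : measurable (A k).
  apply: measurable_set_le; first exact: measurable_cst.
  by apply: measurableT_comp => //; exact: measurable_RV.
pose F k w : \bar R := (expR (a * k.+1%:R ^+ 2) * \1_(A k) w)%:E.
have mF k : measurable_fun setT (F k).
  by apply/measurable_EFinP; apply: measurable_funM => //; exact: measurable_indic.
have F0 k w : (0 <= F k w)%E.
  by rewrite lee_fin mulr_ge0 ?expR_ge0// indicE ler0n.
apply: (@le_trans _ _ (\int[P]_w (\sum_(k <oo) F k w))%E).
  apply: ge0_le_integral => //.
  - by apply/measurable_EFinP; apply: measurableT_comp => //; apply: measurable_funM => //; apply: measurable_funX; exact: measurable_RV.
  - exact: ge0_emeasurable_sum.
  - move=> w _.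
    pose k := Num.trunc `|xi w|.
    have /andP[k1 k2] : k%:R <= `|xi w| < k.+1%:R by exact: trunc_itv.
    have : (F k w <= \sum_(i <oo) F i w)%E.
      apply: le_trans (nneseries_lim_ge k.+1 _) => //.
      rewrite big_nat_recr//= leeDr//.
      by apply: sume_ge0 => *; exact: F0.
    apply: le_trans; rewrite /F indicE mem_set//= mulr1 lee_fin ler_expR.
    rewrite ler_wpM2l ?(ltW a0)// -[xi w ^+ 2]real_normK ?num_real//.
    by rewrite ler_sqr ?nnegrE ?normr_ge0// ltW.
rewrite (@integral_nneseries _ _ _ P _ measurableT F mF (fun n x _ => F0 n x)).
have IF k : (\int[P]_w F k w = (expR (a * k.+1%:R ^+ 2))%:E * P (A k))%E.
  rewrite /F; under eq_integral do rewrite EFinM.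
  rewrite ge0_integralZl ?lee_fin ?expR_ge0//.
  + by rewrite integral_indic// setIT.
  + by apply/measurable_EFinP; exact: measurable_indic.
suff key N : (\sum_(0 <= k < N) \int[P]_w F k w <= (expR a + C' / (1 - q))%:E)%E.
  apply: lime_le; last exact: nearW.
  by apply: is_cvg_nneseries => n _ _; apply: integral_ge0 => w _; exact: F0.
case: N => [|N].
  by rewrite big_geq// lee_fin addr_ge0 ?expR_ge0// divr_ge0// ?le_max ?lexx ?orbT//; lra.
rewrite big_nat_recl// EFinD; apply: leeD.
  rewrite IF expr1n mulr1 -[leRHS]mule1 lee_wpmul2l ?lee_fin ?expR_ge0//.
  exact: probability_le1.
apply: (@le_trans _ _ (\sum_(0 <= k < N) (C' * q ^+ k.+1)%:E)%E).
  apply: lee_sum => k _; rewrite IF.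
  apply: (@le_trans _ _ ((expR (a * k.+2%:R ^+ 2))%:E * (C * expR (- (k.+1%:R ^+ 2 / T0)))%:E)%E).
    by rewrite lee_wpmul2l ?lee_fin ?expR_ge0//; apply: HC; rewrite ltr0n.
  rewrite -EFinM lee_fin mulrCA.
  have -> : C * (expR (a * k.+2%:R ^+ 2) * expR (- (k.+1%:R ^+ 2 / T0))) =
     C * expR (a * k.+2%:R ^+ 2 - k.+1%:R ^+ 2 / T0) by rewrite expRD.
  apply: (@le_trans _ _ (C' * expR (a * k.+2%:R ^+ 2 - k.+1%:R ^+ 2 / T0))).
    by rewrite ler_wpM2r ?expR_ge0// le_max lexx.
  rewrite ler_wpM2l ?le_max ?lexx ?orbT// -expRM_natl ler_expR.
  have k1 : (1 : R) <= k.+1%:R by rewrite ler1n.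
  rewrite -natr1; have [x xE] : exists x : R, k.+1%:R = x by exists k.+1%:R.
  rewrite !xE in k1 *.
  have -> : a * (x + 1) ^+ 2 - x ^+ 2 / T0 = (((x + 1) / (2 * x)) ^+ 2 / 2 - 1) * (x ^+ 2 / T0).
    rewrite /a; field; apply/andP; split; rewrite gt_eqF//; lra.
  have -> : x * - (2 * T0)^-1 = (- (2 * x)^-1) * (x ^+ 2 / T0).
    by field; apply/andP; split; rewrite gt_eqF//; lra.
  apply: ler_wpM2r; first by rewrite divr_ge0 ?sqr_ge0// ltW.
  have x20 : 0 < 2 * x by move: k1; clear -xi; lra.
  have h1 : (x + 1) / (2 * x) <= 1 by rewrite ler_pdivrMr//; move: k1; clear -xi; lra.
  have h0 : 0 <= (x + 1) / (2 * x) by rewrite divr_ge0 ?(ltW x20)//; move: k1; clear -xi; lra.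
  have h2 : (2 * x)^-1 <= 2^-1 by rewrite lef_pV2 ?posrE//; move: k1; clear -xi; lra.
  have h3 : ((x + 1) / (2 * x)) ^+ 2 <= 1 by rewrite expr_le1.
  by move: h2 h3; clear -xi; lra.
rewrite sumEFin lee_fin -mulr_sumr ler_wpM2l ?le_max ?lexx ?orbT//.
have -> : \sum_(0 <= k < N) q ^+ k.+1 = q * \sum_(0 <= k < N) q ^+ k.
  by rewrite mulr_sumr; apply: eq_bigr => k _; rewrite exprS.
have hs : (1 - q) * \sum_(0 <= k < N) q ^+ k = 1 - q ^+ N.
  by rewrite big_mkord -[1 - q]opprB mulNr -subrX1 opprB.
rewrite -div1r ler_pdivlMr; last by lra.
have qN : 0 <= q ^+ N by rewrite exprn_ge0// ltW.
rewrite -mulrA [_ * (1 - q)]mulrC hs; nra.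
Qed.


Hypothesis tail : subgaussian_tail xi.

Let intg (f : Om -> R) := P.-integrable setT (EFin \o f).

Lemma ExD_i (f g : Om -> R) : intg f -> intg g ->
  Ex P (fun w => f w + g w) = Ex P f + Ex P g.
Proof. by move=> hf hg; rewrite /Ex RintegralD. Qed.

Lemma ExZ_i (c : R) (f : Om -> R) : intg f -> Ex P (fun w => c * f w) = c * Ex P f.
Proof. by move=> hf; rewrite /Ex RintegralZl. Qed.

Lemma Ex_le_i (f g : Om -> R) : intg f -> intg g ->
  (forall w, f w <= g w) -> Ex P f <= Ex P g.
Proof. by move=> hf hg h; apply: le_Rintegral. Qed.

Lemma integrable_le (f g : Om -> R) : measurable_fun setT f ->
  (forall w, `|f w| <= g w) -> intg g -> intg f.
Proof.
move=> mf fg ig; apply: (le_integrable measurableT _ _ ig).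
  exact/measurable_EFinP.
by move=> w _ /=; rewrite lee_fin (le_trans (fg w))// ler_norm.
Qed.

Lemma integrableZ (c : R) (f : Om -> R) : intg f -> intg (fun w => c * f w).
Proof. by move=> hf; have := integrableZl measurableT c hf. Qed.

Lemma integrableDr (f g : Om -> R) : intg f -> intg g -> intg (fun w => f w + g w).
Proof. by move=> hf hg; have := integrableD measurableT hf hg. Qed.

Lemma subgaussian_integrable : exists2 a : R, 0 < a &
  intg (fun w => expR (a * xi w ^+ 2)).
Proof.
have [a a0 [K HK]] := subgaussian_exp_sq tail.
exists a => //; apply/integrableP; split.
  apply/measurable_EFinP; apply: measurableT_comp => //.
  by apply: measurable_funM => //; apply: measurable_funX; exact: measurable_RV.
apply: (@le_lt_trans _ _ K%:E); last exact: ltry.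
apply: le_trans HK; under eq_integral do rewrite /= ger0_norm ?expR_ge0//.
by [].
Qed.

Lemma subgaussian_int_sq : intg (fun w => xi w ^+ 2).
Proof.
have [a a0 ia] := subgaussian_integrable.
apply: (integrable_le _ _ (integrableZ a^-1 ia)).
  by apply: measurable_funX; exact: measurable_RV.
move=> w; rewrite ger0_norm ?sqr_ge0//.
have := expR_ge1Dx (a * xi w ^+ 2).
by move=> h; rewrite [leRHS]mulrC ler_pdivlMr// mulrC; lra.
Qed.

Lemma subgaussian_int_p4 : intg (fun w => xi w ^+ 4).
Proof.
have [a a0 ia] := subgaussian_integrable.
apply: (integrable_le _ _ (integrableZ (2 / a ^+ 2) ia)).
  by apply: measurable_funX; exact: measurable_RV.
move=> w; rewrite ger0_norm; last by rewrite -[4%N]/(2 * 2)%N exprM sqr_ge0.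
have h0 : 0 <= a * xi w ^+ 2 by rewrite mulr_ge0 ?sqr_ge0// ltW.
have := expR_ge1Dxn 1 h0.
rewrite (_ : (2`!)%:R = 2 :> R)// => h.
rewrite mulrAC ler_pdivlMr ?exprn_gt0//.
have -> : xi w ^+ 4 * a ^+ 2 = (a * xi w ^+ 2) ^+ 2 by ring.
lra.
Qed.

Lemma subgaussian_int_abs : intg (fun w => `|xi w|).
Proof.
have i1 : intg (fun=> 1) by exact: (bmf_integrable P (@bmf_cst R _ Om 1)).
apply: (integrable_le _ _ (integrableDr i1 subgaussian_int_sq)).
  by apply: measurableT_comp => //; exact: measurable_RV.
move=> w; rewrite normr_id -[xi w ^+ 2]real_normK ?num_real//.
have := normr_ge0 (xi w); nra.
Qed.

Lemma subgaussian_int_id : intg xi.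
Proof.
apply: (integrable_le _ _ subgaussian_int_abs) => //; exact: measurable_RV.
Qed.

Hypothesis xi_mean : ('E_P[xi] = 0)%E.
Hypothesis xi_var : ('V_P[xi] = 1)%E.

Lemma Ex_xi : Ex P xi = 0.
Proof. by rewrite /Ex /Rintegral -expectation_def xi_mean. Qed.

Lemma Ex_xi2 : Ex P (fun w => xi w ^+ 2) = 1.
Proof.
have := xi_var; rewrite /variance covariance.unlock xi_mean expectation.unlock.
move=> /(congr1 fine) /= <-; apply: eq_Rintegral => w _ /=.
have -> : ((xi \- cst 0) * (xi \- cst 0)) w = (xi w - 0) * (xi w - 0) by [].
by rewrite subr0 expr2.
Qed.

(** Mean zero makes the positive and the negative part equally large on average, and variance and
    fourth moment keep E|xi| away from 0. Consequently two independent copies differ by at least 2 b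
    with probability at least p^2. *)
Lemma subgaussian_two_sided : exists b B p : R,
  [/\ 0 < b, 0 < B, 0 < p,
     p <= fine (P [set w | b <= xi w <= B]) &
     p <= fine (P [set w | - B <= xi w <= - b])].
Proof.
have i1 : intg (fun=> 1) by exact: (bmf_integrable P (@bmf_cst R _ Om 1)).
pose m4 := Ex P (fun w => xi w ^+ 4).
have m40 : 0 <= m4 by apply: Rintegral_ge0 => w _; rewrite -[4%N]/(2 * 2)%N exprM sqr_ge0.
pose u := 2 * m4 + 1; have u1 : 1 <= u by rewrite /u; lra.
have u0 : 0 < u by lra.
have iabs := subgaussian_int_abs; have isq := subgaussian_int_sq.
have iid := subgaussian_int_id; have i4 := subgaussian_int_p4.
(* Integrate x^2 <= u |x| + x^4 / u^2, clear on comparing |x| with u; u is chosen so that the last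
   term contributes at most 1/2. *)
have e1 : 1 <= u * Ex P (fun w => `|xi w|) + u ^- 2 * m4.
  rewrite -Ex_xi2 -ExZ_i// -ExZ_i// -ExD_i; [|exact: integrableZ..].
  apply: Ex_le_i => //; first by apply: integrableDr; exact: integrableZ.
  move=> w; rewrite -[xi w ^+ 2]real_normK ?num_real//.
  have -> : xi w ^+ 4 = `|xi w| ^+ 2 ^+ 2 by rewrite real_normK ?num_real// -exprM.
  set x := `|xi w|; have x0 : 0 <= x := normr_ge0 _.
  have q0 : 0 <= u ^- 2 * x ^+ 2 ^+ 2 by rewrite mulr_ge0 ?invr_ge0 ?sqr_ge0.
  have [xu|xu] := leP x u.
    have : x ^+ 2 <= u * x by rewrite expr2 ler_wpM2r.
    lra.
  have : x ^+ 2 <= u ^- 2 * x ^+ 2 ^+ 2.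
    rewrite mulrC ler_pdivlMr ?exprn_gt0// [leRHS]expr2 ler_wpM2l ?sqr_ge0//.
    by rewrite ler_sqr ?nnegrE// ltW.
  have : 0 <= u * x by rewrite mulr_ge0// ltW.
  lra.
have e2 : u ^- 2 * m4 <= 2^-1.
  rewrite mulrC ler_pdivrMr ?exprn_gt0//.
  have : m4 <= u / 2 by rewrite /u; lra.
  nra.
have e3 : (2 * u)^-1 <= Ex P (fun w => `|xi w|).
  rewrite -[leLHS]mul1r ler_pdivrMr; last by lra.
  lra.
pose e := (4 * u)^-1.
have e0 : 0 < e by rewrite invr_gt0; lra.
have ee : (2 * u)^-1 = 2 * e by rewrite /e; field; rewrite gt_eqF.
pose b := e / 4; pose B := 4 / e.
have B0 : 0 < B by rewrite divr_gt0.
have key (s : R) : (s = 1) \/ (s = - 1) ->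
    e / (4 * B) <= fine (P [set w | b <= s * xi w <= B]).
  move=> hs.
  set A := [set w | _].
  have mA : measurable A.
    have ms : measurable_fun setT (fun w => s * xi w).
      by apply: measurable_funM => //; exact: measurable_RV.
    rewrite (_ : A = [set w | b <= s * xi w] `&` [set w | s * xi w <= B]).
      by apply: measurableI; apply: measurable_set_le => //; exact: measurable_cst.
    by apply/seteqP; split => w /=; [move=> /andP[]|move=> [h1 h2]; apply/andP; split].
  have iA := bmf_integrable P (@bmf_indic R _ _ _ mA).
  have -> : fine (P A) = Ex P (\1_A : Om -> R) by rewrite (Ex_indic P mA).
  have h1 : 2 * e <= Ex P (fun w => `|xi w|) by rewrite -ee.
  have h2 : Ex P (fun w => `|xi w| + s * xi w) = Ex P (fun w => `|xi w|).
    by rewrite ExD_i ?ExZ_i// ?Ex_xi ?mulr0 ?addr0//; exact: integrableZ.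
  have ib : intg (fun=> 2 * b) by exact: (bmf_integrable P (@bmf_cst R _ Om (2 * b))).
  (* |x| + x is twice the positive part of x: at most 2 b below b, at most 2 B on the event, and at
     most 2 x^2 / B above B. *)
  have h3 : Ex P (fun w => `|xi w| + s * xi w) <=
      2 * b + (2 * B * Ex P (\1_A : Om -> R) + 2 / B * Ex P (fun w => xi w ^+ 2)).
    rewrite -ExZ_i// -ExZ_i//.
    rewrite -ExD_i; [|exact: integrableZ..].
    rewrite -[X in X + _](Ex_cst P) -ExD_i//; last first.
      by apply: integrableDr; exact: integrableZ.
    apply: Ex_le_i.
    - by apply: integrableDr => //; exact: integrableZ.
    - by apply: integrableDr => //; apply: integrableDr; exact: integrableZ.
    move=> w /=.
    have xs : `|xi w| = `|s * xi w|.
      by case: hs => ->; rewrite ?mul1r// mulN1r normrN.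
    have xq : xi w ^+ 2 = (s * xi w) ^+ 2.
      by case: hs => ->; rewrite ?mul1r// mulN1r sqrrN.
    rewrite xs xq indicE; set x := s * xi w.
    have b0 : 0 < b by rewrite divr_gt0.
    have q0 : 0 <= 2 / B * x ^+ 2 by rewrite mulr_ge0 ?sqr_ge0// divr_ge0// ltW.
    have j0 : 0 <= 2 * B * (w \in A)%:R by rewrite mulr_ge0 ?ler0n// mulr_ge0// ltW.
    have [x0|x0] := leP x 0; first by rewrite ler0_norm//; move: b0 q0 j0; clear; lra.
    rewrite (gtr0_norm x0).
    have [xb|xb] := leP b x; last by move: xb q0 j0; clear; lra.
    have [xB|xB] := leP x B.
      by rewrite mem_set ?mulr1; [move: xB b0 q0; clear; lra|rewrite /A/= -/x xb xB].
    have : x <= B^-1 * x ^+ 2.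
      by rewrite mulrC ler_pdivlMr// expr2 ler_wpM2l// ltW.
    by move: b0 j0; clear; lra.
  rewrite Ex_xi2 in h3.
  have h4 : 2 / B = e / 2 by rewrite /B; field; rewrite gt_eqF.
  rewrite ler_pdivrMr; last exact: mulr_gt0.
  by move: h1 h2 h3 h4 e0; rewrite /b; clear; lra.
exists b, B, (e / (4 * B)); split => //.
- by rewrite divr_gt0.
- by rewrite divr_gt0//; lra.
- have := key 1 (or_introl erefl).
  by under [X in fine (P X)]eq_set do rewrite mul1r.
- have := key (-1) (or_intror erefl).
  rewrite (_ : [set w | b <= -1 * xi w <= B] = [set w | - B <= xi w <= - b])//.
  by apply/seteqP; split => w /=; rewrite mulN1r => /andP[h1 h2]; rewrite lerNl lerNr h1 h2.
Qed.

(** For small t the linear term vanishes by mean zero and exp (2 t^2 xi^2) is interpolated between 1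
    and exp (a xi^2). For large t one completes the square, and K is absorbed into the exponential
    because 2 t^2 / a >= 1. *)
Lemma subgaussian_mgf : exists2 C : R, 0 < C & forall t : R,
  (\int[P]_w (expR (t * xi w))%:E <= (expR (C * t ^+ 2))%:E)%E.
Proof.
have [a a0 ia] := subgaussian_integrable.
have i1 : intg (fun=> 1) by exact: (bmf_integrable P (@bmf_cst R _ Om 1)).
pose K := Ex P (fun w => expR (a * xi w ^+ 2)).
have K1 : 1 <= K.
  rewrite -(Ex_cst P 1); apply: Ex_le_i => // w.
  by rewrite -[leLHS]expR0 ler_expR mulr_ge0 ?sqr_ge0// ltW.
have itx t : intg (fun w => expR (t * xi w)).
  apply: (integrable_le _ _ (integrableZ (expR (t ^+ 2 / (4 * a))) ia)).
    apply: measurableT_comp => //; apply: measurable_funM => //; exact: measurable_RV.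
  move=> w; rewrite ger0_norm ?expR_ge0// -expRD ler_expR.
  have : 0 <= (2 * a * xi w - t) ^+ 2 / (4 * a) by rewrite divr_ge0 ?sqr_ge0//; lra.
  have -> : (2 * a * xi w - t) ^+ 2 / (4 * a) = t ^+ 2 / (4 * a) + a * xi w ^+ 2 - t * xi w.
    by field; rewrite gt_eqF.
  lra.
exists ((1 / 4 + 2 * K) / a); first by rewrite divr_gt0//; lra.
move=> t.
have -> : (\int[P]_w (expR (t * xi w))%:E = (Ex P (fun w => expR (t * xi w)))%:E)%E.
  by rewrite /Ex /Rintegral fineK//; apply: integrable_fin_num => //; exact: itx.
rewrite lee_fin.
have t0 := sqr_ge0 t.
have [ta|ta] := leP (2 * t ^+ 2) a.
  pose th := 2 * t ^+ 2 / a.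
  have th01 : 0 <= th <= 1.
    by rewrite /th divr_ge0 ?ler_pdivrMr ?mul1r ?ta//; lra.
  have th0 : 0 <= th by case/andP: th01.
  have ile : intg (fun w => t * xi w + (1 - th + th * expR (a * xi w ^+ 2))).
    apply: integrableDr; first exact: (integrableZ _ subgaussian_int_id).
    apply: integrableDr; last exact: integrableZ.
    exact: (bmf_integrable P (@bmf_cst R _ Om (1 - th))).
  apply: (@le_trans _ _ (1 + th * (K - 1))).
    apply: (@le_trans _ _ (Ex P (fun w => t * xi w + (1 - th + th * expR (a * xi w ^+ 2))))).
      apply: Ex_le_i => // w.
      apply: le_trans (expR_le_id_sq _) _; rewrite lerD2l.
      have := expR_weighted (a * xi w ^+ 2) th01.
      by rewrite (_ : th * (a * xi w ^+ 2) = 2 * (t * xi w) ^+ 2)// /th; field; rewrite gt_eqF.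
    rewrite ExD_i; [|exact: (integrableZ _ subgaussian_int_id)|]; last first.
      apply: integrableDr; last exact: integrableZ.
      exact: (bmf_integrable P (@bmf_cst R _ Om (1 - th))).
    rewrite ExZ_i ?Ex_xi; last exact: subgaussian_int_id.
    rewrite ExD_i; [|exact: (bmf_integrable P (@bmf_cst R _ Om (1 - th)))|exact: integrableZ].
    by rewrite ExZ_i// Ex_cst -/K; lra.
  apply: le_trans (expR_ge1Dx _); rewrite lerD2l.
  have -> : (1 / 4 + 2 * K) / a * t ^+ 2 = th * (1 / 8 + K).
    by rewrite /th; field; rewrite gt_eqF.
  by rewrite ler_wpM2l//; lra.
apply: (@le_trans _ _ (expR (t ^+ 2 / (4 * a)) * K)).
  rewrite -ExZ_i//; apply: Ex_le_i; [exact: itx|exact: integrableZ|].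
  move=> w; rewrite -expRD ler_expR.
  have : 0 <= (2 * a * xi w - t) ^+ 2 / (4 * a) by rewrite divr_ge0 ?sqr_ge0//; lra.
  have -> : (2 * a * xi w - t) ^+ 2 / (4 * a) = t ^+ 2 / (4 * a) + a * xi w ^+ 2 - t * xi w.
    by field; rewrite gt_eqF.
  lra.
have -> : (1 / 4 + 2 * K) / a * t ^+ 2 = t ^+ 2 / (4 * a) + K * (2 * t ^+ 2 / a).
  by field; rewrite gt_eqF.
rewrite expRD ler_wpM2l ?expR_ge0//.
have h1 : 1 <= 2 * t ^+ 2 / a by rewrite ler_pdivlMr; lra.
apply: (@le_trans _ _ (K * (2 * t ^+ 2 / a))); first by rewrite ler_peMr//; lra.
have := expR_ge1Dx (K * (2 * t ^+ 2 / a)); lra.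
Qed.

End Subgaussian.

(** * The gap of the characteristic function *)

Lemma measurable_fun_scaled (R : realType) (h : R -> R) (c : R) :
  measurable_fun setT h -> measurable_fun setT (fun x => h (c * x)).
Proof. by move=> mh; apply: (measurableT_comp mh); exact: mulrl_measurable. Qed.

Section CharFun.
Context (R : realType) (disp : measure_display) (Om : measurableType disp)
  (P : probability Om R) (xi : {RV P >-> R}).

Definition char_re (t : R) : R := Ex P (fun w => cos (t * xi w)).
Definition char_im (t : R) : R := Ex P (fun w => sin (t * xi w)).
Definition char_gap (t : R) : R := 1 - (char_re t ^+ 2 + char_im t ^+ 2).

Lemma measurable_cos : measurable_fun setT (@cos R).
Proof. by apply: continuous_measurable_fun; exact: continuous_cos. Qed.

Lemma measurable_sin : measurable_fun setT (@sin R).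
Proof. by apply: continuous_measurable_fun; exact: continuous_sin. Qed.

Lemma bmf_cos (f : Om -> R) : measurable_fun setT f -> bmf (fun w => cos (f w)).
Proof.
move=> mf; split; last by exists 1 => w; exact: cos_max.
exact: (measurableT_comp measurable_cos mf).
Qed.

Lemma bmf_sin (f : Om -> R) : measurable_fun setT f -> bmf (fun w => sin (f w)).
Proof.
move=> mf; split; last by exists 1 => w; exact: sin_max.
exact: (measurableT_comp measurable_sin mf).
Qed.

Lemma measurable_Zxi t : measurable_fun setT (fun w => t * xi w).
Proof. by apply: measurable_funM => //; exact: measurable_RV. Qed.

(** Symmetrization without a product space: this is the mean over one copy of the sum of 1 - cos (M
    i (x - copy)), with the copy integrated out. Averaging over x = xi gives the sum of the gaps. *)
Let gapsum (I : finType) (M : I -> R) (x : R) : R :=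
  \sum_i (1 - (cos (M i * x) * char_re (M i) + sin (M i * x) * char_im (M i))).

Let gapsumE (I : finType) (M : I -> R) (x : R) :
  gapsum M x = Ex P (fun w => \sum_i (1 - cos (M i * (x - xi w)))).
Proof.
have b1 := @bmf_cst R _ Om 1.
have bc (t : R) := bmf_cos (measurable_Zxi t).
have bs (t : R) := bmf_sin (measurable_Zxi t).
have E (i : I) : (fun w => cos (M i * (x - xi w))) =
   (fun w => cos (M i * x) * cos (M i * xi w) + sin (M i * x) * sin (M i * xi w)).
  by apply/funext => w; rewrite mulrBr cosB.
have bE (i : I) : bmf (fun w => cos (M i * (x - xi w))).
  by rewrite E; apply: bmfD; exact: bmfZ.
rewrite Ex_sum; last by move=> i; exact: bmfB.
apply: eq_bigr => i _.
rewrite ExB// Ex_cst E ExD; [|exact: bmfZ..].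
by rewrite !ExZ.
Qed.

Let gap_bmf (I : finType) (M : I -> R) (x : R) :
  bmf (fun w => \sum_i (1 - cos (M i * (x - xi w)))).
Proof.
apply: bmf_sum => i; apply: bmfB; first exact: bmf_cst.
by apply: bmf_cos; apply: measurable_funM => //; apply: measurable_funB.
Qed.

Let gapsum_ge0 (I : finType) (M : I -> R) (x : R) : 0 <= gapsum M x.
Proof.
rewrite gapsumE; apply: Rintegral_ge0 => w _; apply: sumr_ge0 => i _.
by rewrite subr_ge0 cos_le1.
Qed.

Let gapsum_bmf (I : finType) (M : I -> R) : bmf (fun w => gapsum M (xi w)).
Proof.
apply: bmf_sum => i; apply: bmfB; first exact: bmf_cst.
apply: bmfD; apply: bmfM; (try exact: bmf_cst).
  by apply: bmf_cos; exact: measurable_Zxi.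
by apply: bmf_sin; exact: measurable_Zxi.
Qed.

Let gapsum_Ex (I : finType) (M : I -> R) :
  Ex P (fun w => gapsum M (xi w)) = \sum_i char_gap (M i).
Proof.
have b1 := @bmf_cst R _ Om 1.
have bc (t : R) := bmf_cos (measurable_Zxi t).
have bs (t : R) := bmf_sin (measurable_Zxi t).
have bp i : bmf (fun w => cos (M i * xi w) * char_re (M i) + sin (M i * xi w) * char_im (M i)).
  by apply: bmfD; apply: bmfM => //; exact: bmf_cst.
rewrite /gapsum Ex_sum; last by move=> i; exact: bmfB.
apply: eq_bigr => i _.
rewrite ExB// Ex_cst ExD; [|by apply: bmfM => //; exact: bmf_cst..].
rewrite /char_gap -/(char_re (M i)).
under [X in Ex _ X + _]eq_fun do rewrite mulrC.
under [X in _ + Ex _ X]eq_fun do rewrite mulrC.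
by rewrite !ExZ// -/(char_re _) -/(char_im _) !expr2.
Qed.

Lemma char_gap_ge0 t : 0 <= char_gap t.
Proof.
have := gapsum_Ex (fun _ : 'I_1 => t); rewrite big_ord1 => <-.
by apply: Rintegral_ge0 => w _; exact: gapsum_ge0.
Qed.

Lemma char_gap_le1 t : char_gap t <= 1.
Proof.
rewrite /char_gap; have := sqr_ge0 (char_re t); have := sqr_ge0 (char_im t); lra.
Qed.

Hypothesis tail : subgaussian_tail xi.
Hypothesis xi_mean : ('E_P[xi] = 0)%E.
Hypothesis xi_var : ('V_P[xi] = 1)%E.

(** Restrict one copy to the positive range and the other to the negative range of
    [subgaussian_two_sided]: their difference falls in the range where Q is a lower bound. No
    expansion at t = 0 is involved, so the frequencies may be arbitrarily large. *)
Lemma char_gap_sum_lower : exists b B p : R, [/\ 0 < b, 0 < B, 0 < p &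
  forall (I : finType) (M : I -> R) (Q : R), 0 <= Q ->
    (forall z, b <= z <= B -> Q <= \sum_i (1 - cos (M i * z))) ->
    p * Q <= \sum_i char_gap (M i)].
Proof.
have [b [B [p [b0 B0 p0 H1 H2]]]] := subgaussian_two_sided tail xi_mean xi_var.
exists (2 * b), (2 * B), (p * p); split; [lra|lra|exact: mulr_gt0|].
move=> I M Q Q0 HQ.
set A1 := [set w | b <= xi w <= B] in H1.
set A2 := [set w | - B <= xi w <= - b] in H2.
have mA1 : measurable A1.
  rewrite (_ : A1 = [set w | b <= xi w] `&` [set w | xi w <= B]).
    by apply: measurableI; apply: measurable_set_le => //; exact: measurable_RV.
  by apply/seteqP; split => w /=; [move=> /andP[]|move=> [h1 h2]; apply/andP; split].
have mA2 : measurable A2.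
  rewrite (_ : A2 = [set w | - B <= xi w] `&` [set w | xi w <= - b]).
    by apply: measurableI; apply: measurable_set_le => //; exact: measurable_RV.
  by apply/seteqP; split => w /=; [move=> /andP[]|move=> [h1 h2]; apply/andP; split].
have bi1 := @bmf_indic R _ _ _ mA1.
have bi2 := @bmf_indic R _ _ _ mA2.
have e1 : fine (P A1) = Ex P (\1_A1 : Om -> R) by rewrite (Ex_indic P mA1).
have e2 : fine (P A2) = Ex P (\1_A2 : Om -> R) by rewrite (Ex_indic P mA2).
rewrite -gapsum_Ex.
have key w : Q * p * \1_A1 w <= gapsum M (xi w).
  rewrite indicE; have [/set_mem wA|wA] := boolP (w \in A1); last first.
    by rewrite mulr0; exact: gapsum_ge0.
  rewrite mulr1 gapsumE; apply: (@le_trans _ _ (Q * Ex P (\1_A2 : Om -> R))).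
    by rewrite ler_wpM2l// -e2.
  rewrite -ExZ//; apply: Ex_le => //; first exact: bmfZ.
  move=> w'; rewrite indicE; have [/set_mem wA'|wA'] := boolP (w' \in A2); last first.
    by rewrite mulr0; apply: sumr_ge0 => i _; rewrite subr_ge0 cos_le1.
  rewrite mulr1; apply: HQ; move: wA wA'; rewrite /A1 /A2 /= => /andP[? ?] /andP[? ?].
  by apply/andP; split; lra.
apply: (@le_trans _ _ (Q * p * Ex P (\1_A1 : Om -> R))); last first.
  by rewrite -ExZ//; apply: Ex_le => //; exact: bmfZ.
rewrite -e1 mulrC -mulrA ler_wpM2l// ler_wpM2l//; exact: ltW.
Qed.

Lemma char_gap_quad : exists c t0 : R, [/\ 0 < c, 0 < t0 &
  forall t, `|t| <= t0 -> c * t ^+ 2 <= char_gap t].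
Proof.
have [b [B [p [b0 B0 p0 H]]]] := char_gap_sum_lower.
have c1 := @cos1_gt0 R.
have ct0 : 0 < cos 1 ^+ 2 / 8 :> R by rewrite divr_gt0 ?exprn_gt0.
exists (p * (cos 1 ^+ 2 / 8 * b ^+ 2)), B^-1; split.
- by rewrite !mulr_gt0// exprn_gt0.
- by rewrite invr_gt0.
move=> t tB; have := H 'I_1 (fun=> t) (cos 1 ^+ 2 / 8 * b ^+ 2 * t ^+ 2).
rewrite big_ord1 => H'; rewrite -mulrA; apply: H'.
  by rewrite mulr_ge0 ?sqr_ge0// mulr_ge0 ?sqr_ge0// ltW.
move=> z /andP[z1 z2]; rewrite big_ord1.
apply: (@le_trans _ _ (cos 1 ^+ 2 / 8 * (t * z) ^+ 2)).
  rewrite -mulrA ler_wpM2l ?(ltW ct0)// mulrC exprMn ler_wpM2l ?sqr_ge0//.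
  by rewrite ler_sqr ?nnegrE//; lra.
apply: one_sub_cos_lower.
rewrite normrM (ger0_norm (_ : 0 <= z)); last by lra.
apply: (@le_trans _ _ (B^-1 * B)); first by apply: ler_pM => //; lra.
by rewrite mulVf ?gt_eqF//; have := @pi_ge2 R; lra.
Qed.

(** By [char_gap_sum_lower], a small sum of gaps forces a small sum of 1 - cos (M i z) at one z, the
    same for all i; each term controls the distance of M i z / (2 pi) to the integers. *)
Lemma char_gap_near_int : exists b B C : R, [/\ 0 < b, 0 < B, 0 < C &
  forall (I : finType) (M : I -> R) (Q : R), 0 <= Q ->
    \sum_i char_gap (M i) < Q ->
    exists z : R, b <= z <= B /\
    exists p : I -> int, \sum_i (z * M i - (p i)%:~R) ^+ 2 <= C * Q].
Proof.
have [b [B [p [b0 B0 p0 H]]]] := char_gap_sum_lower.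
have pi0 := @pi_gt0 R; have pi2 : 0 < 2 * pi :> R by lra.
have c1 := @cos1_gt0 R.
pose c : R := cos 1 ^+ 2 / 8 * (2 * pi) ^+ 2.
have c0 : 0 < c by rewrite mulr_gt0 ?divr_gt0 ?exprn_gt0.
exists (b / (2 * pi)), (B / (2 * pi)), ((p * c)^-1); split.
- exact: divr_gt0.
- exact: divr_gt0.
- by rewrite invr_gt0 mulr_gt0.
move=> I M Q Q0 HQ.
have [z [/andP[zb zB] hz]] : exists z, b <= z <= B /\ \sum_i (1 - cos (M i * z)) < Q / p.
  apply: contrapT => nz.
  have : p * (Q / p) <= \sum_i char_gap (M i).
    apply: H; first by rewrite divr_ge0// ltW.
    move=> z zbB; rewrite leNgt; apply/negP => hlt; apply: nz; by exists z.
  by rewrite mulrC divfK ?gt_eqF// leNgt HQ.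
exists (z / (2 * pi)); split.
  by rewrite !ler_pM2r ?invr_gt0// zb zB.
have ch i := near_int_of_cos (M i * z).
exists (fun i => projT1 (cid (ch i))).
have key : c * \sum_i (z / (2 * pi) * M i - (projT1 (cid (ch i)))%:~R) ^+ 2 <= Q / p.
  apply: le_trans (ltW hz); rewrite mulr_sumr; apply: ler_sum => i _.
  case: cid => q /= hq; apply: le_trans hq; rewrite /c.
  by rewrite (_ : z / (2 * pi) * M i = M i * z / (2 * pi))//; ring.
rewrite -(ler_pM2l c0); apply: le_trans key _.
by rewrite invfM mulrCA mulrA mulfVK ?gt_eqF// mulrC.
Qed.

End CharFun.

(** * Linear forms in independent copies: characteristic function and exponential moments *)

Section Family.
Context (R : realType) (disp0 : measure_display) (Om0 : measurableType disp0)
  (P0 : probability Om0 R) (xi : {RV P0 >-> R}) (disp : measure_display)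
  (Om : measurableType disp) (P : probability Om R)
  (J : finType) (a : J -> {RV P >-> R}).
Hypothesis iid : iid_copies xi a.

Definition lin (c : J -> R) (w : Om) : R := \sum_j c j * a j w.

Lemma measurable_lin c : measurable_fun setT (lin c).
Proof. exact: measurable_linf. Qed.

Lemma Ex_copy (j : J) (h : R -> R) (M : R) :
  measurable_fun setT h -> (forall x, `|h x| <= M) ->
  Ex P (fun w => h (a j w)) = Ex P0 (fun w => h (xi w)).
Proof.
move=> mh hM.
have mhE : measurable_fun setT (EFin \o h) by exact/measurable_EFinP.
have i1 : P.-integrable setT (fun w => (h (a j w))%:E).
  apply: (@bmf_integrable _ _ _ P (fun w => h (a j w))); split; last by exists M.
  by apply: (measurableT_comp mh); exact: measurable_funPT.
have i2 : P0.-integrable setT (fun w => (h (xi w))%:E).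
  apply: (@bmf_integrable _ _ _ P0 (fun w => h (xi w))); split; last by exists M.
  by apply: (measurableT_comp mh); exact: measurable_funPT.
rewrite /Ex /Rintegral; congr fine.
have -> := esym (integral_distribution mhE i1).
have -> := esym (integral_distribution mhE i2).
by apply: eq_measure_integral => A mA _; exact: (iid.2 j A mA).
Qed.

Lemma integral_copy (j : J) (h : R -> R) :
  measurable_fun setT h -> (forall x, 0 <= h x) ->
  (\int[P]_w (h (a j w))%:E = \int[P0]_w (h (xi w))%:E)%E.
Proof.
move=> mh h0.
have mhE : measurable_fun setT (EFin \o h) by exact/measurable_EFinP.
have h0E y : (0 <= (EFin \o h) y)%E by rewrite lee_fin.
have -> := esym (ge0_integral_distribution (a j) mhE h0E).
have -> := esym (ge0_integral_distribution xi mhE h0E).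
by apply: eq_measure_integral => A mA _; exact: (iid.2 j A mA).
Qed.

Lemma indep2_lin (c : J -> R) (j : J) (r : seq J) : uniq (j :: r) ->
  indep2 P (a j) (fun w => \sum_(i <- r) c i * a i w).
Proof.
move=> ur A B mA mB.
have ind := iid.1.
have mC : measurable (B `*` (setT : set R)) by exact: measurableX.
have [e1 e2] := indep_of_cons mA ur (indep_ofT ind ur).
rewrite setTI in e2.
have ur' : uniq r by case/andP: ur.
have := @indep_linf2 _ _ _ P J a ind c (fun=> 0) _ _ _ (measurable_preim a j mA) ur' e2 mC.
rewrite (_ : linf2 a c (fun=> 0) r @^-1` (B `*` setT) =
  (fun w => \sum_(i <- r) c i * a i w) @^-1` B)//.
by apply/seteqP; split => w /=; [case|split].
Qed.

Let LRV (c : J -> R) (r : seq J) : {mfun Om >-> R} :=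
  mfun_Sub (mem_set (measurable_linf a c r)).

(** The squared modulus of the characteristic function is multiplicative over independent summands;
    cos and sin keep the computation real. *)
Lemma char_prod (c : J -> R) (r : seq J) : uniq r ->
  Ex P (fun w => cos (\sum_(j <- r) c j * a j w)) ^+ 2 +
  Ex P (fun w => sin (\sum_(j <- r) c j * a j w)) ^+ 2 =
  \prod_(j <- r) (1 - char_gap xi (c j)).
Proof.
elim: r => [|j r IH] ur.
  under eq_fun do rewrite big_nil cos0.
  under [in X in _ + X]eq_fun do rewrite big_nil sin0.
  by rewrite !Ex_cst big_nil expr1n expr0n addr0.
have ur' : uniq r by case/andP: ur.
have mcj : measurable_fun setT (fun x : R => cos (c j * x)).
  exact: (@measurable_fun_scaled R _ (c j) (@measurable_cos R)).
have msj : measurable_fun setT (fun x : R => sin (c j * x)).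
  exact: (@measurable_fun_scaled R _ (c j) (@measurable_sin R)).
have iXY := @indep2_lin c j r ur.
have pr (g h : R -> R) : measurable_fun setT g -> measurable_fun setT h ->
  (forall x, `|g x| <= 1) -> (forall x, `|h x| <= 1) ->
  Ex P (fun w => g (a j w) * h (\sum_(i <- r) c i * a i w)) =
  Ex P (fun w => g (a j w)) * Ex P (fun w => h (\sum_(i <- r) c i * a i w)).
  by move=> mg mh g1 h1; exact: (@indep2_Ex _ _ _ _ _ _ _ P (a j) (LRV c r)).
have cb x : `|cos (c j * x)| <= 1 by exact: cos_max.
have sb x : `|sin (c j * x)| <= 1 by exact: sin_max.
have cm := @cos_max R; have sm := @sin_max R.
have mc := @measurable_cos R; have ms := @measurable_sin R.
have ml := measurable_linf a c r.
have maj : measurable_fun setT (fun w => c j * a j w).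
  by apply: measurable_funM => //; exact: measurable_funPT.
have bcj := bmf_cos maj; have bsj := bmf_sin maj.
have bcl := bmf_cos ml; have bsl := bmf_sin ml.
have -> : (fun w => cos (\sum_(i <- j :: r) c i * a i w)) =
  (fun w => cos (c j * a j w) * cos (\sum_(i <- r) c i * a i w) -
            sin (c j * a j w) * sin (\sum_(i <- r) c i * a i w)).
  by apply/funext => w; rewrite big_cons cosD.
have -> : (fun w => sin (\sum_(i <- j :: r) c i * a i w)) =
  (fun w => sin (c j * a j w) * cos (\sum_(i <- r) c i * a i w) +
            cos (c j * a j w) * sin (\sum_(i <- r) c i * a i w)).
  by apply/funext => w; rewrite big_cons sinD.
rewrite ExB; [|exact: bmfM..].
rewrite ExD; [|exact: bmfM..].
rewrite (pr _ _ mcj mc cb cm) (pr _ _ msj ms sb sm).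
rewrite (pr _ _ msj mc sb cm) (pr _ _ mcj ms cb sm).
rewrite (@Ex_copy j _ 1 mcj cb) (@Ex_copy j _ 1 msj sb).
rewrite big_cons -IH// /char_gap /char_re /char_im.
set u := Ex P0 _; set v := Ex P0 _; set x := Ex P _; set y := Ex P _.
by ring.
Qed.

(** The shift by b is a rotation of the pair (E cos, E sin), so the left side is at most the
    modulus. Its square is a product of factors 1 - gap <= exp (- gap), whence the 1/2 in the
    exponent. *)
Lemma char_bound (c : J -> R) (b : R) :
  `|Ex P (fun w => cos (lin c w - b))| <=
  expR (- (2^-1 * \sum_j char_gap xi (c j))).
Proof.
have ml := measurable_lin c.
have bc := bmf_cos ml; have bs := bmf_sin ml.
have -> : (fun w => cos (lin c w - b)) =
  (fun w => cos b * cos (lin c w) + sin b * sin (lin c w)).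
  by apply/funext => w; rewrite cosB; ring.
rewrite ExD; [|exact: bmfZ..].
rewrite !ExZ//.
have := char_prod c (index_enum_uniq J); rewrite -/(lin c).
set u := Ex P _; set v := Ex P _ => h.
have {}h : u ^+ 2 + v ^+ 2 <= expR (- \sum_j char_gap xi (c j)).
  rewrite h -sumrN expR_sum; apply: ler_prod => j _.
  rewrite subr_ge0 char_gap_le1/=.
  exact: expR_ge1Dx.
have cs := cos2Dsin2 b.
rewrite -(@ler_sqr R) ?nnegrE ?normr_ge0 ?expR_ge0//.
rewrite real_normK ?num_real// -expRM_natl.
have -> : 2%:R * - (2^-1 * \sum_j char_gap xi (c j)) = - \sum_j char_gap xi (c j).
  by field.
apply: le_trans h.
have : 0 <= (cos b * v - sin b * u) ^+ 2 by exact: sqr_ge0.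
have -> : u ^+ 2 + v ^+ 2 = (cos b ^+ 2 + sin b ^+ 2) * (u ^+ 2 + v ^+ 2) by rewrite cs mul1r.
nra.
Qed.

Lemma mgf_bound (C : R) (c : J -> R) :
  (forall t : R, (\int[P0]_w (expR (t * xi w))%:E <= (expR (C * t ^+ 2))%:E)%E) ->
  (\int[P]_w (expR (lin c w))%:E <= (expR (C * \sum_j c j ^+ 2))%:E)%E.
Proof.
move=> HC; rewrite /lin.
have key (r : seq J) : uniq r ->
  (\int[P]_w (expR (\sum_(j <- r) c j * a j w))%:E <=
    (expR (C * \sum_(j <- r) c j ^+ 2))%:E)%E.
  elim: r => [|j r IH] ur.
    under eq_integral do rewrite big_nil expR0.
    by rewrite big_nil mulr0 expR0 integral_cst//= mul1e probability_setT.
  have ur' : uniq r by case/andP: ur.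
  have me : measurable_fun setT (fun x : R => expR (c j * x)).
    exact: (@measurable_fun_scaled R _ (c j) (@measurable_expR R)).
  under eq_integral do rewrite big_cons expRD.
  have -> := @indep2_ge0_prod _ _ _ _ _ _ _ P (a j) (LRV c r) (fun x => expR (c j * x)) (@expR R)
    (@indep2_lin c j r ur) me (@measurable_expR R) (fun x => expR_ge0 _) (fun x => expR_ge0 _).
  rewrite (integral_copy _ me) => [|x]; last exact: expR_ge0.
  rewrite big_cons mulrDr expRD EFinM; apply: lee_pmul.
  - by apply: integral_ge0 => w _; rewrite lee_fin expR_ge0.
  - by apply: integral_ge0 => w _; rewrite lee_fin expR_ge0.
  - exact: HC.
  - exact: IH.
exact: key (index_enum_uniq J).
Qed.

Lemma lin_tail (C : R) (c : J -> R) (v s : R) :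
  (forall t : R, (\int[P0]_w (expR (t * xi w))%:E <= (expR (C * t ^+ 2))%:E)%E) ->
  0 < C -> 0 < v -> 0 <= s -> \sum_j c j ^+ 2 <= v ->
  (P [set w | (s <= lin c w)%R] <= (expR (- (s ^+ 2 / (4 * C * v))))%:E)%E.
Proof.
move=> HC C0 v0 s0 cv.
set A := [set w | _].
have mA : measurable A.
  by apply: measurable_set_le; [exact: measurable_cst|exact: measurable_lin].
(* The minimizer of the Chernoff exponent C t^2 v - t s. *)
pose t := s / (2 * C * v).
have t0 : 0 <= t by rewrite divr_ge0//; nra.
have h1 := mgf_bound (fun j => t * c j) HC.
have h2 : ((expR (t * s))%:E * P A <= \int[P]_w (expR (lin (fun j => t * c j) w))%:E)%E.
  have -> : ((expR (t * s))%:E * P A = \int[P]_w (expR (t * s) * \1_A w)%:E)%E.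
    under eq_integral do rewrite EFinM.
    rewrite ge0_integralZl ?lee_fin ?expR_ge0//.
    + by rewrite integral_indic// setIT.
    + by apply/measurable_EFinP; exact: measurable_indic.
  apply: ge0_le_integral => //.
  - by apply/measurable_EFinP; apply: measurable_funM => //; exact: measurable_indic.
  - apply/measurable_EFinP; apply: (measurableT_comp (@measurable_expR R)).
    exact: measurable_lin.
  move=> w _; rewrite lee_fin indicE.
  have [/set_mem wA|wA] := boolP (w \in A); last by rewrite mulr0 expR_ge0.
  rewrite mulr1 ler_expR.
  have -> : lin (fun j => t * c j) w = t * lin c w.
    by rewrite /lin mulr_sumr; apply: eq_bigr => j _; rewrite mulrA.
  by rewrite ler_wpM2l.
have h3 := le_trans h2 h1.
have e : \sum_j (t * c j) ^+ 2 = t ^+ 2 * \sum_j c j ^+ 2.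
  by rewrite mulr_sumr; apply: eq_bigr => j _; rewrite exprMn.
have fP : P A \is a fin_num by exact: fin_num_measure.
rewrite -[P A]fineK// -EFinM lee_fin in h3.
rewrite -[P A]fineK// lee_fin.
have h4 : fine (P A) <= expR (C * \sum_j (t * c j) ^+ 2 - t * s).
  by rewrite expRB ler_pdivlMr ?expR_gt0// mulrC.
apply: le_trans h4 _; rewrite ler_expR e.
have : C * (t ^+ 2 * \sum_j c j ^+ 2) <= C * (t ^+ 2 * v).
  by rewrite ler_wpM2l ?ler_wpM2l ?sqr_ge0// ltW.
have -> : - (s ^+ 2 / (4 * C * v)) = C * (t ^+ 2 * v) - t * s.
  by rewrite /t; field; rewrite !gt_eqF.
lra.
Qed.

End Family.

(** * Nets from integer codes *)

Section Counting.
Context (R : realType).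

Lemma geom_partial (q : R) (n : nat) : 0 <= q < 1 ->
  \sum_(0 <= k < n) q ^+ k.+1 <= q / (1 - q).
Proof.
move=> /andP[q0 q1].
rewrite ler_pdivlMr; last by lra.
have -> : \sum_(0 <= k < n) q ^+ k.+1 = q * \sum_(0 <= k < n) q ^+ k.
  by rewrite mulr_sumr; apply: eq_bigr => k _; rewrite exprS.
have -> : q * (\sum_(0 <= k < n) q ^+ k) * (1 - q) = q * (1 - q ^+ n).
  rewrite -mulrA; congr (_ * _); rewrite mulrC.
  by rewrite big_mkord -[1 - q]opprB mulNr -subrX1 opprB.
by have := exprn_ge0 n q0; nra.
Qed.

(** In truncated subtraction one of the two terms is 0, so the exponent is |k - l|. *)
Lemma geom_two_sided (q : R) (l m : nat) : 0 <= q < 1 -> (l < m)%N ->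
  \sum_(k < m) q ^+ ((k - l) + (l - k)) <= 1 + 2 * (q / (1 - q)).
Proof.
move=> q01 lm; rewrite -(big_mkord xpredT (fun k => q ^+ ((k - l) + (l - k)))).
rewrite (@big_cat_nat _ _ _ l)//=; last exact: ltnW.
rewrite (@big_ltn _ _ _ l)// subnn addn0 expr0.
have h1 : \sum_(0 <= i < l) q ^+ (i - l + (l - i)) <= q / (1 - q).
  rewrite big_nat_rev/= add0n; apply: le_trans (geom_partial l q01).
  rewrite [leLHS]big_nat [leRHS]big_nat; apply: ler_sum => i /= il.
  by rewrite (_ : (_ + _)%N = i.+1)//; lia.
have h2 : \sum_(l.+1 <= i < m) q ^+ (i - l + (l - i)) <= q / (1 - q).
  rewrite -[l.+1]add0n big_addn; apply: le_trans (geom_partial (m - l.+1) q01).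
  by apply: ler_sum => i _; rewrite (_ : (_ + _)%N = i.+1)//; lia.
lra.
Qed.

Lemma expR_ratio (r : R) : 0 < r -> expR (- r) / (1 - expR (- r)) <= r^-1.
Proof.
move=> r0; have := expR_ge1Dx r; have := expR_gt0 r; rewrite expRN.
set e := expR r => e0 e1.
have h : 0 < 1 - e^-1 by rewrite subr_gt0 invf_lt1//; lra.
rewrite ler_pdivrMr// -(ler_pM2l r0) mulrA mulfV ?gt_eqF// mul1r.
rewrite -(ler_pM2r e0) -mulrA mulVf ?gt_eqF// mulr1 mulrBl mulVf ?gt_eqF//; lra.
Qed.

Lemma geom_expR (r : R) (l m : nat) : 0 < r -> (l < m)%N ->
  \sum_(k < m) expR (- (r * `|k%:R - l%:R|)) <= 1 + 2 / r.
Proof.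
move=> r0 lm.
have q01 : 0 <= expR (- r) < 1 by rewrite expR_ge0 expR_lt1; lra.
apply: (@le_trans _ _ (1 + 2 * (expR (- r) / (1 - expR (- r))))); last first.
  by rewrite lerD2l ler_wpM2l// expR_ratio.
apply: le_trans (geom_two_sided q01 lm).
apply: ler_sum => k _; rewrite -expRM_natl ler_expR.
rewrite mulrN lerN2 [leLHS]mulrC ler_wpM2l ?(ltW r0)// natrD.
have [kl|lk] := leqP k l.
  by rewrite (eqP kl) add0r natrB// distrC ger0_norm ?subr_ge0 ?ler_nat.
by rewrite (eqP (ltnW lk)) addr0 natrB ?(ltnW lk)// ger0_norm ?subr_ge0 ?ler_nat ?(ltnW lk).
Qed.

(* Chernoff-type count of integer vectors: [1 <= expR (s - \sum_i w i * `|p i|)]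
   for every admissible [p], and the exponential sum factorizes. *)
Lemma net_exists (T : Type) (G : set T) (I : finType) (F : T -> I -> int)
    (w : I -> R) (s : R) :
  (forall i, 0 < w i) ->
  (forall g, G g -> \sum_i w i * `|(F g i)%:~R| <= s) ->
  exists r : seq T, [/\ forall g, List.In g r -> G g,
    forall g, G g -> exists2 g', List.In g' r & F g' = F g &
    (size r)%:R <= expR s * \prod_i (1 + 2 / w i)].
Proof.
move=> w0 HF0.
have HF g : G g -> \sum_i w i * `|F g i|%:~R <= s.
  by move=> Gg; under eq_bigr do rewrite intr_norm; exact: HF0.
(* Admissible codes have entries in [-B, B]; shifted by B they live in a finite type, over which the
   exponential weights are summed. *)
pose B : nat := \max_(i : I) (Num.trunc (s / w i)).+1.
have hB g i : G g -> (`|F g i| <= B)%N.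
  move=> Gg; have hi := HF g Gg.
  have h1 : w i * `|F g i|%:~R <= s.
    apply: le_trans hi; rewrite (bigD1 i)//= lerDl; apply: sumr_ge0 => j _.
    by rewrite mulr_ge0 ?ler0z// ltW.
  have h2 : (`|F g i|)%:R <= s / w i :> R.
    by rewrite ler_pdivlMr// mulrC natr_absz.
  apply: leq_trans (leq_bigmax i).
  rewrite -ltnS -(ltr_nat R); apply: le_lt_trans h2 _.
  have := truncnS_gt (s / w i); rewrite -!natr1; lra.
pose code (g : T) : {ffun I -> 'I_(2 * B).+1} :=
  [ffun i => inord `|(F g i + B%:Z)%R|%N].
have codeE g i : G g -> (code g i)%:Z = F g i + B%:Z :> int.
  move=> Gg; rewrite ffunE inordK; have := hB g i Gg; lia.
pose real (c : {ffun I -> 'I_(2 * B).+1}) := exists2 g, G g & code g = c.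
pose rep (c : {ffun I -> 'I_(2 * B).+1}) : option T :=
  match pselect (real c) with
  | left h => Some (projT1 (cid2 h)) | right _ => None end.
pose reps := pmap rep (enum {: {ffun I -> 'I_(2 * B).+1}}).
have InP (X Y : Type) (f : X -> option Y) (l : seq X) y :
    List.In y (pmap f l) <-> exists2 x, List.In x l & f x = Some y.
  elim: l => [|x l [IH1 IH2]] /=; first by split => // -[].
  case E : (f x) => [z|] /=.
    split.
      by move=> [<-|/IH1[x' h1 h2]]; [exists x => //; left|exists x' => //; right].
    move=> [x' [<-|h1] h2]; first by left; rewrite E in h2; case: h2.
    by right; apply: IH2; exists x'.
  split; first by move=> /IH1[x' h1 h2]; exists x' => //; right.
  move=> [x' [<-|h1] h2]; first by rewrite E in h2.
  by apply: IH2; exists x'.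
have InE (X : eqType) (x : X) (l : seq X) : x \in l -> List.In x l.
  by elim: l => // y l IH; rewrite inE => /orP[/eqP->|/IH]; [left|right].
exists reps; split.
- by move=> g /InP[c _]; rewrite /rep; case: pselect => // h [<-]; case: cid2.
- move=> g Gg.
  have hr : real (code g) by exists g.
  have [g' [repE Gg' e]] : exists g', [/\ rep (code g) = Some g', G g' & code g' = code g].
    by rewrite /rep; case: pselect => // h; case: cid2 => g' /=; exists g'.
  exists g'.
    by apply/InP; exists (code g) => //; apply: InE; rewrite mem_enum.
  apply/funext => i.
  have := codeE g' i Gg'; rewrite e codeE//; lia.
- rewrite size_pmap -sum1_count big_enum_cond/= natr_sum.
  pose wt (c : {ffun I -> 'I_(2 * B).+1}) : R :=
    \prod_i expR (- (w i * `|(c i)%:R - B%:R|)).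
  apply: (@le_trans _ _ (\sum_(c : {ffun I -> 'I_(2 * B).+1}) expR s * wt c)).
    rewrite big_mkcond/=; apply: ler_sum => c _.
    have wt0 : 0 <= expR s * wt c.
      by rewrite mulr_ge0 ?expR_ge0//; apply: prodr_ge0 => i _; exact: expR_ge0.
    case: ifP => // hc.
    have [g Gg cE] : real c by move: hc; rewrite /rep; case: pselect.
    rewrite /wt -expR_sum -expRD -[leLHS]expR0 ler_expR.
    rewrite sumrN subr_ge0; apply: le_trans (HF g Gg).
    apply: ler_sum => i _; rewrite ler_wpM2l ?(ltW (w0 i))//.
    rewrite -cE; have := codeE g i Gg => h.
    have -> : (code g i)%:R - B%:R = (F g i)%:~R :> R.
      by rewrite !pmulrn h rmorphD/= addrK.
    by rewrite intr_norm.
  rewrite -mulr_sumr ler_wpM2l ?expR_ge0// /wt.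
  rewrite -(bigA_distr_bigA (fun i (k : 'I_(2 * B).+1) => expR (- (w i * `|k%:R - B%:R|)))).
  apply: ler_prod => i _; rewrite sumr_ge0/=; last by move=> *; exact: expR_ge0.
  by apply: geom_expR => //; lia.
Qed.

End Counting.

(** * Small ball estimate and tensorization *)

Section SmallBall.
Context (R : realType) (disp0 : measure_display) (Om0 : measurableType disp0)
  (P0 : probability Om0 R) (xi : {RV P0 >-> R}) (disp : measure_display)
  (Om : measurableType disp) (P : probability Om R)
  (J : finType) (a : J -> {RV P >-> R}).
Hypothesis iid : iid_copies xi a.

Definition gap2 (u v : J -> R) (k1 k2 : R) : R :=
  \sum_j char_gap xi (k1 * u j + k2 * v j).

Lemma measurable_box (u v : J -> R) (b1 b2 s1 s2 : R) :
  measurable [set w | `|lin a u w - b1| <= s1 /\ `|lin a v w - b2| <= s2].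
Proof.
have mb c b s : measurable [set w | `|lin a c w - b| <= s].
  apply: measurable_set_le; last exact: measurable_cst.
  apply: measurableT_comp => //; apply: measurable_funB => //.
  exact: measurable_lin.
exact: (measurableI _ _ (mb u b1 s1) (mb v b2 s2)).
Qed.

(** On the box every phase [th k] is at most 1 in absolute value, so the sum of exp (i th k) over
    the m1 m2 frequencies has real part at least m1 m2 / 2. Its squared modulus is a double sum of
    cosines of phase differences, and [char_bound] applies to each. *)
Lemma box_fourier (u v : J -> R) (b1 b2 : R) (m1 m2 : nat) :
  (0 < m1)%N -> (0 < m2)%N ->
  fine (P [set w | `|lin a u w - b1| <= (2 * m1%:R)^-1 /\
              `|lin a v w - b2| <= (2 * m2%:R)^-1]) <=
  4 / (m1%:R * m2%:R) ^+ 2 *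
  \sum_(l : 'I_m1 * 'I_m2) \sum_(k : 'I_m1 * 'I_m2)
    expR (- (2^-1 * gap2 u v (k.1%:R - l.1%:R) (k.2%:R - l.2%:R))).
Proof.
move=> m10 m20.
set A := [set w | _].
have mA : measurable A by exact: measurable_box.
have n1 : 0 < m1%:R :> R by rewrite ltr0n.
have n2 : 0 < m2%:R :> R by rewrite ltr0n.
have -> : fine (P A) = Ex P (\1_A : Om -> R) by rewrite (Ex_indic P mA).
pose th (k : 'I_m1 * 'I_m2) w := k.1%:R * (lin a u w - b1) + k.2%:R * (lin a v w - b2).
have mth k : measurable_fun setT (th k).
  apply: measurable_funD; apply: measurable_funM => //; apply: measurable_funB => //; exact: measurable_lin.
have thE (k l : 'I_m1 * 'I_m2) : (fun w => cos (th k w - th l w)) =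
   (fun w => cos (lin a (fun j => (k.1%:R - l.1%:R) * u j + (k.2%:R - l.2%:R) * v j) w -
     ((k.1%:R - l.1%:R) * b1 + (k.2%:R - l.2%:R) * b2))).
  apply/funext => w; congr cos.
  have -> : lin a (fun j => (k.1%:R - l.1%:R) * u j + (k.2%:R - l.2%:R) * v j) w =
     (k.1%:R - l.1%:R) * lin a u w + (k.2%:R - l.2%:R) * lin a v w.
    rewrite /lin !mulr_sumr -big_split/=; apply: eq_bigr => j _; ring.
  rewrite /th; ring.
have bthkl (l k : 'I_m1 * 'I_m2) : bmf (fun w => cos (th k w - th l w)).
  by apply: bmf_cos; apply: measurable_funB; exact: mth.
pose K w := \sum_l \sum_k cos (th k w - th l w).
have KE w : K w = (\sum_k cos (th k w)) ^+ 2 + (\sum_k sin (th k w)) ^+ 2.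
  rewrite !expr2 !mulr_suml -big_split/=; apply: eq_bigr => l _.
  rewrite !mulr_sumr -big_split/=; apply: eq_bigr => k _.
  by rewrite cosB; ring.
have card2 : #|{: 'I_m1 * 'I_m2}|%:R = m1%:R * m2%:R :> R.
  by rewrite card_prod !card_ord natrM.
have hA w : (m1%:R * m2%:R / 2) ^+ 2 * \1_A w <= K w.
  rewrite KE indicE.
  have [/set_mem [w1 w2]|wA] := boolP (w \in A); last first.
    by rewrite mulr0 addr_ge0 ?sqr_ge0.
  rewrite mulr1.
  have cge k : 2^-1 <= cos (th k w).
    have thk : `|th k w| <= 1.
      apply: le_trans (ler_normD _ _) _; rewrite !normrM !(ger0_norm (ler0n _ _)).
      have h1 : k.1%:R * `|lin a u w - b1| <= m1%:R * (2 * m1%:R)^-1.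
        by apply: ler_pM => //; rewrite ler_nat ltnW.
      have h2 : k.2%:R * `|lin a v w - b2| <= m2%:R * (2 * m2%:R)^-1.
        by apply: ler_pM => //; rewrite ler_nat ltnW.
      have e1 : m1%:R * (2 * m1%:R)^-1 = 2^-1 :> R by field; rewrite gt_eqF.
      have e2 : m2%:R * (2 * m2%:R)^-1 = 2^-1 :> R by field; rewrite gt_eqF.
      by rewrite e1 in h1; rewrite e2 in h2; move: (lerD h1 h2); clear -iid; lra.
    apply: le_trans (cos_ge_quad _).
    have : th k w ^+ 2 <= 1.
      by rewrite -[th k w ^+ 2]real_normK ?num_real// expr_le1.
    by clear -iid; lra.
  have h : m1%:R * m2%:R / 2 <= \sum_k cos (th k w).
    rewrite -card2 mulrC mulr_natr -sumr_const; exact: ler_sum.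
  have : (m1%:R * m2%:R / 2) ^+ 2 <= (\sum_k cos (th k w)) ^+ 2.
    by rewrite ler_sqr ?nnegrE ?divr_ge0 ?mulr_ge0 ?(ltW n1) ?(ltW n2)//; apply: le_trans h; rewrite divr_ge0 ?mulr_ge0 ?(ltW n1) ?(ltW n2).
  by have := sqr_ge0 (\sum_k sin (th k w)); clear -iid; lra.
have bK : bmf K by apply: bmf_sum => l; apply: bmf_sum => k.
have biA := @bmf_indic R _ _ _ mA.
have : (m1%:R * m2%:R / 2) ^+ 2 * Ex P (\1_A : Om -> R) <= Ex P K.
  by rewrite -ExZ//; apply: Ex_le => //; exact: bmfZ.
have -> : Ex P K = \sum_l \sum_k Ex P (fun w => cos (th k w - th l w)).
  rewrite /K Ex_sum; last by move=> l; exact: bmf_sum.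
  by apply: eq_bigr => l _; rewrite Ex_sum.
move=> h; rewrite -ler_pdivrMl; last by rewrite divr_gt0// exprn_gt0// mulr_gt0.
have -> : (4 / (m1%:R * m2%:R) ^+ 2)^-1 = (m1%:R * m2%:R / 2) ^+ 2 :> R.
  by field; rewrite !gt_eqF.
apply: le_trans h _; apply: ler_sum => l _; apply: ler_sum => k _.
rewrite thE; apply: le_trans (ler_norm _) _.
exact: (char_bound iid).
Qed.

(** Comparison with a geometric sum through c^2 y^2 / 2 >= c y - 1/2; the lost factor exp (1/2) is
    below 2. *)
Lemma geom_gauss (c : R) (l m : nat) : 0 < c <= 1 -> (l < m)%N ->
  \sum_(k < m) expR (- (c ^+ 2 * (k%:R - l%:R) ^+ 2 / 2)) <= 6 / c.
Proof.
move=> /andP[c0 c1] lm.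
apply: (@le_trans _ _ (\sum_(k < m) 2 * expR (- (c * `|k%:R - l%:R|)))).
  apply: ler_sum => k _.
  have -> : 2 * expR (- (c * `|k%:R - l%:R|)) = expR (ln 2 + - (c * `|k%:R - l%:R|)) :> R.
    by rewrite expRD lnK// posrE.
  rewrite ler_expR.
  have l2 : 2^-1 <= ln 2 :> R.
    have -> : ln 2 = - ln (2^-1) :> R by rewrite lnV ?posrE// opprK.
    have := @le_ln1Dx R (- 2^-1).
    have -> : 1 + - 2^-1 = 2^-1 :> R by lra.
    lra.
  rewrite -[(k%:R - l%:R) ^+ 2]real_normK ?num_real//.
  set y := `|_|.
  have : 0 <= (c * y - 1) ^+ 2 by exact: sqr_ge0.
  nra.
rewrite -mulr_sumr; apply: (@le_trans _ _ (2 * (1 + 2 / c))).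
  by rewrite ler_wpM2l// geom_expR.
have -> : 2 * (1 + 2 / c) = (2 * c + 4) / c by field; rewrite gt_eqF.
by rewrite ler_pM2r ?invr_gt0//; lra.
Qed.

Lemma expR_max (q x y : R) : 0 <= x -> 0 <= y -> Num.max x y <= q ->
  expR (- (2^-1 * q)) <= expR (- (4^-1 * x)) * expR (- (4^-1 * y)).
Proof.
move=> x0 y0; rewrite ge_max => /andP[h1 h2].
by rewrite -expRD ler_expR; lra.
Qed.

(** 300 exceeds 36 + 81 + 1, the sums over the three kinds of frequencies in [small_ball]; 64 is the
    4 of [box_fourier] times two factors 4 from 1 / m <= 4 s. *)
Definition csb : R := 300 * 64.

Lemma csb_gt0 : 0 < csb.
Proof. by apply: mulr_gt0; rewrite ltr0n. Qed.

(** Frequencies with a quadratic gap sum to O (1 / c^2), those whose gap exceeds max (|k1|, |k2|) to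
    O (1). Those with gap at least L contribute at most their number times exp (- L / 2), which the
    assumption on L makes at most 1. *)
Lemma small_ball (u v : J -> R) (b1 b2 s1 s2 c L : R) :
  0 < c <= 1 -> 0 < s1 <= 4^-1 -> 0 < s2 <= 4^-1 ->
  (4 * s1 * s2)^-1 <= expR (L / 2) ->
  (forall k1 k2 : int, `|k1%:~R| < (2 * s1)^-1 :> R -> `|k2%:~R| < (2 * s2)^-1 :> R ->
     [\/ c ^+ 2 * (k1%:~R ^+ 2 + k2%:~R ^+ 2) <= gap2 u v k1%:~R k2%:~R,
         Num.max `|k1%:~R| `|k2%:~R| <= gap2 u v k1%:~R k2%:~R |
         L <= gap2 u v k1%:~R k2%:~R]) ->
  fine (P [set w | `|lin a u w - b1| <= s1 /\ `|lin a v w - b2| <= s2]) <=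
   csb / c ^+ 2 * s1 * s2.
Proof.
move=> /andP[c0 c1] /andP[s10 s11] /andP[s20 s21] HL good.
(* Rounding 1 / (2 s) down to an integer m only enlarges the box, and loses at most a factor 2 since
   s <= 1/4. *)
have key (s : R) : 0 < s -> s <= 4^-1 -> exists2 m : nat, (0 < m)%N &
    m%:R <= (2 * s)^-1 /\ (4 * s)^-1 <= m%:R.
  move=> s0 s4; pose m := Num.trunc (2 * s)^-1.
  have i0 : 0 <= (2 * s)^-1 by rewrite invr_ge0; lra.
  have /andP[t1 t2] := trunc_itv i0.
  rewrite -/m in t1 t2.
  have h1 : 2 <= (2 * s)^-1.
    by rewrite -[leLHS]invrK lef_pV2 ?posrE ?mulr_gt0 ?invr_gt0//; move: s4; clear -iid; lra.
  have h2 : (2 * s)^-1 = 2 * (4 * s)^-1 by field; rewrite gt_eqF.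
  rewrite -[m.+1%:R]natr1 in t2.
  exists m; last by split => //; move: t2 h1 h2; clear -iid; lra.
  by rewrite -(ltr0n R); move: t2 h1; clear -iid; lra.
have [m1 m10 [m1s m1l]] := key _ s10 s11.
have [m2 m20 [m2s m2l]] := key _ s20 s21.
have n1 : 0 < m1%:R :> R by rewrite ltr0n.
have n2 : 0 < m2%:R :> R by rewrite ltr0n.
have sm (s : R) (m : nat) : 0 < s -> 0 < m%:R :> R -> m%:R <= (2 * s)^-1 -> s <= (2 * m%:R)^-1.
  move=> s0 mm0 h; rewrite -[leLHS]invrK lef_pV2 ?posrE ?invr_gt0//; last exact: mulr_gt0.
  have -> : s^-1 = 2 * (2 * s)^-1 by field; rewrite gt_eqF.
  by move: h; clear -iid; lra.
have h1 : fine (P [set w | `|lin a u w - b1| <= s1 /\ `|lin a v w - b2| <= s2]) <=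
   fine (P [set w | `|lin a u w - b1| <= (2 * m1%:R)^-1 /\
              `|lin a v w - b2| <= (2 * m2%:R)^-1]).
  apply: fine_le; [by apply: fin_num_measure; exact: measurable_box|by apply: fin_num_measure; exact: measurable_box|].
  apply: le_measure; [by rewrite inE; exact: measurable_box|by rewrite inE; exact: measurable_box|].
  by move=> w [w1 w2]; split; [apply: le_trans w1 _|apply: le_trans w2 _]; exact: sm.
apply: le_trans h1 _; apply: le_trans (box_fourier u v b1 b2 m10 m20) _.
have sconst (x : R) : \sum_(k : 'I_m1 * 'I_m2) x = m1%:R * m2%:R * x.
  rewrite sumr_const (_ : #|_| = (m1 * m2)%N); last by rewrite card_prod !card_ord.
  by rewrite -[LHS]mulr_natl natrM.
have dist_lt (x y z : R) : 0 <= x -> 0 <= y -> x < z -> y < z -> `|x - y| < z.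
  by move=> *; rewrite ltr_norml; apply/andP; split; lra.
have hin (l : 'I_m1 * 'I_m2) : \sum_(k : 'I_m1 * 'I_m2)
    expR (- (2^-1 * gap2 u v (k.1%:R - l.1%:R) (k.2%:R - l.2%:R))) <= 300 / c ^+ 2.
  pose f1 (k : 'I_m1 * 'I_m2) := expR (- (c ^+ 2 * (k.1%:R - l.1%:R) ^+ 2 / 2)) *
      expR (- (c ^+ 2 * (k.2%:R - l.2%:R) ^+ 2 / 2)).
  pose f2 (k : 'I_m1 * 'I_m2) := expR (- (4^-1 * `|k.1%:R - l.1%:R|)) *
      expR (- (4^-1 * `|k.2%:R - l.2%:R|)) : R.
  apply: (@le_trans _ _ (\sum_k (f1 k + f2 k + expR (- (L / 2))))).
    apply: ler_sum => k _.
    have e1 : k.1%:R - l.1%:R = (k.1%:Z - l.1%:Z)%:~R :> R by rewrite rmorphB.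
    have e2 : k.2%:R - l.2%:R = (k.2%:Z - l.2%:Z)%:~R :> R by rewrite rmorphB.
    have f10 : 0 <= f1 k by rewrite mulr_ge0 ?expR_ge0.
    have f20 : 0 <= f2 k by rewrite mulr_ge0 ?expR_ge0.
    have f30 : 0 <= expR (- (L / 2)) by exact: expR_ge0.
    have lt1 : `|(k.1%:Z - l.1%:Z)%:~R| < (2 * s1)^-1 :> R.
      rewrite -e1; apply: lt_le_trans m1s.
      have := ltn_ord k.1; have := ltn_ord l.1; rewrite -!(ltr_nat R) => ? ?.
      have := ler0n R k.1; have := ler0n R l.1 => ? ?.
      exact: dist_lt.
    have lt2 : `|(k.2%:Z - l.2%:Z)%:~R| < (2 * s2)^-1 :> R.
      rewrite -e2; apply: lt_le_trans m2s.
      have := ltn_ord k.2; have := ltn_ord l.2; rewrite -!(ltr_nat R) => ? ?.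
      have := ler0n R k.2; have := ler0n R l.2 => ? ?.
      exact: dist_lt.
    have := good _ _ lt1 lt2; rewrite -e1 -e2.
    set q := gap2 _ _ _ _; move=> [hq|hq|hq].
    - have : expR (- (2^-1 * q)) <= f1 k by rewrite /f1 -expRD ler_expR; move: hq; clear -iid; lra.
      by move: f20 f30; clear -iid; lra.
    - have := expR_max (normr_ge0 _) (normr_ge0 _) hq; by rewrite -/(f2 k); move: f10 f30; clear -iid; lra.
    - have : expR (- (2^-1 * q)) <= expR (- (L / 2)) by rewrite ler_expR; move: hq; clear -iid; lra.
      by move: f10 f20; clear -iid; lra.
  rewrite !big_split/=.
  have c2 : 1 <= (c ^+ 2)^-1 by rewrite invf_ge1 ?exprn_gt0// expr_le1// ltW.
  have sumprod (F : 'I_m1 -> R) (G : 'I_m2 -> R) :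
     \sum_(k : 'I_m1 * 'I_m2) F k.1 * G k.2 = (\sum_k F k) * (\sum_k G k).
    rewrite mulr_suml (eq_bigr (fun k => \sum_j F k * G j)); last by move=> k _; rewrite mulr_sumr.
    by rewrite pair_bigA.
  have S1 : \sum_k f1 k <= 36 / c ^+ 2.
    rewrite (sumprod (fun k => expR (- (c ^+ 2 * (k%:R - l.1%:R) ^+ 2 / 2)))
       (fun k => expR (- (c ^+ 2 * (k%:R - l.2%:R) ^+ 2 / 2)))).
    have -> : 36 / c ^+ 2 = (6 / c) * (6 / c) by field; rewrite gt_eqF.
    by apply: ler_pM; rewrite ?geom_gauss ?c0 ?ltn_ord//; apply: sumr_ge0 => *; exact: expR_ge0.
  have S2 : \sum_k f2 k <= 9 * 9.
    rewrite (sumprod (fun k => expR (- (4^-1 * `|k%:R - l.1%:R|)))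
       (fun k => expR (- (4^-1 * `|k%:R - l.2%:R|)))).
    have g4 (l' m : nat) : (l' < m)%N ->
       \sum_(k < m) expR (- (4^-1 * `|k%:R - l'%:R|)) <= 9 :> R.
      move=> lm; apply: le_trans (geom_expR _ lm) _ => //.
      by rewrite invrK; lra.
    by apply: ler_pM; rewrite ?g4 ?ltn_ord//; apply: sumr_ge0 => *; exact: expR_ge0.
  have S3 : \sum_(k : 'I_m1 * 'I_m2) expR (- (L / 2)) <= 1.
    rewrite sconst expRN ler_pdivrMr ?expR_gt0// mul1r; apply: le_trans HL.
    have -> : (4 * s1 * s2)^-1 = (2 * s1)^-1 * (2 * s2)^-1 by field; rewrite !gt_eqF.
    by apply: ler_pM => //; exact: ltW.
  by move: S1 S2 S3 c2; clear -iid; lra.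
apply: (@le_trans _ _ (4 / (m1%:R * m2%:R) ^+ 2 * (m1%:R * m2%:R * (300 / c ^+ 2)))).
  apply: ler_wpM2l; first by rewrite divr_ge0 ?sqr_ge0.
  apply: (@le_trans _ _ (\sum_(l : 'I_m1 * 'I_m2) (300 / c ^+ 2))); first exact: ler_sum.
  by rewrite sconst.
have i1 : m1%:R^-1 <= 4 * s1.
  by rewrite -[leRHS]invrK lef_pV2 ?posrE ?invr_gt0// mulr_gt0.
have i2 : m2%:R^-1 <= 4 * s2.
  by rewrite -[leRHS]invrK lef_pV2 ?posrE ?invr_gt0// mulr_gt0.
have i12 : m1%:R^-1 * m2%:R^-1 <= (4 * s1) * (4 * s2).
  by apply: ler_pM => //; rewrite invr_ge0 ler0n.
have fin (K : R) : 4 / (m1%:R * m2%:R) ^+ 2 * (m1%:R * m2%:R * (K / c ^+ 2)) =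
   4 * K / c ^+ 2 * (m1%:R^-1 * m2%:R^-1) by field; rewrite !gt_eqF.
rewrite fin; have c20 : 0 <= 4 * 300 / c ^+ 2.
  by apply: divr_ge0; [exact: mulr_ge0 (ler0n R 4) (ler0n R 300)|exact: sqr_ge0].
apply: le_trans (ler_wpM2l c20 i12) _.
have fin2 (K : R) : 4 * K / c ^+ 2 * (4 * s1 * (4 * s2)) = K * 64 / c ^+ 2 * s1 * s2.
  by field; rewrite gt_eqF.
by rewrite fin2.
Qed.

End SmallBall.

(** * Independence of the rows and tensorization *)

Section Rows.
Context (R : realType) (disp0 : measure_display) (Om0 : measurableType disp0)
  (P0 : probability Om0 R) (xi : {RV P0 >-> R}) (disp : measure_display)
  (Om : measurableType disp) (P : probability Om R)
  (m : nat) (T : finType) (a : 'I_m * T -> {RV P >-> R}).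
Hypothesis iid : iid_copies xi a.

(** Extension by 0 to the variables of all rows, so that the estimates for general linear forms
    apply to one row. *)
Definition rowc (l : 'I_m) (u : T -> R) : 'I_m * T -> R :=
  fun j => if j.1 == l then u j.2 else 0.

Definition row (u : T -> R) (l : 'I_m) (w : Om) : R := \sum_t u t * a (l, t) w.

Lemma lin_rowc l u w : lin a (rowc l u) w = row u l w.
Proof.
rewrite /lin /rowc /row.
rewrite (eq_bigr (fun p : 'I_m * T => (if p.1 == l then u p.2 else 0) * a (p.1, p.2) w)); last by case.
rewrite -(pair_bigA _ (fun i t => (if i == l then u t else 0) * a (i, t) w))/=.
rewrite (bigD1 l)//= eqxx [X in _ + X]big1 ?addr0// => i /negPf il.
by apply: big1 => t _; rewrite il mul0r.
Qed.

Lemma char_gap0 : char_gap xi 0 = 0.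
Proof.
rewrite /char_gap /char_re /char_im.
under eq_fun do rewrite mul0r cos0.
under [X in _ + Ex _ X ^+ 2]eq_fun do rewrite mul0r sin0.
by rewrite !Ex_cst; ring.
Qed.

Definition row_gap (u v : T -> R) (k1 k2 : R) : R :=
  \sum_t char_gap xi (k1 * u t + k2 * v t).

Lemma gap2_rowc l u v k1 k2 :
  gap2 xi (rowc l u) (rowc l v) k1 k2 = row_gap u v k1 k2.
Proof.
rewrite /gap2 /rowc /row_gap.
rewrite -(pair_bigA _ (fun i t => char_gap xi (k1 * (if i == l then u t else 0) + k2 * (if i == l then v t else 0))))/=.
rewrite (bigD1 l)//= eqxx [X in _ + X]big1 ?addr0// => i /negPf il.
by apply: big1 => t _; rewrite il !mulr0 addr0 char_gap0.
Qed.

Definition row_idx (l : 'I_m) : seq ('I_m * T) := [seq (l, t) | t <- enum T].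

Lemma uniq_row_idx l : uniq (row_idx l).
Proof. by rewrite map_inj_uniq ?enum_uniq// => x y []. Qed.

Lemma mem_row_idx l (j : 'I_m * T) : (j \in row_idx l) = (j.1 == l).
Proof.
apply/mapP/eqP => [[t _ ->]//|jl].
by exists j.2; rewrite ?mem_enum// -jl; case: j {jl}.
Qed.

Definition row_box (u v : T -> R) (b1 b2 : 'I_m -> R) (s1 s2 : R) (l : 'I_m) : set Om :=
  [set w | `|row u l w - b1 l| <= s1 /\ `|row v l w - b2 l| <= s2].

Lemma row_boxE u v b1 b2 s1 s2 l : row_box u v b1 b2 s1 s2 l =
  [set w | `|lin a (rowc l u) w - b1 l| <= s1 /\ `|lin a (rowc l v) w - b2 l| <= s2].
Proof. by apply/seteqP; split => w /=; rewrite /row_box/= !lin_rowc. Qed.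

Lemma measurable_row_box u v b1 b2 s1 s2 l :
  measurable (row_box u v b1 b2 s1 s2 l).
Proof. by rewrite row_boxE; exact: measurable_box. Qed.

Lemma linf2_row u v l w :
  linf2 a (fun j => u j.2) (fun j => v j.2) (row_idx l) w = (row u l w, row v l w).
Proof.
rewrite /linf2 /row_idx !big_map /row.
by congr (_, _) => /=; rewrite big_enum.
Qed.

Lemma indep_of_cat E (r r' : seq ('I_m * T)) : measurable E -> uniq (r ++ r') ->
  indep_of a E (r ++ r') -> forall B, (forall j, measurable (B j)) ->
  P (E `&` cylinder a r B) = (P E * \prod_(j <- r) P (a j @^-1` B j))%E /\
  indep_of a (E `&` cylinder a r B) r'.
Proof.
elim: r E => [|j r IH] E mE ur iE B mB.
  by rewrite cylinder_nil setIT big_nil mule1.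
have [e1 e2] := indep_of_cons (mB j) ur iE.
have ur' : uniq (r ++ r') by case/andP: ur.
have mEj : measurable (E `&` a j @^-1` B j).
  by apply: measurableI => //; exact: measurable_preim.
have [f1 f2] := IH _ mEj ur' e2 B mB.
by rewrite cylinder_cons setIA big_cons f1 e1 muleA.
Qed.

(** Independence from any variables of the other rows is part of the conclusion because the
    induction needs it: it is applied to [r'] enlarged by the variables of the next row. *)
Lemma rows_indep u v b1 b2 s1 s2 (ls : seq 'I_m) (r' : seq ('I_m * T)) :
  uniq ls -> uniq r' -> (forall j, j \in r' -> j.1 \notin ls) ->
  let E := [set w | forall l, l \in ls -> row_box u v b1 b2 s1 s2 l w] in
  [/\ measurable E, P E = (\prod_(l <- ls) P (row_box u v b1 b2 s1 s2 l))%E &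
     indep_of a E r'].
Proof.
elim: ls r' => [|l ls IH] r' uls ur' dis /=.
  have -> : [set w | forall l, l \in [::] -> row_box u v b1 b2 s1 s2 l w] = setT.
    by apply/seteqP; split.
  split => //; first by rewrite big_nil probability_setT.
  exact: (indep_ofT iid.1).
have /andP[lls uls'] := uls.
set F := [set w | forall l', l' \in ls -> row_box u v b1 b2 s1 s2 l' w].
have -> : [set w | forall l', l' \in l :: ls -> row_box u v b1 b2 s1 s2 l' w] =
   F `&` row_box u v b1 b2 s1 s2 l.
  apply/seteqP; split => w /=.
    by move=> H; split; [move=> l' h; apply: H; rewrite inE h orbT|apply: H; rewrite inE eqxx].
  by move=> [H1 H2] l'; rewrite inE => /orP[/eqP->//|]; exact: H1.
pose r2 := r' ++ row_idx l.
have ur2 : uniq r2.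
  rewrite cat_uniq ur' uniq_row_idx andbT/=; apply/hasPn => j.
  rewrite mem_row_idx => /eqP jl; apply/negP => jr.
  by have := dis _ jr; rewrite jl inE eqxx.
have dis2 j : j \in r2 -> j.1 \notin ls.
  rewrite mem_cat => /orP[jr|]; last by rewrite mem_row_idx => /eqP->.
  by have := dis _ jr; rewrite inE negb_or => /andP[].
have [mF PF iF] := IH r2 uls' ur2 dis2.
rewrite -/F in mF PF iF.
pose C : set (R * R) := [set z | `|z.1 - b1 l| <= s1 /\ `|z.2 - b2 l| <= s2].
have mC : measurable C.
  apply: measurableI; apply: measurable_set_le; try exact: measurable_cst.
    by apply: measurableT_comp => //; apply: measurable_funB.
  by apply: measurableT_comp => //; apply: measurable_funB.
pose lf := linf2 a (fun j : 'I_m * T => u j.2) (fun j => v j.2) (row_idx l).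
have boxE : row_box u v b1 b2 s1 s2 l = lf @^-1` C.
  have -> : lf = (fun w => (row u l w, row v l w)) by apply/funext => w; exact: linf2_row.
  by [].
have key (G : set Om) : measurable G -> indep_of a G (row_idx l) ->
  P (G `&` row_box u v b1 b2 s1 s2 l) = (P G * P (row_box u v b1 b2 s1 s2 l))%E.
  move=> mG iG; rewrite boxE.
  exact: (indep_linf2 iid.1 _ _ mG (uniq_row_idx l) iG mC).
have mB0 : forall j : 'I_m * T, measurable (setT : set R) by [].
have iFrow : indep_of a F (row_idx l).
  have [_] := indep_of_cat mF ur2 iF mB0.
  have -> : cylinder a r' (fun=> setT) = setT by apply/seteqP; split.
  by rewrite setIT.
have mbox := measurable_row_box u v b1 b2 s1 s2 l.
split.
- exact: measurableI.
- by rewrite key// PF big_cons muleC.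
- move=> B mB.
  have [g1 g2] := indep_of_cat mF ur2 iF mB.
  have mcyl := @measurable_cylinder _ _ _ P _ a r' B mB.
  rewrite setIAC key//; last exact: measurableI.
  by rewrite g1 key// muleAC.
Qed.

Lemma rows_prob u v b1 b2 s1 s2 (p : R) : 0 <= p ->
  (forall l, fine (P (row_box u v b1 b2 s1 s2 l)) <= p) ->
  outer_le P [set w | forall l, row_box u v b1 b2 s1 s2 l w] (p ^+ m).
Proof.
move=> p0 hp.
have [mE PE _] := @rows_indep u v b1 b2 s1 s2 (enum 'I_m) [::] (enum_uniq _) isT (fun j h => ltac:(by [])).
eexists; split; [exact: mE| |].
  by move=> w H l _; exact: H.
rewrite PE big_enum/=.
have -> : (\prod_(l : 'I_m) P (row_box u v b1 b2 s1 s2 l) =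
   (\prod_(l : 'I_m) fine (P (row_box u v b1 b2 s1 s2 l)))%:E)%E.
  rewrite -prodEFin; apply: eq_bigr => l _; rewrite fineK//; apply: fin_num_measure.
  exact: measurable_row_box.
rewrite lee_fin -[in leRHS](card_ord m) -prodr_const.
by apply: ler_prod => l _; rewrite fine_ge0//= hp.
Qed.

(* Rounding the rows to the centres of boxes of size [2 s1] by [2 s2] and
   summing over the possible roundings. *)
Lemma tensorization u v (s1 s2 p lam s : R) :
  0 < s1 -> 0 < s2 -> 0 <= p -> 0 < lam ->
  (forall l b1 b2, fine (P (row_box u v b1 b2 s1 s2 l)) <= p) ->
  outer_le P [set w | \sum_l ((row u l w / s1) ^+ 2 + (row v l w / s2) ^+ 2) <= s]
    (expR (lam * s) * ((1 + 2 / lam) ^+ 2 * p) ^+ m).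
Proof.
move=> s10 s20 p0 lam0 hp.
set A := [set w | _].
pose rd (x : R) : int := Num.floor (x / 2 + 2^-1).
have rd1 x : `|x - 2 * (rd x)%:~R| <= 1.
  have := floor_itv (x / 2 + 2^-1); rewrite -/(rd x) intrD => /andP[h1 h2].
  by rewrite ler_norml; apply/andP; split; lra.
(* If r = rd x is not 0, then |x| >= 2 |r| - 1 >= 1, whose square is at least |r|. A quadratic
   budget thus bounds the l^1 norm that [net_exists] counts. *)
have rd2 x : `|(rd x)%:~R| <= x ^+ 2 :> R.
  have [r0|rn0] := eqVneq (rd x) 0; first by rewrite r0 normr0 sqr_ge0.
  have h1 : 1 <= `|(rd x)%:~R| :> R by rewrite -intr_norm -[1]/(1%:~R) ler_int -gtz0_ge1 normr_gt0.
  have h := rd1 x.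
  have h2 : 2 * `|(rd x)%:~R| - 1 <= `|x|.
    have := ler_normB x (x - 2 * (rd x)%:~R).
    rewrite opprB addrC subrK normrM ger0_norm// => h3.
    by have := le_trans h3 (lerD (lexx _) h); lra.
  rewrite -[x ^+ 2]real_normK ?num_real//; nra.
pose F (w : Om) (i : 'I_m + 'I_m) : int :=
  match i with inl l => rd (row u l w / s1) | inr l => rd (row v l w / s2) end.
have [] := @net_exists R Om A _ F (fun=> lam) (lam * s) (fun=> lam0).
  move=> w Aw; rewrite -mulr_sumr ler_wpM2l ?(ltW lam0)//; apply: le_trans Aw.
  rewrite big_sumType/= big_split/=; apply: lerD; apply: ler_sum => l _; exact: rd2.
move=> r [rA rcov rsz].
apply: (@outer_leS _ _ _ _ _ [set w | exists2 g, List.In g r & F w = F g] _ ((size r)%:R * p ^+ m)).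
- by move=> w Aw; have [g gr e] := rcov w Aw; exists g.
- apply: (@le_trans _ _ (expR (lam * s) * (\prod_(i : 'I_m + 'I_m) (1 + 2 / lam)) * p ^+ m)).
    by rewrite ler_wpM2r ?exprn_ge0.
  rewrite prodr_const card_sum card_ord -mulrA.
  by rewrite exprMn -exprM mul2n -addnn.
apply: outer_le_seq; first exact: exprn_ge0.
move=> g _.
pose c1 (l : 'I_m) := 2 * s1 * (F g (inl l))%:~R.
pose c2 (l : 'I_m) := 2 * s2 * (F g (inr l))%:~R.
apply: (@outer_leS _ _ _ _ _ [set w | forall l, row_box u v c1 c2 s1 s2 l w] _ (p ^+ m)) => //.
  move=> w e l; rewrite /row_box /c1 /c2 -e /=.
  have sc x s' : 0 < s' -> `|x - 2 * s' * (rd (x / s'))%:~R| <= s'.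
    move=> s'0; have := rd1 (x / s').
    rewrite -[x in `|x - _| <= s'](divfK (lt0r_neq0 s'0)).
    have -> : x / s' * s' - 2 * s' * (rd (x / s'))%:~R = (x / s' - 2 * (rd (x / s'))%:~R) * s' by ring.
    by rewrite normrM (gtr0_norm s'0) => h; rewrite -[leRHS]mul1r ler_pM2r.
  by split; exact: sc.
exact: rows_prob.
Qed.

End Rows.

(** * Vectors and tensors *)

Section Vectors.
Context (R : realType) (I : finType).
Implicit Types u v x y : I -> R.

Definition dot u v : R := \sum_i u i * v i.
Definition nrm u : R := Num.sqrt (dot u u).

Lemma dotC u v : dot u v = dot v u.
Proof. by apply: eq_bigr => i _; rewrite mulrC. Qed.

Lemma dot_ge0 u : 0 <= dot u u.
Proof. by apply: sumr_ge0 => i _; rewrite -expr2 sqr_ge0. Qed.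

Lemma nrm_ge0 u : 0 <= nrm u.
Proof. exact: sqrtr_ge0. Qed.

Lemma nrm_sq u : nrm u ^+ 2 = dot u u.
Proof. by rewrite sqr_sqrtr ?dot_ge0. Qed.

Lemma nrm_le_sq u (c : R) : 0 <= c -> (nrm u <= c) = (dot u u <= c ^+ 2).
Proof. by move=> c0; rewrite -nrm_sq ler_sqr ?nnegrE ?nrm_ge0. Qed.

Lemma nrm1 u : dot u u = 1 -> nrm u = 1.
Proof. by rewrite /nrm => ->; rewrite sqrtr1. Qed.

Lemma dotDl u v x : dot (fun i => u i + v i) x = dot u x + dot v x.
Proof. by rewrite /dot -big_split; apply: eq_bigr => i _; rewrite mulrDl. Qed.

Lemma dotZl (c : R) u v : dot (fun i => c * u i) v = c * dot u v.
Proof. by rewrite /dot mulr_sumr; apply: eq_bigr => i _; rewrite mulrA. Qed.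

Lemma dotDr u v x : dot x (fun i => u i + v i) = dot x u + dot x v.
Proof. by rewrite dotC dotDl !(dotC x). Qed.

Lemma dotZr (c : R) u v : dot u (fun i => c * v i) = c * dot u v.
Proof. by rewrite dotC dotZl dotC. Qed.

Lemma dotNl u v : dot (fun i => - u i) v = - dot u v.
Proof. by rewrite /dot -sumrN; apply: eq_bigr => i _; rewrite mulNr. Qed.

Lemma dotBl u v x : dot (fun i => u i - v i) x = dot u x - dot v x.
Proof. by rewrite dotDl dotNl. Qed.

Lemma dotBr u v x : dot x (fun i => u i - v i) = dot x u - dot x v.
Proof. by rewrite dotC dotBl !(dotC x). Qed.

Lemma dot_lin2 (a b c d : R) u v x y :
  dot (fun i => a * u i + b * v i) (fun i => c * x i + d * y i) =
  a * c * dot u x + a * d * dot u y + b * c * dot v x + b * d * dot v y.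
Proof. rewrite dotDl !dotZl !dotDr !dotZr; ring. Qed.

Lemma cauchy_schwarz u v : dot u v ^+ 2 <= dot u u * dot v v.
Proof.
have [v0|v0] := eqVneq (dot v v) 0.
  have vi i : v i = 0.
    have := v0; rewrite /dot (bigD1 i)//= => /eqP.
    rewrite paddr_eq0 -?expr2 ?sqr_ge0//; last first.
      by apply: sumr_ge0 => j _; rewrite -expr2 sqr_ge0.
    by rewrite sqrf_eq0 => /andP[/eqP].
  have -> : dot u v = 0 by rewrite /dot big1// => i _; rewrite vi mulr0.
  by rewrite v0 mulr0 expr0n.
have vp : 0 < dot v v by rewrite lt0r v0 dot_ge0.
have := dot_ge0 (fun i => dot v v * u i - dot u v * v i).
rewrite dotBl !dotBr !dotZl !dotZr (dotC v u) => h.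
have : 0 <= dot v v * (dot u u * dot v v - dot u v ^+ 2).
  by apply: le_trans h _; rewrite le_eqVlt; apply/orP; left; apply/eqP; ring.
by rewrite pmulr_rge0// subr_ge0.
Qed.

Lemma dot_le u v : `|dot u v| <= nrm u * nrm v.
Proof.
rewrite -(@ler_sqr R) ?nnegrE ?mulr_ge0 ?nrm_ge0//.
by rewrite real_normK ?num_real// exprMn !nrm_sq cauchy_schwarz.
Qed.

Lemma nrmD u v : nrm (fun i => u i + v i) <= nrm u + nrm v.
Proof.
rewrite nrm_le_sq ?addr_ge0 ?nrm_ge0//.
rewrite dotDl !dotDr (dotC v u) sqrrD !nrm_sq.
have := dot_le u v; rewrite ler_norml => /andP[_ h].
by rewrite -mulr_natl; lra.
Qed.

Lemma nrmZ (c : R) u : nrm (fun i => c * u i) = `|c| * nrm u.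
Proof.
by rewrite /nrm dotZl dotZr mulrA -expr2 sqrtrM ?sqr_ge0// sqrtr_sqr.
Qed.

Lemma nrmN u : nrm (fun i => - u i) = nrm u.
Proof. by rewrite /nrm dotNl dotC dotNl opprK. Qed.

Lemma nrm_dist u v : nrm (fun i => u i - v i) = nrm (fun i => v i - u i).
Proof. by rewrite -nrmN; congr nrm; apply/funext => i; rewrite opprB. Qed.

Lemma nrm_sub_le u v : nrm u <= nrm v + nrm (fun i => u i - v i).
Proof.
have := nrmD v (fun i => u i - v i).
by have -> : (fun i => v i + (u i - v i)) = u by apply/funext => i; rewrite addrC subrK.
Qed.

Lemma nrm_coord u i : `|u i| <= nrm u.
Proof.
rewrite -(@ler_sqr R) ?nnegrE ?nrm_ge0// nrm_sq real_normK ?num_real//.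
rewrite /dot (bigD1 i)//= -expr2 lerDl; apply: sumr_ge0 => j _.
by rewrite -expr2 sqr_ge0.
Qed.

Lemma nrm0 : nrm (fun=> 0) = 0.
Proof. by rewrite /nrm /dot big1 ?sqrtr0// => i _; rewrite mulr0. Qed.

Lemma nrm_eq0 u : nrm u = 0 -> forall i, u i = 0.
Proof. by move=> h i; apply/eqP; rewrite -normr_le0 -h nrm_coord. Qed.

Lemma nrm_le_coord u (c : R) : 0 <= c -> (forall i, `|u i| <= c) ->
  nrm u <= Num.sqrt #|I|%:R * c.
Proof.
move=> c0 h; rewrite nrm_le_sq ?mulr_ge0 ?sqrtr_ge0//.
rewrite exprMn sqr_sqrtr ?ler0n//.
apply: (@le_trans _ _ (\sum_(i : I) c ^+ 2)).
  apply: ler_sum => i _; rewrite -expr2 -[u i ^+ 2]real_normK ?num_real//.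
  by rewrite ler_sqr ?nnegrE.
by rewrite sumr_const mulr_natl.
Qed.

Lemma sum_abs_le u : \sum_i `|u i| <= Num.sqrt #|I|%:R * nrm u.
Proof.
have := dot_le (fun=> 1) (fun i => `|u i|).
have -> : dot (fun=> 1) (fun i => `|u i|) = \sum_i `|u i|.
  by apply: eq_bigr => i _; rewrite mul1r.
have -> : nrm (fun=> 1) = Num.sqrt #|I|%:R.
  by congr Num.sqrt; rewrite /dot (eq_bigr (fun=> 1)) ?sumr_const// => i _; rewrite mulr1.
have -> : nrm (fun i => `|u i|) = nrm u.
  by congr Num.sqrt; apply: eq_bigr => i _; rewrite -!expr2 real_normK ?num_real.
by rewrite ger0_norm// sumr_ge0.
Qed.

End Vectors.

Section Tensors.
Context (R : realType) (I : finType).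
Implicit Types (x y z u : I -> R) (s : seq I) (d : nat).

(** The summand is a function of sequences rather than tuples, so that inductions on d can strip the
    first index. *)
Definition tsum d (F : seq I -> R) : R := \sum_(t : d.-tuple I) F t.

Lemma tsum0 F : tsum 0 F = F [::].
Proof.
rewrite /tsum (big_pred1 [tuple]) => [//|t].
by apply/esym/eqP; exact: tuple0.
Qed.

Lemma tsumS d F : tsum d.+1 F = \sum_i tsum d (fun s => F (i :: s)).
Proof.
rewrite /tsum pair_bigA/=.
rewrite (reindex (fun p : I * d.-tuple I => [tuple of p.1 :: p.2]))//=.
exists (fun t : d.+1.-tuple I => (thead t, [tuple of behead t])) => /=.
  by move=> [i t] _ /=; congr pair; apply: val_inj.
by move=> t _; rewrite [RHS]tuple_eta; apply: val_inj.
Qed.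

Lemma eq_tsum d F G : (forall s, size s = d -> F s = G s) -> tsum d F = tsum d G.
Proof. by move=> h; apply: eq_bigr => t _; rewrite h// size_tuple. Qed.

Lemma tsumD d F G : tsum d (fun s => F s + G s) = tsum d F + tsum d G.
Proof. by rewrite /tsum big_split. Qed.

Lemma tsumZ d c F : tsum d (fun s => c * F s) = c * tsum d F.
Proof. by rewrite /tsum mulr_sumr. Qed.

Lemma tsum_ge0 d F : (forall s, 0 <= F s) -> 0 <= tsum d F.
Proof. by move=> h; apply: sumr_ge0. Qed.

Definition tU x s : R := \prod_(i <- s) x i.

(** The derivative of [tU] at x in the direction y, by the Leibniz rule along the sequence; paired
    with the coefficients of the system it gives D_x(y). *)
Fixpoint tV x y s : R :=
  if s is i :: s' then x i * tV x y s' + y i * tU x s' else 0.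

Lemma tU_cons x i s : tU x (i :: s) = x i * tU x s.
Proof. by rewrite /tU big_cons. Qed.

Lemma tU_nil x : tU x [::] = 1.
Proof. by rewrite /tU big_nil. Qed.

Lemma tsum_UU d x y : tsum d (fun s => tU x s * tU y s) = dot x y ^+ d.
Proof.
elim: d => [|d IH]; first by rewrite tsum0 !tU_nil mulr1 expr0.
rewrite tsumS exprS -IH /dot mulr_suml; apply: eq_bigr => i _.
by rewrite -tsumZ; apply: eq_tsum => s _; rewrite !tU_cons; ring.
Qed.

Lemma tsum_UV d x u : dot x x = 1 ->
  tsum d (fun s => tU x s * tV x u s) = d%:R * dot x u.
Proof.
move=> xx; elim: d => [|d IH]; first by rewrite tsum0/= mulr0 mul0r.
rewrite tsumS (eq_bigr (fun i => (x i * x i) * (d%:R * dot x u) + (x i * u i) * 1)).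
  by rewrite big_split/= -!mulr_suml -/(dot x x) -/(dot x u) xx -natr1; ring.
move=> i _; rewrite -IH -[in X in _ + X](expr1n _ d) -[in X in _ + X]xx -tsum_UU.
rewrite -!tsumZ -tsumD; apply: eq_tsum => s _; rewrite tU_cons/=; ring.
Qed.

(** Origin of the factor sqrt d in [hatV]: the d Leibniz terms are mutually orthogonal when u is
    orthogonal to x. *)
Lemma tsum_VV d x u : dot x x = 1 -> dot x u = 0 ->
  tsum d (fun s => tV x u s * tV x u s) = d%:R * dot u u.
Proof.
move=> xx xu; elim: d => [|d IH]; first by rewrite tsum0/= mulr0 mul0r.
rewrite tsumS (eq_bigr (fun i => (x i * x i) * (d%:R * dot u u) + (u i * u i) * 1
   + (2 * (x i * u i)) * (d%:R * dot x u))).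
  rewrite !big_split/= -!mulr_suml -mulr_sumr -/(dot x x) -/(dot x u) -/(dot u u).
  by rewrite xx xu -natr1; ring.
move=> i _; rewrite -IH -(tsum_UV d u xx).
rewrite -[in X in _ + X + _](expr1n _ d) -[in X in _ + X + _]xx -tsum_UU.
rewrite -!tsumZ -!tsumD; apply: eq_tsum => s _ /=; ring.
Qed.

(** Both sides depend only on c = dot x y, and 1 - c^d <= d (1 - c) when |c| <= 1. *)
Lemma tsum_Udiff d x y : dot x x = 1 -> dot y y = 1 ->
  tsum d (fun s => (tU x s - tU y s) ^+ 2) <=
  d%:R * dot (fun i => x i - y i) (fun i => x i - y i).
Proof.
move=> xx yy.
have -> : tsum d (fun s => (tU x s - tU y s) ^+ 2) = 2 * (1 - dot x y ^+ d).
  rewrite (eq_tsum (G := fun s => tU x s * tU x s + (-2) * (tU x s * tU y s) + tU y s * tU y s)); last by move=> s _; ring.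
  by rewrite !tsumD tsumZ !tsum_UU xx yy expr1n; ring.
have -> : dot (fun i => x i - y i) (fun i => x i - y i) = 2 * (1 - dot x y).
  by rewrite dotBl !dotBr xx yy (dotC y x); ring.
have c1 : `|dot x y| <= 1.
  by have := dot_le x y; rewrite (nrm1 xx) (nrm1 yy) mulr1.
have : 1 - dot x y ^+ d <= d%:R * (1 - dot x y); last by lra.
set c := dot x y in c1 *; have c2 : c <= 1 by move: c1; rewrite ler_norml => /andP[].
elim: d => [|d IH]; first by rewrite expr0 mul0r subrr.
have h : `|c ^+ d| <= 1 by rewrite normrX exprn_ile1.
have h2 : c ^+ d <= 1 by move: h; rewrite ler_norml => /andP[].
have -> : 1 - c ^+ d.+1 = (1 - c ^+ d) + c ^+ d * (1 - c) by rewrite exprSr; ring.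
rewrite -natr1 mulrDl mul1r; apply: lerD => //.
by rewrite -[leRHS]mul1r ler_wpM2r// subr_ge0.
Qed.

(* [hatV b d] is the unit tensor of the second equation: [b = false] for
   D_x(y) divided by sqrt d, [b = true] for f(y). *)
Definition hatV (b : bool) d x y s : R :=
  if b then tU y s else tV x y s / Num.sqrt d%:R.

Definition comb (b : bool) d x y (t1 t2 : R) s : R := t1 * tU x s + t2 * hatV b d x y s.

(** With the other indices frozen, the second index runs through a vector of the plane of x and y.
    This is how an integer tensor close to [comb] produces an integer vector close to that plane. *)
Lemma comb_row b d x y t1 t2 i s : exists r1 r2 : R,
  forall j, comb b d x y t1 t2 (i :: j :: s) = r1 * x j + r2 * y j.
Proof.
case: b; rewrite /comb /hatV.
  exists (t1 * x i * tU x s), (t2 * y i * tU y s) => j.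
  by rewrite !tU_cons; ring.
exists (t1 * x i * tU x s + t2 / Num.sqrt d%:R * (x i * tV x y s + y i * tU x s)),
  (t2 / Num.sqrt d%:R * x i * tU x s) => j.
by rewrite /= !tU_cons; ring.
Qed.

Lemma slice_sum (S : pred I) x y d (A B : seq I -> R) :
  \sum_(i | i \notin S) tsum d (fun s => (x i * A s + y i * B s) ^+ 2) =
  (\sum_(i | i \notin S) x i ^+ 2) * tsum d (fun s => A s * A s) +
  2 * (\sum_(i | i \notin S) x i * y i) * tsum d (fun s => A s * B s) +
  (\sum_(i | i \notin S) y i ^+ 2) * tsum d (fun s => B s * B s).
Proof.
rewrite mulr_sumr !mulr_suml -!big_split/=; apply: eq_bigr => i _.
rewrite -!tsumZ -!tsumD; apply: eq_tsum => s _; ring.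
Qed.

Lemma sum_mul_sq (S : pred I) x y :
  (\sum_(i | i \notin S) x i * y i) ^+ 2 <=
  (\sum_(i | i \notin S) x i ^+ 2) * (\sum_(i | i \notin S) y i ^+ 2).
Proof.
pose px i := if i \notin S then x i else 0.
pose py i := if i \notin S then y i else 0.
have e u v : \sum_(i | i \notin S) u i * v i =
   dot (fun i => if i \notin S then u i else 0) (fun i => if i \notin S then v i else 0).
  by rewrite big_mkcond; apply: eq_bigr => i _; case: ifP => //; rewrite mulr0.
have q u : \sum_(i | i \notin S) u i ^+ 2 = \sum_(i | i \notin S) u i * u i.
  by apply: eq_bigr => i _; rewrite expr2.
by rewrite !q !e cauchy_schwarz.
Qed.

Lemma off_sum_le (S : pred I) x : \sum_(i | i \notin S) x i ^+ 2 <= dot x x.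
Proof.
rewrite /dot (bigID (fun i => i \notin S) predT)/= (eq_bigr (fun i => x i * x i)) => [|i _]; last by rewrite expr2.
by rewrite lerDl; apply: sumr_ge0 => i _; rewrite -expr2 sqr_ge0.
Qed.

(* [r] is the squared mass of [x] off the small sets of coordinates: writing
   [comb] as x (x) A + y (x) B, the mass off [S] is a quadratic form in
   [(t1, t2)] whose smallest eigenvalue is of order [r ^ 2 d]. *)
Lemma comb_off_mass (b : bool) d x y (S : pred I) (t1 t2 r : R) : (0 < d)%N ->
  dot x x = 1 -> dot y y = 1 -> dot x y = 0 -> 0 < r <= 1 -> r * d.+1%:R <= 2 ->
  r <= \sum_(i | i \notin S) x i ^+ 2 ->
  (b -> r <= \sum_(i | i \notin S) y i ^+ 2) ->
  r ^+ 2 * d.+1%:R / 8 * (t1 ^+ 2 + t2 ^+ 2) <=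
  \sum_(i | i \notin S) tsum d (fun s => comb b d.+1 x y t1 t2 (i :: s) ^+ 2).
Proof.
move=> d0 xx yy xy /andP[r0 r1] rd hx hy.
set D : R := d.+1%:R in rd *.
have D1 : 1 <= D by rewrite /D ler1n.
case: b hy => hy.
  have -> : \sum_(i | i \notin S) tsum d (fun s => comb true d.+1 x y t1 t2 (i :: s) ^+ 2) =
     \sum_(i | i \notin S) tsum d (fun s => (x i * (t1 * tU x s) + y i * (t2 * tU y s)) ^+ 2).
    by apply: eq_bigr => i _; apply: eq_tsum => s _; rewrite /comb /hatV !tU_cons; ring.
  rewrite slice_sum.
  have eA : tsum d (fun s => t1 * tU x s * (t1 * tU x s)) = t1 ^+ 2.
    rewrite -[RHS]mulr1 -(expr1n _ d) -xx -tsum_UU -tsumZ; apply: eq_tsum => s _; ring.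
  have eB : tsum d (fun s => t2 * tU y s * (t2 * tU y s)) = t2 ^+ 2.
    rewrite -[RHS]mulr1 -(expr1n _ d) -yy -tsum_UU -tsumZ; apply: eq_tsum => s _; ring.
  have eAB : tsum d (fun s => t1 * tU x s * (t2 * tU y s)) = 0.
    have -> : 0 = (t1 * t2) * (dot x y ^+ d) by rewrite xy expr0n -[d]prednK//= mulr0.
    rewrite -tsum_UU -tsumZ; apply: eq_tsum => s _; ring.
  rewrite eA eB eAB mulr0 addr0.
  have t10 := sqr_ge0 t1; have t20 := sqr_ge0 t2.
  have h1 := ler_wpM2r t10 hx; have h2 := ler_wpM2r t20 (hy isT).
  have h3 : r ^+ 2 * D / 8 <= r.
    have -> : r ^+ 2 * D / 8 = r * (r * D / 8) by ring.
    by rewrite -[leRHS]mulr1 ler_wpM2l ?(ltW r0)//; lra.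
  have h4 := ler_wpM2r (addr_ge0 t10 t20) h3.
  by apply: le_trans h4 _; lra.
set q : R := Num.sqrt D.
have q2 : q ^+ 2 = D by rewrite sqr_sqrtr//; lra.
have q0 : 0 < q by rewrite sqrtr_gt0; lra.
have -> : \sum_(i | i \notin S) tsum d (fun s => comb false d.+1 x y t1 t2 (i :: s) ^+ 2) =
   \sum_(i | i \notin S) tsum d (fun s => (x i * (t1 * tU x s + t2 / q * tV x y s) + y i * (t2 / q * tU x s)) ^+ 2).
  by apply: eq_bigr => i _; apply: eq_tsum => s _; rewrite /comb /hatV !tU_cons/= -/D -/q; ring.
rewrite slice_sum.
have eUU : tsum d (fun s => tU x s * tU x s) = 1 by rewrite tsum_UU xx expr1n.
have eUV : tsum d (fun s => tU x s * tV x y s) = 0 by rewrite tsum_UV// xy mulr0.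
have eVV : tsum d (fun s => tV x y s * tV x y s) = d%:R by rewrite tsum_VV// yy mulr1.
have eA : tsum d (fun s => (t1 * tU x s + t2 / q * tV x y s) * (t1 * tU x s + t2 / q * tV x y s)) =
   t1 ^+ 2 + (t2 / q) ^+ 2 * d%:R.
  rewrite (eq_tsum (G := fun s => t1 ^+ 2 * (tU x s * tU x s) + (2 * t1 * (t2 / q)) * (tU x s * tV x y s) + (t2 / q) ^+ 2 * (tV x y s * tV x y s))); last by move=> s _; ring.
  by rewrite !tsumD !tsumZ eUU eUV eVV; ring.
have eAB : tsum d (fun s => (t1 * tU x s + t2 / q * tV x y s) * (t2 / q * tU x s)) = t1 * (t2 / q).
  rewrite (eq_tsum (G := fun s => t1 * (t2 / q) * (tU x s * tU x s) + (t2 / q) ^+ 2 * (tU x s * tV x y s))); last by move=> s _; ring.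
  by rewrite !tsumD !tsumZ eUU eUV; ring.
have eB : tsum d (fun s => t2 / q * tU x s * (t2 / q * tU x s)) = (t2 / q) ^+ 2.
  rewrite (eq_tsum (G := fun s => (t2 / q) ^+ 2 * (tU x s * tU x s))); last by move=> s _; ring.
  by rewrite tsumZ eUU mulr1.
rewrite eA eAB eB.
set h := \sum_(i | i \notin S) x i ^+ 2 in hx *.
set g := \sum_(i | i \notin S) y i ^+ 2.
set c := \sum_(i | i \notin S) x i * y i.
have cgh : c ^+ 2 <= h * g by exact: sum_mul_sq.
have g0 : 0 <= g by apply: sumr_ge0 => i _; exact: sqr_ge0.
have g1 : g <= 1 by rewrite -yy; exact: off_sum_le.
have h1 : h <= 1 by rewrite -xx; exact: off_sum_le.
have h0 : 0 < h by apply: lt_le_trans hx.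
set t := t2 / q.
have tt : t ^+ 2 * D = t2 ^+ 2 by rewrite /t expr_div_n q2 divfK//; apply: lt0r_neq0; lra.
have dD : d%:R = D - 1 :> R by rewrite /D -natr1 addrK.
have d1 : 1 <= d%:R :> R by rewrite ler1n.
have D2 : 2 <= D by move: d1; rewrite dD; clear; lra.
(* X is what the cross term leaves of the quadratic form after Cauchy-Schwarz; Y comes from the
   Leibniz terms that differentiate a later factor. *)
pose X : R := (Num.sqrt h * `|t1| - Num.sqrt g * `|t|) ^+ 2.
pose Y := h * (t ^+ 2 * d%:R).
have X0 : 0 <= X by exact: sqr_ge0.
have low : X + Y <= h * (t1 ^+ 2 + t ^+ 2 * d%:R) + 2 * c * (t1 * t) + g * t ^+ 2.
  have h3 : `|c| <= Num.sqrt h * Num.sqrt g.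
    rewrite -(@ler_sqr R) ?nnegrE ?mulr_ge0 ?sqrtr_ge0// real_normK ?num_real//.
    by rewrite exprMn !sqr_sqrtr// ltW.
  have h4 : - (c * (t1 * t)) <= (Num.sqrt h * Num.sqrt g) * (`|t1| * `|t|).
    apply: le_trans (ler_norm _) _; rewrite normrN !normrM.
    by rewrite ler_wpM2r ?mulr_ge0.
  have e1 : X = h * t1 ^+ 2 - 2 * ((Num.sqrt h * Num.sqrt g) * (`|t1| * `|t|)) + g * t ^+ 2.
    transitivity (Num.sqrt h ^+ 2 * `|t1| ^+ 2 - 2 * ((Num.sqrt h * Num.sqrt g) * (`|t1| * `|t|)) + Num.sqrt g ^+ 2 * `|t| ^+ 2).
      by rewrite /X; ring.
    by rewrite !sqr_sqrtr ?(ltW h0)// !real_normK ?num_real.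
  by rewrite e1 /Y; move: h4; clear; lra.
apply: le_trans _ low.
have Y2 : h * t2 ^+ 2 / 2 <= Y.
  rewrite /Y -tt dD.
  have -> : h * (t ^+ 2 * D) / 2 = h * t ^+ 2 * (D / 2) by ring.
  rewrite [leRHS]mulrA ler_wpM2l//; first by rewrite mulr_ge0 ?sqr_ge0 ?(ltW h0).
  by move: D2; clear; lra.
(* X can vanish with t1 nonzero, but only when t is comparable to t1; this t is paid for by Y, since
   t^2 = t2^2 / D. *)
have X1 : h * t1 ^+ 2 <= 2 * X + 2 * t ^+ 2.
  have s1 : Num.sqrt h * `|t1| = (Num.sqrt h * `|t1| - Num.sqrt g * `|t|) + Num.sqrt g * `|t| by ring.
  have -> : h * t1 ^+ 2 = (Num.sqrt h * `|t1|) ^+ 2.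
    by rewrite exprMn sqr_sqrtr ?(ltW h0)// real_normK ?num_real.
  have s2 : (Num.sqrt g * `|t|) ^+ 2 <= t ^+ 2.
    rewrite exprMn sqr_sqrtr// real_normK ?num_real//.
    by rewrite -[leRHS]mul1r ler_wpM2r ?sqr_ge0.
  rewrite s1 /X; set e := Num.sqrt h * `|t1| - _; set e' := Num.sqrt g * `|t| in s2 *.
  have : 0 <= (e - e') ^+ 2 by exact: sqr_ge0.
  by move: s2; clearbody e e'; clear; nra.
have t20 := sqr_ge0 t2; have t10 := sqr_ge0 t1.
have rh : r * t1 ^+ 2 <= 2 * X + 2 * t ^+ 2 by apply: le_trans X1; rewrite ler_wpM2r.
have rh2 : r * t2 ^+ 2 / 2 <= Y by apply: le_trans Y2; rewrite ler_pM2r// ler_wpM2r.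
have rD0 : 0 <= r * D / 8 by rewrite divr_ge0 ?mulr_ge0// ?(ltW r0)//; lra.
have k1 := ler_wpM2l rD0 rh.
have k2 : r * D / 8 * (2 * t ^+ 2) <= Y / 2.
  have -> : r * D / 8 * (2 * t ^+ 2) = (r * t2 ^+ 2 / 2) / 2 by rewrite -tt; field.
  by move: rh2; clear; lra.
have k3 : r * D / 8 * (2 * X) <= X / 2.
  have -> : r * D / 8 * (2 * X) = (r * D / 4) * X by field.
  by rewrite mulrC ler_wpM2l//; move: rd; clear; lra.
have k4 : r ^+ 2 * D / 8 * t2 ^+ 2 <= Y / 2.
  have -> : r ^+ 2 * D / 8 * t2 ^+ 2 = (r * D / 4) * (r * t2 ^+ 2 / 2) by field.
  have : (r * D / 4) * (r * t2 ^+ 2 / 2) <= 2^-1 * Y.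
    have n1 : 0 <= r * D / 4 by rewrite divr_ge0 ?mulr_ge0 ?(ltW r0)//; lra.
    have n2 : 0 <= r * t2 ^+ 2 / 2 by exact: divr_ge0 (mulr_ge0 (ltW r0) t20) (ler0n R 2).
    by apply: ler_pM n1 n2 _ rh2; move: rd; clear; lra.
  by move=> k5; apply: le_trans k5 _; rewrite mulrC.
have -> : r ^+ 2 * D / 8 * (t1 ^+ 2 + t2 ^+ 2) = r * D / 8 * (r * t1 ^+ 2) + r ^+ 2 * D / 8 * t2 ^+ 2 by ring.
by rewrite mulrDr in k1; move: k1 k2 k3 k4 X0; clear; lra.
Qed.

End Tensors.

(** * Multilinear bounds *)

Section Projective.
Context (R : realType) (I : finType).
Implicit Types (x y z u : I -> R) (s : seq I) (d : nat).

Definition app (m d : nat) (A : 'I_m -> seq I -> R) (tau : seq I -> R) : 'I_m -> R :=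
  fun l => tsum d (fun s => A l s * tau s).

Lemma app_ext m d (A : 'I_m -> seq I -> R) tau tau' :
  (forall s, size s = d -> tau s = tau' s) -> app d A tau = app d A tau'.
Proof. by move=> h; apply/funext => l; apply: eq_tsum => s sd; rewrite h. Qed.

Lemma appD m d (A : 'I_m -> seq I -> R) tau tau' :
  app d A (fun s => tau s + tau' s) = fun l => app d A tau l + app d A tau' l.
Proof. by apply/funext => l; rewrite /app -tsumD; apply: eq_tsum => s _; ring. Qed.

Lemma appZ m d (A : 'I_m -> seq I -> R) c tau :
  app d A (fun s => c * tau s) = fun l => c * app d A tau l.
Proof. by apply/funext => l; rewrite /app -tsumZ; apply: eq_tsum => s _; ring. Qed.

Lemma appB m d (A : 'I_m -> seq I -> R) tau tau' :
  app d A (fun s => tau s - tau' s) = fun l => app d A tau l - app d A tau' l.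
Proof.
rewrite (@app_ext _ _ _ _ (fun s => tau s + (-1) * tau' s)); last by move=> s _; ring.
by rewrite appD appZ; apply/funext => l; ring.
Qed.

Definition contract (m : nat) (A : 'I_m -> seq I -> R) z : 'I_m -> seq I -> R :=
  fun l s => \sum_i z i * A l (i :: s).

Fixpoint contr (m : nat) (A : 'I_m -> seq I -> R) (zs : seq (I -> R)) : 'I_m -> R :=
  if zs is z :: zs' then contr (contract A z) zs' else fun l => A l [::].

Fixpoint tP (zs : seq (I -> R)) s : R :=
  match zs, s with
  | z :: zs', i :: s' => z i * tP zs' s'
  | [::], [::] => 1
  | _, _ => 0
  end.

Lemma app_cons m d (A : 'I_m -> seq I -> R) z tau (tau' : seq I -> R) :
  (forall i s, tau' (i :: s) = z i * tau s) ->
  app d.+1 A tau' = app d (contract A z) tau.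
Proof.
move=> h; apply/funext => l; rewrite /app tsumS /contract.
rewrite [RHS](_ : _ = tsum d (fun s => \sum_i z i * A l (i :: s) * tau s)); last first.
  by apply: eq_tsum => s _; rewrite mulr_suml.
rewrite /tsum exchange_big/=; apply: eq_bigr => t _; apply: eq_bigr => i _.
by rewrite h; ring.
Qed.

Lemma contrE m (A : 'I_m -> seq I -> R) zs : contr A zs = app (size zs) A (tP zs).
Proof.
elim: zs A => [|z zs IH] A /=.
  by apply/funext => l; rewrite /app tsum0 mulr1.
by rewrite (@app_cons _ _ _ z (tP zs)).
Qed.

Lemma contrD m (A B : 'I_m -> seq I -> R) zs :
  contr (fun l s => A l s + B l s) zs = fun l => contr A zs l + contr B zs l.
Proof.
elim: zs A B => [|z zs IH] A B //=.
rewrite -IH; congr contr; apply/funext => l; apply/funext => s.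
by rewrite /contract -big_split; apply: eq_bigr => i _; rewrite mulrDr.
Qed.

Lemma contrZ m (A : 'I_m -> seq I -> R) c zs :
  contr (fun l s => c * A l s) zs = fun l => c * contr A zs l.
Proof.
elim: zs A => [|z zs IH] A //=.
rewrite -IH; congr contr; apply/funext => l; apply/funext => s.
by rewrite /contract mulr_sumr; apply: eq_bigr => i _; rewrite mulrCA.
Qed.

(** A bound for the injective norm, that is the norm as a d-linear map between Euclidean spaces. *)
Definition injective_bound (m d : nat) (A : 'I_m -> seq I -> R) (beta : R) : Prop :=
  forall zs : seq (I -> R), size zs = d -> (forall z, List.In z zs -> nrm z <= 1) ->
  nrm (contr A zs) <= beta.

Lemma injective_bound_contract m d (A : 'I_m -> seq I -> R) beta z :
  injective_bound d.+1 A beta -> nrm z <= 1 -> injective_bound d (contract A z) beta.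
Proof.
move=> h z1 zs szs hz; apply: (h (z :: zs)); first by rewrite /= szs.
by move=> z' [<-//|]; exact: hz.
Qed.

(* Dual form of the projective tensor norm. *)
Definition proj_le d (c : R) (tau : seq I -> R) : Prop :=
  forall m (A : 'I_m -> seq I -> R) beta, injective_bound d A beta ->
  nrm (app d A tau) <= c * beta.

Lemma proj_le_ext d c tau tau' : (forall s, size s = d -> tau s = tau' s) ->
  proj_le d c tau -> proj_le d c tau'.
Proof. by move=> h hp m A b hb; rewrite -(@app_ext _ _ _ _ _ h); exact: hp. Qed.

Lemma injective_bound_ge0 m d (A : 'I_m -> seq I -> R) beta :
  injective_bound d A beta -> 0 <= beta.
Proof.
move=> h; apply: le_trans (nrm_ge0 _) (h (nseq d (fun=> 0)) _ _); first by rewrite size_nseq.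
by elim: d {h} => [|d IH] z //= [<-|/IH//]; rewrite nrm0 ler01.
Qed.

Lemma proj_leW d c c' tau : c <= c' -> proj_le d c tau -> proj_le d c' tau.
Proof.
move=> cc h m A b hb; apply: le_trans (h _ _ _ hb) _.
by rewrite ler_wpM2r// (injective_bound_ge0 hb).
Qed.

Lemma proj_leD d c c' tau tau' : proj_le d c tau -> proj_le d c' tau' ->
  proj_le d (c + c') (fun s => tau s + tau' s).
Proof.
move=> h h' m A b hb; rewrite appD mulrDl; apply: le_trans (nrmD _ _) _.
by apply: lerD; [exact: h|exact: h'].
Qed.

Lemma proj_le0 d : proj_le d 0 (fun=> 0).
Proof.
move=> m A b hb; rewrite mul0r (_ : app d A (fun=> 0) = fun=> 0) ?nrm0//.
by apply/funext => l; rewrite /app /tsum big1// => s _; rewrite mulr0.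
Qed.

(** After normalization z is contracted away, and contraction with a unit vector preserves
    [injective_bound]. *)
Lemma proj_le_cons d c z tau (tau' : seq I -> R) :
  (forall i s, tau' (i :: s) = z i * tau s) ->
  proj_le d c tau -> proj_le d.+1 (nrm z * c) tau'.
Proof.
move=> h hp m A b hb; rewrite (app_cons _ _ h).
have [z0|z0] := eqVneq (nrm z) 0.
  rewrite z0 !mul0r (_ : app d (contract A z) tau = fun=> 0) ?nrm0//.
  apply/funext => l; rewrite /app /tsum big1// => s _.
  by rewrite /contract big1 ?mul0r// => i _; rewrite (nrm_eq0 z0) mul0r.
have zp : 0 < nrm z by rewrite lt0r z0 nrm_ge0.
pose z' i := (nrm z)^-1 * z i.
have z'1 : nrm z' <= 1.
  by rewrite nrmZ gtr0_norm ?invr_gt0// mulVf.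
have e : contract A z = fun l s => nrm z * contract A z' l s.
  apply/funext => l; apply/funext => s; rewrite /contract mulr_sumr.
  by apply: eq_bigr => i _; rewrite /z' !mulrA mulfV// mul1r.
have e2 : app d (contract A z) tau = fun l => nrm z * app d (contract A z') tau l.
  apply/funext => l; rewrite e /app -tsumZ; apply: eq_tsum => s _; ring.
rewrite e2 nrmZ ger0_norm ?nrm_ge0// -mulrA ler_wpM2l ?nrm_ge0//.
exact: hp (injective_bound_contract hb z'1).
Qed.

Lemma proj_le_unit : proj_le 0 1 (tU (R := R) (I := I) (fun=> 0)).
Proof.
move=> m A b hb; rewrite mul1r; apply: le_trans (hb [::] erefl _) => //.
rewrite contrE/= (@app_ext _ _ _ _ (tP [::])) => // s /size0nil->.
by rewrite tU_nil.
Qed.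

Lemma proj_le_U d x : nrm x <= 1 -> proj_le d 1 (tU x).
Proof.
move=> x1; elim: d => [|d IH].
  by apply: proj_le_ext proj_le_unit => s /size0nil->; rewrite !tU_nil.
apply: proj_leW (_ : nrm x * 1 <= 1) _; first by rewrite mulr1.
exact: (proj_le_cons (fun i s => tU_cons x i s)).
Qed.

(** Telescoping: one factor at a time is changed from x to y. *)
Lemma proj_le_Udiff d x y : nrm x <= 1 -> nrm y <= 1 ->
  proj_le d (d%:R * nrm (fun i => x i - y i)) (fun s => tU x s - tU y s).
Proof.
move=> x1 y1; set D := nrm _; have D0 : 0 <= D := nrm_ge0 _.
elim: d => [|d IH].
  rewrite mul0r; apply: (@proj_le_ext 0%N 0 (fun=> 0)); last exact: proj_le0.
  move=> s /size0nil->.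
  by rewrite !tU_nil subrr.
have h1 : proj_le d.+1 (nrm x * (d%:R * D)) (fun s => if s is i :: s' then x i * (tU x s' - tU y s') else 0).
  exact: (proj_le_cons (fun i s => erefl)).
have h2 : proj_le d.+1 (D * 1) (fun s => if s is i :: s' then (x i - y i) * tU y s' else 0).
  by refine (@proj_le_cons d _ (fun i => x i - y i) (tU y) _ _ (@proj_le_U d _ y1)).
apply: proj_le_ext (proj_leW _ (proj_leD h1 h2)).
  by case => [//|i s] _; rewrite !tU_cons; ring.
have : nrm x * (d%:R * D) <= 1 * (d%:R * D) by rewrite ler_wpM2r ?mulr_ge0.
rewrite -natr1; lra.
Qed.

Lemma proj_le_V d x u : nrm x <= 1 -> proj_le d (d%:R * nrm u) (tV x u).
Proof.
move=> x1; have D0 : 0 <= nrm u := nrm_ge0 _.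
elim: d => [|d IH].
  rewrite mul0r; apply: (@proj_le_ext 0%N 0 (fun=> 0)); last exact: proj_le0.
  by move=> s /size0nil->.
have h1 : proj_le d.+1 (nrm x * (d%:R * nrm u)) (fun s => if s is i :: s' then x i * tV x u s' else 0).
  exact: (proj_le_cons (fun i s => erefl)).
have h2 : proj_le d.+1 (nrm u * 1) (fun s => if s is i :: s' then u i * tU x s' else 0).
  by refine (@proj_le_cons d _ u (tU x) _ _ (@proj_le_U d _ x1)).
apply: proj_le_ext (proj_leW _ (proj_leD h1 h2)).
  by case.
have : nrm x * (d%:R * nrm u) <= 1 * (d%:R * nrm u) by rewrite ler_wpM2r ?mulr_ge0.
rewrite -natr1; lra.
Qed.

Lemma proj_le_Vdiff d x y u : nrm x <= 1 -> nrm y <= 1 -> nrm u <= 1 ->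
  proj_le d (d%:R ^+ 2 * nrm (fun i => x i - y i)) (fun s => tV x u s - tV y u s).
Proof.
move=> x1 y1 u1; set D := nrm _; have D0 : 0 <= D := nrm_ge0 _.
elim: d => [|d IH].
  rewrite expr0n mul0r; apply: (@proj_le_ext 0%N 0 (fun=> 0)); last exact: proj_le0.
  move=> s /size0nil->.
  by rewrite subrr.
have h1 : proj_le d.+1 (nrm x * (d%:R ^+ 2 * D)) (fun s => if s is i :: s' then x i * (tV x u s' - tV y u s') else 0).
  exact: (proj_le_cons (fun i s => erefl)).
have h2 : proj_le d.+1 (D * (d%:R * nrm u)) (fun s => if s is i :: s' then (x i - y i) * tV y u s' else 0).
  by refine (@proj_le_cons d _ (fun i => x i - y i) (tV y u) _ _ (@proj_le_V d _ u y1)).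
have h3 : proj_le d.+1 (nrm u * (d%:R * D)) (fun s => if s is i :: s' then u i * (tU x s' - tU y s') else 0).
  by refine (@proj_le_cons d _ u (fun s => tU x s - tU y s) _ _ (@proj_le_Udiff d _ _ x1 y1)).
apply: proj_le_ext (proj_leW _ (proj_leD (proj_leD h1 h2) h3)).
  by case => [|i s] _ /=; [rewrite !addr0 subrr|ring].
have d0 : 0 <= d%:R :> R by [].
have e1 : nrm x * (d%:R ^+ 2 * D) <= 1 * (d%:R ^+ 2 * D) by rewrite ler_wpM2r ?mulr_ge0 ?sqr_ge0.
have e2 : D * (d%:R * nrm u) <= D * (d%:R * 1) by rewrite !ler_wpM2l.
have e3 : nrm u * (d%:R * D) <= 1 * (d%:R * D) by rewrite ler_wpM2r ?mulr_ge0.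
rewrite -natr1; nra.
Qed.

Lemma tV_lin x (a : R) u v s : tV x (fun i => a * u i + v i) s = a * tV x u s + tV x v s.
Proof. by elim: s => [|i s IH] /=; [ring|rewrite IH; ring]. Qed.

Lemma tV_self x s : tV x x s = (size s)%:R * tU x s.
Proof.
elim: s => [|i s IH] /=; first by rewrite mul0r.
by rewrite IH tU_cons -[in RHS]natr1; ring.
Qed.

(** Stripping one factor leaves the previous remainder and the product of x - y with a derivative,
    which is of order d |x - y|^2; the sum over the d factors gives d^2. *)
Lemma proj_le_taylor d x y : nrm x <= 1 -> nrm y <= 1 ->
  proj_le d (d%:R ^+ 2 * nrm (fun i => x i - y i) ^+ 2)
   (fun s => tU x s - tU y s - tV y (fun i => x i - y i) s).
Proof.
move=> x1 y1; set u := fun i => x i - y i; set D := nrm u; have D0 : 0 <= D := nrm_ge0 _.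
elim: d => [|d IH].
  rewrite expr0n mul0r; apply: (@proj_le_ext 0%N 0 (fun=> 0)); last exact: proj_le0.
  move=> s /size0nil->.
  by rewrite !tU_nil/= !subrr.
have h1 : proj_le d.+1 (nrm x * (d%:R ^+ 2 * D ^+ 2)) (fun s => if s is i :: s' then x i * (tU x s' - tU y s' - tV y u s') else 0).
  exact: (proj_le_cons (fun i s => erefl)).
have h2 : proj_le d.+1 (D * (d%:R * D)) (fun s => if s is i :: s' then u i * tV y u s' else 0).
  by refine (@proj_le_cons d _ u (tV y u) _ _ (@proj_le_V d _ u y1)).
apply: proj_le_ext (proj_leW _ (proj_leD h1 h2)).
  by case => [//|i s] _ /=; rewrite !tU_cons /u; ring.
have d0 : 0 <= d%:R :> R by [].
have e1 : nrm x * (d%:R ^+ 2 * D ^+ 2) <= 1 * (d%:R ^+ 2 * D ^+ 2) by rewrite ler_wpM2r ?mulr_ge0 ?sqr_ge0.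
rewrite -natr1; nra.
Qed.

(** The usual net argument, without a supremum: some bound C exists coordinatewise, and each pass
    improves a bound K to M + eta K, so that the bounds tend to M / (1 - eta). *)
Lemma net_to_ball (J : finType) (L : (I -> R) -> J -> R) (N : seq (I -> R)) (eta M : R) :
  (forall u v, L (fun i => u i + v i) = fun j => L u j + L v j) ->
  (forall c u, L (fun i => c * u i) = fun j => c * L u j) ->
  0 <= eta < 1 ->
  (forall z, nrm z <= 1 -> exists2 z', List.In z' N & nrm (fun i => z i - z' i) <= eta) ->
  (forall z, List.In z N -> nrm (L z) <= M) ->
  forall z, nrm z <= 1 -> nrm (L z) <= M / (1 - eta).
Proof.
move=> LD LZ /andP[e0 e1] hN hM.
have L0 : L (fun=> 0) = fun=> 0.
  have := LZ 0 (fun=> 0); rewrite (_ : (fun i => 0 * (fun=> 0) i) = (fun=> 0)); last by apply/funext => i; rewrite mul0r.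
  by move=> ->; apply/funext => j; rewrite mul0r.
have Lsum (s : seq I) z : L (fun i => \sum_(j <- s) z j * (i == j)%:R) =
    fun k => \sum_(j <- s) z j * L (fun i => (i == j)%:R) k.
  elim: s => [|j s IH].
    by under eq_fun do rewrite big_nil; rewrite L0; apply/funext => k; rewrite big_nil.
  under eq_fun do rewrite big_cons.
  by rewrite LD LZ IH; apply/funext => k; rewrite big_cons.
pose C := \sum_j nrm (L (fun i => (i == j)%:R)).
have C0 : 0 <= C by apply: sumr_ge0 => j _; exact: nrm_ge0.
have bnd z : nrm z <= 1 -> nrm (L z) <= C.
  move=> z1.
  have -> : z = fun i => \sum_(j <- index_enum I) z j * (i == j)%:R.
    apply/funext => i; rewrite (bigD1 i)//= eqxx mulr1 big1 ?addr0// => j /negPf ji.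
    by rewrite eq_sym ji mulr0.
  rewrite Lsum /C.
  elim: (index_enum I) => [|j s IH].
    by under eq_fun do rewrite big_nil; rewrite nrm0 big_nil.
  under [X in nrm X]eq_fun do rewrite big_cons.
  rewrite big_cons; apply: le_trans (nrmD _ _) _; apply: lerD => //.
  rewrite nrmZ -[leRHS]mul1r ler_wpM2r ?nrm_ge0//.
  exact: le_trans (nrm_coord z j) z1.
have step K z : (forall z, nrm z <= 1 -> nrm (L z) <= K) -> nrm z <= 1 ->
   nrm (L z) <= M + eta * K.
  move=> hK z1; have [z' z'N zz] := hN z z1.
  pose v i := z i - z' i.
  have vK : nrm (L v) <= eta * K.
    have [v0|v0] := eqVneq (nrm v) 0.
      have -> : v = fun=> 0 by apply/funext => i; exact: (nrm_eq0 v0).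
      rewrite L0 nrm0 mulr_ge0//; apply: le_trans (nrm_ge0 (L z)) (hK z z1).
    have vp : 0 < nrm v by rewrite lt0r v0 nrm_ge0.
    have -> : v = fun i => nrm v * ((nrm v)^-1 * v i).
      by apply/funext => i; rewrite mulrA mulfV// mul1r.
    rewrite LZ nrmZ ger0_norm ?nrm_ge0//.
    have h : nrm (L (fun i => (nrm v)^-1 * v i)) <= K.
      by apply: hK; rewrite nrmZ gtr0_norm ?invr_gt0// mulVf.
    by apply: ler_pM; rewrite ?nrm_ge0.
  have -> : z = fun i => z' i + v i by apply/funext => i; rewrite /v addrC subrK.
  by rewrite LD; apply: le_trans (nrmD _ _) _; apply: lerD => //; exact: hM.
have iter k z : nrm z <= 1 -> nrm (L z) <= M / (1 - eta) + eta ^+ k * `|C - M / (1 - eta)|.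
  elim: k z => [|k IH] z z1.
    by rewrite expr0 mul1r; apply: le_trans (bnd z z1) _; have := ler_norm (C - M / (1 - eta)); lra.
  apply: le_trans (step _ _ IH z1) _.
  rewrite le_eqVlt; apply/orP; left; apply/eqP; rewrite exprS.
  by field; apply: lt0r_neq0; lra.
move=> z z1; apply/ler_addgt0Pr => e ep.
pose K := `|C - M / (1 - eta)|.
have K0 : 0 <= K := normr_ge0 _.
have cv : (fun k => eta ^+ k) @ \oo --> (0 : R).
  by apply: cvg_expr; rewrite ger0_norm.
have eK : 0 < e / (K + 1) by rewrite divr_gt0//; lra.
have [k _ hk] := (cvgrPdist_le _ _).1 cv _ eK.
have := hk k (leqnn k); rewrite sub0r normrN ger0_norm ?exprn_ge0// => hk'.
apply: le_trans (iter k z z1) _; rewrite lerD2l -/K.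
apply: (@le_trans _ _ (e / (K + 1) * K)); first by rewrite ler_wpM2r.
rewrite mulrAC ler_pdivrMr; nra.
Qed.

(** The slots are released from the net one after the other, each at the price of a factor 1 / (1 -
    eta). *)
Lemma injective_bound_net m d (A : 'I_m -> seq I -> R) (N : seq (I -> R)) (eta M : R) :
  0 <= eta < 1 ->
  (forall z, nrm z <= 1 -> exists2 z', List.In z' N & nrm (fun i => z i - z' i) <= eta) ->
  (forall zs, size zs = d -> (forall z, List.In z zs -> List.In z N) -> nrm (contr A zs) <= M) ->
  injective_bound d A (M / (1 - eta) ^+ d).
Proof.
move=> e01 hN; elim: d A => [|d IH] A hA.
  move=> zs szs _; rewrite expr0 divr1; apply: hA => //.
  by rewrite (size0nil szs).
move=> [|z zs]//= [szs] hz.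
have z1 : nrm z <= 1 by apply: hz; left.
have hzs z' : List.In z' zs -> nrm z' <= 1 by move=> h; apply: hz; right.
rewrite exprSr invfM mulrA.
apply: (@net_to_ball _ (fun z => contr (contract A z) zs) N eta _) => //.
- move=> u v; rewrite -contrD; congr contr; apply/funext => l; apply/funext => s.
  by rewrite /contract -big_split; apply: eq_bigr => i _; rewrite mulrDl.
- move=> c u; rewrite -contrZ; congr contr; apply/funext => l; apply/funext => s.
  by rewrite /contract mulr_sumr; apply: eq_bigr => i _; rewrite mulrA.
move=> z' z'N.
apply: (IH (contract A z')) => // zs' szs' hzs'.
apply: (hA (z' :: zs')); first by rewrite /= szs'.
by move=> z'' [<-//|]; exact: hzs'.
Qed.

Lemma tP_sq (zs : seq (I -> R)) :
  tsum (size zs) (fun s => tP zs s ^+ 2) = \prod_(z <- zs) dot z z.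
Proof.
elim: zs => [|z zs IH] /=; first by rewrite tsum0 big_nil expr1n.
rewrite tsumS big_cons -IH /dot mulr_suml; apply: eq_bigr => i _.
by rewrite -tsumZ; apply: eq_tsum => s _; ring.
Qed.

End Projective.

(** * Nets on the sphere and on structured pairs *)

Section Rounding.
Context (R : realType).

Definition rd (x : R) : int := Num.floor (x + 2^-1).

Lemma rd_dist x : `|x - (rd x)%:~R| <= 2^-1.
Proof.
have := floor_itv (x + 2^-1); rewrite -/(rd x) intrD => /andP[h1 h2].
by rewrite ler_norml; apply/andP; split; lra.
Qed.

Lemma rd_le x : `|(rd x)%:~R| <= 2 * `|x|.
Proof.
have [->|r0] := eqVneq (rd x) 0; first by rewrite normr0 mulr_ge0.
have h1 : 1 <= `|(rd x)%:~R| :> R by rewrite -intr_norm -[1]/(1%:~R) ler_int -gtz0_ge1 normr_gt0.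
have := ler_normB x (x - (rd x)%:~R).
rewrite opprB addrC subrK => h3.
by have := le_trans h3 (lerD (lexx _) (rd_dist x)); lra.
Qed.

Lemma rd_eq x y : rd x = rd y -> `|x - y| <= 1.
Proof.
move=> e; have := rd_dist x; have := rd_dist y; rewrite e !ler_norml.
by move=> /andP[? ?] /andP[? ?]; apply/andP; split; lra.
Qed.

Lemma rd_scale (x y t : R) : 0 < t -> rd (x / t) = rd (y / t) -> `|x - y| <= t.
Proof.
move=> t0 /rd_eq; rewrite -mulrBl normrM normfV (gtr0_norm t0).
by rewrite ler_pdivrMr// mul1r.
Qed.

Lemma rd_scale_le (x t : R) : 0 < t -> `|(rd (x / t))%:~R| <= 2 * `|x| / t.
Proof.
move=> t0; apply: le_trans (rd_le _) _.
by rewrite normrM normfV (gtr0_norm t0) mulrA.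
Qed.

Lemma rd_diff (x y t K : R) : 0 < t -> `|x - y| <= K * t ->
  `|((rd (x / t) - rd (y / t))%:~R : R)| <= K + 1.
Proof.
move=> t0 h.
have h1 : `|x / t - y / t| <= K.
  by rewrite -mulrBl normrM normfV (gtr0_norm t0) ler_pdivrMr.
have := rd_dist (x / t); have := rd_dist (y / t).
move: h1; rewrite rmorphB/= !ler_norml => /andP[? ?] /andP[? ?] /andP[? ?].
by apply/andP; split; lra.
Qed.

End Rounding.

Section Nets.
Context (R : realType).

Lemma nrm_le_coord_scale (I : finType) (u : I -> R) (h : R) : (0 < #|I|)%N -> 0 <= h ->
  (forall i, `|u i| <= h / Num.sqrt #|I|%:R) -> nrm u <= h.
Proof.
move=> I0 h0 H; have q0 : 0 < Num.sqrt #|I|%:R :> R by rewrite sqrtr_gt0 ltr0n.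
have := @nrm_le_coord _ _ u (h / Num.sqrt #|I|%:R) (divr_ge0 h0 (ltW q0)) H.
by rewrite mulrCA mulfV ?mulr1// gt_eqF.
Qed.

(** The weight w is left free: a weight of the order of the precision suits vectors with all
    coordinates in play, a large one suits sparse vectors. *)
Lemma round_net (T : Type) (G : set T) (I : finType) (X : T -> I -> R) (t w B : R) :
  0 < t -> 0 < w -> (forall g, G g -> \sum_i `|X g i| <= B) ->
  exists r : seq T, [/\ forall g, List.In g r -> G g,
    forall g, G g -> exists2 g', List.In g' r & forall i, `|X g i - X g' i| <= t &
    (size r)%:R <= expR (2 * w * B / t) * (1 + 2 / w) ^+ #|I|].
Proof.
move=> t0 w0 hB.
have [] := @net_exists R T G I (fun g i => rd (X g i / t)) (fun=> w) (2 * w * B / t) (fun=> w0).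
  move=> g Gg; rewrite -mulr_sumr.
  have -> : 2 * w * B / t = w * (2 / t * B) by ring.
  rewrite ler_pM2l//; apply: le_trans (_ : 2 / t * \sum_i `|X g i| <= _).
    rewrite mulr_sumr; apply: ler_sum => i _; apply: le_trans (rd_scale_le _ t0) _.
    by rewrite le_eqVlt; apply/orP; left; apply/eqP; ring.
  by rewrite ler_pM2l ?divr_gt0//; exact: hB.
move=> r [r1 r2 r3]; exists r; split => //.
  move=> g Gg; have [g' g'r e] := r2 g Gg; exists g' => // i.
  by apply: rd_scale => //; have := congr1 (fun f => f i) e.
by move: r3; rewrite prodr_const.
Qed.

Lemma coarse_net (T : Type) (G : set T) (I : finType) (X : T -> I -> R) (M : R) :
  (0 < #|I|)%N -> 1 <= M -> (forall g, G g -> nrm (X g) <= 2) ->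
  exists r : seq T, [/\ forall g, List.In g r -> G g,
    forall g, G g -> exists2 g', List.In g' r & nrm (fun i => X g i - X g' i) <= M^-1 &
    (size r)%:R <= expR (4 * #|I|%:R) * (1 + 2 * M) ^+ #|I|].
Proof.
move=> I0 M1 hG; set N : R := #|I|%:R; have N0 : 0 < N by rewrite ltr0n.
have q0 : 0 < Num.sqrt N by rewrite sqrtr_gt0.
have qq : Num.sqrt N * Num.sqrt N = N by rewrite -expr2 sqr_sqrtr// ltW.
have M0 : 0 < M by lra.
have [|||] := @round_net T G I X (M^-1 / Num.sqrt N) M^-1 (Num.sqrt N * 2).
- by rewrite divr_gt0// invr_gt0.
- by rewrite invr_gt0.
- by move=> g Gg; apply: le_trans (sum_abs_le _) _; rewrite ler_pM2l//; exact: hG.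
move=> r [r1 r2 r3]; exists r; split => //.
  move=> g Gg; have [g' g'r e] := r2 g Gg; exists g' => //.
  by apply: nrm_le_coord_scale => //; rewrite invr_ge0 ltW.
apply: le_trans r3 _.
have -> : 2 * M^-1 * (Num.sqrt N * 2) / (M^-1 / Num.sqrt N) = 4 * N.
  by rewrite -[in RHS]qq; field; rewrite !gt_eqF//.
by rewrite invrK.
Qed.

(* Unit vectors with at most [k] non-zero coordinates: the weight [w] is large,
   so that each of the zero coordinates contributes a factor close to 1. *)
Lemma sparse_net (I : finType) (k : nat) (M w : R) : (0 < #|I|)%N -> 1 <= M -> 0 < w ->
  exists r : seq (I -> R),
   [/\ forall z : I -> R, List.In z r -> dot z z = 1,
    forall z : I -> R, dot z z = 1 -> (#|[pred i | z i != 0%R]| <= k)%N ->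
      exists2 z', List.In z' r & nrm (fun i => z i - z' i) <= M^-1 &
    (size r)%:R <= expR (2 * w * M * Num.sqrt (k%:R * #|I|%:R) + #|I|%:R * (2 / w))].
Proof.
move=> I0 M1 w0; set N : R := #|I|%:R; have N0 : 0 < N by rewrite ltr0n.
have q0 : 0 < Num.sqrt N by rewrite sqrtr_gt0.
have M0 : 0 < M by lra.
pose G : set (I -> R) := [set z | dot z z = 1 /\ (#|[pred i | z i != 0%R]| <= k)%N].
have [|||] := @round_net _ G I (fun z => z) (M^-1 / Num.sqrt N) w (Num.sqrt k%:R).
- by rewrite divr_gt0// invr_gt0.
- by [].
- move=> z [zz zk].
  pose A := [pred i | z i != 0].
  have -> : \sum_i `|z i| = \sum_(i in A) `|z i|.
    rewrite (bigID (fun i => i \in A))/= [X in _ + X]big1 ?addr0// => i.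
    by rewrite inE/= negbK => /eqP->; rewrite normr0.
  have -> : \sum_(i in A) `|z i| = dot (fun i => (i \in A)%:R) (fun i => `|z i|).
    rewrite /dot [LHS]big_mkcond; apply: eq_bigr => i _.
    by case: (i \in A); rewrite ?mul1r ?mul0r.
  apply: le_trans (ler_norm _) _; apply: le_trans (dot_le _ _) _.
  have -> : nrm (fun i => `|z i|) = 1.
    rewrite -(nrm1 zz); congr Num.sqrt; apply: eq_bigr => i _.
    by rewrite -!expr2 real_normK ?num_real.
  rewrite mulr1 /nrm; apply: ler_wsqrtr.
  rewrite /dot (eq_bigr (fun i => (if i \in A then 1 else 0) : R)); last first.
    by move=> i _; case: (i \in A); rewrite ?mulr1 ?mulr0.
  by rewrite -big_mkcond sumr_const ler_nat.
move=> r [r1 r2 r3]; exists r; split.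
- by move=> z /r1[].
- move=> z zz zk; have [//|z' z'r e] := r2 z.
  exists z' => //.
  by apply: nrm_le_coord_scale => //; rewrite invr_ge0 ltW.
apply: le_trans r3 _.
have -> : 2 * w * Num.sqrt k%:R / (M^-1 / Num.sqrt N) = 2 * w * M * Num.sqrt (k%:R * N).
  by rewrite sqrtrM ?ler0n//; field; rewrite !gt_eqF//.
rewrite expRD ler_pM2l ?expR_gt0// expRM_natl lerXn2r ?nnegrE ?expR_ge0 ?expR_ge1Dx//.
by rewrite addr_ge0// divr_ge0// ltW.
Qed.

Definition orthonormal2 (I : finType) (g : (I -> R) * (I -> R)) : Prop :=
  [/\ dot g.1 g.1 = 1, dot g.2 g.2 = 1 & dot g.1 g.2 = 0].

(** Such pairs are rare: one unit vector of their plane is determined by [p] up to a small error. *)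
Definition structured (I : finType) (Pm eta : R) (x y : I -> R) : Prop :=
  exists al be : R, exists p : I -> int,
   [/\ al ^+ 2 + be ^+ 2 = 1,
       nrm (fun i => (p i)%:~R : R) <= Pm &
       nrm (fun i => al * x i + be * y i - (p i)%:~R / nrm (fun i => (p i)%:~R)) <= 2 * eta].

Lemma nrm_unit_comb (I : finType) (g : (I -> R) * (I -> R)) (al be : R) : orthonormal2 g ->
  al ^+ 2 + be ^+ 2 = 1 -> nrm (fun i => al * g.1 i + be * g.2 i) = 1.
Proof.
move=> [xx yy xy] ab; apply: nrm1; rewrite dot_lin2 xx yy xy dotC xy -[RHS]ab; ring.
Qed.

(** A pair is coded in a rotated basis (v, v') of its plane: the integer vector p exactly, the small
    difference of v and p / |p|, then v' and the angle. Only v' costs a full factor 1 + 2 m per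
    coordinate; p and the difference cost about Pm / sqrt N and m eta. *)
Lemma structured_net (I : finType) (H : set ((I -> R) * (I -> R))) (Pm eta m : R) :
  (0 < #|I|)%N -> 0 <= Pm -> 0 <= eta -> 1 <= m ->
  exists r : seq ((I -> R) * (I -> R)),
   [/\ forall g, List.In g r -> H g /\ orthonormal2 g,
    forall g, H g -> orthonormal2 g -> structured Pm eta g.1 g.2 ->
      exists2 g', List.In g' r &
        nrm (fun i => g.1 i - g'.1 i) <= 4 / m /\ nrm (fun i => g.2 i - g'.2 i) <= 4 / m &
    (size r)%:R <= expR (7 * #|I|%:R + 4) *
      ((3 + 2 * (Pm / Num.sqrt #|I|%:R)) * (3 + 2 * (m * eta)) * (1 + 2 * m)) ^+ #|I|
      * (1 + 2 * m) ^+ 2].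
Proof.
move=> I0 P0 e0 m1; set N : R := #|I|%:R; have N0 : 0 < N by rewrite ltr0n.
have q0 : 0 < Num.sqrt N by rewrite sqrtr_gt0.
have qq : Num.sqrt N * Num.sqrt N = N by rewrite -expr2 sqr_sqrtr// ltW.
have m0 : 0 < m by lra.
pose V := (I -> R)%type.
pose T := ((V * V) * (R * R) * (I -> int))%type.
pose pr (g : T) : V := fun i => (g.2 i)%:~R.
pose vv (g : T) : V := fun i => g.1.2.1 * g.1.1.1 i + g.1.2.2 * g.1.1.2 i.
pose vp (g : T) : V := fun i => - g.1.2.2 * g.1.1.1 i + g.1.2.1 * g.1.1.2 i.
pose dv (g : T) : V := fun i => vv g i - pr g i / nrm (pr g).
pose G : set T := [set g | [/\ H g.1.1, orthonormal2 g.1.1,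
   g.1.2.1 ^+ 2 + g.1.2.2 ^+ 2 = 1, nrm (pr g) <= Pm & nrm (dv g) <= 2 * eta]].
pose t := m^-1 / Num.sqrt N.
have t0 : 0 < t by rewrite divr_gt0// invr_gt0.
pose J := ((I + I) + (I + bool))%type.
pose F (g : T) (j : J) : int := match j with
  | inl (inl i) => g.2 i
  | inl (inr i) => rd (dv g i / t)
  | inr (inl i) => rd (vp g i / t)
  | inr (inr b) => rd ((if b then g.1.2.1 else g.1.2.2) / m^-1) end.
(* Weights inverse to the typical entries of each block, so that the blocks use N, 4 N and 2 N of
   the exponent and the angle uses 4. *)
pose w1 := (1 + Pm / Num.sqrt N)^-1.
pose w2 := (1 + m * eta)^-1.
have p10 : 0 <= Pm / Num.sqrt N by rewrite divr_ge0// ltW.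
have p20 : 0 <= m * eta by rewrite mulr_ge0// ltW.
have w1' : 0 < 1 + Pm / Num.sqrt N by exact: ltr_pwDl.
have w2' : 0 < 1 + m * eta by exact: ltr_pwDl.
have w10 : 0 < w1 by rewrite invr_gt0.
have w20 : 0 < w2 by rewrite invr_gt0.
have m'0 : 0 < m^-1 by rewrite invr_gt0.
pose w (j : J) : R := match j with
  | inl (inl i) => w1 | inl (inr i) => w2 | inr _ => m^-1 end.
have w0 j : 0 < w j by case: j => [[]|].
have sumrd (u : V) K : nrm u <= K -> \sum_i `|(rd (u i / t))%:~R : R| <= 2 * K * m * N.
  move=> uK; apply: (@le_trans _ _ (2 / t * \sum_i `|u i|)).
    rewrite mulr_sumr; apply: ler_sum => i _; apply: le_trans (rd_scale_le _ t0) _.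
    by rewrite le_eqVlt; apply/orP; left; apply/eqP; ring.
  apply: (@le_trans _ _ (2 / t * (Num.sqrt N * K))).
    rewrite ler_pM2l ?divr_gt0//; apply: le_trans (sum_abs_le _) _.
    by rewrite ler_pM2l.
  rewrite le_eqVlt; apply/orP; left; apply/eqP; rewrite -[in RHS]qq /t.
  by field; rewrite !gt_eqF.
have [] := @net_exists R T G J F w (7 * N + 4) w0.
  move=> g [_ og ab pP dP].
  have ab1 (c : R) : c ^+ 2 <= 1 -> `|c| <= 1.
    by move=> h; rewrite -(@ler_sqr R) ?nnegrE// expr1n real_normK ?num_real.
  have a1 : `|g.1.2.1| <= 1 by apply: ab1; rewrite -ab lerDl sqr_ge0.
  have b1 : `|g.1.2.2| <= 1 by apply: ab1; rewrite -ab lerDr sqr_ge0.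
  have vp1 : nrm (vp g) <= 1.
    have ab' : (- g.1.2.2) ^+ 2 + g.1.2.1 ^+ 2 = 1 by rewrite sqrrN addrC.
    by rewrite /vp (nrm_unit_comb og ab').
  rewrite big_sumType/= !big_sumType/= big_bool/= -!mulr_sumr.
  have h1 : w1 * (\sum_i `|(g.2 i)%:~R|) <= N.
    rewrite mulrC ler_pdivrMr//.
    apply: le_trans (sum_abs_le (pr g)) _.
    apply: (@le_trans _ _ (Num.sqrt N * Pm)); first by rewrite ler_pM2l.
    have eN : N * (Pm / Num.sqrt N) = Num.sqrt N * Pm.
      by rewrite -[N in N * _]qq; field; rewrite gt_eqF.
    by rewrite mulrDr mulr1 eN lerDr ltW.
  have h2 : w2 * (\sum_i `|(rd (dv g i / t))%:~R|) <= 4 * N.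
    rewrite mulrC ler_pdivrMr//.
    apply: le_trans (sumrd _ _ dP) _; rewrite -/N.
    have -> : 2 * (2 * eta) * m * N = 4 * N * (m * eta) by ring.
    by rewrite ler_wpM2l ?mulr_ge0 ?(ltW N0)// lerDr.
  have h3 : m^-1 * (\sum_i `|(rd (vp g i / t))%:~R|) <= 2 * N.
    rewrite mulrC ler_pdivrMr//.
    apply: le_trans (sumrd _ _ vp1) _.
    by rewrite le_eqVlt; apply/orP; left; apply/eqP; ring.
  have h4 (c : R) : `|c| <= 1 -> m^-1 * `|(rd (c / m^-1))%:~R| <= 2.
    move=> c1; rewrite mulrC ler_pdivrMr//; apply: le_trans (rd_scale_le _ m'0) _.
    by rewrite invrK ler_pM2r ?invr_gt0// ?ler_piMr.
  have := h4 _ a1; have := h4 _ b1; move: h1 h2 h3; clear; lra.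
move=> r [r1 r2 r3].
exists [seq g.1.1 | g <- r]; split.
- move=> g /List.in_map_iff[g' [<- /r1[]]]; by split.
- move=> g Hg og [al [be [p [ab pP dP]]]].
  have [|g' g'r e] := r2 (g, (al, be), p).
    by split.
  have [_ og' ab' _ _] := r1 _ g'r.
  exists g'.1.1; first by apply/List.in_map_iff; exists g'.
  pose g0 : T := (g, (al, be), p).
  have eF j : F g' j = F g0 j by rewrite e.
  have ep i : g'.2 i = p i := eF (inl (inl i)).
  have dvb : nrm (fun i => vv g0 i - vv g' i) <= m^-1.
    have -> : (fun i => vv g0 i - vv g' i) = (fun i => dv g0 i - dv g' i).
      have epr : pr g' = pr g0 by apply/funext => i; rewrite /pr ep.
      by apply/funext => i; rewrite /dv epr; ring.
    apply: nrm_le_coord_scale => //; first exact: ltW.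
    by move=> i; exact: (rd_scale t0 (esym (eF (inl (inr i))))).
  have vpb : nrm (fun i => vp g0 i - vp g' i) <= m^-1.
    apply: nrm_le_coord_scale => //; first exact: ltW.
    by move=> i; exact: (rd_scale t0 (esym (eF (inr (inl i))))).
  have alb : `|al - g'.1.2.1| <= m^-1.
    by exact: (rd_scale m'0 (esym (eF (inr (inr true))))).
  have beb : `|be - g'.1.2.2| <= m^-1.
    by exact: (rd_scale m'0 (esym (eF (inr (inr false))))).
  have ab1 (c : R) : c ^+ 2 <= 1 -> `|c| <= 1.
    by move=> h; rewrite -(@ler_sqr R) ?nnegrE// expr1n real_normK ?num_real.
  have a1 : `|al| <= 1 by apply: ab1; rewrite -ab lerDl sqr_ge0.
  have b1 : `|be| <= 1 by apply: ab1; rewrite -ab lerDr sqr_ge0.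
  have nv' : nrm (vv g') = 1 by rewrite /vv (nrm_unit_comb og' ab').
  have nvp' : nrm (vp g') = 1.
    have ab2 : (- g'.1.2.2) ^+ 2 + g'.1.2.1 ^+ 2 = 1 by rewrite sqrrN addrC.
    by rewrite /vp (nrm_unit_comb og' ab2).
  have four (u1 u2 u3 u4 : V) : nrm u1 <= m^-1 -> nrm u2 <= m^-1 -> nrm u3 <= m^-1 -> nrm u4 <= m^-1 ->
     nrm (fun i => u1 i + u2 i + (u3 i + u4 i)) <= 4 / m.
    move=> k1 k2 k3 k4; apply: le_trans (nrmD _ _) _.
    have := nrmD u1 u2; have := nrmD u3 u4; move: k1 k2 k3 k4; clear; lra.
  have sc (c : R) (u : V) : `|c| <= 1 -> nrm u <= m^-1 -> nrm (fun i => c * u i) <= m^-1.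
    move=> c1 um; rewrite nrmZ -[leRHS]mul1r; apply: ler_pM => //; exact: nrm_ge0.
  have sc2 (c : R) (u : V) : `|c| <= m^-1 -> nrm u = 1 -> nrm (fun i => c * u i) <= m^-1.
    by move=> c1 um; rewrite nrmZ um mulr1.
  have N' (c : R) : `|- c| = `|c| by rewrite normrN.
  (* Rotating back: x and y are expressed through the basis and the angle, and each of the four
     resulting errors is at most 1 / m. *)
  have recx (h : T) : h.1.2.1 ^+ 2 + h.1.2.2 ^+ 2 = 1 ->
     h.1.1.1 = fun i => h.1.2.1 * vv h i - h.1.2.2 * vp h i.
    move=> hh; apply/funext => i; rewrite /vv /vp.
    transitivity ((h.1.2.1 ^+ 2 + h.1.2.2 ^+ 2) * h.1.1.1 i); first by rewrite hh mul1r.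
    by ring.
  have recy (h : T) : h.1.2.1 ^+ 2 + h.1.2.2 ^+ 2 = 1 ->
     h.1.1.2 = fun i => h.1.2.2 * vv h i + h.1.2.1 * vp h i.
    move=> hh; apply/funext => i; rewrite /vv /vp.
    transitivity ((h.1.2.1 ^+ 2 + h.1.2.2 ^+ 2) * h.1.1.2 i); first by rewrite hh mul1r.
    by ring.
  have al' : `|al - g'.1.2.1| <= m^-1 by [].
  split.
    have -> : (fun i => g.1 i - g'.1.1.1 i) = (fun i =>
      al * (vv g0 i - vv g' i) + (al - g'.1.2.1) * vv g' i +
      ((- be) * (vp g0 i - vp g' i) + (- (be - g'.1.2.2)) * vp g' i)).
      apply/funext => i; rewrite (recx _ ab').
      have -> : g.1 i = al * vv g0 i - be * vp g0 i by have := congr1 (fun f => f i) (recx g0 ab).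
      by ring.
    by apply: four; [exact: sc|exact: sc2|apply: sc; rewrite ?N'|apply: sc2; rewrite ?N'].
  have -> : (fun i => g.2 i - g'.1.1.2 i) = (fun i =>
    be * (vv g0 i - vv g' i) + (be - g'.1.2.2) * vv g' i +
    (al * (vp g0 i - vp g' i) + (al - g'.1.2.1) * vp g' i)).
    apply/funext => i; rewrite (recy _ ab').
    have -> : g.2 i = be * vv g0 i + al * vp g0 i by have := congr1 (fun f => f i) (recy g0 ab).
    by ring.
  by apply: four; [exact: sc|exact: sc2|exact: sc|exact: sc2].
rewrite size_map; apply: le_trans r3 _.
rewrite big_sumType/= !big_sumType/= !prodr_const card_bool !invrK.
rewrite -[leRHS]mulrA ler_pM2l ?expR_gt0// [leLHS]mulrA.
have -> : 1 + 2 * (1 + Pm / Num.sqrt N) = 3 + 2 * (Pm / Num.sqrt N) by ring.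
have -> : 1 + 2 * (1 + m * eta) = 3 + 2 * (m * eta) by ring.
by rewrite !exprMn.
Qed.

End Nets.

(** * Optimal nets of orthonormal pairs *)

Section ExactNet.
Context (R : realType) (I : finType).
Implicit Types (x y : I -> R).

Lemma net_union (T : Type) (C : finType) (G : C -> set T) (near : T -> T -> Prop) (Q : T -> Prop) (S : R) :
  (forall c, exists r : seq T, [/\ forall g, List.In g r -> Q g,
    forall g, G c g -> exists2 g', List.In g' r & near g g' & (size r)%:R <= S]) ->
  exists r : seq T, [/\ forall g, List.In g r -> Q g,
    forall c g, G c g -> exists2 g', List.In g' r & near g g' & (size r)%:R <= #|C|%:R * S].
Proof.
move=> /boolp.choice[f hf]; exists (flatten [seq f c | c <- enum C]); split.
- move=> g; elim: (enum C) => //= c s IH /List.in_app_iff[h|/IH//].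
  by have [h1 _ _] := hf c; exact: h1.
- move=> c g Gg; have [_ h2 _] := hf c; have [g' g'r ng] := h2 g Gg.
  exists g' => //; have : c \in enum C by rewrite mem_enum.
  elim: (enum C) => //= c' s IH; rewrite inE => /orP[/eqP<-|/IH h]; apply/List.in_app_iff; [by left|by right].
rewrite cardE; elim: (enum C) => [|c s IH] /=; first by rewrite mul0r.
by have [_ _ h3] := hf c; rewrite size_cat natrD -natr1; lra.
Qed.

Lemma sum_le_card (F : I -> R) (Q : pred I) (c : R) : 0 <= c -> (forall k, Q k -> `|F k| <= c) ->
  `|\sum_(k | Q k) F k| <= #|I|%:R * c.
Proof.
move=> c0 h; apply: le_trans (ler_norm_sum _ _ _) _.
apply: le_trans (ler_sum _ h) _; rewrite sumr_const -[leLHS]mulr_natl ler_wpM2r//.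
by rewrite ler_nat max_card.
Qed.

Lemma exists_large (F : I -> R) : \sum_i F i ^+ 2 = 1 -> exists i, #|I|%:R^-1 <= F i ^+ 2.
Proof.
move=> h; apply: contrapT => /forallNP H.
have I0 : (0 < #|I|)%N.
  rewrite lt0n; apply/eqP => I0; move: h; rewrite big1 => [/eqP|i _].
    by rewrite eq_sym oner_eq0.
  by have := card0_eq I0 i; rewrite inE.
have : \sum_i F i ^+ 2 < \sum_(i : I) #|I|%:R^-1.
  have /card_gt0P[i _] := I0.
  apply: ltr_sum => [|j _]; last by rewrite ltNge; apply/negP; exact: H.
  by apply/hasP; exists i; rewrite ?mem_index_enum.
rewrite h sumr_const -[ltRHS]mulr_natl divff ?ltxx// pnatr_eq0 -lt0n //.
Qed.

(* Only 2N - 3 coordinates have to be stored in a net, and in the Lipschitz bounds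
   powers of N are harmless. *)
Lemma omitted_coordinates (i j : I) (s1 s2 t u N : R) (x y x' y' : I -> R) :
  N = #|I|%:R -> 2 <= N -> i != j -> s1 = 1 \/ s1 = -1 -> s2 = 1 \/ s2 = -1 ->
  orthonormal2 (x, y) -> orthonormal2 (x', y') -> 0 < t -> t <= u -> 2 * N ^+ 3 * t <= 1 ->
  N^-1 <= s1 * x i -> N^-1 <= s1 * x' i ->
  N^-1 <= s2 * (x i * y j - x j * y i) -> N^-1 <= s2 * (x' i * y' j - x' j * y' i) ->
  (forall k, k != i -> `|x k - x' k| <= t) ->
  (forall k, k != i -> k != j -> `|y k - y' k| <= u) ->
  [/\ `|x i - x' i| <= N ^+ 2 * t, `|y i - y' i| <= 6 * N ^+ 4 * u & `|y j - y' j| <= 6 * N ^+ 4 * u].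
Proof.
move=> NE N2 ij s1E s2E [/= xx yy xy] [/= xx' yy' xy'] t0 tu tN a1 a1' a2 a2' hx hy.
have s11 : `|s1| = 1 by case: s1E => ->; rewrite ?normrN normr1.
have s21 : `|s2| = 1 by case: s2E => ->; rewrite ?normrN normr1.
have N0 : 0 < N by exact: lt_le_trans N2.
have N1 : 1 <= N by apply: le_trans N2; rewrite ler1n.
have c1 (z : I -> R) k : dot z z = 1 -> `|z k| <= 1 by move=> /nrm1<-; exact: nrm_coord.
have n2 (z z' : I -> R) k : dot z z = 1 -> dot z' z' = 1 -> `|z k + z' k| <= 2.
  by move=> h h'; apply: le_trans (ler_normD _ _) _; have := c1 _ k h; have := c1 _ k h'; clear; lra.
have u0 : 0 < u by exact: lt_le_trans tu.
have NI : N * N^-1 = 1 by rewrite mulfV// gt_eqF.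
have dxi : `|x i - x' i| <= N ^+ 2 * t.
  (* Both vectors are unit, so the differences of squares add up to 0 and the omitted one is
     determined by the others. *)
  have e : (x i - x' i) * (x i + x' i) = - \sum_(k | k != i) (x k - x' k) * (x k + x' k).
    have : \sum_k (x k - x' k) * (x k + x' k) = 0.
      rewrite (eq_bigr (fun k => x k * x k - x' k * x' k)); last by move=> k _; ring.
      by rewrite sumrB -/(dot x x) -/(dot x' x') xx xx' subrr.
    by rewrite (bigD1 i)//= => /eqP; rewrite addr_eq0 => /eqP.
  have h1 : `|(x i - x' i) * (x i + x' i)| <= N * (t * 2).
    rewrite e normrN NE; apply: sum_le_card; first by rewrite mulr_ge0// ltW.
    by move=> k ki; rewrite normrM; apply: ler_pM => //; [exact: hx|exact: n2].
  have h2 : 2 * N^-1 <= `|x i + x' i|.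
    have -> : `|x i + x' i| = `|s1 * x i + s1 * x' i| by rewrite -mulrDr normrM s11 mul1r.
    by apply: le_trans (ler_norm _); move: a1 a1'; clear; lra.
  rewrite normrM in h1; set D := `|x i - x' i| in h1 *; have D0 : 0 <= D by exact: normr_ge0.
  have h3 : D * (2 * N^-1) <= N * (t * 2) by apply: le_trans h1; rewrite ler_wpM2l.
  have : D * (2 * N^-1) * N <= N * (t * 2) * N by rewrite ler_pM2r.
  have -> : D * (2 * N^-1) * N = 2 * D * (N * N^-1) by ring.
  by rewrite NI mulr1 expr2; clear; lra.
have dx k : `|x k - x' k| <= N ^+ 2 * t.
  have [->//|ki] := eqVneq k i; apply: le_trans (hx k ki) _.
  by rewrite -[leLHS]mul1r ler_pM2r// exprn_ege1.
pose Dl k := y k - y' k; pose z k := y k + y' k.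
have ij' : j != i by rewrite eq_sym.
have split2 (F : I -> R) : \sum_k F k = F i + F j + \sum_(k | (k != i) && (k != j)) F k.
  by rewrite (bigD1 i)//= (bigD1 j)//= addrA.
have N3 : N ^+ 3 = N * N ^+ 2 by rewrite exprS.
have N3N : N <= N ^+ 3 by rewrite N3 ler_peMr ?(ltW N0)// exprn_ege1.
(* Orthogonality bounds A, and the norm of y bounds B below. These are two linear equations for
   [Dl i] and [Dl j]; their determinant W stays away from 0 by the sign conditions on the minor. *)
set A := x i * Dl i + x j * Dl j.
have hA : `|A| <= 2 * N ^+ 3 * u.
  have e1 : \sum_k x k * Dl k = - \sum_k (x k - x' k) * y' k.
    apply/eqP; rewrite -addr_eq0 -big_split/=; apply/eqP.
    rewrite (eq_bigr (fun k => x k * y k - x' k * y' k)); last by move=> k _; rewrite /Dl; ring.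
    by rewrite sumrB -/(dot x y) -/(dot x' y') xy xy' subrr.
  have h1 : `|\sum_k x k * Dl k| <= N * (N ^+ 2 * t * 1).
    rewrite e1 normrN NE; apply: sum_le_card.
      by rewrite mulr1 mulr_ge0 ?sqr_ge0// ltW.
    by move=> k _; rewrite normrM -NE; apply: ler_pM => //; exact: c1.
  have h2 : `|\sum_(k | (k != i) && (k != j)) x k * Dl k| <= N * (1 * u).
    rewrite NE; apply: sum_le_card; first by rewrite mul1r ltW.
    by move=> k /andP[ki kj]; rewrite normrM; apply: ler_pM => //; [exact: c1|exact: hy].
  have -> : A = \sum_k x k * Dl k - \sum_(k | (k != i) && (k != j)) x k * Dl k.
    by rewrite split2 /A addrK.
  apply: le_trans (ler_normB _ _) _.
  rewrite mulr1 mulrA -N3 in h1; rewrite mul1r in h2.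
  have : N * u <= N ^+ 3 * u by rewrite ler_pM2r.
  have : N ^+ 3 * t <= N ^+ 3 * u by rewrite ler_pM2l// exprn_gt0.
  by move: h1 h2; clear; lra.
set B := z i * Dl i + z j * Dl j.
have hB : `|B| <= 2 * N * u.
  have e1 : \sum_k z k * Dl k = 0.
    rewrite (eq_bigr (fun k => y k * y k - y' k * y' k)); last by move=> k _; rewrite /z /Dl; ring.
    by rewrite sumrB -/(dot y y) -/(dot y' y') yy yy' subrr.
  have -> : B = - \sum_(k | (k != i) && (k != j)) z k * Dl k.
    by apply/eqP; rewrite -addr_eq0 /B -split2 e1.
  have -> : 2 * N * u = N * (2 * u) by ring.
  rewrite normrN NE; apply: sum_le_card; first by rewrite mulr_ge0// ltW.
  by move=> k /andP[ki kj]; rewrite normrM; apply: ler_pM => //; [exact: n2|exact: hy].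
set W := x i * z j - x j * z i.
have hW : N^-1 <= `|W|.
  have -> : `|W| = `|s2 * W| by rewrite normrM s21 mul1r.
  apply: le_trans (ler_norm _).
  have e : s2 * W = s2 * (x i * y j - x j * y i) + s2 * (x' i * y' j - x' j * y' i)
     + s2 * ((x i - x' i) * y' j - (x j - x' j) * y' i) by rewrite /W /z; ring.
  have h : `|s2 * ((x i - x' i) * y' j - (x j - x' j) * y' i)| <= 2 * (N ^+ 2 * t).
    rewrite normrM s21 mul1r; apply: le_trans (ler_normB _ _) _; rewrite !normrM.
    have k1 : `|x i - x' i| * `|y' j| <= (N ^+ 2 * t) * 1 by apply: ler_pM => //; exact: c1.
    have k2 : `|x j - x' j| * `|y' i| <= (N ^+ 2 * t) * 1 by apply: ler_pM => //; exact: c1.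
    by move: k1 k2; clear; lra.
  have h' : 2 * (N ^+ 2 * t) <= N^-1.
    rewrite -(ler_pM2l N0) NI; by apply: le_trans tN; rewrite N3 le_eqVlt; apply/orP; left; apply/eqP; ring.
  move: h; rewrite e ler_norml => /andP[h _]; move: h h' a2 a2'; clear; lra.
have Wp : 0 < `|W| by apply: lt_le_trans hW; rewrite invr_gt0.
have fin (D p q a b : R) : D * W = A * p - B * q -> `|p| <= 2 -> `|q| <= 1 -> `|D| <= 6 * N ^+ 4 * u.
  move=> e p2 q1.
  have h : `|D| * `|W| <= 6 * N ^+ 3 * u.
    rewrite -normrM e; apply: le_trans (ler_normB _ _) _; rewrite !normrM.
    have k1 : `|A| * `|p| <= (2 * N ^+ 3 * u) * 2 by apply: ler_pM.
    have k2 : `|B| * `|q| <= (2 * N * u) * 1 by apply: ler_pM.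
    have : N * u <= N ^+ 3 * u by rewrite ler_pM2r.
    by move: k1 k2; clear; lra.
  have h2 : `|D| * N^-1 <= 6 * N ^+ 3 * u by apply: le_trans h; rewrite ler_wpM2l.
  move: h2; rewrite ler_pdivrMr// => h2; apply: le_trans h2 _.
  by rewrite le_eqVlt; apply/orP; left; apply/eqP; ring.
split => //.
  by apply: (fin _ (z j) (x j) 0 0); [rewrite /A /B /W -/(Dl i); ring|exact: n2|exact: c1].
apply: (fin _ (- z i) (- x i) 0 0); rewrite ?normrN; last exact: c1.
  by rewrite /A /B /W -/(Dl j); ring.
exact: n2.
Qed.

Lemma modz_close (K : nat) (a b : int) (C : R) : (0 < K)%N -> C < K%:R ->
  `|((a - b)%:~R : R)| <= C -> (a %% K)%Z = (b %% K)%Z -> a = b.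
Proof.
move=> K0 CK h /eqP; rewrite eqz_mod_dvd => /dvdzP[q e].
have : `|a - b| < K%:Z.
  by rewrite -(ltr_int R) intr_norm; apply: le_lt_trans h _.
rewrite e normrM => h2.
have q0 : q = 0.
  apply/eqP; rewrite -normr_eq0; apply: contraT => qn.
  have : 1 <= `|q| by rewrite -gtz0_ge1 lt0r qn normr_ge0.
  have : `|K%:Z| = K%:Z by [].
  by move: h2 => /[swap] -> /[swap]; nia.
by move: e; rewrite q0 mul0r => /eqP; rewrite subr_eq0 => /eqP.
Qed.

Lemma modz_weight (K : nat) (a : int) : (0 < K)%N ->
  K%:R^-1 * `|((a %% K)%Z)%:~R| <= 1 :> R.
Proof.
move=> K0; rewrite mulrC ler_pdivrMr ?ltr0n// mul1r -intr_norm -[leRHS]/((K%:Z)%:~R) ler_int.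
have Kp : 0 < K%:Z by [].
have Kn : K%:Z != 0 by rewrite gt_eqF.
by rewrite ger0_norm ?modz_ge0//; apply: ltW; exact: ltz_pmod.
Qed.

Lemma sum_rd_le (z : I -> R) (h N : R) (A : pred I) : N = #|I|%:R -> 0 < N -> 0 < h ->
  dot z z = 1 ->
  \sum_(k | A k) h * `|(rd (z k / (h / Num.sqrt N)))%:~R| <= 2 * N.
Proof.
move=> NE N0 h0 zz; have q0 : 0 < Num.sqrt N by rewrite sqrtr_gt0.
have qq : Num.sqrt N * Num.sqrt N = N by rewrite -expr2 sqr_sqrtr// ltW.
apply: (@le_trans _ _ (\sum_k (2 * Num.sqrt N) * `|z k|)).
  rewrite [leLHS]big_mkcond; apply: ler_sum => k _.
  have e0 : 0 <= 2 * Num.sqrt N * `|z k| by rewrite mulr_ge0// mulr_ge0// ltW.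
  case: ifP => // _.
  have := @rd_scale_le R (z k) (h / Num.sqrt N) (divr_gt0 h0 q0).
  rewrite -(ler_pM2l h0) => /le_trans; apply.
  by rewrite le_eqVlt; apply/orP; left; apply/eqP; field; rewrite !gt_eqF.
rewrite -mulr_sumr; apply: (@le_trans _ _ (2 * Num.sqrt N * Num.sqrt N)); last by rewrite -mulrA qq.
rewrite ler_pM2l ?mulr_gt0//; apply: le_trans (sum_abs_le z) _.
by rewrite (nrm1 zz) mulr1 -NE.
Qed.

(** Pivots and signs are fixed. The coordinate i of x and the coordinates i and j of y are
    determined by the others up to O (N^4) rounding units, so only their residues modulo K are
    stored. This polynomial cost replaces one factor 1 / hx and two factors 1 / hy. *)
Lemma exact_net_class (H : set ((I -> R) * (I -> R))) (i j : I) (s1 s2 hx hy N : R) :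
  N = #|I|%:R -> 2 <= N -> 0 < hx -> hx <= hy -> 2 * N ^+ 3 * hy <= 1 ->
  i != j -> s1 = 1 \/ s1 = -1 -> s2 = 1 \/ s2 = -1 ->
  exists r : seq ((I -> R) * (I -> R)),
   [/\ forall g, List.In g r -> H g /\ orthonormal2 g,
    forall g, [/\ H g, orthonormal2 g, N^-1 <= s1 * g.1 i &
        N^-1 <= s2 * (g.1 i * g.2 j - g.1 j * g.2 i)] ->
      exists2 g', List.In g' r &
        nrm (fun i => g.1 i - g'.1 i) <= hx /\ nrm (fun i => g.2 i - g'.2 i) <= hy &
    (size r)%:R <= expR (4 * N + 3) * (1 + 2 * (6 * N ^+ 4 + 2)) ^+ 3 *
      ((1 + 2 / hx) ^+ #|I|.-1 * (1 + 2 / hy) ^+ #|I|.-2)].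
Proof.
move=> NE N2 hx0 hxy hN ij s1P s2P; have N0 : 0 < N by lra.
have hy0 : 0 < hy by lra.
have cI : (0 < #|I|)%N by rewrite -(ltr_nat R) -NE.
have q0 : 0 < Num.sqrt N by rewrite sqrtr_gt0.
pose T := ((I -> R) * (I -> R))%type.
pose t := hx / Num.sqrt N; pose u := hy / Num.sqrt N.
have t0 : 0 < t by rewrite divr_gt0.
have u0 : 0 < u by rewrite divr_gt0.
have tu : t <= u by rewrite ler_pM2r ?invr_gt0.
have q1 : 1 <= Num.sqrt N by rewrite -[leLHS]sqrtr1 ler_wsqrtr//; lra.
have uhy : u <= hy by rewrite ler_pdivrMr// ler_peMr// ltW.
have N1 : 1 <= N by apply: le_trans N2; rewrite ler1n.
have tN : 2 * N ^+ 3 * t <= 1.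
  apply: le_trans hN; rewrite ler_pM2l ?mulr_gt0 ?exprn_gt0//; lra.
(* Two roundings of an omitted coordinate differ by at most 6 N^4 + 1, so their residues modulo K
   decide whether they are equal. *)
pose K := (6 * #|I| ^ 4 + 2)%N.
have KE : K%:R = 6 * N ^+ 4 + 2 :> R by rewrite /K natrD natrM natrX NE.
have K0 : (0 < K)%N by rewrite /K addn2.
have Kp : 0 < K%:R :> R by rewrite ltr0n.
pose G : set T := [set g : T | [/\ H g, orthonormal2 g, N^-1 <= s1 * g.1 i &
        N^-1 <= s2 * (g.1 i * g.2 j - g.1 j * g.2 i)]].
pose F (g : T) (k : I + I) : int := match k with
  | inl k => if k == i then (rd (g.1 k / t) %% K)%Z else rd (g.1 k / t)
  | inr k => if (k == i) || (k == j) then (rd (g.2 k / u) %% K)%Z else rd (g.2 k / u) end.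
pose w (k : I + I) : R := match k with
  | inl k => if k == i then K%:R^-1 else hx
  | inr k => if (k == i) || (k == j) then K%:R^-1 else hy end.
have w0 k : 0 < w k by rewrite /w; case: k => k; case: ifP; rewrite ?invr_gt0.
have [] := @net_exists R T G _ F w (4 * N + 3) w0.
  move=> g [_ [xx yy xy] _ _].
  rewrite big_sumType/=.
  rewrite [X in X + _](bigD1 i)//= eqxx.
  rewrite [X in _ + X](bigD1 i)//= eqxx/= [X in _ + (_ + X)](bigD1 j)/=; last by rewrite eq_sym.
  rewrite eqxx orbT.
  have h1 := @modz_weight K (rd (g.1 i / t)) K0; have h2 := @modz_weight K (rd (g.2 i / u)) K0; have h3 := @modz_weight K (rd (g.2 j / u)) K0.
  have h4 : \sum_(k | k != i) (if k == i then K%:R^-1 else hx) *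
       `|(if k == i then (rd (g.1 k / t) %% K)%Z else rd (g.1 k / t))%:~R| <= 2 * N.
    apply: le_trans (sum_rd_le (fun k => k != i) NE N0 hx0 xx).
    by apply: ler_sum => k /negPf->.
  have h5 : \sum_(k | (k != i) && (k != j)) (if (k == i) || (k == j) then K%:R^-1 else hy) *
       `|(if (k == i) || (k == j) then (rd (g.2 k / u) %% K)%Z else rd (g.2 k / u))%:~R| <= 2 * N.
    apply: le_trans (sum_rd_le (fun k => (k != i) && (k != j)) NE N0 hy0 yy).
    by apply: ler_sum => k /andP[/negPf-> /negPf->].
  by move: h1 h2 h3 h4 h5; clear; lra.
move=> r [r1 r2 r3]; exists r; split.
- by move=> g /r1[].
- move=> [x y] Gg; have [[x' y'] g'r e] := r2 _ Gg; exists (x', y') => //.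
  have [_ og a1 a2] := Gg; have [_ og' a1' a2'] := r1 _ g'r.
  have eF k : F (x', y') k = F (x, y) k by rewrite e.
  have ex k : k != i -> `|x k - x' k| <= t.
    by move=> /negPf ki; have := eF (inl k); rewrite /= ki => h; exact: rd_scale t0 (esym h).
  have ey k : k != i -> k != j -> `|y k - y' k| <= u.
    by move=> /negPf ki /negPf kj; have := eF (inr k); rewrite /= ki kj => h; exact: rd_scale u0 (esym h).
  have [d1 d2 d3] := omitted_coordinates NE N2 ij s1P s2P og og' t0 tu tN a1 a1' a2 a2' ex ey.
  have N24 : N ^+ 2 <= 6 * N ^+ 4.
    have -> : N ^+ 4 = N ^+ 2 * N ^+ 2 by ring.
    have : N ^+ 2 <= N ^+ 2 * N ^+ 2 by rewrite ler_peMr ?sqr_ge0// exprn_ege1.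
    by have := sqr_ge0 N; clear; lra.
  have ex' k : `|x k - x' k| <= t.
    have [->|] := eqVneq k i; last exact: ex.
    apply: (rd_scale t0); have := eF (inl i); rewrite /= eqxx => h.
    have := rd_diff t0 d1 => d1'.
    by apply: (modz_close K0 _ d1' (esym h)); rewrite KE; move: N24; clear; lra.
  have ey' k : `|y k - y' k| <= u.
    have [->|ki] := eqVneq k i.
      apply: (rd_scale u0); have := eF (inr i); rewrite /= eqxx => h.
      by apply: (modz_close K0 _ (rd_diff u0 d2) (esym h)); rewrite KE; clear; lra.
    have [->|kj] := eqVneq k j; last exact: ey.
    apply: (rd_scale u0); have := eF (inr j); rewrite /= eqxx orbT => h.
    by apply: (modz_close K0 _ (rd_diff u0 d3) (esym h)); rewrite KE; clear; lra.
  split; apply: nrm_le_coord_scale; rewrite -?NE ?(ltW hx0) ?(ltW hy0)//; lia.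
apply: le_trans r3 _; rewrite -[leRHS]mulrA ler_pM2l ?expR_gt0//.
rewrite big_sumType/= [X in X * _](bigD1 i)//= eqxx.
rewrite [X in _ * X](bigD1 i)//= eqxx/= [X in _ * (_ * X)](bigD1 j)/=; last by rewrite eq_sym.
rewrite eqxx orbT invrK -KE.
rewrite (eq_bigr (fun=> 1 + 2 / hx)); last by move=> k /negPf->.
rewrite (eq_bigr (F1 := fun k => 1 + 2 / (if (k == i) || (k == j) then K%:R^-1 else hy)) (fun=> 1 + 2 / hy)); last by move=> k /andP[/negPf-> /negPf->].
rewrite !prodr_const.
have -> : #|[pred k | k != i]| = #|I|.-1 by rewrite cardC1.
have -> : #|[pred k | (k != i) && (k != j)]| = #|I|.-2.
  have := cardC [pred k | (k == i) || (k == j)].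
  rewrite card2 ij => <-; rewrite add2n/=.
  by apply: eq_card => k; rewrite !inE negb_or.
by rewrite le_eqVlt; apply/orP; left; apply/eqP; ring.
Qed.

(** The classes cover all pairs: some x_i^2 is at least 1 / N, and the squares of the minors x_i y_k
    - x_k y_i sum to x_i^2 + y_i^2, so one minor is at least 1 / N in absolute value. Two pivots and
    two signs make at most 4 N^2 classes. *)
Lemma exact_net (H : set ((I -> R) * (I -> R))) (hx hy N : R) :
  N = #|I|%:R -> 2 <= N -> 0 < hx -> hx <= hy -> 2 * N ^+ 3 * hy <= 1 ->
  exists r : seq ((I -> R) * (I -> R)),
   [/\ forall g, List.In g r -> H g /\ orthonormal2 g,
    forall g, H g -> orthonormal2 g ->
      exists2 g', List.In g' r &
        nrm (fun i => g.1 i - g'.1 i) <= hx /\ nrm (fun i => g.2 i - g'.2 i) <= hy &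
    (size r)%:R <= 4 * N ^+ 2 * (expR (4 * N + 3) * (1 + 2 * (6 * N ^+ 4 + 2)) ^+ 3 *
      ((1 + 2 / hx) ^+ #|I|.-1 * (1 + 2 / hy) ^+ #|I|.-2))].
Proof.
move=> NE N2 hx0 hxy hN; have N0 : 0 < N by lra.
have hy0 : 0 < hy by lra.
have cI : (2 <= #|I|)%N by rewrite -(ler_nat R) -NE.
pose V := (I -> R)%type; pose T := (V * V)%type.
pose sg (b : bool) : R := if b then 1 else -1.
pose C := {c : (I * I) * (bool * bool) | c.1.1 != c.1.2}.
pose ci (c : C) := (val c).1.1; pose cj (c : C) := (val c).1.2.
pose G (c : C) : set T := [set g | [/\ H g, orthonormal2 g,
  N^-1 <= sg (val c).2.1 * g.1 (ci c) &
  N^-1 <= sg (val c).2.2 * (g.1 (ci c) * g.2 (cj c) - g.1 (cj c) * g.2 (ci c))]].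
pose K := (6 * #|I| ^ 4 + 2)%N.
have KE : K%:R = 6 * N ^+ 4 + 2 :> R by rewrite /K natrD natrM natrX NE.
have K0 : (0 < K)%N by rewrite /K addn2.
have Kp : 0 < K%:R :> R by rewrite ltr0n.
pose near (g g' : T) : Prop := nrm (fun i => g.1 i - g'.1 i) <= hx /\ nrm (fun i => g.2 i - g'.2 i) <= hy.
pose Q (g : T) : Prop := H g /\ orthonormal2 g.
pose S : R := expR (4 * N + 3) * (1 + 2 * (6 * N ^+ 4 + 2)) ^+ 3 *
      ((1 + 2 / hx) ^+ #|I|.-1 * (1 + 2 / hy) ^+ #|I|.-2).
have S0 : 0 <= S.
  rewrite /S -KE !mulr_ge0 ?expR_ge0 ?exprn_ge0// addr_ge0// ?divr_ge0// ?mulr_ge0// ltW//.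
have [c|r [r1 r2 r3]] := @net_union T C G near Q S; last first.
  exists r; split => //.
  - move=> [x y] Hg og; have [/= xx yy xy] := og.
    have Nsq (z : R) : N^-1 <= z ^+ 2 -> `|z| <= 1 -> N^-1 <= `|z|.
      move=> h1 h2; apply: le_trans h1 _; rewrite -real_normK ?num_real// expr2 ler_piMl ?normr_ge0 //.
    have [i] := @exists_large x (etrans (eq_bigr _ (fun k _ => expr2 (x k))) xx).
    rewrite -NE => xi2.
    have xi : N^-1 <= `|x i| by apply: Nsq => //; rewrite -(nrm1 xx) nrm_coord.
    pose D k := x i * y k - x k * y i.
    have D2 : \sum_k D k ^+ 2 = x i ^+ 2 + y i ^+ 2.
      rewrite (eq_bigr (fun k => x i ^+ 2 * (y k * y k) + y i ^+ 2 * (x k * x k) + (- 2 * x i * y i) * (x k * y k))); last by move=> k _; rewrite /D; ring.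
      by rewrite !big_split/= -!mulr_sumr -/(dot x x) -/(dot y y) -/(dot x y) xx yy xy; ring.
    pose nD := Num.sqrt (\sum_k D k ^+ 2).
    have D2p : N^-1 <= \sum_k D k ^+ 2.
      by rewrite D2; apply: le_trans (xi2 : N^-1 <= x i ^+ 2) _; rewrite lerDl sqr_ge0.
    have Ni0 : 0 < N^-1 by rewrite invr_gt0.
    have [j Dj] : exists j, N^-1 <= `|D j|.
      apply: contrapT => /forallNP hD.
      have : \sum_k D k ^+ 2 < \sum_(k : I) N^-1 * N^-1.
        apply: ltr_sum => [|k _]; first by apply/hasP; exists i; rewrite ?mem_index_enum.
        have /negP := hD k; rewrite -ltNge => h.
        by rewrite -real_normK ?num_real// expr2; apply: ltr_pM.
      rewrite sumr_const -[X in _ < X]mulr_natl -NE mulrA mulfV ?gt_eqF// mul1r.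
      by move=> /lt_le_trans/(_ D2p); rewrite ltxx.
    have ij : i != j.
      apply/eqP => e; move: Dj; rewrite /D e subrr normr0 leNgt.
      by rewrite Ni0.
    have sgE (z : R) : `|z| = sg (0 <= z) * z.
      by rewrite /sg; have [z0|z0] := leP 0 z; rewrite ?mul1r ?mulN1r; [exact: ger0_norm|exact: ltr0_norm].
    have cP : ((i, j), (0 <= x i, 0 <= D j)).1.1 != ((i, j), (0 <= x i, 0 <= D j)).1.2 by [].
    have [|g' g'r ng] := r2 (exist _ ((i, j), (0 <= x i, 0 <= D j)) cP) (x, y).
      by split => //=; rewrite /ci /cj/= -?sgE// -/(D j) -sgE.
    by exists g'.
  - apply: le_trans r3 _; rewrite ler_wpM2r//.
    rewrite NE; apply: (@le_trans _ _ (#|{: (I * I) * (bool * bool)}|%:R)).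
      by rewrite ler_nat card_sig max_card.
    by rewrite !card_prod !card_bool !natrM; lra.
have sgP b : sg b = 1 \/ sg b = -1 by case: b; [left|right].
exact: (exact_net_class H NE N2 hx0 hxy hN (valP c) (sgP _) (sgP _)).
Qed.

End ExactNet.

(** * Norm of the random system *)

Section ExpBounds.
Context (R : realType).

Lemma expR_ge_id (x : R) : x <= expR x.
Proof. by have := expR_ge1Dx x; lra. Qed.

Lemma exprn_le_expR (x : R) k : 0 <= x -> x ^+ k <= expR (k%:R * x).
Proof. by move=> x0; rewrite expRM_natl; apply: lerXn2r; rewrite ?nnegrE ?expR_ge0// expR_ge_id. Qed.

(** Used with x = [lam]: the logarithm of a precision that is a power of d is bounded by a multiple
    of [lam]. *)
Lemma one_add_le_expR (K x : R) k : 1 <= K -> 1 <= x ->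
  1 + 2 * (K * x ^+ k) <= expR (2 + K + k%:R * x).
Proof.
move=> K1 x1; have h1 := expR_ge_id K; have h2 := @exprn_le_expR x k (le_trans ler01 x1).
have h3 : 1 <= x ^+ k by rewrite exprn_ege1.
have h4 : 1 <= K * x ^+ k by apply: mulr_ege1.
apply: (@le_trans _ _ (3 * (K * x ^+ k))); first by lra.
have h5 : 3 <= expR (2 : R) by have := expR_ge1Dx (2 : R); lra.
have -> : expR (2 + K + k%:R * x) = expR 2 * (expR K * expR (k%:R * x)).
  by rewrite -!expRD addrA.
apply: ler_pM => //; first by lra.
by apply: ler_pM => //; lra.
Qed.

End ExpBounds.

Fixpoint words (V : Type) (k : nat) (s : seq V) : seq (seq V) :=
  if k is k'.+1 then flatten [seq [seq z :: zs | zs <- words k' s] | z <- s] else [:: [::]].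

Lemma size_words (V : Type) k (s : seq V) : size (words k s) = (size s ^ k)%N.
Proof.
elim: k => //= k IH; rewrite expnS -IH.
move: (words k s) => ws; elim: s {IH} => //= z s IHs.
by rewrite size_cat size_map IHs mulSn.
Qed.

Lemma words_In (V : Type) k (s : seq V) zs : size zs = k ->
  (forall z, List.In z zs -> List.In z s) -> List.In zs (words k s).
Proof.
elim: k zs => [|k IH] [|z zs]//=; first by left.
move=> [szs] h.
have h1 : List.In zs (words k s) by apply: IH => // z' z'zs; apply: h; right.
have : List.In z s by apply: h; left.
elim: s {h IH h1}(words k s) h1 => // z' s IHs ws h1 /= [->|zs'].
  by apply/List.in_app_iff; left; apply/List.in_map_iff; exists zs.
by apply/List.in_app_iff; right; exact: IHs.
Qed.

Lemma words_P (V : Type) k (s : seq V) zs : List.In zs (words k s) ->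
  size zs = k /\ forall z, List.In z zs -> List.In z s.
Proof.
elim: k zs => [|k IH] zs /=; first by case=> [<-|].
have aux (ws : seq (seq V)) : forall s', List.In zs (flatten [seq [seq z :: zs | zs <- ws] | z <- s']) ->
    exists z zs', [/\ zs = z :: zs', List.In z s' & List.In zs' ws].
  elim=> //= z s' IHs /List.in_app_iff[/List.in_map_iff[zs' [<- zin]]|/IHs[z' [zs' [-> h1 h2]]]].
    by exists z, zs'; split => //; left.
  by exists z', zs'; split => //; right.
move=> /aux[z [zs' [-> zin /IH[<- h]]]]; split => // z' /= [<-//|/h//].
Qed.

Section Operator.
Context (R : realType) (disp0 : measure_display) (Om0 : measurableType disp0)
  (P0 : probability Om0 R) (xi : {RV P0 >-> R}) (disp : measure_display)
  (Om : measurableType disp) (P : probability Om R)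
  (m d : nat) (I : finType) (a : 'I_m * d.-tuple I -> {RV P >-> R}).
Hypothesis iid : iid_copies xi a.

(** Coefficients indexed by sequences, as the tensor recursions require; the default 0 occurs only
    at lengths other than d. *)
Definition sysA (w : Om) (l : 'I_m) (s : seq I) : R :=
  if insub s is Some t then a (l, t) w else 0.

Lemma app_sys tau l w : app d (sysA w) tau l = row a (fun t => tau t) l w.
Proof.
rewrite /app /tsum /row; apply: eq_bigr => t _.
by rewrite /sysA valK mulrC.
Qed.

Variables (C N : R).
Hypotheses (C0 : 0 < C) (NE : N = #|I|%:R) (N0 : 0 < N) (m0 : (0 < m)%N) (mN : (m <= #|I|)%N).
Hypothesis mgf : forall t : R, (\int[P0]_w (expR (t * xi w))%:E <= (expR (C * t ^+ 2))%:E)%E.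

Lemma dot_app_tail (tau : seq I -> R) (z : 'I_m -> R) (v K : R) : 0 < v -> 0 <= K ->
  nrm z <= 1 -> tsum d (fun s => tau s ^+ 2) <= v ->
  outer_le P [set w | K <= dot z (app d (sysA w) tau)] (expR (- (K ^+ 2 / (4 * C * v)))).
Proof.
move=> v0 K0 z1 tv.
pose c (j : 'I_m * d.-tuple I) := z j.1 * tau j.2.
have -> : [set w | K <= dot z (app d (sysA w) tau)] = [set w | (K <= lin a c w)%R].
  apply/seteqP; split => w /=; rewrite (_ : dot z _ = lin a c w)//.
    rewrite /dot /lin (eq_bigr (fun l => \sum_t c (l, t) * a (l, t) w)) => [|l _].
      by rewrite pair_bigA; apply: eq_bigr; case.
    by rewrite app_sys /row mulr_sumr; apply: eq_bigr => t _; rewrite /c mulrA.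
  rewrite /dot /lin (eq_bigr (fun l => \sum_t c (l, t) * a (l, t) w)) => [|l _].
    by rewrite pair_bigA; apply: eq_bigr; case.
  by rewrite app_sys /row mulr_sumr; apply: eq_bigr => t _; rewrite /c mulrA.
exists [set w | (K <= lin a c w)%R]; split; [|by []|].
  by apply: measurable_set_le; [exact: measurable_cst|exact: measurable_lin].
apply: (lin_tail iid mgf C0 v0 K0).
rewrite (eq_bigr (fun j : 'I_m * d.-tuple I => (z j.1 ^+ 2) * (tau j.2 ^+ 2))); last by move=> j _; rewrite /c exprMn.
rewrite -(pair_bigA _ (fun l (t : d.-tuple I) => (z l ^+ 2) * (tau t ^+ 2)))/=.
under eq_bigr do rewrite -mulr_sumr.
rewrite -mulr_suml -/(tsum d (fun s => tau s ^+ 2)).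
have -> : \sum_l z l ^+ 2 = nrm z ^+ 2 by rewrite nrm_sq; apply: eq_bigr => l _; rewrite expr2.
have t0 : 0 <= tsum d (fun s => tau s ^+ 2) by apply: tsum_ge0 => s; exact: sqr_ge0.
apply: le_trans tv; by rewrite -[leRHS]mul1r ler_wpM2r// expr_le1 ?nrm_ge0.
Qed.

(** A net of precision 1/2 of the unit ball of R^m reduces the norm to linear forms; its entropy
    accounts for the 8 N. *)
Lemma op_tail (tau : seq I -> R) (v T : R) : 0 < v -> 0 <= T ->
  tsum d (fun s => tau s ^+ 2) <= v ->
  outer_le P [set w | 2 * T * Num.sqrt N * Num.sqrt v < nrm (app d (sysA w) tau)]
    (expR (N * (8 - T ^+ 2 / (4 * C)))).
Proof.
move=> v0 T0 tv; pose K := T * Num.sqrt N * Num.sqrt v.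
have K0 : 0 <= K by rewrite !mulr_ge0 ?sqrtr_ge0.
have c0 : (0 < #|'I_m|)%N by rewrite card_ord.
have [] := @coarse_net R _ [set z : 'I_m -> R | nrm z <= 1] 'I_m (fun z => z) 2 c0.
- by lra.
- by move=> z /= z1; lra.
move=> r [r1 r2 r3].
apply: (outer_leS _ _ (@outer_le_seq _ _ _ P _ r (fun z => [set w | K <= dot z (app d (sysA w) tau)])
   (expR (- (K ^+ 2 / (4 * C * v)))) (expR_ge0 _) _)).
- move=> w /= h; set F := app d (sysA w) tau in h *.
  have F0 : 0 < nrm F by apply: le_lt_trans h; rewrite -!mulrA mulr_ge0 ?mulr_ge0 ?sqrtr_ge0.
  pose z i := (nrm F)^-1 * F i.
  have z1 : nrm z = 1 by rewrite nrmZ gtr0_norm ?invr_gt0// mulVf// gt_eqF.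
  have [|z' z'r e] := r2 z; first by rewrite /= z1.
  exists z' => //=.
  have zF : dot z F = nrm F by rewrite dotZl -nrm_sq expr2 mulrA mulVf ?mul1r// gt_eqF.
  have := dot_le (fun i => z i - z' i) F; rewrite dotBl zF ler_norml => /andP[_ h2].
  have : nrm (fun i => z i - z' i) * nrm F <= 2^-1 * nrm F by rewrite ler_pM2r.
  move: h; have -> : 2 * T * Num.sqrt N * Num.sqrt v = 2 * K by rewrite /K; ring.
  lra.
- rewrite mulrC; apply: (@le_trans _ _ (expR (- (K ^+ 2 / (4 * C * v))) * expR (8 * N))).
    rewrite ler_pM2l ?expR_gt0//; apply: le_trans r3 _.
    rewrite card_ord; apply: (@le_trans _ _ (expR (4 * m%:R) * expR 4 ^+ m)).
      rewrite ler_pM2l ?expR_gt0//; apply: lerXn2r; rewrite ?nnegrE ?expR_ge0//.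
      have := expR_ge1Dx (4 : R); lra.
    rewrite -expRM_natl -expRD ler_expR NE.
    have : m%:R <= #|I|%:R :> R by rewrite ler_nat.
    lra.
  rewrite -expRD ler_expR.
  have -> : K ^+ 2 / (4 * C * v) = N * (T ^+ 2 / (4 * C)).
    by rewrite /K !exprMn !sqr_sqrtr ?(ltW N0) ?(ltW v0)//; field; rewrite !gt_eqF.
  lra.
- by move=> z zr; apply: dot_app_tail => //; exact: r1.
Qed.

(** S is the entropy of the family per dimension, which T^2 / (4 C) has to exceed; Q discards the
    members whose tensor is too large. *)
Lemma op_tail_seq (G : Type) (r : seq G) (Q : G -> Prop) (tau : G -> seq I -> R) (v T S : R) :
  0 < v -> 0 <= T -> (forall g, List.In g r -> Q g -> tsum d (fun s => tau g s ^+ 2) <= v) ->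
  (size r)%:R <= expR (N * S) -> 8 + S + 1 <= T ^+ 2 / (4 * C) ->
  outer_le P [set w | exists2 g, List.In g r & Q g /\ 2 * T * Num.sqrt N * Num.sqrt v < nrm (app d (sysA w) (tau g))]
    (expR (- N)).
Proof.
move=> v0 T0 tv rS hT.
apply: (outer_leS _ _ (@outer_le_seq _ _ _ P _ r
   (fun g => [set w | Q g /\ 2 * T * Num.sqrt N * Num.sqrt v < nrm (app d (sysA w) (tau g))])
   (expR (N * (8 - T ^+ 2 / (4 * C)))) (expR_ge0 _) _)) => //.
- apply: (@le_trans _ _ (expR (N * S) * expR (N * (8 - T ^+ 2 / (4 * C))))).
    by rewrite ler_pM2r ?expR_gt0.
  rewrite -expRD ler_expR -mulrDr -[leRHS]mulrN1 ler_pM2l//; lra.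
- move=> g gr; have [Qg|nQ] := pselect (Q g).
    by apply: outer_leS (op_tail v0 T0 (tv g gr Qg)) => // w [].
  apply: (outer_leS _ _ (outer_le_set0 P (expR_ge0 _))) => // w [] //.
Qed.

Variable lam : R.
Hypotheses (lam1 : 1 <= lam) (lamd : lam ^+ 24 = d%:R).

Lemma lam_gt0 : 0 < lam.
Proof. exact: lt_le_trans ltr01 lam1. Qed.

Let lam0 := lam_gt0.

Definition cG1 : R := 4 * Num.sqrt (4 * C * 50).

Lemma d_gt0 : (0 < d)%N.
Proof. by rewrite -(ltr_nat R) -lamd exprn_gt0. Qed.

(** Precision 1 / (2 d) in every slot keeps (1 - eta)^d >= 1/2. The d nets together have entropy of
    order d N lam, which is beaten by T^2 of order d lam^2; this is the source of sqrt d. *)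
Lemma injective_bound_whp : outer_le P
  [set w | ~ injective_bound d (sysA w) (cG1 * Num.sqrt N * Num.sqrt d%:R * lam)] (expR (- N)).
Proof.
have l1 := lam1; have NP := N0; have d0 := d_gt0; have dR : 1 <= d%:R :> R by rewrite ler1n.
have I0 : (0 < #|I|)%N by rewrite -(ltr_nat R) -NE.
pose K := Num.sqrt (4 * C * 50); have K2 : K ^+ 2 = 4 * C * 50 by rewrite sqr_sqrtr// !mulr_ge0 ?(ltW C0).
have [] := @coarse_net R _ [set z : I -> R | nrm z <= 1] I (fun z => z) (2 * d%:R) I0.
- by lra.
- by move=> z /= z1; lra.
move=> r [r1 r2 r3].
pose T := K * Num.sqrt d%:R * lam.
have T0 : 0 <= T by rewrite !mulr_ge0 ?sqrtr_ge0 ?(ltW lam0).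
apply: outer_leS (op_tail_seq (Q := fun=> True) (r := words d r) (tau := @tP R I) (v := 1) ltr01 T0 _ _ _) => //.
- move=> w /= H; apply: contrapT => H2; apply: H.
  pose M := 2 * T * Num.sqrt N.
  have M0 : 0 <= M := mulr_ge0 (mulr_ge0 (ler0n R 2) T0) (sqrtr_ge0 N).
  pose eta : R := (2 * d%:R)^-1.
  have e0 : 0 <= eta by rewrite invr_ge0; lra.
  have ed : d%:R * eta = 2^-1 by rewrite /eta; field; lra.
  have e12 : eta <= 2^-1 by rewrite -ed ler_peMl.
  have h : injective_bound d (sysA w) (M / (1 - eta) ^+ d).
    apply: (@injective_bound_net _ _ _ _ _ r); first by apply/andP; split; lra.
      by move=> z z1; have [//|z' z'r e] := r2 z; exists z'.
    move=> zs szs hzs; rewrite contrE szs leNgt; apply/negP => hM; apply: H2.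
    by exists zs; [exact: words_In|rewrite sqrtr1 mulr1].
  move=> zs szs hzs; apply: le_trans (h zs szs hzs) _.
  have b : 2^-1 <= (1 - eta) ^+ d.
    have bern k : 1 - k%:R * eta <= (1 - eta) ^+ k.
      elim: k => [|k IH]; first by rewrite mul0r subr0 expr0.
      rewrite exprS -natr1; have : 0 <= k%:R * (eta * eta) by rewrite !mulr_ge0.
      have := ler_wpM2l (_ : 0 <= 1 - eta) IH; move=> /(_ ltac:(lra)).
      lra.
    by have := bern d; lra.
  have b0 : 0 < (1 - eta) ^+ d by apply: lt_le_trans b; lra.
  rewrite ler_pdivrMr//.
  have -> : cG1 * Num.sqrt N * Num.sqrt d%:R * lam = 2 * M by rewrite /cG1 -/K /M /T; ring.
  by have := ler_wpM2l M0 b; lra.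
- move=> zs /words_P[szs hzs] _; rewrite -szs tP_sq.
  elim: (zs) hzs => [|z zs' IH] hz; first by rewrite big_nil.
  rewrite big_cons; apply: mulr_ile1; rewrite ?dot_ge0 ?prodr_ge0//.
  + by move=> *; exact: dot_ge0.
  + rewrite -nrm_sq expr_le1 ?nrm_ge0//; apply: r1; apply: hz; by left.
  + by apply: IH => z' h; apply: hz; right.
- rewrite size_words natrX; apply: (@le_trans _ _ (expR (N * (9 + 24 * lam)) ^+ d)).
    apply: lerXn2r; rewrite ?nnegrE ?expR_ge0//; apply: le_trans r3 _.
    have := @one_add_le_expR R 2 lam 24 (ltac:(lra)) lam1.
    rewrite lamd => h; apply: (@le_trans _ _ (expR (4 * N) * expR (2 + 2 + 24 * lam) ^+ #|I|)).
      rewrite -NE ler_pM2l ?expR_gt0//; apply: lerXn2r; rewrite ?nnegrE ?expR_ge0//; lra.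
    by rewrite -expRM_natl -expRD ler_expR -NE; nra.
  by rewrite -expRM_natl ler_expR mulrCA.
have -> : T ^+ 2 / (4 * C) = 50 * (d%:R * lam ^+ 2).
  by rewrite /T !exprMn K2 sqr_sqrtr ?ler0n//; field; rewrite gt_eqF.
have l2 : lam <= lam ^+ 2 by rewrite expr2 ler_peMl ?(ltW lam0) ?lam1.
have a1 := ler_wpM2l (ler0n R d) l2; have a2 := ler_wpM2l (ler0n R d) l1; lra.
Qed.

Lemma sq_tV (x u : I -> R) : orthonormal2 (x, u) -> tsum d (fun s => tV x u s ^+ 2) <= d%:R.
Proof.
move=> [/= xx uu xu]; rewrite (eq_tsum (G := fun s => tV x u s * tV x u s)); last by move=> s _; rewrite expr2.
by rewrite tsum_VV// uu mulr1.
Qed.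

Definition cG2 : R := 2 * Num.sqrt (4 * C * 200) + cG1.

Lemma cG1_ge0 : 0 <= cG1. Proof. by rewrite mulr_ge0 ?sqrtr_ge0. Qed.

(** For pairs a single net suffices, of entropy N lam instead of d N lam, while the tensor has norm
    sqrt d. This saves a factor d over the bound that [proj_le_V] draws from the injective norm. *)
Definition dirderiv_bound (w : Om) : Prop := forall x u : I -> R, orthonormal2 (x, u) ->
  nrm (app d (sysA w) (tV x u)) <= cG2 * Num.sqrt N * Num.sqrt d%:R * lam.

Lemma dirderiv_bound_whp : (1 < d)%N ->
  outer_le P [set w | ~ dirderiv_bound w] (2 * expR (- N)).
Proof.
move=> d1; have l1 := lam1; have NP := N0; have dR : 2 <= d%:R :> R by rewrite ler_nat.
have I0 : (0 < #|I|)%N by rewrite -(ltr_nat R) -NE.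
pose K := Num.sqrt (4 * C * 200); have K2 : K ^+ 2 = 4 * C * 200 by exact: sqr_sqrtr (mulr_ge0 (mulr_ge0 (ler0n R 4) (ltW C0)) (ler0n R 200)).
(* A pair is read as one vector over I + I, so that [coarse_net] applies to it. *)
pose X (g : (I -> R) * (I -> R)) (k : I + I) : R := match k with inl i => g.1 i | inr i => g.2 i end.
have XE g : dot (X g) (X g) = dot g.1 g.1 + dot g.2 g.2 by rewrite /dot big_sumType.
have XB (g g' : (I -> R) * (I -> R)) (e : R) : nrm (fun k => X g k - X g' k) <= e ->
   nrm (fun i => g.1 i - g'.1 i) <= e /\ nrm (fun i => g.2 i - g'.2 i) <= e.
  have -> : (fun k => X g k - X g' k) = X (fun i => g.1 i - g'.1 i, fun i => g.2 i - g'.2 i).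
    by apply/funext => -[].
  move=> h; split; apply: le_trans h; rewrite /nrm; apply: ler_wsqrtr; rewrite XE/=.
    by rewrite lerDl dot_ge0.
  by rewrite lerDr dot_ge0.
have II0 : (0 < #|{: I + I}|)%N by rewrite card_sum addn_gt0 I0.
have d31 : 1 <= d%:R ^+ 3 :> R by rewrite exprn_ege1//; lra.
have [//||] := @coarse_net R _ (@orthonormal2 R I) (I + I)%type X (d%:R ^+ 3) II0.
  move=> g [xx yy _]; rewrite nrm_le_sq// XE xx yy; lra.
move=> r [r1 r2 r3].
pose T := K * lam.
have T0 : 0 <= T by rewrite mulr_ge0 ?sqrtr_ge0 ?(ltW lam0).
have d0 : 0 < d%:R :> R by lra.
have -> : 2 * expR (- N) = expR (- N) + expR (- N) by ring.
apply: outer_leS (outer_leU injective_bound_whp (op_tail_seq (Q := fun=> True) (r := r) (tau := fun g => tV g.1 g.2) (v := d%:R) d0 T0 _ _ _)) => //.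
- move=> w /= H; apply: contrapT => /not_orP[/contrapT h1 h2]; apply: H => x u og.
  have [[x0 u0] gr /XB[/= hx hu]] := r2 _ og.
  have [/= xx uu xu] := og; have [/= xx0 uu0 xu0] := r1 _ gr.
  have k1 : nrm (app d (sysA w) (tV x0 u0)) <= 2 * T * Num.sqrt N * Num.sqrt d%:R.
    by rewrite leNgt; apply/negP => h; apply: h2; exists (x0, u0).
  set b := cG1 * _ * _ * _ in h1.
  have b0 : 0 <= b := injective_bound_ge0 h1.
  have n1 (z : I -> R) : dot z z = 1 -> nrm z <= 1 by move=> /nrm1->.
  have k2 := @proj_le_Vdiff _ _ d x x0 u (n1 _ xx) (n1 _ xx0) (n1 _ uu) _ _ _ h1.
  have k3 := @proj_le_V _ _ d x0 (fun i => u i - u0 i) (n1 _ xx0) _ _ _ h1.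
  have -> : app d (sysA w) (tV x u) = fun l => app d (sysA w) (tV x0 u0) l +
     (app d (sysA w) (fun s => tV x u s - tV x0 u s) l + app d (sysA w) (tV x0 (fun i => u i - u0 i)) l).
    transitivity (app d (sysA w) (fun s => tV x0 u0 s + ((tV x u s - tV x0 u s) + tV x0 (fun i => u i - u0 i) s))).
      apply: app_ext => s _; have := tV_lin x0 (-1) u0 u s.
      rewrite (_ : (fun i => -1 * u0 i + u i) = (fun i => u i - u0 i)); last by apply/funext => i; ring.
      by move=> ->; ring.
    by rewrite appD; apply/funext => l; congr (_ + _); rewrite appD.
  apply: le_trans (nrmD _ _) _.
  have := nrmD (app d (sysA w) (fun s => tV x u s - tV x0 u s)) (app d (sysA w) (tV x0 (fun i => u i - u0 i))).
  have e1 : d%:R ^+ 2 * nrm (fun i => x i - x0 i) * b <= 2^-1 * b.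
    rewrite ler_wpM2r//; apply: (@le_trans _ _ (d%:R ^+ 2 * (d%:R ^+ 3)^-1)).
      by rewrite ler_wpM2l ?sqr_ge0.
    have -> : d%:R ^+ 2 * (d%:R ^+ 3)^-1 = d%:R^-1 :> R by field; rewrite gt_eqF.
    by rewrite lef_pV2 ?posrE.
  have e2 : d%:R * nrm (fun i => u i - u0 i) * b <= 2^-1 * b.
    rewrite ler_wpM2r//; apply: (@le_trans _ _ (d%:R * (d%:R ^+ 3)^-1)).
      by rewrite ler_wpM2l// ltW.
    have -> : d%:R * (d%:R ^+ 3)^-1 = (d%:R * d%:R)^-1 :> R by field; rewrite gt_eqF.
    by rewrite lef_pV2 ?posrE ?mulr_gt0//; nra.
  have -> : cG2 * Num.sqrt N * Num.sqrt d%:R * lam = 2 * T * Num.sqrt N * Num.sqrt d%:R + b.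
    by rewrite /cG2 -/K /T /b; ring.
  lra.
- by move=> [x u] gr _; exact: sq_tV (r1 _ gr).
- rewrite card_sum natrD -NE in r3.
  have := @one_add_le_expR R 1 lam 72 (ltac:(lra)) lam1.
  have -> : lam ^+ 72 = d%:R ^+ 3 by rewrite -lamd -exprM.
  rewrite mul1r => h.
  apply: le_trans r3 (_ : _ <= expR (N * (8 + 6 + 144 * lam))) .
  apply: (@le_trans _ _ (expR (4 * (N + N)) * expR (2 + 1 + 72 * lam) ^+ (#|I| + #|I|))).
    rewrite ler_pM2l ?expR_gt0//; apply: lerXn2r; rewrite ?nnegrE ?expR_ge0//; lra.
  by rewrite -expRM_natl natrD -NE -expRD ler_expR; nra.
have -> : T ^+ 2 / (4 * C) = 200 * lam ^+ 2.
  by rewrite /T exprMn K2; field; rewrite gt_eqF.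
have l2 : lam <= lam ^+ 2 by rewrite expr2 ler_peMl ?(ltW lam0) ?lam1.
nra.
Qed.

End Operator.

(** * Directions concentrated on few coordinates *)

Section Spread.
Context (R : realType) (I : finType).
Implicit Types x y z : I -> R.

Definition spread (k r : R) x : Prop :=
  forall S : pred I, #|S|%:R <= k -> r <= \sum_(i | i \notin S) x i ^+ 2.

(** Restrict x to the exceptional set and normalize: each of the two steps moves it by at most sqrt
    r. *)
Lemma nonspread_sparse (k r : R) x : dot x x = 1 -> 0 < r <= 4^-1 -> ~ spread k r x ->
  exists z, [/\ dot z z = 1, #|[pred i | z i != 0%R]|%:R <= k &
    nrm (fun i => x i - z i) <= 2 * Num.sqrt r].
Proof.
move=> xx /andP[r0 r4] /existsNP[S] /not_implyP[Sk] /negP; rewrite -ltNge => hS.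
pose z0 i := if i \in S then x i else 0.
have e0 : dot z0 z0 = 1 - \sum_(i | i \notin S) x i ^+ 2.
  rewrite -xx /dot (bigID (fun i => i \in S) (fun=> true) (fun i => x i * x i))/=.
  rewrite [X in _ = _ + X - _](eq_bigr (fun i => x i ^+ 2)); last by move=> i _; rewrite expr2.
  rewrite addrK [RHS]big_mkcond; apply: eq_bigr => i _.
  by rewrite /z0; case: ifP => // _; rewrite mulr0.
set o := \sum_(i | _) _ in hS e0.
have o0 : 0 <= o by apply: sumr_ge0 => i _; exact: sqr_ge0.
pose q := nrm z0; have q2 : q ^+ 2 = 1 - o by rewrite nrm_sq.
have q0 : 0 <= q := nrm_ge0 _.
have qp : 2^-1 <= q by rewrite -(@ler_sqr R) ?nnegrE// q2; lra.
have q1 : q <= 1 by rewrite -(@ler_sqr R) ?nnegrE// q2; lra.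
exists (fun i => q^-1 * z0 i); split.
- by rewrite dotZl dotZr -nrm_sq -/q; field; lra.
- apply: le_trans Sk; rewrite ler_nat; apply: subset_leq_card.
  apply/fintype.subsetP => i; rewrite !inE /z0; case: ifP => //.
  by rewrite mulr0 eqxx.
have -> : (fun i => x i - q^-1 * z0 i) = (fun i => (x i - z0 i) + (1 - q^-1) * z0 i).
  by apply/funext => i; ring.
apply: le_trans (nrmD _ _) _.
have h1 : nrm (fun i => x i - z0 i) <= Num.sqrt r.
  rewrite /nrm; apply: ler_wsqrtr; apply: le_trans (ltW hS); rewrite /o /dot [leRHS]big_mkcond.
  apply: ler_sum => i _; rewrite /z0; case: ifP => _; first by rewrite subrr mulr0.
  by rewrite subr0 -expr2.
have rs : r <= Num.sqrt r.
  have sr : Num.sqrt r ^+ 2 = r by rewrite sqr_sqrtr// ltW.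
  have : Num.sqrt r <= 1 by rewrite -[leRHS]sqrtr1 ler_wsqrtr//; lra.
  have := sqrtr_ge0 r; set y := Num.sqrt r in sr * => y0 y1; rewrite -[leLHS]sr; nra.
have h2 : nrm (fun i => (1 - q^-1) * z0 i) <= r.
  rewrite nrmZ -/q.
  have -> : `|1 - q^-1| = q^-1 - 1.
    rewrite ler0_norm ?opprB// subr_le0 -[leLHS]invr1 lef_pV2 ?posrE//; lra.
  have -> : (q^-1 - 1) * q = 1 - q by field; lra.
  apply: (@le_trans _ _ o); last by lra.
  have : o = 1 - q ^+ 2 by rewrite q2; ring.
  nra.
lra.
Qed.

End Spread.

Section Difference.
Context (R : realType) (disp0 : measure_display) (Om0 : measurableType disp0)
  (P0 : probability Om0 R) (xi : {RV P0 >-> R}) (disp : measure_display)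
  (Om : measurableType disp) (P : probability Om R)
  (m d : nat) (I : finType) (a : 'I_m * d.-tuple I -> {RV P >-> R}).
Hypothesis iid : iid_copies xi a.
Variables (C N : R).
Hypotheses (C0 : 0 < C) (NE : N = #|I|%:R) (N0 : 0 < N) (m0 : (0 < m)%N) (mN : (m <= #|I|)%N).
Hypothesis mgf : forall t : R, (\int[P0]_w (expR (t * xi w))%:E <= (expR (C * t ^+ 2))%:E)%E.
Variable lam : R.
Hypotheses (lam1 : 1 <= lam) (lamd : lam ^+ 24 = d%:R).

Definition cG4 (Kc : R) : R := 2 * Num.sqrt (4 * C * (100 + Kc)).

(** The tensors of x and z are at distance sqrt d rho, so a union bound over differences gives an
    error of order lam sqrt d rho. The deterministic Lipschitz bound would lose a factor d; it
    serves only for the last approximation, at precision 1 / (Kc d^3). *)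
Lemma net_difference_whp (Kc rho : R) (Nz : seq (I -> R)) : (1 < d)%N -> 1 <= Kc -> 0 < rho ->
  (forall z, List.In z Nz -> dot z z = 1) -> (size Nz)%:R <= expR N ->
  outer_le P [set w | ~ forall x z : I -> R, dot x x = 1 -> List.In z Nz ->
     nrm (fun i => x i - z i) <= rho ->
     nrm (fun l => app d (sysA a w) (tU x) l - app d (sysA a w) (tU z) l) <=
     Num.sqrt N * (cG4 Kc * lam * Num.sqrt d%:R * (rho + (Kc * d%:R ^+ 3)^-1) + cG1 C / Kc)]
   (2 * expR (- N)).
Proof.
move=> d1 Kc1 rho0 hNz sNz; have l1 := lam1; have NP := N0; have CP := C0.
have lam0 : 0 < lam by exact: lt_le_trans l1.
have dR1 : 1 <= d%:R :> R by rewrite ler1n ltnW.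
have d0 : 0 < d%:R :> R by exact: lt_le_trans dR1.
have I0 : (0 < #|I|)%N by rewrite -(ltr_nat R) -NE.
pose K := Num.sqrt (4 * C * (100 + Kc)).
have K2 : K ^+ 2 = 4 * C * (100 + Kc) by exact: sqr_sqrtr (mulr_ge0 (mulr_ge0 (ler0n R 4) (ltW C0)) (addr_ge0 (ler0n R 100) (le_trans ler01 Kc1))).
pose M := Kc * d%:R ^+ 3.
have d31 : 1 <= d%:R ^+ 3 :> R by rewrite exprn_ege1.
have M1 : 1 <= M by apply: mulr_ege1.
have [] := @coarse_net R _ [set z : I -> R | dot z z = 1] I (fun z => z) M I0 M1.
  by move=> z /= /nrm1 ->; lra.
move=> r [r1 r2 r3].
pose T := K * lam.
have T0 : 0 <= T by rewrite mulr_ge0 ?sqrtr_ge0 ?(ltW lam0).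
pose rho' := rho + M^-1.
have M'0 : 0 < M^-1 by rewrite invr_gt0; exact: lt_le_trans M1.
have rho'0 : 0 < rho' by exact: addr_gt0.
pose v := d%:R * rho' ^+ 2.
have v0 : 0 < v by rewrite mulr_gt0// exprn_gt0.
have vE : Num.sqrt v = Num.sqrt d%:R * rho'.
  by rewrite sqrtrM ?(ltW d0)// sqrtr_sqr gtr0_norm.
pose Q (g : (I -> R) * (I -> R)) : Prop := nrm (fun i => g.1 i - g.2 i) <= rho'.
have -> : 2 * expR (- N) = expR (- N) + expR (- N) by ring.
apply: outer_leS (outer_leU (injective_bound_whp iid C0 NE N0 m0 mN mgf lam1 lamd)
  (op_tail_seq iid C0 NE N0 m0 mN mgf (Q := Q) (r := List.list_prod r Nz)
     (tau := fun g s => tU g.1 s - tU g.2 s) (S := 7 + Kc + 72 * lam) v0 T0 _ _ _)) => //.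
- move=> w /= H; apply: contrapT => /not_orP[/contrapT h1 h2]; apply: H => x z xx zN xz.
  have [//|x0 x0r xx0] := r2 x.
  have k1 : nrm (app d (sysA a w) (fun s => tU x0 s - tU z s)) <= 2 * T * Num.sqrt N * Num.sqrt v.
    rewrite leNgt; apply/negP => h; apply: h2; exists (x0, z).
      by apply/List.in_prod_iff.
    split => //; rewrite /Q/=.
    have -> : (fun i => x0 i - z i) = (fun i => (x0 i - x i) + (x i - z i)).
      by apply/funext => i; ring.
    apply: le_trans (nrmD _ _) _; rewrite nrm_dist /rho'; lra.
  set b := cG1 C * _ * _ * _ in h1.
  have b0 : 0 <= b := injective_bound_ge0 h1.
  have n1 (y : I -> R) : dot y y = 1 -> nrm y <= 1 by move=> /nrm1->.
  have k2 := @proj_le_Udiff _ _ d x x0 (n1 _ xx) (n1 _ (r1 _ x0r)) _ _ _ h1.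
  have -> : (fun l => app d (sysA a w) (tU x) l - app d (sysA a w) (tU z) l) =
     (fun l => app d (sysA a w) (fun s => tU x s - tU x0 s) l + app d (sysA a w) (fun s => tU x0 s - tU z s) l).
    by apply/funext => l; rewrite !appB; ring.
  apply: le_trans (nrmD _ _) _.
  have e1 : d%:R * nrm (fun i => x i - x0 i) * b <= Num.sqrt N * (cG1 C / Kc).
    apply: (@le_trans _ _ (d%:R * M^-1 * b)); first by rewrite ler_wpM2r// ler_wpM2l// ltW.
    have -> : d%:R * M^-1 * b = Num.sqrt N * (cG1 C / Kc) * (Num.sqrt d%:R * lam / d%:R ^+ 2).
      by rewrite /M /b; field; rewrite !gt_eqF// (lt_le_trans ltr01).
    rewrite ler_piMr//.
      by rewrite mulr_ge0 ?sqrtr_ge0// divr_ge0 ?cG1_ge0// (le_trans ler01).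
    rewrite ler_pdivrMr ?exprn_gt0// mul1r expr2; apply: ler_pM; rewrite ?sqrtr_ge0 ?(ltW lam0)//.
      rewrite -[leRHS]ger0_norm ?ler0n// -sqrtr_sqr; apply: ler_wsqrtr; nra.
    by rewrite -lamd exprS ler_peMr ?(ltW lam0)// exprn_ege1.
  have -> : Num.sqrt N * (cG4 Kc * lam * Num.sqrt d%:R * (rho + M^-1) + cG1 C / Kc) =
     Num.sqrt N * (cG1 C / Kc) + 2 * T * Num.sqrt N * Num.sqrt v.
    by rewrite vE /cG4 -/K /T /rho'; ring.
  lra.
- move=> [x z] /List.in_prod_iff[xr zN]; rewrite /Q/= => xz.
  apply: le_trans (tsum_Udiff d (r1 _ xr) (hNz _ zN)) _.
  rewrite -nrm_sq ler_wpM2l// ?ler0n// ler_sqr ?nnegrE ?nrm_ge0//; exact: ltW.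
- rewrite (_ : size _ = (size r * size Nz)%N); last exact: List.length_prod.
  rewrite natrM.
  have := @one_add_le_expR R Kc lam 72 Kc1 lam1.
  have -> : lam ^+ 72 = d%:R ^+ 3 by rewrite -lamd -exprM.
  rewrite -/M => h.
  apply: (@le_trans _ _ (expR (4 * N) * expR (2 + Kc + 72 * lam) ^+ #|I| * expR N)).
    apply: ler_pM => //; apply: le_trans r3 _; rewrite -NE ler_pM2l ?expR_gt0//.
    by apply: lerXn2r; rewrite ?nnegrE ?expR_ge0//; lra.
  by rewrite -expRM_natl -NE -!expRD ler_expR; nra.
have -> : T ^+ 2 / (4 * C) = (100 + Kc) * lam ^+ 2.
  by rewrite /T exprMn K2; field; rewrite gt_eqF.
have l2 : lam <= lam ^+ 2 by rewrite expr2 ler_peMl ?(ltW lam0).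
have l3 : 1 <= lam ^+ 2 by lra.
nra.
Qed.

End Difference.

(** One frequency suffices: at t0 all entries of the unit tensor are in the range of
    [char_gap_quad], so E cos <= e0 < 1 and a row cannot concentrate on a short interval.
    [tensorization] is used with second form 0. *)
Lemma single_small (R : realType) (disp0 : measure_display) (Om0 : measurableType disp0)
  (P0 : probability Om0 R) (xi : {RV P0 >-> R}) :
  subgaussian_tail xi -> ('E_P0[xi] = 0)%E -> ('V_P0[xi] = 1)%E ->
  exists eta c : R, [/\ 0 < eta, 0 < c &
  forall (disp : measure_display) (Om : measurableType disp) (P : probability Om R)
    (m d : nat) (I : finType) (a : 'I_m * d.-tuple I -> {RV P >-> R}) (z : I -> R),
    iid_copies xi a -> dot z z = 1 ->
    outer_le P [set w | nrm (app d (sysA a w) (tU z)) <= eta * Num.sqrt m%:R]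
      (expR (- (c * m%:R)))].
Proof.
move=> tail mean var.
have [c0 [t0 [c00 t00 gapq]]] := char_gap_quad tail mean var.
pose e0 := expR (- (2^-1 * (c0 * t0 ^+ 2))).
have e00 : 0 < e0 := expR_gt0 _.
have e01 : e0 < 1.
  by rewrite -[ltRHS]expR0 ltr_expR oppr_lt0 !mulr_gt0// exprn_gt0.
pose kap : R := (1 - e0) / 4.
pose s1 : R := Num.sqrt (2 * kap) / t0.
have kap0 : 0 < kap by rewrite divr_gt0//; lra.
have s10 : 0 < s1 by rewrite divr_gt0// sqrtr_gt0 mulr_gt0.
have s1k : t0 ^+ 2 * s1 ^+ 2 / 2 = kap.
  have e : Num.sqrt (2 * kap) ^+ 2 = 2 * kap by rewrite sqr_sqrtr// mulr_ge0// ltW.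
  by rewrite /s1 expr_div_n e; field; rewrite gt_eqF.
(* The cosine is at least 1 - kap on the event and at least -1 elsewhere, so its mean, at most e0,
   is at least (2 - kap) P - 1. *)
pose p : R := (1 + e0) / (2 - kap).
have k2 : 0 < 2 - kap by rewrite /kap; lra.
have p0 : 0 < p by rewrite divr_gt0//; lra.
have p1 : p < 1 by rewrite ltr_pdivrMr// mul1r /kap; lra.
pose q : R := (1 + p) / 2.
have q0 : 0 < q by rewrite /q; lra.
have qlt1 : q < 1 by rewrite /q; lra.
have pq : 1 < q / p by rewrite ltr_pdivlMr// mul1r /q; lra.
pose rho : R := Num.sqrt (q / p) - 1.
have rho0 : 0 < rho.
  by rewrite subr_gt0 -[ltLHS]sqrtr1 ltr_sqrt//; lra.
(* L is such that the rounding loss of [tensorization] turns p into q < 1; below, sig is such that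
   exp (L sig m) uses up only half of the decay of q^m. *)
pose L : R := 2 / rho; have L0 : 0 < L by rewrite divr_gt0.
have Lq : (1 + 2 / L) ^+ 2 * p = q.
  have -> : 1 + 2 / L = Num.sqrt (q / p) by rewrite /L /rho; field; rewrite gt_eqF//= subr_eq0 gt_eqF// -subr_gt0.
  by rewrite sqr_sqrtr ?divfK ?gt_eqF//; lra.
pose c : R := - ln q / 2.
have lq : ln q < 0 by rewrite ln_lt0// q0.
have cp : 0 < c by rewrite divr_gt0// oppr_gt0.
pose sig : R := c / L; have sig0 : 0 < sig by rewrite divr_gt0.
exists (s1 * Num.sqrt sig), c; split => //; first by rewrite mulr_gt0// sqrtr_gt0.
move=> disp Om P m d I a z iid zz.
pose u (t : d.-tuple I) := tU z t.
have uu : \sum_t u t ^+ 2 = 1.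
  rewrite -(expr1n _ d) -zz -tsum_UU /tsum; apply: eq_bigr => t _; exact: expr2.
have u1 t : `|u t| <= 1.
  rewrite -(@ler_sqr R) ?nnegrE// expr1n real_normK ?num_real// -uu (bigD1 t)//= lerDl.
  by apply: sumr_ge0 => *; exact: sqr_ge0.
have rowp l b1 b2 : fine (P (row_box a u (fun=> 0) b1 b2 s1 1 l)) <= p.
  have mb := measurable_row_box a u (fun=> 0) b1 b2 s1 1 l.
  rewrite (Ex_indic P mb)/=.
  set A := row_box _ _ _ _ _ _ _ _ in mb *.
  pose S w := lin a (fun j => t0 * rowc l u j) w - t0 * b1 l.
  have SE w : S w = t0 * (row a u l w - b1 l).
    rewrite /S -lin_rowc /lin mulrBr; congr (_ - _); rewrite mulr_sumr.
    by apply: eq_bigr => j _; rewrite mulrA.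
  have ch := le_trans (ler_norm _) (char_bound iid (fun j => t0 * rowc l u j) (t0 * b1 l)).
  have gl : c0 * t0 ^+ 2 <= \sum_j char_gap xi (t0 * rowc l u j).
    have -> : \sum_j char_gap xi (t0 * rowc l u j) = gap2 xi (rowc l u) (rowc l (fun=> 0)) t0 0.
      by apply: eq_bigr => j _; rewrite mul0r addr0.
    rewrite gap2_rowc /row_gap -[leLHS]mulr1 -uu mulr_sumr; apply: ler_sum => t _.
    rewrite mulr0 addr0 -mulrA -exprMn; apply: gapq.
    by rewrite normrM gtr0_norm// ler_piMr// ltW.
  have ch2 : Ex P (fun w => cos (S w)) <= e0.
    by apply: le_trans ch _; rewrite ler_expR lerN2 ler_pM2l.
  have mS : measurable_fun setT S.
    apply: measurable_funB => //; exact: measurable_lin.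
  have bc := bmf_cos mS.
  have bA := @bmf_indic R _ _ _ mb.
  have lowb w : (2 - kap) * \1_A w - 1 <= cos (S w).
    rewrite indicE; have [/set_mem[wA _]|_] := boolP (w \in A); last first.
      by rewrite mulr0 sub0r; exact: cos_geN1.
    rewrite mulr1; apply: le_trans (cos_ge_quad _).
    have : S w ^+ 2 <= t0 ^+ 2 * s1 ^+ 2.
      rewrite SE exprMn ler_pM2l ?exprn_gt0// -[leLHS]real_normK ?num_real//.
      by rewrite ler_sqr ?nnegrE ?normr_ge0 ?(ltW s10).
    move: s1k; lra.
  have h : (2 - kap) * Ex P (\1_A : Om -> R) - 1 <= e0.
    apply: le_trans ch2.
    rewrite -[X in _ - X](Ex_cst P 1) -ExZ// -ExB; [|exact: bmfZ|exact: bmf_cst].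
    by apply: Ex_le => //; apply: bmfB; [exact: bmfZ|exact: bmf_cst].
  by rewrite /p ler_pdivlMr// mulrC; lra.
apply: outer_leS (tensorization iid (sig * m%:R) s10 ltr01 (ltW p0) L0 rowp).
  move=> w /= h.
  rewrite (eq_bigr (fun l => s1 ^- 2 * (app d (sysA a w) (tU z) l * app d (sysA a w) (tU z) l))); last first.
    move=> l _; rewrite app_sys /u; set r := row _ _ _ _.
    have -> : row a (fun=> 0) l w = 0 by rewrite /row big1// => t _; rewrite mul0r.
    by rewrite mul0r expr0n addr0; field; rewrite gt_eqF.
  rewrite -mulr_sumr -/(dot (app d (sysA a w) (tU z)) (app d (sysA a w) (tU z))) -nrm_sq mulrC.
  rewrite ler_pdivrMr ?exprn_gt0//.
  set K := s1 * _ * _ in h; have K0 : 0 <= K := mulr_ge0 (mulr_ge0 (ltW s10) (sqrtr_ge0 _)) (sqrtr_ge0 _).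
  have KE : K ^+ 2 = sig * m%:R * s1 ^+ 2.
    have e1 : Num.sqrt sig ^+ 2 = sig by rewrite sqr_sqrtr// ltW.
    have e2 : Num.sqrt m%:R ^+ 2 = m%:R :> R by rewrite sqr_sqrtr// ler0n.
    by rewrite /K !exprMn e1 e2; ring.
  by rewrite -KE ler_sqr ?nnegrE ?nrm_ge0.
have qq : q = expR (ln q) by rewrite lnK.
rewrite Lq [in q ^+ m]qq -expRM_natl -expRD ler_expR /sig.
have -> : L * (c / L * m%:R) = c * m%:R by field; rewrite gt_eqF.
have : ln q = - (2 * c) by rewrite /c; field.
move=> ->; lra.
Qed.

(** A vector that is not spread is near a sparse one. The sparse vectors have a net small enough for
    a union bound over [single_small], and [net_difference_whp] transfers the estimate. *)
Lemma nonspread_whp (R : realType) (disp0 : measure_display) (Om0 : measurableType disp0)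
  (P0 : probability Om0 R) (xi : {RV P0 >-> R}) :
  subgaussian_tail xi -> ('E_P0[xi] = 0)%E -> ('V_P0[xi] = 1)%E ->
  exists r0 c s0 eta : R, [/\ 0 < r0 <= 4^-1, 0 < c <= 1, 1 <= s0, 0 < eta &
  forall (disp : measure_display) (Om : measurableType disp) (P : probability Om R)
    (m d : nat) (I : finType) (a : 'I_m * d.-tuple I -> {RV P >-> R}) (N lam s : R),
    iid_copies xi a -> N = #|I|%:R -> (0 < m)%N -> (m <= #|I|)%N -> N <= 2 * m%:R ->
    1 <= lam -> lam ^+ 24 = d%:R -> (1 < d)%N -> s ^+ 16 = N -> s0 <= s -> d%:R <= s ->
    outer_le P [set w | exists x : I -> R, [/\ dot x x = 1,
       ~ spread (s ^+ 8) (r0 / (d%:R * lam ^+ 2)) x &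
       nrm (app d (sysA a w) (tU x)) <= eta * Num.sqrt N]]
      (3 * expR (- (c * N)))].
Proof.
move=> tail mean var.
have [C C0 mgf] := subgaussian_mgf tail mean.
have [eta1 [c1 [eta10 c10 single]]] := single_small tail mean var.
pose eta : R := eta1 / 4; have eta0 : 0 < eta by rewrite divr_gt0.
pose B : R := 2 * Num.sqrt (4 * C * 101); have B0 : 0 <= B by rewrite mulr_ge0 ?sqrtr_ge0.
have G0 := cG1_ge0 C.
(* Kc = y^2 below: [cG4] grows like sqrt Kc, so that the errors [cG4] / Kc and [cG1] / Kc together
   are at most (B + [cG1]) / y <= eta / 3. *)
pose y : R := 1 + 3 * (B + cG1 C) / eta.
have t0 : 0 <= 3 * (B + cG1 C) / eta by rewrite divr_ge0 ?(ltW eta0)// mulr_ge0// addr_ge0.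
have y1 : 1 <= y by rewrite /y; lra.
have y0 : 0 < y by lra.
have yh : B + cG1 C <= eta / 3 * y.
  have -> : eta / 3 * y = eta / 3 + (B + cG1 C) by rewrite /y; field; rewrite gt_eqF.
  by rewrite lerDr divr_ge0// ltW.
pose Kc : R := y ^+ 2.
have Kc1 : 1 <= Kc by rewrite /Kc exprn_ege1.
have Kc0 : 0 < Kc by exact: lt_le_trans Kc1.
have g4 : cG4 C Kc <= B * y.
  rewrite /cG4 /B -[leRHS]mulrA ler_pM2l//.
  have -> : Num.sqrt (4 * C * 101) * y = Num.sqrt (4 * C * 101 * Kc).
    rewrite [RHS]sqrtrM ?mulr_ge0 ?(ltW C0)// /Kc sqrtr_sqr gtr0_norm//.
  by apply: ler_wsqrtr; move: (mulr_ge0 (ltW C0) (ltW Kc0)) (mulr_ge0 (ltW C0) (le_trans ler01 Kc1)) (ler_peMr (ltW C0) Kc1); clear; lra.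
have g40 : 0 <= cG4 C Kc by rewrite mulr_ge0 ?sqrtr_ge0.
(* g is the square root of r0. The distance to the net is rho = 3 g / (sqrt d lam), so the main
   error is 3 g [cG4] <= eta / 3. *)
pose g : R := Num.min 2^-1 (eta / (9 * (cG4 C Kc + 1))).
have q1 : 0 < cG4 C Kc + 1 by lra.
have g0 : 0 < g by rewrite lt_min invr_gt0 ltr0n/= divr_gt0// mulr_gt0.
have g2 : g <= 2^-1 by rewrite ge_min lexx.
have g3 : 9 * (cG4 C Kc * g) <= eta.
  have : g <= eta / (9 * (cG4 C Kc + 1)) by rewrite ge_min lexx orbT.
  rewrite ler_pdivlMr ?mulr_gt0// => h; apply: le_trans h; nra.
pose r0 : R := g ^+ 2.
have r00 : 0 < r0 by rewrite exprn_gt0.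
have r04 : r0 <= 4^-1 by rewrite /r0; nra.
have sr0 : Num.sqrt r0 = g by rewrite sqrtr_sqr gtr0_norm.
pose c : R := Num.min 1 (c1 / 4).
have c0 : 0 < c by rewrite lt_min ltr01 divr_gt0.
have cle1 : c <= 1 by rewrite ge_min lexx.
have cc1 : c <= c1 / 4 by rewrite ge_min lexx orbT.
pose s0 : R := 2 * (g^-1 + 1) / c.
have gi : 2 <= g^-1 by rewrite -[leLHS]invrK lef_pV2 ?posrE// invr_gt0.
have s01 : 1 <= s0 by rewrite /s0 ler_pdivlMr// mul1r; move: gi cle1; clear; lra.
exists r0, c, s0, eta; split; rewrite ?r00 ?r04 ?c0//.
move=> disp Om P m d I a N lam s iid NE m0 mN Nm lam1 lamd d1 sN ss0 ds.
have lam0 : 0 < lam by exact: lt_le_trans lam1.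
have s1 : 1 <= s by exact: le_trans ss0.
have sp : 0 < s by exact: lt_le_trans s1.
have Np : 0 < N by rewrite -sN exprn_gt0.
have dR : 2 <= d%:R :> R by rewrite ler_nat.
have d0 : 0 < d%:R :> R by exact: lt_le_trans dR.
have dR1 : 1 <= d%:R :> R by rewrite ler1n ltnW.
pose r : R := r0 / (d%:R * lam ^+ 2).
have dl1 : 1 <= d%:R * lam ^+ 2 by apply: mulr_ege1 => //; rewrite exprn_ege1.
have dl0 : 0 < d%:R * lam ^+ 2 by exact: lt_le_trans dl1.
have r_0 : 0 < r by rewrite divr_gt0.
have r_4 : r <= 4^-1 by apply: le_trans r04; rewrite ler_pdivrMr ?ler_peMr ?(ltW r00).
pose sd : R := Num.sqrt d%:R.
have sd2 : sd ^+ 2 = d%:R by rewrite sqr_sqrtr// ltW.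
have sd0 : 0 < sd by rewrite sqrtr_gt0.
have sr : Num.sqrt r = g / (sd * lam).
  have -> : r = (g / (sd * lam)) ^+ 2 by rewrite /r /r0 expr_div_n exprMn sd2.
  by rewrite sqrtr_sqr gtr0_norm// divr_gt0// mulr_gt0.
have sr0' : 0 < Num.sqrt r by rewrite sqrtr_gt0.
have lam2d : lam ^+ 2 <= d%:R by rewrite -lamd -[24%N]/(2 + 22)%N exprD ler_peMr ?exprn_ege1// exprn_ge0// ltW.
have sdl : sd * lam <= d%:R.
  rewrite -(@ler_sqr R) ?nnegrE ?mulr_ge0 ?(ltW sd0) ?(ltW lam0) ?(ltW d0)// exprMn sd2 expr2.
  by rewrite ler_pM2l.
pose M : R := (Num.sqrt r)^-1.
have M1 : 1 <= M.
  rewrite /M invf_ge1// -[leRHS]sqrtr1 ler_wsqrtr//; move: r_4; clear; lra.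
have ME : M <= g^-1 * s.
  rewrite /M sr invf_div mulrC ler_pM2l ?invr_gt0//; exact: le_trans sdl ds.
have I0 : (0 < #|I|)%N by rewrite -(ltr_nat R) -NE.
pose k := Num.trunc (s ^+ 8).
have s80 : 0 <= s ^+ 8 by rewrite exprn_ge0// ltW.
have /andP[k1 k2] := trunc_itv s80; rewrite -/k in k1 k2.
(* With the weight s^2 both terms in the entropy of [sparse_net] are O (s^15), that is O (N / s):
   the support has at most s^8 points and M is O (s). *)
have w0 : 0 < s ^+ 2 by rewrite exprn_gt0.
have [Nz [z1 z2 z3]] := @sparse_net R I k M (s ^+ 2) I0 M1 w0.
have szN : (size Nz)%:R <= expR (c * N).
  apply: le_trans z3 _; rewrite ler_expR -NE.
  have h1 : Num.sqrt (k%:R * N) <= s ^+ 12.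
    rewrite -[leRHS]ger0_norm ?exprn_ge0 ?(ltW sp)// -sqrtr_sqr; apply: ler_wsqrtr.
    rewrite -exprM -sN -[(12 * 2)%N]/(8 + 16)%N exprD ler_wpM2r ?exprn_ge0 ?(ltW sp)//.
  have h2 : 2 * s ^+ 2 * M * Num.sqrt (k%:R * N) <= 2 * s ^+ 2 * (g^-1 * s) * s ^+ 12.
    have a0 : 0 < 2 * s ^+ 2 by exact: mulr_gt0.
    have M0 : 0 <= M by exact: le_trans M1.
    apply: ler_pM h1; [exact: mulr_ge0 (ltW a0) M0|exact: sqrtr_ge0|by rewrite ler_pM2l].
  have h3 : N * (2 / s ^+ 2) = 2 * s ^+ 14.
    by rewrite -sN; field; rewrite gt_eqF.
  have h4 : s ^+ 14 <= s ^+ 15 by rewrite [leRHS]exprS ler_peMl// exprn_ge0// ltW.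
  have h5 : 2 * (g^-1 + 1) <= c * s by move: ss0; rewrite /s0 ler_pdivrMr// [c * s]mulrC.
  have s15 : 0 < s ^+ 15 by rewrite exprn_gt0.
  have h6 : 2 * (g^-1 + 1) * s ^+ 15 <= c * s * s ^+ 15 by rewrite ler_pM2r.
  have h7 : c * s * s ^+ 15 = c * N by rewrite -sN; ring.
  have h8 : 2 * s ^+ 2 * (g^-1 * s) * s ^+ 12 = 2 * g^-1 * s ^+ 15 by ring.
  have h9 : 2 * (g^-1 + 1) * s ^+ 15 = 2 * g^-1 * s ^+ 15 + 2 * s ^+ 15 by ring.
  by move: h2 h3 h4 h6 h7 h8 h9; clear; lra.
pose rho : R := 3 * Num.sqrt r.
have rho0 : 0 < rho by rewrite mulr_gt0.
have szN1 : (size Nz)%:R <= expR N by apply: le_trans szN _; rewrite ler_expR ler_piMl// ltW.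
have diff := net_difference_whp iid C0 NE Np m0 mN mgf lam1 lamd d1 Kc1 rho0 z1 szN1.
have small : outer_le P [set w | exists2 z, List.In z Nz &
    nrm (app d (sysA a w) (tU z)) <= eta1 * Num.sqrt m%:R] ((size Nz)%:R * expR (- (c1 * m%:R))).
  apply: (outer_le_seq (E := fun z => [set w | nrm (app d (sysA a w) (tU z)) <= eta1 * Num.sqrt m%:R])); first exact: expR_ge0.
  by move=> z zN; apply: single => //; exact: z1.
apply: outer_leS (outer_leU diff small).
- move=> w [x [xx nsx fx]]; apply: contrapT => /not_orP[/contrapT h1 h2]; apply: h2.
  have [|z [zz zk xz]] := @nonspread_sparse R I (s ^+ 8) r x xx _ nsx; first by apply/andP.
  have zk' : (#|[pred i | z i != 0%R]| <= k)%N.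
    rewrite -ltnS -(ltr_nat R); exact: le_lt_trans zk k2.
  have [z' z'N zz'] := z2 z zz zk'.
  exists z' => //=.
  have xz' : nrm (fun i => x i - z' i) <= rho.
    have -> : (fun i => x i - z' i) = (fun i => (x i - z i) + (z i - z' i)).
      by apply/funext => i; ring.
    apply: le_trans (nrmD _ _) _.
    by move: zz' xz; rewrite /M invrK /rho; clear; lra.
  have := h1 x z' xx z'N xz'.
  set Dm := Num.sqrt N * _ => hD.
  have sN0 : 0 < Num.sqrt N by rewrite sqrtr_gt0.
  have Dle : Dm <= Num.sqrt N * eta.
    rewrite /Dm ler_pM2l//.
    have -> : cG4 C Kc * lam * Num.sqrt d%:R * (rho + (Kc * d%:R ^+ 3)^-1) =
       3 * (cG4 C Kc * g) + cG4 C Kc / Kc * (lam * sd / d%:R ^+ 3).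
      by rewrite /rho sr -/sd; field; rewrite !gt_eqF.
    have e1 : cG4 C Kc / Kc <= B / y.
      have -> : B / y = (B * y) / Kc by rewrite /Kc; field; rewrite gt_eqF.
      by rewrite ler_pM2r ?invr_gt0.
    have e2 : cG1 C / Kc <= cG1 C / y.
      rewrite ler_wpM2l// lef_pV2 ?posrE//.
      by rewrite /Kc expr2 ler_peMr// ltW.
    have e3 : B / y + cG1 C / y <= eta / 3 by rewrite -mulrDl ler_pdivrMr.
    have e4 : cG4 C Kc / Kc * (lam * sd / d%:R ^+ 3) <= cG4 C Kc / Kc.
      rewrite ler_piMr ?divr_ge0 ?(ltW Kc0)//.
      rewrite ler_pdivrMr ?exprn_gt0// mul1r mulrC; apply: le_trans sdl _.
      by rewrite exprS ler_peMr ?exprn_ege1// ?(ltW d0).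
    by move: e1 e2 e3 e4 g3 eta0; clear; lra.
  have e5 : nrm (app d (sysA a w) (tU z')) <= nrm (app d (sysA a w) (tU x)) + Dm.
    apply: le_trans (nrm_sub_le _ (app d (sysA a w) (tU x))) _.
    by rewrite lerD2l nrm_dist.
  apply: le_trans e5 _; apply: (@le_trans _ _ (2 * eta * Num.sqrt N)); first by move: fx Dle; clear; lra.
  have e6 : Num.sqrt N <= 2 * Num.sqrt m%:R.
    rewrite -(@ler_sqr R) ?nnegrE ?mulr_ge0 ?sqrtr_ge0//.
    by rewrite exprMn !sqr_sqrtr ?ler0n ?(ltW Np)//; have := ler0n R m; move: Nm; clear; lra.
  by rewrite /eta; have := ler_wpM2l (ltW eta10) e6; clear; lra.
have e1 : expR (- N) <= expR (- (c * N)) by rewrite ler_expR lerN2 ler_piMl// ltW.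
have e2 : (size Nz)%:R * expR (- (c1 * m%:R)) <= expR (- (c * N)).
  apply: (@le_trans _ _ (expR (c * N) * expR (- (c1 * m%:R)))); first by rewrite ler_pM2r ?expR_gt0.
  rewrite -expRD ler_expR.
  have := ler_wpM2l (ltW c10) Nm; have := ler_wpM2r (ltW Np) cc1; clear; lra.
by move: e1 e2; set u := expR (- N); set v := expR (- (c * N)); set z := _ * _; clear; lra.
Qed.

(** * Structured pairs *)

Section BadStructured.
Context (R : realType) (disp0 : measure_display) (Om0 : measurableType disp0)
  (P0 : probability Om0 R) (xi : {RV P0 >-> R}) (I : finType).
Implicit Types x y : I -> R.

Definition tensor_gap (b : bool) d x y (k1 k2 : R) : R :=
  \sum_(t : d.-tuple I) char_gap xi (comb b d x y k1 k2 t).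

Lemma tsum_comb (b : bool) d x y (t1 t2 : R) : (0 < d)%N -> orthonormal2 (x, y) ->
  tsum d (fun s => comb b d x y t1 t2 s ^+ 2) = t1 ^+ 2 + t2 ^+ 2.
Proof.
move=> d0 [/= xx yy xy].
have UU : tsum d (fun s => tU x s * tU x s) = 1 by rewrite tsum_UU xx expr1n.
rewrite (eq_tsum (G := fun s => t1 ^+ 2 * (tU x s * tU x s) +
   2 * t1 * t2 * (tU x s * hatV b d x y s) + t2 ^+ 2 * (hatV b d x y s * hatV b d x y s))); last first.
  by move=> s _; rewrite /comb; ring.
rewrite !tsumD !tsumZ UU.
have [-> ->] : tsum d (fun s => tU x s * hatV b d x y s) = 0 /\
   tsum d (fun s => hatV b d x y s * hatV b d x y s) = 1.
  case: b; rewrite /hatV.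
    by rewrite !tsum_UU xy yy expr1n expr0n (gtn_eqF d0).
  have q0 : 0 < d%:R :> R by rewrite ltr0n.
  have w2 : (Num.sqrt d%:R)^-1 ^+ 2 * d%:R = 1 :> R.
    by rewrite exprVn sqr_sqrtr ?ler0n// mulVf// gt_eqF.
  move: w2; set w := (Num.sqrt d%:R)^-1 => w2; split.
    rewrite (eq_tsum (G := fun s => w * (tU x s * tV x y s))); last by move=> s _; ring.
    by rewrite tsumZ tsum_UV// xy !mulr0.
  rewrite (eq_tsum (G := fun s => w ^+ 2 * (tV x y s * tV x y s))); last by move=> s _; ring.
  by rewrite tsumZ tsum_VV// yy mulr1.
ring.
Qed.

Lemma tsum_rows e (F : seq I -> R) :
  tsum e.+2 F = \sum_i tsum e (fun J => \sum_j F (i :: j :: J)).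
Proof.
rewrite tsumS; apply: eq_bigr => i _; rewrite tsumS /tsum exchange_big/=.
by apply: eq_bigr => J _.
Qed.

(** An integer vector at relative distance at most 1/2 from a nonzero vector is nonzero, hence of
    norm at least 1, and normalizing it at most doubles the error. *)
Lemma direction_near_int (v : I -> R) (q : I -> int) (Rr eta : R) :
  nrm v = 1 -> 0 < Rr -> 0 <= eta <= 2^-1 ->
  nrm (fun j => Rr * v j - (q j)%:~R) <= eta * Rr ->
  let qR := fun j => (q j)%:~R : R in
  [/\ 1 <= nrm qR, nrm qR <= 2 * Rr & nrm (fun j => v j - qR j / nrm qR) <= 2 * eta].
Proof.
move=> v1 R0 /andP[e0 e2] h qR.
have nR : nrm (fun j => Rr * v j) = Rr by rewrite nrmZ v1 mulr1 gtr0_norm.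
have eR : eta * Rr <= 2^-1 * Rr by rewrite ler_pM2r.
have up := nrm_sub_le qR (fun j => Rr * v j); rewrite nrm_dist nR in up.
have lo := nrm_sub_le (fun j => Rr * v j) qR; rewrite nR in lo.
set Q := nrm qR in up lo *; set D := nrm _ in h up lo.
have Q0 : 0 < Q by move: R0 eR h lo; clear; lra.
split.
- have [j qj] : exists j, q j != 0.
    apply: contrapT => /forallNP H; move: Q0; rewrite /Q (_ : qR = fun=> 0) ?nrm0 ?ltxx//.
    by apply/funext => j; have /negP := H j; rewrite negbK => /eqP qj; rewrite /qR qj.
  apply: le_trans (nrm_coord qR j).
  by rewrite /qR -intr_norm -[1]/(1%:~R) ler_int -gtz0_ge1 normr_gt0.
- by move: R0 eR h up; clear; lra.
have -> : (fun j => v j - qR j / Q) = (fun j => Rr^-1 * (Rr * v j - qR j) + (Rr^-1 - Q^-1) * qR j).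
  by apply/funext => j; field; rewrite !gt_eqF.
apply: le_trans (nrmD _ _) _; rewrite !nrmZ -/D -/Q.
have -> : `|Rr^-1 - Q^-1| * Q = `|Q - Rr| / Rr.
  rewrite -[X in _ * X]gtr0_norm// -normrM (_ : (Rr^-1 - Q^-1) * Q = (Q - Rr) / Rr); last first.
    by field; rewrite !gt_eqF.
  by rewrite normrM normfV (gtr0_norm R0).
have QR : `|Q - Rr| <= eta * Rr.
  by move: h up lo; clear; rewrite ler_norml => h up lo; apply/andP; split; lra.
rewrite normfV (gtr0_norm R0) mulrC -mulrDl ler_pdivrMr//.
by move: h QR; clear; lra.
Qed.

Variables (bz Bz Cz : R).
Hypotheses (bz0 : 0 < bz) (Bz0 : 0 < Bz) (Cz0 : 0 < Cz).
Hypothesis near_int : forall (J : finType) (M : J -> R) (Q : R), 0 <= Q ->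
    \sum_i char_gap xi (M i) < Q ->
    exists z : R, bz <= z <= Bz /\
    exists p : J -> int, \sum_i (z * M i - (p i)%:~R) ^+ 2 <= Cz * Q.

(** A small sum of gaps puts z [comb] near an integer tensor. At most s^8 coordinates i have a heavy
    slice; by spreadness the others carry a share kap of the mass, so one of their slices has
    relative error at most sqrt eta2. That slice lies in the plane of x and y, and being light it is
    close to an integer vector of norm O (sqrt K2 / s^4). *)
Lemma small_gap_structured (b : bool) e x y (s r k1 k2 Q : R) :
  let kap := r ^+ 2 * e.+2%:R / 8 in let K2 := k1 ^+ 2 + k2 ^+ 2 in
  orthonormal2 (x, y) -> 0 < s -> 0 < r <= 1 -> r * e.+2%:R <= 2 ->
  spread (s ^+ 8) r x -> (b -> spread (s ^+ 8) r y) ->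
  0 < K2 -> 0 < Q -> Q <= bz ^+ 2 * kap / (8 * Cz) * K2 ->
  tensor_gap b e.+2 x y k1 k2 < Q ->
  1 <= 2 * Bz * Num.sqrt K2 / s ^+ 4 /\
  structured (2 * Bz * Num.sqrt K2 / s ^+ 4) (Num.sqrt (2 * Cz * Q / (bz ^+ 2 * kap * K2))) x y.
Proof.
move=> kap K2 og s0 r01 rd spx spy K20 Q0 Qle /(near_int (ltW Q0))[z [/andP[z1 z2] [p hp]]].
have [/= xx yy xy] := og; have /andP[r0 r1] := r01.
have kap0 : 0 < kap by rewrite divr_gt0// mulr_gt0// ?exprn_gt0 ?ltr0n.
have z0 : 0 < z by exact: lt_le_trans z1.
pose co := comb b e.+2 x y k1 k2.
pose pz (u : seq I) : int := if insub u is Some t then p t else 0.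
(* Mass, and below distance to the integers, of the slice with first index i and tail J. *)
pose rm i J := \sum_j co (i :: j :: J) ^+ 2.
pose re i J := \sum_j (z * co (i :: j :: J) - (pz (i :: j :: J))%:~R) ^+ 2.
have rm0 i J : 0 <= rm i J by apply: sumr_ge0 => j _; exact: sqr_ge0.
have re0 i J : 0 <= re i J by apply: sumr_ge0 => j _; exact: sqr_ge0.
have err : \sum_i tsum e (re i) <= Cz * Q.
  apply: le_trans hp; rewrite -(tsum_rows e (fun u => (z * co u - (pz u)%:~R) ^+ 2)).
  by apply: ler_sum => t _; rewrite /pz valK.
have mass : \sum_i tsum e (rm i) = K2.
  by rewrite -(tsum_rows e (fun u => co u ^+ 2)) tsum_comb.
have s80 : 0 < s ^+ 8 by rewrite exprn_gt0.
pose th := K2 / s ^+ 8; have th0 : 0 < th by rewrite divr_gt0.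
pose S : pred I := [pred i | `[< exists J : e.-tuple I, th < rm i J >]].
have Sle : #|S|%:R <= s ^+ 8.
  have : #|S|%:R * th <= K2.
    rewrite -mass -sum1_card natr_sum mulr_suml [leLHS]big_mkcond.
    apply: ler_sum => i _; have t0 : 0 <= tsum e (rm i) by apply: sumr_ge0 => J _; exact: rm0.
    case: ifPn => // /asboolP[J hJ]; rewrite mul1r; apply: le_trans (ltW hJ) _.
    rewrite /tsum (bigD1 J)//= lerDl; apply: sumr_ge0 => J' _; exact: rm0.
  by rewrite /th mulrA ler_pdivrMr// mulrC ler_pM2l.
have off : kap * K2 <= \sum_(i | i \notin S) tsum e (rm i).
  have := @comb_off_mass R I b e.+1 x y S k1 k2 r isT xx yy xy r01 rd (spx S Sle) (fun h => spy h S Sle).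
  move=> /le_trans; apply; apply: ler_sum => i _; rewrite tsumS /tsum exchange_big/=.
  exact: lexx.
pose eta2 := 2 * Cz * Q / (bz ^+ 2 * kap * K2).
have den0 : 0 < bz ^+ 2 * kap * K2 by rewrite !mulr_gt0// exprn_gt0.
have eta20 : 0 < eta2 by rewrite divr_gt0// !mulr_gt0.
have eta24 : eta2 <= 2^-1 ^+ 2.
  have e1 : 2 * Cz * Q <= 2 * Cz * (bz ^+ 2 * kap / (8 * Cz) * K2) by rewrite ler_pM2l// mulr_gt0.
  rewrite /eta2 ler_pdivrMr//; apply: le_trans e1 _.
  by rewrite le_eqVlt; apply/orP; left; apply/eqP; field; rewrite gt_eqF.
have [i [J [iS hJ]]] : exists i (J : e.-tuple I), i \notin S /\ re i J < eta2 * z ^+ 2 * rm i J.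
  apply: contrapT => H.
  have h1 : eta2 * z ^+ 2 * (kap * K2) <= Cz * Q.
    apply: le_trans err; apply: (@le_trans _ _ (\sum_(i | i \notin S) tsum e (re i))); last first.
      rewrite [leLHS]big_mkcond; apply: ler_sum => i _; case: ifP => // _.
      by apply: sumr_ge0 => J _; exact: re0.
    apply: (@le_trans _ _ (eta2 * z ^+ 2 * \sum_(i | i \notin S) tsum e (rm i))).
      by rewrite ler_pM2l// mulr_gt0// exprn_gt0.
    rewrite mulr_sumr; apply: ler_sum => i iS; rewrite -tsumZ; apply: ler_sum => J _.
    by rewrite leNgt; apply/negP => h; apply: H; exists i, J.
  have h2 : eta2 * bz ^+ 2 * (kap * K2) <= eta2 * z ^+ 2 * (kap * K2).
    rewrite ler_pM2r ?mulr_gt0// ler_pM2l//; apply: lerXn2r; rewrite ?nnegrE ?(ltW bz0) ?(ltW z0)//.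
  have h3 : eta2 * bz ^+ 2 * (kap * K2) = 2 * (Cz * Q).
    by rewrite /eta2; field; rewrite !gt_eqF//; move: bz0; clear; lra.
  have : 0 < Cz * Q by rewrite mulr_gt0.
  by move: h1 h2 h3; clear; lra.
have rmp : 0 < rm i J.
  have : 0 < eta2 * z ^+ 2 * rm i J by apply: le_lt_trans hJ.
  by rewrite pmulr_rgt0// mulr_gt0// exprn_gt0.
have [c1 [c2 hc]] := @comb_row R I b e.+2 x y k1 k2 i J.
have rmE : rm i J = c1 ^+ 2 + c2 ^+ 2.
  rewrite /rm (eq_bigr (fun j => (c1 * x j + c2 * y j) * (c1 * x j + c2 * y j))).
    rewrite -/(dot (fun j => c1 * x j + c2 * y j) (fun j => c1 * x j + c2 * y j)).
    by rewrite dot_lin2 xx yy (dotC y x) xy; ring.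
  by move=> j _; rewrite /co hc expr2.
pose rho := Num.sqrt (rm i J); have rho0 : 0 < rho by rewrite sqrtr_gt0.
have rho2 : rho ^+ 2 = rm i J by rewrite sqr_sqrtr// ltW.
pose al := c1 / rho; pose be := c2 / rho.
have ab : al ^+ 2 + be ^+ 2 = 1.
  by rewrite /al /be !expr_div_n -mulrDl -rmE rho2 mulfV// gt_eqF.
pose v j := al * x j + be * y j.
have v1 : nrm v = 1 by exact: (nrm_unit_comb og ab).
pose q j := pz (i :: j :: J).
pose eta := Num.sqrt eta2.
have eta0 : 0 <= eta by exact: sqrtr_ge0.
have eta12 : eta <= 2^-1.
  by rewrite /eta -[leRHS]ger0_norm// -sqrtr_sqr; exact: ler_wsqrtr.
have Rr0 : 0 < z * rho by rewrite mulr_gt0.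
have hnear : nrm (fun j => z * rho * v j - (q j)%:~R) <= eta * (z * rho).
  rewrite nrm_le_sq; last by rewrite mulr_ge0// ltW.
  rewrite exprMn (sqr_sqrtr (ltW eta20)) exprMn rho2 mulrA; apply: le_trans (ltW hJ).
  apply: ler_sum => j _; rewrite -expr2 /co hc /v /al /be /q.
  by rewrite le_eqVlt; apply/orP; left; apply/eqP; congr (_ ^+ 2); field; rewrite gt_eqF.
have [n1 n2 n3] := direction_near_int v1 Rr0 (introT andP (conj eta0 eta12)) hnear.
have n4 : nrm (fun j => (q j)%:~R : R) <= 2 * Bz * Num.sqrt K2 / s ^+ 4.
  apply: le_trans n2 _.
  have h1 : rho <= Num.sqrt K2 / s ^+ 4.
    have h2 : rm i J <= th.
      by rewrite leNgt; apply/negP => h; move/negP: iS; apply; apply/asboolP; exists J.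
    have -> : Num.sqrt K2 / s ^+ 4 = Num.sqrt th.
      rewrite /th sqrtrM ?(ltW K20)//; congr (_ * _).
      by rewrite -[LHS]ger0_norm ?invr_ge0 ?exprn_ge0 ?(ltW s0)// -sqrtr_sqr; congr Num.sqrt; rewrite exprVn -exprM.
    exact: ler_wsqrtr.
  have h3 : z * rho <= Bz * (Num.sqrt K2 / s ^+ 4) by apply: ler_pM => //; exact: ltW.
  by move: h3; clear; rewrite !mulrA => h; lra.
split; first exact: le_trans n1 n4.
by exists al, be, q; split.
Qed.

End BadStructured.

(** * Small ball bound for one pair, and union bounds over the levels of structured pairs *)

Section PairProbability.
Context (R : realType) (disp0 : measure_display) (Om0 : measurableType disp0)
  (P0 : probability Om0 R) (xi : {RV P0 >-> R}).

(** The alternatives of [small_ball]. All three bounds given by a failure are used: the quadratic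
    one makes the relative error at most 1/2, the other two make it small enough for the net of
    structured pairs. *)
Definition good3 (b : bool) d (I : finType) (x y : I -> R) (c2 L : R) (k1 k2 : int) : Prop :=
  [\/ c2 * (k1%:~R ^+ 2 + k2%:~R ^+ 2) <= tensor_gap xi b d x y k1%:~R k2%:~R,
      Num.max `|k1%:~R| `|k2%:~R| <= tensor_gap xi b d x y k1%:~R k2%:~R |
      L <= tensor_gap xi b d x y k1%:~R k2%:~R].

Context (disp : measure_display) (Om : measurableType disp) (P : probability Om R)
  (m d : nat) (I : finType) (a : 'I_m * d.-tuple I -> {RV P >-> R}).
Hypothesis iid : iid_copies xi a.

Lemma pair_prob (b : bool) (x y : I -> R) (s1 s2 c2 L tt X : R) :
  0 < c2 <= 1 -> 0 < s1 <= 4^-1 -> 0 < s2 <= 4^-1 ->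
  (4 * s1 * s2)^-1 <= expR (L / 2) -> 0 < tt ->
  (forall k1 k2 : int, `|k1%:~R| < (2 * s1)^-1 :> R -> `|k2%:~R| < (2 * s2)^-1 :> R ->
     good3 b d x y c2 L k1 k2) ->
  outer_le P [set w | (nrm (app d (sysA a w) (tU x)) / s1) ^+ 2 +
                      (nrm (app d (sysA a w) (hatV b d x y)) / s2) ^+ 2 <= X]
    (expR (tt * X) * ((1 + 2 / tt) ^+ 2 * (csb R / c2 * s1 * s2)) ^+ m).
Proof.
move=> /andP[c0 c1] s1P s2P HL tt0 good.
have /andP[s10 _] := s1P; have /andP[s20 _] := s2P.
pose u (t : d.-tuple I) := tU x t; pose v (t : d.-tuple I) := hatV b d x y t.
pose c := Num.sqrt c2; have cc : c ^+ 2 = c2 by rewrite sqr_sqrtr// ltW.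
have c01 : 0 < c <= 1 by rewrite sqrtr_gt0 c0/= -[leRHS]sqrtr1 ler_wsqrtr.
have rowp l b1 b2 : fine (P (row_box a u v b1 b2 s1 s2 l)) <= csb R / c2 * s1 * s2.
  rewrite row_boxE -cc; apply: (small_ball iid _ _ c01 s1P s2P HL) => k1 k2 h1 h2.
  by rewrite gap2_rowc cc; exact: good.
have p0 : 0 <= csb R / c2 * s1 * s2.
  exact: mulr_ge0 (mulr_ge0 (divr_ge0 (ltW (csb_gt0 R)) (ltW c0)) (ltW s10)) (ltW s20).
apply: outer_leS (tensorization iid X s10 s20 p0 tt0 rowp) => //.
move=> w /= h; apply: le_trans h; rewrite big_split/= !expr_div_n !nrm_sq.
apply: lerD; rewrite mulr_suml; apply: ler_sum => l _; rewrite expr_div_n -app_sys -expr2; exact: lexx.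
Qed.

(** Cruder than the estimate used for generic pairs; the lost powers of d are covered by the gain 1
    / s per row for structured pairs. *)
Lemma F_lipschitz (b : bool) (A : 'I_m -> seq I -> R) (beta h : R) (x y x0 y0 : I -> R) :
  (0 < d)%N -> injective_bound d A beta -> orthonormal2 (x, y) -> orthonormal2 (x0, y0) ->
  nrm (fun i => x i - x0 i) <= h -> nrm (fun i => y i - y0 i) <= h ->
  nrm (app d A (tU x0)) <= nrm (app d A (tU x)) + 2 * d%:R ^+ 2 * beta * h /\
  nrm (app d A (hatV b d x0 y0)) <= nrm (app d A (hatV b d x y)) + 2 * d%:R ^+ 2 * beta * h.
Proof.
move=> d0 hA [/= xx yy xy] [/= xx0 yy0 xy0] hx hy.
have n1 (z : I -> R) : dot z z = 1 -> nrm z <= 1 by move=> /nrm1->.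
have dR : 1 <= d%:R :> R by rewrite ler1n.
have b0 := injective_bound_ge0 hA.
have h0 : 0 <= h := le_trans (nrm_ge0 _) hx.
have bh0 : 0 <= beta * h by rewrite mulr_ge0.
have dd : d%:R <= d%:R ^+ 2 :> R by rewrite expr2 ler_peMl ?ler0n.
have fU (z z0 : I -> R) : dot z z = 1 -> dot z0 z0 = 1 -> nrm (fun i => z i - z0 i) <= h ->
   nrm (app d A (tU z0)) <= nrm (app d A (tU z)) + d%:R * beta * h.
  move=> zz zz0 hz; apply: le_trans (nrm_sub_le _ (app d A (tU z))) _.
  rewrite lerD2l -appB; apply: le_trans (@proj_le_Udiff _ _ d z0 z (n1 _ zz0) (n1 _ zz) _ _ _ hA) _.
  by rewrite nrm_dist mulrAC ler_wpM2l// mulr_ge0.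
have wk : d%:R * beta * h <= 2 * d%:R ^+ 2 * beta * h.
  have -> : 2 * d%:R ^+ 2 * beta * h = 2 * (d%:R ^+ 2 * (beta * h)) by ring.
  have -> : d%:R * beta * h = d%:R * (beta * h) by ring.
  by have := ler_wpM2r bh0 dd; have := mulr_ge0 (sqr_ge0 (d%:R : R)) bh0; lra.
split; first by apply: le_trans (fU _ _ xx xx0 hx) _; rewrite lerD2l.
case: b; first by apply: le_trans (fU _ _ yy yy0 hy) _; rewrite lerD2l.
have q1 : 1 <= Num.sqrt d%:R :> R by rewrite -[leLHS]sqrtr1 ler_wsqrtr.
have q0 : 0 < Num.sqrt d%:R :> R by exact: lt_le_trans q1.
pose qi : R := (Num.sqrt d%:R)^-1.
have qi0 : 0 <= qi by rewrite invr_ge0 ltW.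
have qi1 : qi <= 1 by rewrite invf_le1.
apply: le_trans (nrm_sub_le _ (app d A (hatV false d x y))) _; rewrite lerD2l -appB.
have -> : app d A (fun s => hatV false d x0 y0 s - hatV false d x y s) =
  fun l => qi * app d A (fun s => (tV x0 y0 s - tV x y0 s) + tV x (fun i => y0 i - y i) s) l.
  rewrite -appZ; apply: app_ext => s _; rewrite /hatV.
  have := tV_lin x (-1) y y0 s.
  rewrite (_ : (fun i => -1 * y i + y0 i) = (fun i => y0 i - y i)); last by apply/funext => i; ring.
  by move=> ->; rewrite /qi; ring.
rewrite nrmZ ger0_norm//; set Y := nrm _.
apply: (@le_trans _ _ Y); first by rewrite ler_piMl ?nrm_ge0.
rewrite /Y appD; apply: le_trans (nrmD _ _) _.
have k2 := @proj_le_Vdiff _ _ d x0 x y0 (n1 _ xx0) (n1 _ xx) (n1 _ yy0) _ _ _ hA.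
have k3 := @proj_le_V _ _ d x (fun i => y0 i - y i) (n1 _ xx) _ _ _ hA.
have e1 : d%:R ^+ 2 * nrm (fun i => x0 i - x i) * beta <= d%:R ^+ 2 * beta * h.
  by rewrite nrm_dist mulrAC ler_wpM2l// mulr_ge0 ?sqr_ge0.
have e2 : d%:R * nrm (fun i => y0 i - y i) * beta <= d%:R ^+ 2 * beta * h.
  rewrite nrm_dist mulrAC; apply: ler_pM => //; rewrite ?mulr_ge0 ?nrm_ge0//.
  by rewrite ler_wpM2r.
apply: le_trans (lerD k2 k3) _; apply: le_trans (lerD e1 e2) _.
by rewrite le_eqVlt; apply/orP; left; apply/eqP; ring.
Qed.

End PairProbability.

Lemma structured_le (R : realType) (I : finType) (P P' e e' : R) (x y : I -> R) :
  P <= P' -> e <= e' -> structured P e x y -> structured P' e' x y.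
Proof.
move=> PP ee [al [be [p [h1 h2 h3]]]]; exists al, be, p; split => //.
  exact: le_trans h2 PP.
by apply: le_trans h3 _; rewrite ler_pM2l.
Qed.

(* Exponent count for a fixed level [M] of the lattice points: the entropy of
   the structured pairs against the small ball probability. *)
Lemma level_count (R : realType) (aa bb s M e : R) : 0 <= aa -> 0 <= bb -> 1 <= s ->
  s ^+ 2 <= M -> 0 <= e -> M ^+ 2 * e ^+ 2 <= bb ^+ 2 * M -> M ^+ 2 * e ^+ 2 <= bb ^+ 2 * s ^+ 18 ->
  (3 + aa * M / s ^+ 12) * (3 + 2 * (M * e)) * s <= (3 + aa) * (3 + 2 * bb) * M.
Proof.
move=> a0 b0 s1 sM e0 h1 h2.
have s0 : 0 < s by exact: lt_le_trans s1.
have M1 : 1 <= M by apply: le_trans sM; rewrite exprn_ege1.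
have M0 : 0 < M by exact: lt_le_trans M1.
pose q := Num.sqrt M; have q2 : q ^+ 2 = M by rewrite sqr_sqrtr// ltW.
have q0 : 0 <= q by exact: sqrtr_ge0.
have sq : s <= q by rewrite -(@ler_sqr R) ?nnegrE ?q2// ltW.
have Me0 : 0 <= M * e by rewrite mulr_ge0// ltW.
have bq0 : 0 <= bb * q := mulr_ge0 b0 q0.
have b1 : M * e <= bb * q.
  by rewrite -(ler_sqr (x := M * e)) ?nnegrE// !exprMn q2.
have bs0 : 0 <= bb * s ^+ 9 := mulr_ge0 b0 (exprn_ge0 9 (ltW s0)).
have b2 : M * e <= bb * s ^+ 9.
  have h2' : (M * e) ^+ 2 <= (bb * s ^+ 9) ^+ 2.
    have -> : (bb * s ^+ 9) ^+ 2 = bb ^+ 2 * s ^+ 18 by ring.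
    by rewrite exprMn.
  by move: h2'; rewrite ler_sqr ?nnegrE.
have q1 : 1 <= q by exact: le_trans sq.
have s9 : 1 <= s ^+ 9 by rewrite exprn_ege1.
have k1 : 3 + 2 * (M * e) <= (3 + 2 * bb) * q by move: b1 q1; clear; lra.
have k2 : 3 + 2 * (M * e) <= (3 + 2 * bb) * s ^+ 9 by move: b2 s9; clear; lra.
have B0 : 0 <= 3 + 2 * bb by move: b0; clear; lra.
have e1 : 3 * (3 + 2 * (M * e)) * s <= 3 * (3 + 2 * bb) * M.
  have : (3 + 2 * (M * e)) * s <= ((3 + 2 * bb) * q) * q by apply: ler_pM => //; [move: Me0; clear; lra|exact: ltW].
  by rewrite -mulrA -expr2 q2; lra.
have e2 : aa * M / s ^+ 12 * (3 + 2 * (M * e)) * s <= aa * (3 + 2 * bb) * M.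
  have c0 : 0 <= aa * M / s ^+ 12 by rewrite divr_ge0 ?(mulr_ge0 a0 (ltW M0))// exprn_ge0 ?(ltW s0).
  apply: (@le_trans _ _ (aa * M / s ^+ 12 * ((3 + 2 * bb) * s ^+ 9) * s)).
    by rewrite ler_pM2r// ler_wpM2l.
  have -> : aa * M / s ^+ 12 * ((3 + 2 * bb) * s ^+ 9) * s = aa * (3 + 2 * bb) * M * (s ^+ 2)^-1.
    by field; rewrite gt_eqF.
  rewrite ler_piMr ?mulr_ge0// ?(ltW M0)// invf_le1 ?exprn_gt0// exprn_ege1//.
by move: e1 e2; clear; lra.
Qed.

(** M is meant to be the smallest bad level: since the frequencies below it are good, the small ball
    bound holds at scale 1 / (2 M), and the net of structured pairs is taken at the matching
    precision 4 / M. *)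
Lemma level_prob (R : realType) (disp0 : measure_display) (Om0 : measurableType disp0)
  (P0 : probability Om0 R) (xi : {RV P0 >-> R})
  (disp : measure_display) (Om : measurableType disp) (P : probability Om R)
  (m d : nat) (I : finType) (a : 'I_m * d.-tuple I -> {RV P >-> R}) (b : bool) (N M c2 L Pm eta T beta del : R) :
  iid_copies xi a -> (0 < d)%N -> N = #|I|%:R -> 0 < N -> 2 <= M -> 0 < c2 <= 1 -> M ^+ 2 <= expR (L / 2) ->
  0 <= Pm -> 0 <= eta -> 1 <= T -> del + 2 * d%:R ^+ 2 * beta * (4 / M) <= T * Num.sqrt N / M ->
  outer_le P [set w | exists x y : I -> R, [/\ orthonormal2 (x, y),
      forall k1 k2 : int, `|k1%:~R| < M -> `|k2%:~R| < M -> good3 xi b d x y c2 L k1 k2,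
      structured Pm eta x y, injective_bound d (sysA a w) beta &
      nrm (app d (sysA a w) (tU x)) <= del /\ nrm (app d (sysA a w) (hatV b d x y)) <= del]]
   (expR (15 * N + 4) * ((3 + 2 * (Pm / Num.sqrt N)) * (3 + 2 * (M * eta)) * (1 + 2 * M)) ^+ #|I|
      * (1 + 2 * M) ^+ 2 * (3 * csb R * T ^+ 4 / (c2 * M ^+ 2)) ^+ m).
Proof.
move=> iid d0 NE N0 M2 c2P HL Pm0 e0 T1 hT.
have M0 : 0 < M by lra.
have I0 : (0 < #|I|)%N by rewrite -(ltr_nat R) -NE.
have /andP[c0 c1] := c2P.
pose H : set ((I -> R) * (I -> R)) := [set g | forall k1 k2 : int, `|k1%:~R| < M -> `|k2%:~R| < M ->
   good3 xi b d g.1 g.2 c2 L k1 k2].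
have [r [r1 r2 r3]] := @structured_net R I H Pm eta M I0 Pm0 e0 ltac:(lra).
pose s1 : R := (2 * M)^-1.
have s10 : 0 < s1 by rewrite invr_gt0 mulr_gt0.
have s1P : 0 < s1 <= 4^-1 by rewrite s10 lef_pV2 ?posrE ?mulr_gt0//; lra.
have s1i : (2 * s1)^-1 = M by rewrite /s1; field; rewrite gt_eqF.
have HL' : (4 * s1 * s1)^-1 <= expR (L / 2).
  by apply: le_trans HL; rewrite le_eqVlt; apply/orP; left; apply/eqP; rewrite /s1; field; rewrite gt_eqF.
pose tt : R := (T ^+ 2)^-1.
have T0 : 0 < T by lra.
have T20 : 0 < T ^+ 2 by rewrite exprn_gt0.
have tt0 : 0 < tt by rewrite invr_gt0.
pose X : R := 8 * T ^+ 2 * N.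
pose pr : R := expR (tt * X) * ((1 + 2 / tt) ^+ 2 * (csb R / c2 * s1 * s1)) ^+ m.
pose E (g : (I -> R) * (I -> R)) := [set w | (nrm (app d (sysA a w) (tU g.1)) / s1) ^+ 2 +
                      (nrm (app d (sysA a w) (hatV b d g.1 g.2)) / s1) ^+ 2 <= X].
have hE g : List.In g r -> outer_le P (E g) pr.
  move=> /r1[Hg og]; apply: (@pair_prob _ _ _ _ _ _ _ _ _ _ _ _ iid b g.1 g.2 s1 s1 c2 L tt X c2P s1P s1P HL' tt0) => k1 k2; rewrite s1i.
  exact: Hg.
have base : 0 <= (1 + 2 / tt) ^+ 2 * (csb R / c2 * s1 * s1).
  apply: mulr_ge0; first exact: sqr_ge0.
  exact: mulr_ge0 (mulr_ge0 (divr_ge0 (ltW (csb_gt0 R)) (ltW c0)) (ltW s10)) (ltW s10).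
have pr0 : 0 <= pr by rewrite mulr_ge0 ?expR_ge0// exprn_ge0.
apply: outer_leS (outer_le_seq pr0 hE).
- move=> w [x [y [og Hg st G1 [f1 f2]]]].
  have [g' g'r [/= hx hy]] := r2 (x, y) Hg og st.
  have [_ og'] := r1 _ g'r.
  have og2 : orthonormal2 (g'.1, g'.2) by [].
  have [l1 l2] := F_lipschitz b d0 G1 og og2 hx hy.
  exists g' => //=; rewrite /E/=.
  have sN0 : 0 < Num.sqrt N by rewrite sqrtr_gt0.
  have key (q : R) : 0 <= q -> q <= T * Num.sqrt N / M -> (q / s1) ^+ 2 <= 4 * T ^+ 2 * N.
    move=> q0 qT; have h : q / s1 <= 2 * T * Num.sqrt N.
      rewrite /s1 invrK; apply: (@le_trans _ _ (T * Num.sqrt N / M * (2 * M))).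
        by rewrite ler_wpM2r// mulr_ge0// ltW.
      by rewrite le_eqVlt; apply/orP; left; apply/eqP; field; rewrite gt_eqF.
    have -> : 4 * T ^+ 2 * N = (2 * T * Num.sqrt N) ^+ 2.
      by rewrite !exprMn sqr_sqrtr ?(ltW N0)//; ring.
    by rewrite ler_sqr// nnegrE ?divr_ge0// ?(ltW s10)// !mulr_ge0 ?(ltW sN0) ?(ltW T0).
  have k1 := key _ (nrm_ge0 _) (le_trans l1 (le_trans (lerD f1 (lexx _)) hT)).
  have k2 := key _ (nrm_ge0 _) (le_trans l2 (le_trans (lerD f2 (lexx _)) hT)).
  by move: k1 k2; rewrite /X; clear; lra.
rewrite /pr.
have -> : tt * X = 8 * N by rewrite /tt /X; field; rewrite gt_eqF.
have le9 : (1 + 2 / tt) ^+ 2 * (csb R / c2 * s1 * s1) <= 3 * csb R * T ^+ 4 / (c2 * M ^+ 2).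
  have w0 : 0 <= (c2 * M ^+ 2)^-1 by rewrite invr_ge0 mulr_ge0 ?exprn_ge0 ?(ltW c0) ?(ltW M0).
  have h1 : (1 + 2 / tt) ^+ 2 <= 9 * T ^+ 4.
    rewrite /tt invrK (_ : 9 * T ^+ 4 = (3 * T ^+ 2) ^+ 2); last by ring.
    have : 1 <= T ^+ 2 by rewrite exprn_ege1.
    by move=> h; rewrite ler_sqr ?nnegrE; [move: h|move: h|move: h]; clear; lra.
  have h2 : csb R / c2 * s1 * s1 = csb R / 4 * (c2 * M ^+ 2)^-1.
    by rewrite /s1; field; rewrite !gt_eqF.
  rewrite h2; apply: (@le_trans _ _ (9 * T ^+ 4 * (csb R / 4 * (c2 * M ^+ 2)^-1))).
    by apply: ler_wpM2r => //; exact: mulr_ge0 (divr_ge0 (ltW (csb_gt0 R)) (ler0n R 4)) w0.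
  have c3 : csb R / 4 * 9 <= 3 * csb R by have := csb_gt0 R; clear; lra.
  have v0 : 0 <= T ^+ 4 * (c2 * M ^+ 2)^-1 by rewrite mulr_ge0// exprn_ge0// ltW.
  have := ler_wpM2r v0 c3; clear; lra.
have pw : ((1 + 2 / tt) ^+ 2 * (csb R / c2 * s1 * s1)) ^+ m <= (3 * csb R * T ^+ 4 / (c2 * M ^+ 2)) ^+ m.
  by apply: lerXn2r; rewrite ?nnegrE// (le_trans base).
have -> : expR (15 * N + 4) = expR (7 * N + 4) * expR (8 * N).
  by rewrite -expRD; congr expR; ring.
rewrite -NE in r3.
set A := (_ * (1 + 2 * M)) ^+ #|I| in r3 *.
apply: (@le_trans _ _ (expR (7 * N + 4) * A * (1 + 2 * M) ^+ 2 *
   (expR (8 * N) * (3 * csb R * T ^+ 4 / (c2 * M ^+ 2)) ^+ m))).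
  apply: ler_pM => //; first by rewrite mulr_ge0 ?expR_ge0// exprn_ge0.
  by rewrite ler_pM2l ?expR_gt0.
by rewrite le_eqVlt; apply/orP; left; apply/eqP; ring.
Qed.


(** The power 15 of d collects T^4, of order d^12, then 1 / c2 of order at most d^2, and one d from
    the net. What is gained is 1 / s per row. *)
Lemma level_numeric (R : realType) (aa C7 Tc cc d c2 s M e pm T K : R) :
  0 <= aa -> 0 <= C7 -> 1 <= Tc -> 0 < cc -> 1 <= d -> 0 < c2 -> cc <= c2 * d ^+ 2 -> 1 <= s ->
  s ^+ 2 <= M -> 0 <= e -> M ^+ 2 * e ^+ 2 <= (C7 * d) ^+ 2 * M ->
  M ^+ 2 * e ^+ 2 <= (C7 * d) ^+ 2 * s ^+ 18 -> 2 * pm = aa * M / s ^+ 12 -> T = Tc * d ^+ 3 ->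
  0 <= K ->
  let C8 := (3 + aa) * (3 + 2 * C7) in
  let A := (3 + 2 * pm) * (3 + 2 * (M * e)) * (1 + 2 * M) in
  A * s <= 3 * C8 * d * M ^+ 2 /\
  A * (K * T ^+ 4 / (c2 * M ^+ 2)) <= 3 * C8 * (K * Tc ^+ 4 / cc) * d ^+ 15 / s.
Proof.
move=> a0 C70 Tc1 cc0 d1 c20 ccd s1 sM e0 h1 h2 pmE TE K0 C8 A.
have d0 : 0 < d by lra.
have s0 : 0 < s by lra.
have M1 : 1 <= M by apply: le_trans sM; rewrite exprn_ege1.
have M0 : 0 < M by lra.
have b0 : 0 <= C7 * d by rewrite mulr_ge0// ltW.
have h := level_count a0 b0 s1 sM e0 h1 h2.
have C80 : 0 <= C8 by rewrite /C8; apply: mulr_ge0; lra.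
have h3 : (3 + 2 * pm) * (3 + 2 * (M * e)) * s <= C8 * d * M.
  rewrite pmE; apply: le_trans h _; rewrite ler_pM2r//.
  rewrite /C8 -[leRHS]mulrA ler_wpM2l//; first by lra.
  by move: d1 C70; clear; nra.
have pm0 : 0 <= 3 + 2 * pm.
  rewrite pmE addr_ge0// divr_ge0 ?mulr_ge0 ?exprn_ge0 ?(ltW M0) ?(ltW s0)//.
have me0 : 0 <= 3 + 2 * (M * e) by rewrite addr_ge0// mulr_ge0// mulr_ge0// ltW.
have As : A * s <= 3 * C8 * d * M ^+ 2.
  have -> : A * s = (3 + 2 * pm) * (3 + 2 * (M * e)) * s * (1 + 2 * M) by rewrite /A; ring.
  have -> : 3 * C8 * d * M ^+ 2 = C8 * d * M * (3 * M) by ring.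
  apply: ler_pM => //; rewrite ?mulr_ge0 ?(ltW s0)//; by move: M1; clear; lra.
split => //.
have T0 : 0 <= K * T ^+ 4 by rewrite mulr_ge0// exprn_even_ge0.
have M2 : 0 < M ^+ 2 by rewrite exprn_gt0.
rewrite ler_pdivlMr//.
have -> : A * (K * T ^+ 4 / (c2 * M ^+ 2)) * s = (A * s) * (K * T ^+ 4 / (c2 * M ^+ 2)) by ring.
have w0 : 0 <= K * T ^+ 4 / (c2 * M ^+ 2) by rewrite divr_ge0// mulr_ge0// ltW.
apply: le_trans (ler_wpM2r w0 As) _.
have -> : 3 * C8 * d * M ^+ 2 * (K * T ^+ 4 / (c2 * M ^+ 2)) =
   3 * C8 * (K * Tc ^+ 4) * d ^+ 13 * c2^-1 by rewrite TE; field; rewrite !gt_eqF.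
have -> : 3 * C8 * (K * Tc ^+ 4 / cc) * d ^+ 15 = 3 * C8 * (K * Tc ^+ 4) * d ^+ 13 * (d ^+ 2 / cc).
  by field; rewrite gt_eqF.
apply: ler_wpM2l.
  have tc0 : 0 <= Tc by lra.
  exact: mulr_ge0 (mulr_ge0 (mulr_ge0 (ler0n R 3) C80) (mulr_ge0 K0 (exprn_ge0 4 tc0))) (exprn_ge0 13 (ltW d0)).
by rewrite ler_pdivlMr// mulrC ler_pdivrMr// mulrC.
Qed.

(** There is one row less than there are coordinates; the entropy factor A left without a partner is
    at most M^2. *)
Lemma level_final (R : realType) (N M A B X : R) (m n : nat) :
  N = n%:R -> n = m.+1 -> 1 <= M -> 0 <= A -> 0 <= B -> A <= M ^+ 2 -> A * B <= X ->
  expR (15 * N + 4) * A ^+ n * (1 + 2 * M) ^+ 2 * B ^+ m <= 9 * expR (15 * N + 4) * M ^+ 4 * X ^+ m.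
Proof.
move=> NE -> M1 A0 B0 AM AB.
have M0 : 0 < M by lra.
have -> : expR (15 * N + 4) * A ^+ m.+1 * (1 + 2 * M) ^+ 2 * B ^+ m =
   expR (15 * N + 4) * (A * (1 + 2 * M) ^+ 2 * (A * B) ^+ m) by rewrite exprS exprMn; ring.
have -> : 9 * expR (15 * N + 4) * M ^+ 4 * X ^+ m = expR (15 * N + 4) * (M ^+ 2 * (3 * M) ^+ 2 * X ^+ m) by ring.
rewrite ler_pM2l ?expR_gt0//.
have AB0 : 0 <= A * B by rewrite mulr_ge0.
have m0 : 0 <= 1 + 2 * M by lra.
apply: ler_pM; [exact: mulr_ge0 A0 (sqr_ge0 _)|exact: exprn_ge0| |].
  apply: ler_pM => //; first exact: sqr_ge0.
  by rewrite ler_sqr ?nnegrE//; move: M1; clear; lra.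
by apply: lerXn2r; rewrite ?nnegrE ?(le_trans AB0).
Qed.

(* Summing over the levels: [Mx] is exponential in N, beaten by [1 / s]. *)
Lemma level_sum (R : realType) (N Mx H d X s K : R) (m : nat) :
  N = m.+1%:R -> (0 < m)%N -> 1 <= Mx -> 1 <= H -> 1 <= d -> 0 < s -> 1 <= K ->
  Mx ^+ 5 <= (H * d ^+ 12) ^+ m.+1 -> X = K * d ^+ 15 / s ->
  18 * expR 40 * H ^+ 2 * K * d ^+ 40 <= s ->
  2 * Mx * (9 * expR (15 * N + 4) * Mx ^+ 4 * X ^+ m) <= expR (- N).
Proof.
move=> NE m0 Mx1 H1 d1 s0 K1 hMx XE hs.
have d0 : 0 < d by lra.
(* Four of the powers of Mx come from the bound at one level and the fifth from the number of
   levels. They cost a factor H d^12 per row; Y is the total per row, small because X contains 1 /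
   s. *)
pose Y := expR 16 * (H * d ^+ 12) * X.
have X0 : 0 <= X by rewrite XE divr_ge0 ?(ltW s0)// mulr_ge0 ?exprn_ge0 ?(ltW d0)//; lra.
have Hd0 : 1 <= H * d ^+ 12 by apply: mulr_ege1 => //; rewrite exprn_ege1.
have Hd1 : 0 <= H * d ^+ 12 by lra.
have Y0 : 0 <= Y := mulr_ge0 (mulr_ge0 (expR_ge0 _) Hd1) X0.
have hY : 18 * expR 20 * (H * d ^+ 12) * Y <= 1.
  have -> : 18 * expR 20 * (H * d ^+ 12) * Y = 18 * (expR 20 * expR 16) * H ^+ 2 * K * d ^+ 39 / s.
    by rewrite /Y XE; ring.
  rewrite ler_pdivrMr// mul1r; apply: le_trans hs.
  rewrite -expRD; have e36 : expR (20 + 16) <= expR 40 :> R by rewrite ler_expR; lra.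
  have dd : d ^+ 39 <= d ^+ 40 by rewrite [leRHS]exprS ler_peMl// exprn_ge0// ltW.
  have K0 : 0 <= K by lra.
  apply: ler_pM dd; [|exact: exprn_ge0 (ltW d0)|].
    exact: mulr_ge0 (mulr_ge0 (mulr_ge0 (ler0n R 18) (expR_ge0 _)) (sqr_ge0 _)) K0.
  by rewrite ler_wpM2r// ler_wpM2r ?sqr_ge0// ler_pM2l.
have Y1 : Y <= 1.
  apply: le_trans hY; rewrite ler_peMl//.
  apply: mulr_ege1 => //; apply: mulr_ege1; first by lra.
  by rewrite -[leLHS]expR0 ler_expR.
have hYm : 18 * expR 20 * (H * d ^+ 12) * Y ^+ m <= 1.
  apply: le_trans hY; rewrite ler_wpM2l//.
    exact: mulr_ge0 (mulr_ge0 (ler0n R 18) (expR_ge0 _)) Hd1.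
  by rewrite -(prednK m0) exprS ler_piMr// exprn_ile1.
have -> : 2 * Mx * (9 * expR (15 * N + 4) * Mx ^+ 4 * X ^+ m) =
   18 * expR (15 * N + 4) * X ^+ m * Mx ^+ 5 by ring.
have c0 : 0 <= 18 * expR (15 * N + 4) * X ^+ m.
  by apply: mulr_ge0; [apply: mulr_ge0; [exact: ler0n|exact: expR_ge0]|exact: exprn_ge0].
apply: le_trans (ler_wpM2l c0 hMx) _.
have -> : 18 * expR (15 * N + 4) * X ^+ m * (H * d ^+ 12) ^+ m.+1 =
   (18 * expR 20 * (H * d ^+ 12) * Y ^+ m) * expR (- N).
  rewrite /Y; move: (H * d ^+ 12) => Z; rewrite [Z ^+ m.+1]exprS !exprMn -expRM_natl.
  have -> : expR (15 * N + 4) = expR 20 * expR (m%:R * 16) * expR (- N).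
    by rewrite -!expRD; congr expR; rewrite NE -natr1; ring.
  ring.
by rewrite -[leRHS]mul1r ler_wpM2r ?expR_ge0.
Qed.

Lemma norm_int_absz (R : realType) (k : int) : `|k%:~R| = (absz k)%:R :> R.
Proof. by rewrite natr_absz intr_norm. Qed.

Lemma sq_int_absz (R : realType) (k : int) : k%:~R ^+ 2 = (absz k)%:R ^+ 2 :> R.
Proof. by rewrite -norm_int_absz real_normK// num_real. Qed.

Lemma sq_max_bounds (R : realType) (p q : nat) :
  (maxn p q)%:R ^+ 2 <= p%:R ^+ 2 + q%:R ^+ 2 :> R /\
  p%:R ^+ 2 + q%:R ^+ 2 <= 2 * (maxn p q)%:R ^+ 2 :> R.
Proof.
have sq (i j : nat) : (i <= j)%N -> i%:R ^+ 2 <= j%:R ^+ 2 :> R.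
  by move=> ij; rewrite ler_sqr ?nnegrE// ler_nat.
have := sq _ _ (leq_maxl p q); have := sq _ _ (leq_maxr p q).
have p0 := sqr_ge0 (p%:R : R); have q0 := sqr_ge0 (q%:R : R).
by case/orP: (leq_total p q) => h; [rewrite (maxn_idPr h)|rewrite (maxn_idPl h)]; move=> *; split; lra.
Qed.

Lemma normr_max_absz (R : realType) (k1 k2 : int) :
  Num.max `|k1%:~R| `|k2%:~R| = (maxn (absz k1) (absz k2))%:R :> R.
Proof.
rewrite !norm_int_absz; case/orP: (leq_total (absz k1) (absz k2)) => h.
  by rewrite (maxn_idPr h); apply/max_idPr; rewrite ler_nat.
by rewrite (maxn_idPl h); apply/max_idPl; rewrite ler_nat.
Qed.

Section MinimalBad.
Context (R : realType) (disp0 : measure_display) (Om0 : measurableType disp0)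
  (P0 : probability Om0 R) (xi : {RV P0 >-> R}).

Lemma tensor_gap_ge0 (b : bool) d (I : finType) (x y : I -> R) k1 k2 :
  0 <= tensor_gap xi b d x y k1 k2.
Proof. by apply: sumr_ge0 => t _; exact: char_gap_ge0. Qed.

Lemma minimal_bad (b : bool) d (I : finType) (x y : I -> R) (c2 L : R) (Mx : nat) (k1 k2 : int) :
  ~ good3 xi b d x y c2 L k1 k2 -> (maxn (absz k1) (absz k2) <= Mx)%N ->
  exists M : nat, [/\ (M <= Mx)%N,
    forall j1 j2 : int, `|j1%:~R| < M%:R :> R -> `|j2%:~R| < M%:R :> R -> good3 xi b d x y c2 L j1 j2 &
    exists j1 j2 : int, maxn (absz j1) (absz j2) = M /\ ~ good3 xi b d x y c2 L j1 j2].
Proof.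
move=> bad kM.
pose Q := [pred M : nat | `[< exists j1 j2 : int, maxn (absz j1) (absz j2) = M /\ ~ good3 xi b d x y c2 L j1 j2 >]].
have exQ : exists M, Q M by exists (maxn (absz k1) (absz k2)); apply/asboolP; exists k1, k2.
case: (ex_minnP exQ) => M /asboolP hM minM; exists M; split => //.
  by apply: leq_trans kM; apply: minM; apply/asboolP; exists k1, k2.
move=> j1 j2; rewrite !norm_int_absz !ltr_nat => h1 h2; apply: contrapT => bj.
have : (M <= maxn (absz j1) (absz j2))%N by apply: minM; apply/asboolP; exists j1, j2.
by rewrite leqNgt gtn_max h1 h2.
Qed.

End MinimalBad.

(** [small_gap_structured] with Q the minimum of the three bounds implied by the failure of [good3];
    c2 is small enough for the first of them to meet the condition on Q. *)
Lemma bad_level_structured (R : realType) (disp0 : measure_display) (Om0 : measurableType disp0)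
  (P0 : probability Om0 R) (xi : {RV P0 >-> R}) (I : finType) (bz Bz Cz : R) (b : bool)
  e (x y : I -> R) (s r c2 L : R) (j1 j2 : int) (M : nat) :
  0 < bz -> 0 < Bz -> 0 < Cz ->
  (forall (J : finType) (F : J -> R) (Q : R), 0 <= Q ->
    \sum_i char_gap xi (F i) < Q ->
    exists z : R, bz <= z <= Bz /\
    exists p : J -> int, \sum_i (z * F i - (p i)%:~R) ^+ 2 <= Cz * Q) ->
  let kap := r ^+ 2 * e.+2%:R / 8 in
  orthonormal2 (x, y) -> 0 < s -> 0 < r <= 1 -> r * e.+2%:R <= 2 ->
  spread (s ^+ 8) r x -> (b -> spread (s ^+ 8) r y) ->
  c2 <= bz ^+ 2 * kap / (8 * Cz) ->
  maxn (absz j1) (absz j2) = M -> ~ good3 xi b e.+2 x y c2 L j1 j2 ->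
  [/\ s ^+ 4 <= 3 * Bz * M%:R, 0 < M%:R :> R &
   structured (3 * Bz * M%:R / s ^+ 4)
     (Num.sqrt (2 * Cz * Num.min M%:R L / (bz ^+ 2 * kap * M%:R ^+ 2))) x y].
Proof.
move=> bz0 Bz0 Cz0 near kap og s0 r01 rd spx spy c2le jM bad.
have /andP[r0 r1] := r01.
have kap0 : 0 < kap by rewrite divr_gt0// mulr_gt0// ?exprn_gt0 ?ltr0n.
have g0 := tensor_gap_ge0 xi b e.+2 x y j1%:~R j2%:~R.
have [h1 h2 h3] : [/\ tensor_gap xi b e.+2 x y j1%:~R j2%:~R < c2 * (j1%:~R ^+ 2 + j2%:~R ^+ 2),
   tensor_gap xi b e.+2 x y j1%:~R j2%:~R < M%:R & tensor_gap xi b e.+2 x y j1%:~R j2%:~R < L].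
  split; rewrite ltNge; apply/negP => h; apply: bad; [exact: Or31|apply: Or32|exact: Or33].
  by rewrite normr_max_absz jM.
set g := tensor_gap _ _ _ _ _ _ _ in g0 h1 h2 h3.
set K2 := j1%:~R ^+ 2 + j2%:~R ^+ 2 in h1.
have [m1 m2] := sq_max_bounds R (absz j1) (absz j2).
rewrite -!sq_int_absz jM -/K2 in m1 m2.
have M0 : 0 < M%:R :> R by exact: le_lt_trans h2.
have K20 : 0 < K2 by apply: lt_le_trans m1; rewrite exprn_gt0.
pose Q := Num.min (c2 * K2) (Num.min M%:R L).
have gQ : g < Q by rewrite !lt_min h1 h2 h3.
have Q0 : 0 < Q by exact: le_lt_trans gQ.
have Qle : Q <= bz ^+ 2 * kap / (8 * Cz) * K2.
  by apply: (@le_trans _ _ (c2 * K2)); [rewrite ge_min lexx|rewrite ler_pM2r].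
have [p1 st] := small_gap_structured bz0 Cz0 near og s0 r01 rd spx spy K20 Q0 Qle gQ.
have sK : 2 * Num.sqrt K2 <= 3 * M%:R.
  rewrite -(ler_sqr (x := 2 * _)) ?nnegrE ?mulr_ge0 ?sqrtr_ge0 ?(ltW M0)//.
  rewrite !exprMn sqr_sqrtr ?(ltW K20)//; move: m2 (sqr_ge0 (M%:R : R)); clear; lra.
have s40 : 0 < s ^+ 4 by rewrite exprn_gt0.
have PP : 2 * Bz * Num.sqrt K2 / s ^+ 4 <= 3 * Bz * M%:R / s ^+ 4.
  rewrite ler_pM2r ?invr_gt0//.
  have -> : 2 * Bz * Num.sqrt K2 = Bz * (2 * Num.sqrt K2) by ring.
  have -> : 3 * Bz * M%:R = Bz * (3 * M%:R) by ring.
  by rewrite ler_pM2l.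
split => //.
  by have := le_trans p1 PP; rewrite ler_pdivlMr// mul1r.
apply: structured_le PP _ st; apply: ler_wsqrtr.
have d1 : 0 < bz ^+ 2 * kap by rewrite mulr_gt0// exprn_gt0.
apply: ler_pM.
- by rewrite !mulr_ge0 ?(ltW Cz0) ?(ltW Q0).
- by rewrite invr_ge0 mulr_ge0 ?(ltW d1) ?(ltW K20).
- by rewrite ler_pM2l ?mulr_gt0// ge_min lexx orbT.
- by rewrite lef_pV2 ?posrE ?mulr_gt0 ?exprn_gt0// ler_pM2l.
Qed.

(** A union bound over the smallest bad level, at most Mx. The constant [cc] precedes G and H
    because the final constant K0, and H through it, are defined from [cc]. *)
Lemma structured_whp (R : realType) (disp0 : measure_display) (Om0 : measurableType disp0)
  (P0 : probability Om0 R) (xi : {RV P0 >-> R}) (r0 : R) :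
  subgaussian_tail xi -> ('E_P0[xi] = 0)%E -> ('V_P0[xi] = 1)%E -> 0 < r0 <= 1 ->
  exists cc : R, 0 < cc <= 1 /\ forall G H : R, 0 <= G -> 1 <= H ->
  exists S0 : R, 1 <= S0 /\
  forall (disp : measure_display) (Om : measurableType disp) (P : probability Om R)
    (m d : nat) (I : finType) (a : 'I_m * d.-tuple I -> {RV P >-> R}) (b : bool)
    (N lam s del : R) (Mx : nat),
    iid_copies xi a -> N = #|I|%:R -> #|I| = m.+1 -> (0 < m)%N -> 1 <= lam -> lam ^+ 24 = d%:R ->
    (1 < d)%N -> s ^+ 16 = N -> 1 <= s -> S0 * d%:R ^+ 40 <= s -> (0 < Mx)%N ->
    Mx%:R ^+ 5 <= (H * d%:R ^+ 12) ^+ m.+1 -> 0 <= del -> del * Mx%:R <= Num.sqrt N ->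
    outer_le P [set w | exists x y : I -> R, [/\ orthonormal2 (x, y),
       spread (s ^+ 8) (r0 / (d%:R * lam ^+ 2)) x /\
         (b -> spread (s ^+ 8) (r0 / (d%:R * lam ^+ 2)) y),
       injective_bound d (sysA a w) (G * Num.sqrt N * Num.sqrt d%:R * lam),
       exists k1 k2 : int, (maxn (absz k1) (absz k2) <= Mx)%N /\
         ~ good3 xi b d x y (cc / (d%:R * lam ^+ 4)) (N * s) k1 k2 &
       nrm (app d (sysA a w) (tU x)) <= del /\ nrm (app d (sysA a w) (hatV b d x y)) <= del]]
      (expR (- N)).
Proof.
move=> tail mean var /andP[r00 r01].
have [bz [Bz [Cz [bz0 Bz0 Cz0 near]]]] := char_gap_near_int tail mean var.
pose cw : R := bz ^+ 2 * r0 ^+ 2 / (64 * Cz).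
have cw0 : 0 < cw by rewrite divr_gt0// mulr_gt0// exprn_gt0.
pose cc : R := Num.min 1 cw.
have cc0 : 0 < cc by rewrite lt_min ltr01.
have cc1 : cc <= 1 by rewrite ge_min lexx.
have ccw : cc <= cw by rewrite ge_min lexx orbT.
exists cc; rewrite cc0 cc1; split => // G H G0 H1.
pose aa : R := 6 * Bz; have aa0 : 0 <= aa by rewrite mulr_ge0// ltW.
pose C7 : R := Num.sqrt (16 * Cz) / (bz * r0).
have C70 : 0 <= C7 by rewrite divr_ge0 ?sqrtr_ge0// ltW// mulr_gt0.
have C72 : C7 ^+ 2 = 16 * Cz / (bz ^+ 2 * r0 ^+ 2).
  by rewrite /C7 expr_div_n sqr_sqrtr ?mulr_ge0 ?(ltW Cz0)// exprMn.
pose Tc : R := 1 + 8 * G; have Tc1 : 1 <= Tc by rewrite lerDl mulr_ge0.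
pose K : R := 3 * csb R; have K0 : 0 <= K by rewrite mulr_ge0// ltW// csb_gt0.
pose C8 : R := (3 + aa) * (3 + 2 * C7).
have C81 : 1 <= C8 by apply: mulr_ege1; [move: aa0|move: C70]; clear; lra.
pose K9 : R := 3 * C8 * (K * Tc ^+ 4 / cc).
have K1 : 1 <= K by rewrite /K /csb; clear; lra.
have K91 : 1 <= K9.
  apply: mulr_ege1; first by move: C81; clear; lra.
  rewrite ler_pdivlMr// mul1r; apply: le_trans cc1 _; apply: mulr_ege1 => //.
  by rewrite exprn_ege1.
pose big : R := 18 * expR 40 * H ^+ 2 * K9.
have big0 : 0 <= big.
  by apply: mulr_ge0; [apply: mulr_ge0; [apply: mulr_ge0; [exact: ler0n|exact: expR_ge0]|exact: sqr_ge0]|move: K91; clear; lra].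
(* The sum of all lower bounds required of s / d^40 below. *)
pose S0 : R := 3 * C8 + big + 3 * Bz + 2 * H + 26.
have S01 : 1 <= S0 by rewrite /S0; move: C81 big0 Bz0 H1; clear; lra.
exists S0; split => // disp Om P m d I a b N lam s del Mx iid NE Im m0 lam1 lamd d1 sN s1 hS Mx0 hMx del0 delM.
have s0 : 0 < s by exact: lt_le_trans s1.
have N0 : 0 < N by rewrite -sN exprn_gt0.
have lam0 : 0 < lam by exact: lt_le_trans lam1.
have dR1 : 1 <= d%:R :> R by rewrite ler1n ltnW.
have d0 : 0 < d%:R :> R by exact: lt_le_trans dR1.
have d40 : 1 <= d%:R ^+ 40 :> R by rewrite exprn_ege1.
have d401 : d%:R <= d%:R ^+ 40 :> R by rewrite exprS ler_peMr ?(ltW d0)// exprn_ege1.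
have Ss (q : R) : 0 <= q -> q <= S0 -> q * d%:R ^+ 40 <= s.
  by move=> q0 qS; apply: le_trans hS; rewrite ler_wpM2r// exprn_ge0// ltW.
have Ss1 (q : R) : 0 <= q -> q <= S0 -> q * d%:R <= s.
  by move=> q0 qS; apply: le_trans (Ss q q0 qS); rewrite ler_wpM2l.
have c8s : 3 * C8 * d%:R <= s by apply: Ss1; rewrite /S0; move: C81 big0 Bz0 H1; clear; lra.
have bigs : big * d%:R ^+ 40 <= s by apply: Ss; rewrite /S0; move: C81 big0 Bz0 H1; clear; lra.
have bzs : 3 * Bz + 2 <= s.
  apply: le_trans (Ss1 (3 * Bz + 2) _ _); last by rewrite /S0; move: C81 big0 Bz0 H1; clear; lra.
    by rewrite ler_peMr// addr_ge0// mulr_ge0// ltW.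
  by rewrite addr_ge0// mulr_ge0// ltW.
have Hs : 2 * (H + 12 * d%:R) <= s.
  apply: le_trans (Ss1 (2 * H + 24) _ _); [|by move: H1; clear; lra|by rewrite /S0; move: C81 big0 Bz0 H1; clear; lra].
  have := mulr_ege1 dR1 H1; have : H <= H * d%:R by rewrite ler_peMr//; move: H1; clear; lra.
  by clear; lra.
pose c2 : R := cc / (d%:R * lam ^+ 4).
pose r : R := r0 / (d%:R * lam ^+ 2).
have l4 : 1 <= lam ^+ 4 by rewrite exprn_ege1.
have l2 : 1 <= lam ^+ 2 by rewrite exprn_ege1.
have l4d : lam ^+ 4 <= d%:R by rewrite -lamd -[24%N]/(4 + 20)%N exprD ler_peMr ?exprn_ege1// exprn_ge0// ltW.
have dl4 : 0 < d%:R * lam ^+ 4 by rewrite mulr_gt0// exprn_gt0.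
have dl2 : 0 < d%:R * lam ^+ 2 by rewrite mulr_gt0// exprn_gt0.
have c20 : 0 < c2 by rewrite divr_gt0.
have c21 : c2 <= 1 by rewrite ler_pdivrMr// mul1r (le_trans cc1)// mulr_ege1.
have r_0 : 0 < r by rewrite divr_gt0.
have r_1 : r <= 1 by rewrite ler_pdivrMr// mul1r (le_trans r01)// mulr_ege1.
have rd : r * d%:R <= 2.
  have -> : r * d%:R = r0 / lam ^+ 2 by rewrite /r; field; rewrite !gt_eqF.
  by rewrite ler_pdivrMr ?exprn_gt0//; move: l2 r01; clear; lra.
pose kap : R := r ^+ 2 * d%:R / 8.
have kapE : kap = r0 ^+ 2 / (8 * (d%:R * lam ^+ 4)) by rewrite /kap /r; field; rewrite !gt_eqF.
have c2le : c2 <= bz ^+ 2 * kap / (8 * Cz).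
  have -> : bz ^+ 2 * kap / (8 * Cz) = cw / (d%:R * lam ^+ 4) by rewrite kapE /cw; field; rewrite !gt_eqF.
  by rewrite ler_pM2r ?invr_gt0.
have ccd : cc <= c2 * d%:R ^+ 2.
  have -> : c2 * d%:R ^+ 2 = cc * (d%:R / lam ^+ 4) by rewrite /c2; field; rewrite !gt_eqF.
  by rewrite ler_peMr ?(ltW cc0)// ler_pdivlMr ?exprn_gt0// mul1r.
pose beta : R := G * Num.sqrt N * Num.sqrt d%:R * lam.
pose T : R := Tc * d%:R ^+ 3.
have T1 : 1 <= T by apply: mulr_ege1 => //; rewrite exprn_ege1.
pose L : R := N * s.
pose X : R := K9 * d%:R ^+ 15 / s.
pose bound : R := 9 * expR (15 * N + 4) * Mx%:R ^+ 4 * X ^+ m.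
have X0 : 0 <= X by rewrite divr_ge0 ?(ltW s0)// mulr_ge0 ?exprn_ge0 ?(ltW d0)//; move: K91; clear; lra.
have bound0 : 0 <= bound.
  by apply: mulr_ge0; [apply: mulr_ge0; [apply: mulr_ge0; [exact: ler0n|exact: expR_ge0]|exact: exprn_ge0]|exact: exprn_ge0].
(* In [level_count] the bound by M serves for the term without Pm, and the bound by L = s^17 for the
   term with it. *)
pose eta (M : nat) : R := Num.sqrt (2 * Cz * Num.min M%:R L / (bz ^+ 2 * kap * M%:R ^+ 2)).
pose Pm (M : nat) : R := 3 * Bz * M%:R / s ^+ 4.
pose F (M : nat) : set Om := [set w | (s ^+ 2 <= M%:R /\ (M <= Mx)%N) /\
  exists x y : I -> R, [/\ orthonormal2 (x, y),
      forall k1 k2 : int, `|k1%:~R| < M%:R :> R -> `|k2%:~R| < M%:R :> R -> good3 xi b d x y c2 L k1 k2,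
      structured (Pm M) (eta M) x y, injective_bound d (sysA a w) beta &
      nrm (app d (sysA a w) (tU x)) <= del /\ nrm (app d (sysA a w) (hatV b d x y)) <= del]].
have hF M : outer_le P (F M) bound.
  have [[sM MMx]|nc] := pselect (s ^+ 2 <= M%:R /\ (M <= Mx)%N); last first.
    by apply: (outer_leS _ _ (outer_le_set0 P bound0)) => // w [].
  have s2 : 2 <= s by move: bzs Bz0; clear; lra.
  have M2 : 2 <= M%:R :> R by apply: le_trans sM; move: s2; clear; nra.
  have M0 : 0 < M%:R :> R by exact: lt_le_trans M2.
  have M1 : 1 <= M%:R :> R by move: M2; clear; lra.
  have MMxR : M%:R <= Mx%:R :> R by rewrite ler_nat.
  have L0 : 0 < L by rewrite mulr_gt0.
  have kap0 : 0 < kap by rewrite kapE divr_gt0 ?exprn_gt0// mulr_gt0.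
  have min0 : 0 <= Num.min M%:R L by rewrite le_min (ltW M0) (ltW L0).
  have eta2 : M%:R ^+ 2 * eta M ^+ 2 = C7 ^+ 2 * (d%:R * lam ^+ 4) * Num.min M%:R L.
    rewrite sqr_sqrtr.
      by rewrite C72 kapE; move: (Num.min _ _) => mn; field; rewrite !gt_eqF.
    rewrite divr_ge0//; first by rewrite !mulr_ge0// ltW.
    exact: mulr_ge0 (mulr_ge0 (sqr_ge0 _) (ltW kap0)) (sqr_ge0 _).
  have C7d : C7 ^+ 2 * (d%:R * lam ^+ 4) <= (C7 * d%:R) ^+ 2.
    by rewrite [leRHS]exprMn ler_wpM2l ?sqr_ge0// [leRHS]expr2 ler_pM2l.
  have C7d0 : 0 <= C7 ^+ 2 * (d%:R * lam ^+ 4) by rewrite mulr_ge0 ?sqr_ge0// ltW.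
  have e1 : M%:R ^+ 2 * eta M ^+ 2 <= (C7 * d%:R) ^+ 2 * M%:R.
    by rewrite eta2; apply: ler_pM C7d _ => //; rewrite ge_min lexx.
  have e2 : M%:R ^+ 2 * eta M ^+ 2 <= (C7 * d%:R) ^+ 2 * s ^+ 18.
    rewrite eta2; apply: ler_pM C7d _ => //.
    by rewrite ge_min /L -sN -exprSr [s ^+ 18]exprS orbC ler_peMl ?exprn_ge0 ?(ltW s0).
  have sqN : Num.sqrt N = s ^+ 8.
    by rewrite -sN -[16%N]/(8 * 2)%N exprM sqrtr_sqr ger0_norm// exprn_ge0// ltW.
  have pmE : 2 * (Pm M / Num.sqrt N) = aa * M%:R / s ^+ 12.
    by rewrite sqN /Pm /aa; field; rewrite gt_eqF.
  have [nA nB] := level_numeric aa0 C70 Tc1 cc0 dR1 c20 ccd s1 sM (sqrtr_ge0 _) e1 e2 pmE (erefl T) K0.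
  have hdev : del + 2 * d%:R ^+ 2 * beta * (4 / M%:R) <= T * Num.sqrt N / M%:R.
    rewrite ler_pdivlMr// mulrDl.
    have h1 : del * M%:R <= Num.sqrt N by apply: le_trans delM; rewrite ler_wpM2l.
    have -> : 2 * d%:R ^+ 2 * beta * (4 / M%:R) * M%:R = 8 * G * Num.sqrt N * (d%:R ^+ 2 * (Num.sqrt d%:R * lam)).
      by rewrite /beta; field; rewrite gt_eqF.
    have h2 : Num.sqrt d%:R * lam <= d%:R.
      rewrite -(ler_sqr (x := _ * _)) ?nnegrE ?mulr_ge0 ?sqrtr_ge0 ?(ltW lam0) ?(ltW d0)//.
      rewrite exprMn sqr_sqrtr ?(ltW d0)// [leRHS]expr2 ler_pM2l//; apply: le_trans l4d.
      by rewrite -[4%N]/(2 + 2)%N exprD ler_peMr// exprn_ge0// ltW.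
    have h3 : 8 * G * Num.sqrt N * (d%:R ^+ 2 * (Num.sqrt d%:R * lam)) <= 8 * G * Num.sqrt N * d%:R ^+ 3.
      rewrite ler_wpM2l ?mulr_ge0 ?sqrtr_ge0// [leRHS]exprSr ler_wpM2l// exprn_ge0// ltW.
    have h4 : Num.sqrt N <= Num.sqrt N * d%:R ^+ 3 by rewrite ler_peMr ?sqrtr_ge0// exprn_ege1.
    by rewrite /T /Tc; move: h1 h3 h4; clear; lra.
  have HL : M%:R ^+ 2 <= expR (L / 2).
    apply: (@le_trans _ _ (Mx%:R ^+ 5)).
      apply: (@le_trans _ _ (M%:R ^+ 5)).
        by rewrite -[5%N]/(2 + 3)%N exprD ler_peMr ?exprn_ege1// exprn_ge0// ltW.
      by apply: lerXn2r; rewrite ?nnegrE ?ler0n.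
    apply: le_trans hMx _; rewrite -Im.
    apply: (@le_trans _ _ (expR (H + 12 * d%:R) ^+ #|I|)).
      apply: lerXn2r; rewrite ?nnegrE ?expR_ge0//.
        by rewrite mulr_ge0 ?exprn_ge0 ?(ltW d0)//; move: H1; clear; lra.
      rewrite expRD; apply: ler_pM; rewrite ?expR_ge_id ?exprn_le_expR ?exprn_ge0 ?(ltW d0)//.
      by move: H1; clear; lra.
    rewrite -expRM_natl -NE ler_expR /L -mulrA ler_pM2l//; move: Hs; clear; lra.
  have c2P : 0 < c2 <= 1 by rewrite c20 c21.
  have Pm0 : 0 <= Pm M by rewrite divr_ge0 ?exprn_ge0 ?(ltW s0)// !mulr_ge0// ltW.
  have lp := level_prob b iid (ltnW d1) NE N0 M2 c2P HL Pm0 (sqrtr_ge0 _ : 0 <= eta M) T1 hdev.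
  apply: outer_leS lp; first by move=> w [].
  have A0 : 0 <= (3 + 2 * (Pm M / Num.sqrt N)) * (3 + 2 * (M%:R * eta M)) * (1 + 2 * M%:R).
    apply: mulr_ge0; last by move: M1; clear; lra.
    apply: mulr_ge0; apply: addr_ge0 => //; apply: mulr_ge0 => //.
      by rewrite divr_ge0 ?sqrtr_ge0.
    by rewrite mulr_ge0 ?sqrtr_ge0.
  have B0 : 0 <= K * T ^+ 4 / (c2 * M%:R ^+ 2).
    exact: divr_ge0 (mulr_ge0 K0 (exprn_ge0 4 (le_trans ler01 T1))) (mulr_ge0 (ltW c20) (sqr_ge0 _)).
  have AM : (3 + 2 * (Pm M / Num.sqrt N)) * (3 + 2 * (M%:R * eta M)) * (1 + 2 * M%:R) <= M%:R ^+ 2.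
    rewrite -(ler_pM2r s0); apply: le_trans nA _; rewrite [leRHS]mulrC ler_pM2r ?exprn_gt0//.
  apply: le_trans (level_final NE Im M1 A0 B0 AM nB) _.
  rewrite /bound; apply: ler_wpM2r; first exact: exprn_ge0.
  apply: ler_wpM2l; first by rewrite mulr_ge0 ?expR_ge0.
  by apply: lerXn2r; rewrite ?nnegrE ?ler0n.
have tot := @outer_le_seq _ _ _ P nat (iota 0 Mx.+1) F bound bound0 (fun M _ => hF M).
apply: outer_leS tot.
- move=> w [x [y [og [spx spy] G1 [k1 [k2 [kM bad]]] f12]]].
  have [M [MMx goodb [j1 [j2 [jM badj]]]]] := minimal_bad bad kM.
  have dE : d = d.-2.+2 by case: (d) d1 => [|[]].
  have := @bad_level_structured R _ _ P0 xi I bz Bz Cz b d.-2 x y s r c2 L j1 j2 M bz0 Bz0 Cz0 near og s0.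
  rewrite -dE => /(_ (introT andP (conj r_0 r_1)) rd spx spy c2le jM badj)[m1 m2 m3].
  exists M.
    have : M \in iota 0 Mx.+1 by rewrite mem_iota.
    by elim: (iota _ _) => //= q t IH; rewrite inE => /orP[/eqP->|/IH]; [left|right].
  split; last by exists x, y; split.
  split => //.
  (* The integer vector has norm at least 1, whence s^4 <= 3 Bz M; so no bad level lies below
     s^2. *)
  have Bs : 3 * Bz <= s ^+ 2.
    have : s <= s ^+ 2 by rewrite expr2 ler_peMl// ltW.
    by move: bzs; clear; lra.
  have h : s ^+ 4 <= s ^+ 2 * M%:R by apply: le_trans m1 _; rewrite ler_pM2r.
  by move: h; rewrite -[4%N]/(2 + 2)%N exprD ler_pM2l ?exprn_gt0.
rewrite size_iota.
have Mx1 : 1 <= Mx%:R :> R by rewrite ler1n.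
apply: (@le_trans _ _ (2 * Mx%:R * bound)).
  by rewrite ler_wpM2r// -natr1; move: Mx1; clear; lra.
by apply: (@level_sum R N Mx%:R H d%:R X s K9 m) => //; rewrite NE Im.
Qed.

(** * Generic pairs *)

Section Deviation.
Context (R : realType) (I : finType) (m d : nat) (A : 'I_m -> seq I -> R) (beta gam : R).
Hypotheses (d0 : (0 < d)%N) (gam0 : 0 <= gam) (inj : injective_bound d A beta)
  (dir : forall x u : I -> R, orthonormal2 (x, u) -> nrm (app d A (tV x u)) <= gam).

Let unit_le (z : I -> R) : dot z z = 1 -> nrm z <= 1.
Proof. by move=> /nrm1->. Qed.

(** Split u along x: orthogonally to x the sharp bound [gam] holds, and along x the derivative is d
    f(x) by homogeneity. *)
Lemma nrm_app_tV (x u : I -> R) : dot x x = 1 ->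
  nrm (app d A (tV x u)) <= gam * nrm u + d%:R * beta * `|dot x u|.
Proof.
move=> xx; pose c := dot x u; pose u' := fun i => u i - c * x i.
have beta0 := injective_bound_ge0 inj.
have xu' : dot x u' = 0 by rewrite dotBr dotZr xx mulr1 subrr.
have fx : nrm (app d A (tU x)) <= beta.
  by have := @proj_le_U _ _ d x (unit_le xx) _ _ _ inj; rewrite mul1r.
have split : app d A (tV x u) = fun l => app d A (tV x u') l + c * d%:R * app d A (tU x) l.
  transitivity (app d A (fun s => tV x u' s + (c * d%:R) * tU x s)).
    apply: app_ext => s sd.
    have := tV_lin x c x u' s; rewrite (_ : (fun i => c * x i + u' i) = u).
      by move=> ->; rewrite tV_self sd; ring.
    by apply/funext => i; rewrite /u'; ring.
  by apply/funext => l; rewrite appD appZ.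
have u'u : nrm u' <= nrm u.
  rewrite nrm_le_sq ?nrm_ge0// nrm_sq.
  have -> : dot u' u' = dot u u - c ^+ 2.
    by rewrite dotBr dotZr (dotC u' x) xu' mulr0 subr0 dotBl dotZl; rewrite -/c; ring.
  by rewrite lerBlDr lerDl sqr_ge0.
rewrite split; apply: le_trans (nrmD _ _) _; apply: lerD.
  have [u0|u0] := eqVneq (nrm u') 0.
    have -> : app d A (tV x u') = fun=> 0.
      rewrite (_ : u' = fun i => 0 * u' i + (fun=> 0) i); last by apply/funext => i; rewrite (nrm_eq0 u0); ring.
      apply/funext => l; rewrite /app /tsum big1// => t _.
      rewrite tV_lin (_ : tV x (fun=> 0) t = 0) ?mul0r ?addr0 ?mulr0//.
      by elim: (tval t) => //= i s ->; ring.
    by rewrite nrm0 mulr_ge0 ?nrm_ge0.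
  have up : 0 < nrm u' by rewrite lt0r u0 nrm_ge0.
  pose v i := (nrm u')^-1 * u' i.
  have ov : orthonormal2 (x, v).
    split => //=; last by rewrite dotZr xu' mulr0.
    by rewrite dotZl dotZr -nrm_sq; field.
  have -> : app d A (tV x u') = fun l => nrm u' * app d A (tV x v) l.
    rewrite -appZ; apply: app_ext => s _.
    have := tV_lin x (nrm u') v (fun=> 0) s.
    rewrite (_ : (fun i => nrm u' * v i + 0) = u').
      by move=> ->; rewrite (_ : tV x (fun=> 0) s = 0) ?addr0//; elim: s => //= i s ->; ring.
    by apply/funext => i; rewrite /v addr0 mulrA mulfV// mul1r.
  rewrite nrmZ ger0_norm ?nrm_ge0// mulrC; apply: ler_pM; rewrite ?nrm_ge0//.
  exact: dir.
rewrite nrmZ normrM (ger0_norm (ler0n R d)) -/c.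
have -> : d%:R * beta * `|c| = `|c| * d%:R * beta by ring.
by rewrite ler_wpM2l// mulr_ge0.
Qed.

(** Unit vectors differ radially only to second order, so the weak radial bound of [nrm_app_tV]
    enters only with h^2. *)
Lemma dot_sub_unit (x x0 : I -> R) : dot x x = 1 -> dot x0 x0 = 1 ->
  `|dot x0 (fun i => x i - x0 i)| <= nrm (fun i => x i - x0 i) ^+ 2.
Proof.
move=> xx xx0; rewrite nrm_sq !dotBr !dotBl xx xx0 (dotC x0 x).
set c := dot x x0.
have c1 : c <= 1.
  by have := dot_le x x0; rewrite (nrm1 xx) (nrm1 xx0) mulr1 ler_norml => /andP[].
rewrite ler0_norm; lra.
Qed.

Lemma nrm_app_U_diff (x x0 : I -> R) (h : R) : dot x x = 1 -> dot x0 x0 = 1 ->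
  nrm (fun i => x i - x0 i) <= h ->
  nrm (app d A (tU x0)) <= nrm (app d A (tU x)) + (gam * h + 2 * d%:R ^+ 2 * beta * h ^+ 2).
Proof.
move=> xx xx0 hx; have beta0 := injective_bound_ge0 inj.
have h0 : 0 <= h := le_trans (nrm_ge0 _) hx.
apply: le_trans (nrm_sub_le _ (app d A (tU x))) _; rewrite lerD2l nrm_dist -appB.
pose u := fun i => x i - x0 i.
have -> : app d A (fun s => tU x s - tU x0 s) =
  fun l => app d A (fun s => tU x s - tU x0 s - tV x0 u s) l + app d A (tV x0 u) l.
  by rewrite -appD; apply: app_ext => s _; ring.
apply: le_trans (nrmD _ _) _.
have h2 : nrm u ^+ 2 <= h ^+ 2 by rewrite ler_sqr ?nnegrE ?nrm_ge0.
have k1 := @proj_le_taylor _ _ d x x0 (unit_le xx) (unit_le xx0) _ _ _ inj.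
have k2 := nrm_app_tV u xx0.
have e1 : d%:R ^+ 2 * nrm u ^+ 2 * beta <= d%:R ^+ 2 * beta * h ^+ 2.
  by rewrite mulrAC ler_wpM2l// mulr_ge0 ?sqr_ge0.
have e2 : gam * nrm u <= gam * h by rewrite ler_wpM2l.
have e3 : d%:R * beta * `|dot x0 u| <= d%:R ^+ 2 * beta * h ^+ 2.
  apply: ler_pM; rewrite ?mulr_ge0//.
    by rewrite ler_wpM2r// expr2 ler_peMl ?ler0n// ler1n.
  exact: le_trans (dot_sub_unit xx xx0) h2.
lra.
Qed.

(** The radial part of y - y0 is harmless: for D_x(y) orthogonality turns it into - dot (x - x0) y,
    of order h, and for f(y) it is of order k^2 <= h. Thus k enters only with the sharp factor
    [gam], and y may be rounded more coarsely than x. *)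
Lemma nrm_app_V_diff (b : bool) (x y x0 y0 : I -> R) (h k : R) :
  orthonormal2 (x, y) -> orthonormal2 (x0, y0) ->
  nrm (fun i => x i - x0 i) <= h -> nrm (fun i => y i - y0 i) <= k -> k ^+ 2 <= h ->
  nrm (app d A (hatV b d x0 y0)) <= nrm (app d A (hatV b d x y)) + (gam * k + 2 * d%:R ^+ 2 * beta * h).
Proof.
move=> [/= xx yy xy] [/= xx0 yy0 xy0] hx hy kh; have beta0 := injective_bound_ge0 inj.
have h0 : 0 <= h := le_trans (nrm_ge0 _) hx.
case: b; rewrite /hatV.
  apply: le_trans (nrm_app_U_diff yy yy0 hy) _; rewrite lerD2l lerD2l.
  by rewrite ler_wpM2l// !mulr_ge0 ?sqr_ge0.
have q1 : 1 <= Num.sqrt d%:R :> R by rewrite -[leLHS]sqrtr1 ler_wsqrtr// ler1n.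
have q0 : 0 < Num.sqrt d%:R :> R by exact: lt_le_trans q1.
pose qi : R := (Num.sqrt d%:R)^-1.
have qi0 : 0 <= qi by rewrite invr_ge0 ltW.
have qi1 : qi <= 1 by rewrite invf_le1.
apply: le_trans (nrm_sub_le _ (app d A (hatV false d x y))) _; rewrite lerD2l nrm_dist -appB.
pose u := fun i => y i - y0 i.
have -> : app d A (fun s => hatV false d x y s - tV x0 y0 s / Num.sqrt d%:R) =
  fun l => qi * app d A (fun s => (tV x y s - tV x0 y s) + tV x0 u s) l.
  rewrite -appZ; apply: app_ext => s _; rewrite /hatV.
  have := tV_lin x0 (-1) y0 y s.
  rewrite (_ : (fun i => -1 * y0 i + y i) = u); last by apply/funext => i; rewrite /u; ring.
  by move=> ->; rewrite /qi; ring.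
rewrite nrmZ ger0_norm//; set Y := nrm _.
apply: (@le_trans _ _ Y); first by rewrite ler_piMl ?nrm_ge0.
rewrite /Y appD; apply: le_trans (nrmD _ _) _.
have k1 := @proj_le_Vdiff _ _ d x x0 y (unit_le xx) (unit_le xx0) (unit_le yy) _ _ _ inj.
have k2 := nrm_app_tV u xx0.
have e1 : d%:R ^+ 2 * nrm (fun i => x i - x0 i) * beta <= d%:R ^+ 2 * beta * h.
  by rewrite mulrAC ler_wpM2l// mulr_ge0 ?sqr_ge0.
have e2 : gam * nrm u <= gam * k by rewrite ler_wpM2l.
have e3 : d%:R * beta * `|dot x0 u| <= d%:R ^+ 2 * beta * h.
  apply: ler_pM; rewrite ?mulr_ge0//.
    by rewrite ler_wpM2r// expr2 ler_peMl ?ler0n// ler1n.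
  have -> : dot x0 u = - dot (fun i => x i - x0 i) y.
    by rewrite /u dotBr xy0 dotBl xy; ring.
  rewrite normrN; apply: le_trans (dot_le _ _) _.
  by rewrite (nrm1 yy) mulr1.
lra.
Qed.

End Deviation.

(** The box sizes s1 = lam sqrt d h and s2 = d^2 s1 match, up to C sqrt N, the displacement of the
    two images within a cell of the net of precisions h and d^2 h. Both are at least h, so only
    frequencies up to [Mx] occur. *)
Lemma final_prob (R : realType) (disp0 : measure_display) (Om0 : measurableType disp0)
  (P0 : probability Om0 R) (xi : {RV P0 >-> R})
  (disp : measure_display) (Om : measurableType disp) (P : probability Om R)
  (m d : nat) (I : finType) (a : 'I_m * d.-tuple I -> {RV P >-> R}) (b : bool)
  (N lam h c2 L G1 G2 del : R) (Mx : nat) :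
  iid_copies xi a -> N = #|I|%:R -> 2 <= N -> (1 < d)%N -> 1 <= lam -> 0 < c2 <= 1 ->
  0 <= G1 -> 0 <= G2 -> 0 < h -> 4 * N ^+ 3 * (d%:R ^+ 4 * h) <= 1 -> lam ^+ 2 <= d%:R ->
  h ^- 2 <= expR (L / 2) -> (2 * h)^-1 <= Mx%:R -> del <= Num.sqrt N * h ->
  outer_le P [set w | exists x y : I -> R, [/\ orthonormal2 (x, y),
     forall k1 k2 : int, (maxn (absz k1) (absz k2) <= Mx)%N -> good3 xi b d x y c2 L k1 k2,
     injective_bound d (sysA a w) (G1 * Num.sqrt N * Num.sqrt d%:R * lam),
     forall x u : I -> R, orthonormal2 (x, u) ->
        nrm (app d (sysA a w) (tV x u)) <= G2 * Num.sqrt N * Num.sqrt d%:R * lam &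
     nrm (app d (sysA a w) (tU x)) <= del /\ nrm (app d (sysA a w) (hatV b d x y)) <= del]]
  (4 * N ^+ 2 * (expR (4 * N + 3) * (1 + 2 * (6 * N ^+ 4 + 2)) ^+ 3 *
      ((3 / h) ^+ #|I|.-1 * (3 / (d%:R ^+ 2 * h)) ^+ #|I|.-2)) *
   (expR (2 * (1 + G2 + 2 * G1) ^+ 2 * N) *
    (9 * csb R / c2 * (lam ^+ 2 * d%:R ^+ 3 * h ^+ 2)) ^+ m)).
Proof.
move=> iid NE N2 d1 lam1 c2P G10 G20 h0 hN lamd HL hMx hdel.
have N0 : 0 < N by exact: lt_le_trans N2.
have lam0 : 0 < lam by exact: lt_le_trans lam1.
have /andP[c0 c1] := c2P.
have dR1 : 1 <= d%:R :> R by rewrite ler1n ltnW.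
have d0 : 0 < d%:R :> R by exact: lt_le_trans dR1.
have d02 : 0 < d%:R ^+ 2 :> R by rewrite exprn_gt0.
have d2 : 1 <= d%:R ^+ 2 :> R by rewrite exprn_ege1.
have N31 : 8 <= N ^+ 3.
  have : 2 ^+ 3 <= N ^+ 3 by apply: lerXn2r; rewrite ?nnegrE ?(ltW N0).
  by apply: le_trans; clear; lra.
have d4h : 32 * (d%:R ^+ 4 * h) <= 1.
  apply: le_trans hN; rewrite ler_wpM2r ?mulr_ge0 ?exprn_ge0 ?(ltW d0) ?(ltW h0)//.
  by move: N31; clear; lra.
pose hy : R := d%:R ^+ 2 * h; have hy0 : 0 < hy by rewrite mulr_gt0.
have hxy : h <= hy by rewrite ler_peMl// ltW.
have hy4 : hy <= d%:R ^+ 4 * h.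
  by rewrite ler_pM2r// -[4%N]/(2 + 2)%N exprD ler_peMl// ltW.
have hNy : 2 * N ^+ 3 * hy <= 1.
  apply: le_trans hN; apply: ler_pM => //; rewrite ?(ltW hy0) ?mulr_ge0 ?exprn_ge0 ?(ltW N0)//.
  by move: N31; clear; lra.
have hy1 : hy <= 1 by move: d4h hy4 hy0; clear; lra.
have h1 : h <= 1 by exact: le_trans hxy hy1.
pose H : set ((I -> R) * (I -> R)) := [set g | forall k1 k2 : int, (maxn (absz k1) (absz k2) <= Mx)%N ->
   good3 xi b d g.1 g.2 c2 L k1 k2].
have [r [r1 r2 r3]] := @exact_net R I H h hy N NE N2 h0 hxy hNy.
pose sd : R := Num.sqrt d%:R.
have sd2 : sd ^+ 2 = d%:R by rewrite sqr_sqrtr// ltW.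
have sd1 : 1 <= sd by rewrite -[leLHS]sqrtr1 ler_wsqrtr.
have sd0 : 0 < sd by exact: lt_le_trans sd1.
pose s1 : R := lam * sd * h.
pose s2 : R := lam * sd * hy.
have ls1 : 1 <= lam * sd by apply: mulr_ege1.
have ls0 : 0 < lam * sd by rewrite mulr_gt0.
have lsd : lam * sd <= d%:R.
  rewrite -(ler_sqr (x := lam * sd)) ?nnegrE ?(ltW ls0) ?(ltW d0)// exprMn sd2 [leRHS]expr2.
  by rewrite ler_pM2r.
have s10 : 0 < s1 by rewrite mulr_gt0.
have s20 : 0 < s2 by rewrite mulr_gt0.
have hs1 : h <= s1 by rewrite ler_peMl// ltW.
have hs2 : h <= s2 by apply: le_trans hxy _; rewrite ler_peMl// ltW.
have s2le : s2 <= d%:R ^+ 4 * h.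
  have -> : d%:R ^+ 4 * h = d%:R ^+ 2 * hy by rewrite /hy; ring.
  by rewrite ler_pM2r//; apply: le_trans lsd _; rewrite expr2 ler_peMl// ltW.
have s12 : s1 <= s2 by rewrite ler_pM2l.
have s2P : 0 < s2 <= 4^-1 by rewrite s20; move: d4h s2le s20; clear; lra.
have s1P : 0 < s1 <= 4^-1 by rewrite s10; move: d4h s2le s12 s20; clear; lra.
have HL' : (4 * s1 * s2)^-1 <= expR (L / 2).
  apply: le_trans HL; rewrite lef_pV2 ?posrE ?mulr_gt0 ?exprn_gt0//.
  have : h * h <= s1 * s2 by apply: ler_pM => //; exact: ltW.
  have : 0 < h * h by rewrite mulr_gt0.
  by rewrite expr2; clear; lra.
pose C : R := 1 + G2 + 2 * G1.
pose X : R := 2 * C ^+ 2 * N.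
have C0 : 0 <= C by rewrite /C; move: G10 G20; clear; lra.
pose pr : R := expR (1 * X) * ((1 + 2 / 1) ^+ 2 * (csb R / c2 * s1 * s2)) ^+ m.
pose E (g : (I -> R) * (I -> R)) := [set w | (nrm (app d (sysA a w) (tU g.1)) / s1) ^+ 2 +
                      (nrm (app d (sysA a w) (hatV b d g.1 g.2)) / s2) ^+ 2 <= X].
have hE g : List.In g r -> outer_le P (E g) pr.
  move=> /r1[Hg og].
  apply: (@pair_prob _ _ _ _ _ _ _ _ _ _ _ _ iid b g.1 g.2 s1 s2 c2 L 1 X c2P s1P s2P HL' ltr01) => k1 k2 k1s k2s.
  apply: Hg; rewrite geq_max; have inv (s' : R) : h <= s' -> (2 * s')^-1 <= (2 * h)^-1.
    by move=> hs; rewrite lef_pV2 ?posrE ?mulr_gt0// ?(lt_le_trans h0)// ler_pM2l.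
  have cv (k : int) (s' : R) : h <= s' -> `|k%:~R| < (2 * s')^-1 -> (absz k <= Mx)%N.
    move=> hs ks; apply: ltnW; rewrite -(ltr_nat R) -norm_int_absz; apply: lt_le_trans ks _.
    exact: le_trans (inv _ hs) hMx.
  by rewrite (cv _ _ hs1 k1s) (cv _ _ hs2 k2s).
have base : 0 <= (1 + 2 / 1) ^+ 2 * (csb R / c2 * s1 * s2).
  apply: mulr_ge0; first exact: sqr_ge0.
  exact: mulr_ge0 (mulr_ge0 (divr_ge0 (ltW (csb_gt0 R)) (ltW c0)) (ltW s10)) (ltW s20).
have pr0 : 0 <= pr by rewrite mulr_ge0 ?expR_ge0// exprn_ge0.
have sN0 : 0 < Num.sqrt N by rewrite sqrtr_gt0.
apply: outer_leS (outer_le_seq pr0 hE).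
- move=> w [x [y [og Hg inj dir [f1 f2]]]].
  have [g' g'r [/= hx hhy]] := r2 (x, y) Hg og.
  have [_ og'] := r1 _ g'r.
  have og2 : orthonormal2 (g'.1, g'.2) by [].
  have [/= xx yy xy] := og; have [/= xx0 yy0 xy0] := og2.
  exists g' => //=; rewrite /E/=.
  set A := sysA a w in inj dir f1 f2 *.
  set beta := G1 * _ * _ * _ in inj; set gam := G2 * _ * _ * _ in dir.
  have gam0 : 0 <= gam by rewrite !mulr_ge0 ?(ltW sN0) ?(ltW sd0) ?(ltW lam0).
  have l1 := nrm_app_U_diff (ltnW d1) gam0 inj dir xx xx0 hx.
  have hyh : hy ^+ 2 <= hy by rewrite expr2 ler_piMl// ltW.
  have hy2 : hy ^+ 2 <= hy * 1 by rewrite mulr1.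
  have dh : d%:R ^+ 4 * h <= 1 by move: d4h; have := mulr_gt0 (exprn_gt0 4 d0) h0; clear; lra.
  have l2 : nrm (app d A (hatV b d g'.1 g'.2)) <= nrm (app d A (hatV b d x y)) +
      (gam * hy + 2 * d%:R ^+ 2 * beta * h).
    apply: (nrm_app_V_diff (ltnW d1) gam0 inj dir b og og2 hx hhy).
    have -> : hy ^+ 2 = (d%:R ^+ 4 * h) * h by rewrite /hy; ring.
    by rewrite ler_piMl// ltW.
  have key (q s' : R) : 0 < s' -> 0 <= q -> q <= C * (Num.sqrt N * s') -> (q / s') ^+ 2 <= C ^+ 2 * N.
    move=> s'0 q0 qT; have hq : q / s' <= C * Num.sqrt N by rewrite ler_pdivrMr// -mulrA.
    have -> : C ^+ 2 * N = (C * Num.sqrt N) ^+ 2 by rewrite exprMn sqr_sqrtr ?(ltW N0).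
    by rewrite ler_sqr// nnegrE ?divr_ge0 ?(ltW s'0) ?mulr_ge0 ?(ltW sN0).
  have b1 : del <= Num.sqrt N * s1 by apply: le_trans hdel _; rewrite ler_pM2l.
  have b2 : del <= Num.sqrt N * s2 by apply: le_trans hdel _; rewrite ler_pM2l.
  have a1 : gam * h = G2 * (Num.sqrt N * s1) by rewrite /gam /s1 /sd; ring.
  have a2 : gam * hy = G2 * (Num.sqrt N * s2) by rewrite /gam /s2 /sd; ring.
  have a3 : 2 * d%:R ^+ 2 * beta * h = 2 * G1 * (Num.sqrt N * s2) by rewrite /beta /s2 /hy /sd; ring.
  have a4 : 2 * d%:R ^+ 2 * beta * h ^+ 2 <= 2 * G1 * (Num.sqrt N * s1).
    have -> : 2 * d%:R ^+ 2 * beta * h ^+ 2 = 2 * G1 * (Num.sqrt N * s1) * hy by rewrite /beta /s1 /hy /sd; ring.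
    by rewrite ler_piMr//; exact: mulr_ge0 (mulr_ge0 (ler0n R 2) G10) (mulr_ge0 (ltW sN0) (ltW s10)).
  have k1 : (nrm (app d A (tU g'.1)) / s1) ^+ 2 <= C ^+ 2 * N.
    apply: key => //; first exact: nrm_ge0.
    by rewrite /C; move: l1 f1 b1 a1 a4; clear; lra.
  have k2 : (nrm (app d A (hatV b d g'.1 g'.2)) / s2) ^+ 2 <= C ^+ 2 * N.
    apply: key => //; first exact: nrm_ge0.
    by rewrite /C; move: l2 f2 b2 a2 a3; clear; lra.
  by move: k1 k2; rewrite /X; clear; lra.
rewrite /pr mul1r.
have -> : (1 + 2 / 1) ^+ 2 * (csb R / c2 * s1 * s2) = 9 * csb R / c2 * (lam ^+ 2 * d%:R ^+ 3 * h ^+ 2).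
  have -> : csb R / c2 * s1 * s2 = csb R / c2 * (s1 * s2) by rewrite -mulrA.
  have -> : s1 * s2 = lam ^+ 2 * (sd ^+ 2 * d%:R ^+ 2) * h ^+ 2 by rewrite /s1 /s2 /hy; ring.
  by rewrite sd2 divr1; ring.
rewrite /X -/C; apply: ler_wpM2r.
  have l3 : 0 <= lam ^+ 2 * d%:R ^+ 3 * h ^+ 2 by rewrite mulr_ge0 ?sqr_ge0// mulr_ge0 ?sqr_ge0// exprn_ge0// ltW.
  apply: mulr_ge0 (expR_ge0 _) (exprn_ge0 _ (mulr_ge0 (divr_ge0 (mulr_ge0 (ler0n R 9) _) (ltW c0)) l3)).
  exact: ltW (csb_gt0 R).
apply: le_trans r3 _.
have inv (u : R) : 0 < u -> u <= 1 -> 0 <= 1 + 2 / u /\ 1 + 2 / u <= 3 / u.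
  move=> u0 u1; have : 1 <= u^-1 by rewrite invf_ge1.
  by clear=> ?; split; lra.
have [i1 i2] := inv _ h0 h1; have [i3 i4] := inv _ hy0 hy1.
have A0 : 0 <= 4 * N ^+ 2 by exact: mulr_ge0 (ler0n R 4) (sqr_ge0 N).
have N40 : 0 <= N ^+ 4 by rewrite exprn_ge0 ?(ltW N0).
have B0 : 0 <= 1 + 2 * (6 * N ^+ 4 + 2) by move: N40; clear; lra.
apply: ler_wpM2l => //; apply: ler_wpM2l; first by rewrite mulr_ge0 ?expR_ge0 ?exprn_ge0.
apply: ler_pM; rewrite ?exprn_ge0//; apply: lerXn2r; rewrite ?nnegrE//.
  exact: le_trans i1 i2.
exact: le_trans i3 i4.
Qed.

(** The rows lose D^4 lam^6 each and the coarse rounding of y saves D^2, which leaves D^2 lam^6 =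
    lam^54 = D^(9/4). The second net power is k against k + 1 rows, whence the extra factor D^2 h /
    3. *)
Lemma final_product (R : realType) (K9 h D lam : R) (k : nat) :
  0 < h -> 0 < D -> 0 < lam -> lam ^+ 24 = D ->
  (3 / h) ^+ k.+1 * (3 / (D ^+ 2 * h)) ^+ k * (K9 * D * lam ^+ 4 * (lam ^+ 2 * D ^+ 3 * h ^+ 2)) ^+ k.+1
  = (9 * K9 * lam ^+ 54) ^+ k.+1 * (D ^+ 2 * h / 3).
Proof.
move=> h0 D0 lam0 lamD.
have e1 : 3 / h * (3 / (D ^+ 2 * h)) * (K9 * D * lam ^+ 4 * (lam ^+ 2 * D ^+ 3 * h ^+ 2)) = 9 * K9 * lam ^+ 54.
  have -> : lam ^+ 54 = D ^+ 2 * lam ^+ 6 by rewrite -lamD; ring.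
  by field; rewrite !gt_eqF.
rewrite -e1 [in RHS]exprMn [(_ * _) ^+ k.+1 in RHS]exprMn [(3 / (D ^+ 2 * h)) ^+ k.+1]exprS.
set X := (3 / h) ^+ k.+1; set Y := (3 / (D ^+ 2 * h)) ^+ k; set Z := (_ * (_ * _)) ^+ k.+1.
by field; rewrite !gt_eqF.
Qed.

(** The factor exp (6 + C2) in the base of h pays for exp (4 N) from the net and exp (C2 N) from the
    small ball bound and leaves exp (- 2 N), half of which absorbs the polynomial factors. *)
Lemma final_numeric (R : realType) (K9 C2 h D lam N : R) (k : nat) :
  1 <= 9 * K9 -> 0 < D -> 1 <= lam -> lam ^+ 24 = D -> N = k.+2%:R ->
  h = D ^+ 3 / (9 * K9 * expR (6 + C2) * lam ^+ 54) ^+ k.+2 ->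
  4 * N ^+ 2 * (expR 3 * (1 + 2 * (6 * N ^+ 4 + 2)) ^+ 3) * D ^+ 5 <= expR N ->
  4 * N ^+ 2 * (expR (4 * N + 3) * (1 + 2 * (6 * N ^+ 4 + 2)) ^+ 3 *
      ((3 / h) ^+ k.+1 * (3 / (D ^+ 2 * h)) ^+ k)) *
   (expR (C2 * N) * (K9 * D * lam ^+ 4 * (lam ^+ 2 * D ^+ 3 * h ^+ 2)) ^+ k.+1) <= expR (- N).
Proof.
move=> K1 D0 lam1 lamD NE hE poly.
have lam0 : 0 < lam by exact: lt_le_trans lam1.
have l0 : 0 < lam ^+ 54 by rewrite exprn_gt0.
have l1 : 1 <= lam ^+ 54 by rewrite exprn_ege1.
pose K : R := 9 * K9.
have K0 : 0 < K by exact: lt_le_trans K1.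
pose Q : R := K * lam ^+ 54.
have Q1 : 1 <= Q by apply: mulr_ege1.
have Q0 : 0 < Q by exact: lt_le_trans Q1.
have E0 := expR_gt0 ((6 + C2 : R)).
have hE' : h = D ^+ 3 / (Q ^+ k.+2 * expR ((6 + C2) * N)).
  rewrite hE; congr (_ / _); rewrite (mulrC (6 + C2)) NE expRM_natl -exprMn; congr (_ ^+ _).
  by rewrite /Q /K; ring.
have h0 : 0 < h by rewrite hE' divr_gt0 ?exprn_gt0// mulr_gt0 ?exprn_gt0 ?expR_gt0.
set p := (1 + 2 * (6 * N ^+ 4 + 2)) ^+ 3.
have prod := final_product K9 k h0 D0 lam0 lamD.
have key : (3 / h) ^+ k.+1 * (3 / (D ^+ 2 * h)) ^+ k * (K9 * D * lam ^+ 4 * (lam ^+ 2 * D ^+ 3 * h ^+ 2)) ^+ k.+1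
    <= D ^+ 5 * expR (- ((6 + C2) * N)).
  rewrite prod hE' -/K -/Q expRN.
  have -> : Q ^+ k.+1 * (D ^+ 2 * (D ^+ 3 / (Q ^+ k.+2 * expR ((6 + C2) * N))) / 3) =
     D ^+ 5 * (expR ((6 + C2) * N))^-1 * (3 * Q)^-1.
    rewrite [Q ^+ k.+2]exprS; have := expR_gt0 ((6 + C2) * N); have := exprn_gt0 k.+1 Q0.
    by move: Q0; clear=> Q0 q0 e0; field; rewrite !gt_eqF.
  rewrite ler_piMr ?mulr_ge0 ?exprn_ge0 ?invr_ge0 ?expR_ge0 ?(ltW D0)//.
  have Q3 : 1 <= 3 * Q by apply: mulr_ege1 => //; clear; lra.
  by rewrite invf_le1 ?(lt_le_trans ltr01 Q3).
set A := (3 / h) ^+ _ in key *; set B := (3 / (_ * _)) ^+ _ in key *; set Cc := (_ * _) ^+ k.+1 in key *.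
have N0 : 0 <= N by rewrite NE.
have p0 : 0 <= p.
  have N40 : 0 <= N ^+ 4 by rewrite exprn_ge0.
  by rewrite exprn_ge0//; move: N40; clear; lra.
have -> : 4 * N ^+ 2 * (expR (4 * N + 3) * p * (A * B)) * (expR (C2 * N) * Cc) =
   (4 * N ^+ 2 * (expR 3 * p)) * (expR (4 * N) * expR (C2 * N)) * (A * B * Cc) by rewrite expRD; ring.
have q0 : 0 <= 4 * N ^+ 2 * (expR 3 * p) by exact: mulr_ge0 (mulr_ge0 (ler0n R 4) (sqr_ge0 N)) (mulr_ge0 (expR_ge0 _) p0).
apply: le_trans (ler_wpM2l _ key) _; first exact: mulr_ge0 q0 (mulr_ge0 (expR_ge0 _) (expR_ge0 _)).
have -> : 4 * N ^+ 2 * (expR 3 * p) * (expR (4 * N) * expR (C2 * N)) * (D ^+ 5 * expR (- ((6 + C2) * N))) =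
  4 * N ^+ 2 * (expR 3 * p) * D ^+ 5 * (expR (4 * N) * expR (C2 * N) * expR (- ((6 + C2) * N))) by ring.
rewrite -!expRD.
have -> : 4 * N + C2 * N - (6 + C2) * N = - (2 * N) by ring.
apply: le_trans (ler_wpM2r (expR_ge0 _) poly) _.
by rewrite -expRD ler_expR; move: N0; clear; lra.
Qed.

Lemma monomial_le_expR (R : realType) (s K : R) (k : nat) :
  1 <= s -> 0 <= K <= s -> (k.+1)%:R <= s -> K * s ^+ k <= expR (s ^+ 16).
Proof.
move=> s1 /andP[K0 Ks] ks; have s0 : 0 < s by exact: lt_le_trans s1.
apply: (@le_trans _ _ (s ^+ k.+1)); first by rewrite exprS ler_pM2r ?exprn_gt0.
apply: le_trans (exprn_le_expR _ (ltW s0)) _; rewrite ler_expR.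
apply: (@le_trans _ _ (s * s)); first by rewrite ler_pM2r.
rewrite -expr2 -[16%N]/(2 + 14)%N exprD ler_peMr ?sqr_ge0//; exact: exprn_ege1.
Qed.

Lemma final_conditions (R : realType) (N s D lam K0 S0 : R) (n : nat) :
  N = n%:R -> s ^+ 16 = N -> 1 <= D -> 1 <= lam -> lam ^+ 24 = D -> expR 1 <= K0 ->
  300 <= S0 -> K0 ^+ 4 <= S0 -> 4 * expR 3 * 17 ^+ 3 <= S0 -> S0 * D ^+ 40 <= s ->
  let h := D ^+ 3 / (K0 * lam ^+ 54) ^+ n in
  [/\ 4 * N ^+ 2 * (expR 3 * (1 + 2 * (6 * N ^+ 4 + 2)) ^+ 3) * D ^+ 5 <= expR N,
      4 * N ^+ 3 * (D ^+ 4 * h) <= 1, h ^- 2 <= expR (N * s / 2) &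
      0 < h /\ h^-1 ^+ 5 <= (K0 ^+ 5 * D ^+ 12) ^+ n].
Proof.
move=> NE sN D1 lam1 lamD K0e S300 S4 S17 hs h.
have D0 : 0 < D by exact: lt_le_trans D1.
have D40 : 1 <= D ^+ 40 by rewrite exprn_ege1.
have lam0 : 0 < lam by exact: lt_le_trans lam1.
have S0p : 0 < S0 by move: S300; clear; lra.
have Ss : S0 <= s by apply: le_trans hs; rewrite ler_peMr// ltW.
have s300 : 300 <= s by exact: le_trans S300 Ss.
have s1 : 1 <= s by move: s300; clear; lra.
have s0 : 0 < s by exact: lt_le_trans s1.
have Ds : D <= s.
  apply: le_trans hs; apply: (@le_trans _ _ (1 * D ^+ 40)).
    by rewrite mul1r exprS ler_peMr ?(ltW D0)// exprn_ege1.
  by rewrite ler_pM2r ?exprn_gt0//; move: S300; clear; lra.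
have K1 : 1 <= K0 by apply: le_trans K0e; have := expR_ge1Dx (1 : R); clear; lra.
have K00 : 0 < K0 by exact: lt_le_trans K1.
have l1 : 1 <= lam ^+ 54 by rewrite exprn_ege1.
have l0 : 0 < lam ^+ 54 by rewrite exprn_gt0.
pose Q : R := K0 * lam ^+ 54.
have QK : K0 <= Q by rewrite ler_peMr// ltW.
have Q1 : 1 <= Q by exact: le_trans QK.
have Q0 : 0 < Q by exact: lt_le_trans Q1.
have Qn0 : 0 < Q ^+ n by rewrite exprn_gt0.
have QN : expR N <= Q ^+ n.
  rewrite NE -[n%:R]mulr1 expRM_natl; apply: lerXn2r; rewrite ?nnegrE ?expR_ge0 ?(ltW Q0)//.
  exact: le_trans K0e QK.
have D30 : 0 < D ^+ 3 by rewrite exprn_gt0.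
have h0 : 0 < h by rewrite divr_gt0.
have hV : h^-1 <= Q ^+ n.
  rewrite /h invf_div -/Q ler_pdivrMr// ler_peMr ?(ltW Qn0)//; exact: exprn_ege1.
have hV0 : 0 <= h^-1 by rewrite invr_ge0 ltW.
split=> //.
(* Here 5 + 12 N^4 <= 17 N^4, N^2 (N^4)^3 = s^224 and D^5 <= s^5. *)
- apply: (@le_trans _ _ ((4 * expR 3 * 17 ^+ 3) * s ^+ 229)); last first.
    rewrite -sN; apply: monomial_le_expR => //; last by move: s300; clear; lra.
    by rewrite (le_trans S17 Ss) andbT !mulr_ge0 ?expR_ge0 ?exprn_ge0.
  have N1 : 1 <= N ^+ 4 by rewrite -sN -exprM exprn_ege1.
  have b : (1 + 2 * (6 * N ^+ 4 + 2)) ^+ 3 <= (17 * N ^+ 4) ^+ 3.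
    by apply: lerXn2r; rewrite ?nnegrE; move: N1; clear; lra.
  have -> : 4 * expR 3 * 17 ^+ 3 * s ^+ 229 = 4 * N ^+ 2 * (expR 3 * (17 * N ^+ 4) ^+ 3) * s ^+ 5.
    by rewrite -sN; ring.
  have N20 : 0 <= 4 * N ^+ 2 by exact: mulr_ge0 (ler0n R 4) (sqr_ge0 N).
  have p0 : 0 <= (1 + 2 * (6 * N ^+ 4 + 2)) ^+ 3 by rewrite exprn_ge0//; move: N1; clear; lra.
  apply: ler_pM.
  + exact: mulr_ge0 N20 (mulr_ge0 (expR_ge0 _) p0).
  + by rewrite exprn_ge0// ltW.
  + by rewrite ler_wpM2l// ler_wpM2l// expR_ge0.
  + by apply: lerXn2r; rewrite ?nnegrE ?(ltW D0) ?(ltW s0).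
- have -> : 4 * N ^+ 3 * (D ^+ 4 * h) = 4 * N ^+ 3 * D ^+ 7 / Q ^+ n by rewrite /h -/Q; ring.
  rewrite ler_pdivrMr// mul1r; apply: le_trans QN; rewrite -[in X in _ <= X]sN.
  apply: le_trans (@monomial_le_expR R s 4 55 s1 _ _); last 2 first.
  + by rewrite ler0n/=; move: s300; clear; lra.
  + by move: s300; clear; lra.
  have -> : 4 * s ^+ 55 = 4 * N ^+ 3 * s ^+ 7 by rewrite -sN; ring.
  have N0 : 0 <= N by rewrite -sN exprn_ge0// ltW.
  rewrite ler_wpM2l//; first by rewrite mulr_ge0// exprn_ge0.
  by apply: lerXn2r; rewrite ?nnegrE ?(ltW D0) ?(ltW s0).
- apply: (@le_trans _ _ ((Q ^+ 2) ^+ n)).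
    by rewrite -exprM mulnC exprM -exprVn; apply: lerXn2r; rewrite ?nnegrE ?(ltW Qn0).
  have -> : N * s / 2 = n%:R * (s / 2) by rewrite NE mulrA.
  rewrite expRM_natl; apply: lerXn2r; rewrite ?nnegrE ?sqr_ge0 ?expR_ge0//.
  rewrite -(ler_sqr (x := Q ^+ 2)) ?nnegrE ?sqr_ge0 ?expR_ge0// -exprM.
  have -> : expR (s / 2) ^+ 2 = expR s by rewrite -expRM_natl; congr expR; field.
  apply: le_trans (expR_ge_id s); apply: le_trans hs.
  have -> : Q ^+ (2 * 2) = K0 ^+ 4 * D ^+ 9 by rewrite /Q -lamD; ring.
  apply: ler_pM; rewrite ?exprn_ge0 ?(ltW K00) ?(ltW D0)//.
  by rewrite -[40%N]/(9 + 31)%N exprD ler_peMr ?exprn_ge0 ?(ltW D0)// exprn_ege1.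
- split => //; apply: (@le_trans _ _ ((Q ^+ 5) ^+ n)).
    by rewrite -exprM mulnC exprM; apply: lerXn2r; rewrite ?nnegrE ?(ltW Qn0).
  have q5 : 0 <= Q ^+ 5 by rewrite exprn_ge0 ?(ltW Q0).
  have k5 : 0 <= K0 ^+ 5 * D ^+ 12 by rewrite mulr_ge0// exprn_ge0 ?(ltW K00) ?(ltW D0).
  apply: lerXn2r; rewrite ?nnegrE//.
  (* It remains to see lam^270 <= lam^288 = D^12. *)
  rewrite exprMn ler_pM2l ?exprn_gt0// -lamD -!exprM.
  exact: ler_weXn2l.
Qed.

(** Outside the first four exceptional events every pair considered is spread and without bad
    frequencies, and both norm bounds hold; it is then one of the pairs counted by [final_prob]. *)
Lemma common_small_whp (R : realType) (disp0 : measure_display) (Om0 : measurableType disp0)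
  (P0 : probability Om0 R) (xi : {RV P0 >-> R}) :
  subgaussian_tail xi -> ('E_P0[xi] = 0)%E -> ('V_P0[xi] = 1)%E ->
  exists K0 c0 S0 : R, [/\ 1 <= K0, 0 < c0 < 1, 1 <= S0 &
  forall (disp : measure_display) (Om : measurableType disp) (P : probability Om R)
    (k d : nat) (I : finType) (a : 'I_k.+1 * d.-tuple I -> {RV P >-> R}) (b : bool) (N lam s del : R),
    iid_copies xi a -> N = #|I|%:R -> #|I| = k.+2 -> 1 <= lam -> lam ^+ 24 = d%:R ->
    (1 < d)%N -> s ^+ 16 = N -> S0 * d%:R ^+ 40 <= s ->
    0 <= del -> del <= Num.sqrt N * (d%:R ^+ 3 / (K0 * lam ^+ 54) ^+ k.+2) ->
    outer_le P [set w | exists x y : I -> R, [/\ orthonormal2 (x, y),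
       nrm (app d (sysA a w) (tU x)) <= del & nrm (app d (sysA a w) (hatV b d x y)) <= del]]
      (c0 ^+ k.+2)].
Proof.
move=> tail mean var.
have [C C0 mgf] := subgaussian_mgf tail mean.
have [r0 [c [s0 [eta [/andP[r00 r01] /andP[c00 c01] s01 eta0 nonspr]]]]] := nonspread_whp tail mean var.
have r0P : 0 < r0 <= 1 by rewrite r00; move: r01; clear; lra.
have [cc [ccP str]] := structured_whp tail mean var r0P.
have /andP[cc0 cc1] := ccP.
pose K9 : R := 9 * csb R / cc.
have csb1 : 1 <= csb R by rewrite /csb; clear; lra.
have K91 : 1 <= 9 * K9.
  apply: mulr_ege1; first by clear; lra.
  by rewrite ler_pdivlMr// mul1r; apply: le_trans cc1 _; move: csb1; clear; lra.
pose C2 : R := 2 * (1 + cG2 C + 2 * cG1 C) ^+ 2.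
have C20 : 0 <= C2 by rewrite mulr_ge0// sqr_ge0.
pose K0 : R := 9 * K9 * expR (6 + C2).
have K0e : expR 1 <= K0.
  apply: (@le_trans _ _ (1 * expR (6 + C2))); last by rewrite ler_wpM2r ?expR_ge0.
  by rewrite mul1r ler_expR; move: C20; clear; lra.
have K01 : 1 <= K0 by apply: le_trans K0e; have := expR_ge1Dx (1 : R); clear; lra.
have G10 := cG1_ge0 C.
have G20 : 0 <= cG2 C by exact: addr_ge0 (mulr_ge0 (ler0n R 2) (sqrtr_ge0 _)) G10.
have K05 : 1 <= K0 ^+ 5 by rewrite exprn_ege1.
have [S1 [S11 strH]] := str (cG1 C) (K0 ^+ 5) G10 K05.
pose S0 : R := s0 + S1 + 300 + 16 / c + K0 ^+ 4 + 4 * expR 3 * 17 ^+ 3 + eta^-1.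
have p1 : 0 <= 16 / c by rewrite divr_ge0 ?(ltW c00).
have p2 : 0 <= K0 ^+ 4 by rewrite exprn_ge0// (le_trans ler01 K01).
have p3 : 0 <= 4 * expR 3 * 17 ^+ 3 :> R by rewrite !mulr_ge0 ?expR_ge0 ?exprn_ge0.
have p4 : 0 <= eta^-1 by rewrite invr_ge0 ltW.
have q1 : s0 <= S0 by rewrite /S0; move: S11 p1 p2 p3 p4; clear; lra.
have q2 : S1 <= S0 by rewrite /S0; move: s01 p1 p2 p3 p4; clear; lra.
have q3 : 300 <= S0 by rewrite /S0; move: s01 S11 p1 p2 p3 p4; clear; lra.
have q4 : 16 / c <= S0 by rewrite /S0; move: s01 S11 p1 p2 p3 p4; clear; lra.
have q5 : K0 ^+ 4 <= S0 by rewrite /S0; move: s01 S11 p1 p2 p3 p4; clear; lra.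
have q6 : 4 * expR 3 * 17 ^+ 3 <= S0 by rewrite /S0; move: s01 S11 p1 p2 p3 p4; clear; lra.
have q7 : eta^-1 <= S0 by rewrite /S0; move: s01 S11 p1 p2 p3 p4; clear; lra.
have S01 : 1 <= S0 by move: q3; clear; lra.
exists K0, (expR (- (c / 2))), S0; split => //.
  by rewrite expR_gt0 expR_lt1 oppr_lt0 divr_gt0.
clearbody S0.
move=> disp Om P k d I a b N lam s del iid NE Ik lam1 lamd d1 sN Ss del0 hdel.
have D1 : 1 <= d%:R :> R by rewrite ler1n ltnW.
have D0 : 0 < d%:R :> R by exact: lt_le_trans D1.
have D40 : 1 <= d%:R ^+ 40 :> R by rewrite exprn_ege1.
have lam0 : 0 < lam by exact: lt_le_trans lam1.
have S0p : 0 < S0 by exact: lt_le_trans S01.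
have S0s : S0 <= s by apply: le_trans Ss; rewrite ler_peMr// ltW.
have Ds : d%:R <= s.
  apply: le_trans Ss; apply: (@le_trans _ _ (1 * d%:R ^+ 40)).
    by rewrite mul1r [leRHS]exprS ler_peMr ?(ltW D0)// exprn_ege1.
  by rewrite ler_pM2r// exprn_gt0.
have s1 : 1 <= s by exact: le_trans S0s.
have NE' : N = k.+2%:R by rewrite NE Ik.
have := @final_conditions R N s d%:R lam K0 S0 k.+2 NE' sN D1 lam1 lamd K0e q3 q5 q6 Ss.
set h := d%:R ^+ 3 / _ in hdel *; move=> /= [poly hN hL [h0 hV5]].
have sNN : s <= N by rewrite -sN -[leLHS]expr1; apply: ler_weXn2l.
have N2 : 2 <= N by move: q3 S0s sNN; clear; lra.
have N0 : 0 < N by exact: lt_le_trans N2.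
have sqN0 : 0 < Num.sqrt N by rewrite sqrtr_gt0.
have h8 : 4 * h <= 1.
  apply: le_trans hN; rewrite -mulrA ler_wpM2l//.
  rewrite mulrA ler_peMl ?(ltW h0)//; apply: mulr_ege1; apply: exprn_ege1 => //.
  by move: N2; clear; lra.
have sh : s * h <= 1.
  apply: le_trans hN; apply: ler_pM; rewrite ?(ltW h0) ?(le_trans ler01 s1)//.
    apply: le_trans sNN _; have : N <= N ^+ 3 by rewrite exprS ler_peMr ?(ltW N0)// exprn_ege1//; move: N2; clear; lra.
    by move: N2; clear; lra.
  by rewrite ler_peMl ?(ltW h0)// exprn_ege1.
(* The generic estimate uses the frequencies up to (2 h)^-1, so bad levels have to be excluded up to
   there. *)
pose Mx : nat := (Num.trunc (2 * h)^-1).+1.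
have i0 : 0 <= (2 * h)^-1 by rewrite invr_ge0 mulr_ge0// ltW.
have M1 : (2 * h)^-1 <= Mx%:R by exact/ltW/real_truncnS_gt/ger0_real.
have M2 : Mx%:R <= h^-1.
  have : (Num.trunc (2 * h)^-1)%:R <= (2 * h)^-1 by rewrite truncn_le.
  have e : (2 * h)^-1 = h^-1 / 2 by rewrite invfM mulrC.
  have : 4 <= h^-1 by rewrite -(ler_pM2r h0) mulVf ?gt_eqF.
  by rewrite /Mx -natr1 e; clear; lra.
have Mx5 : Mx%:R ^+ 5 <= (K0 ^+ 5 * d%:R ^+ 12) ^+ k.+2.
  by apply: le_trans hV5; apply: lerXn2r; rewrite ?nnegrE ?ler0n ?invr_ge0 ?(ltW h0).
have delM : del * Mx%:R <= Num.sqrt N.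
  apply: (@le_trans _ _ (Num.sqrt N * h * h^-1)); first exact: ler_pM.
  by rewrite mulfK ?gt_eqF.
have deleta : del <= eta * Num.sqrt N.
  apply: le_trans hdel _; rewrite mulrC ler_pM2r//.
  have : h <= s^-1 by rewrite -(ler_pM2l (lt_le_trans ltr01 s1)) divff ?gt_eqF ?(lt_le_trans ltr01 s1).
  move=> /le_trans; apply; rewrite -[eta]invrK lef_pV2 ?posrE ?invr_gt0 ?(lt_le_trans ltr01 s1)//.
  exact: le_trans S0s.
have mI : (k.+1 <= #|I|)%N by rewrite Ik.
have N2m : N <= 2 * k.+1%:R.
  by rewrite NE' -natrM ler_nat mulSn mul1n addSnnS leq_addl.
have lam4 : 1 <= d%:R * lam ^+ 4 by apply: mulr_ege1 => //; apply: exprn_ege1.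
pose c2 : R := cc / (d%:R * lam ^+ 4).
have l40 : 0 < d%:R * lam ^+ 4 by exact: lt_le_trans lam4.
have c2P : 0 < c2 <= 1.
  by rewrite divr_gt0//= ler_pdivrMr// mul1r; exact: le_trans lam4.
have lam2 : lam ^+ 2 <= d%:R by rewrite -lamd; apply: ler_weXn2l.
have A1 := injective_bound_whp iid C0 NE N0 (ltn0Sn k) mI mgf lam1 lamd.
have A2 := dirderiv_bound_whp iid C0 NE N0 (ltn0Sn k) mI mgf lam1 lamd d1.
have A3 := nonspr _ _ _ _ _ _ _ _ _ _ iid NE (ltn0Sn k) mI N2m lam1 lamd d1 sN (le_trans q1 S0s) Ds.
have Ss1 : S1 * d%:R ^+ 40 <= s by apply: le_trans Ss; rewrite ler_pM2r ?exprn_gt0.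
have A4 := strH _ _ _ _ _ _ _ b _ _ _ _ _ iid NE Ik (ltn0Sn k) lam1 lamd d1 sN s1 Ss1 (ltn0Sn _) Mx5 del0 delM.
have A5 := final_prob b iid NE N2 d1 lam1 c2P G10 G20 h0 hN lam2 hL M1 hdel.
have := @final_numeric R K9 C2 h d%:R lam N k K91 D0 lam1 lamd NE' erefl poly.
have -> : K9 * d%:R * lam ^+ 4 * (lam ^+ 2 * d%:R ^+ 3 * h ^+ 2) = 9 * csb R / c2 * (lam ^+ 2 * d%:R ^+ 3 * h ^+ 2).
  by rewrite /c2 /K9; field; rewrite !gt_eqF.
move: A5; rewrite Ik [k.+2.-1]/= [k.+2.-2]/= -/C2 => A5 num.
have {num}A5 := outer_leS (@subset_refl _ _) num A5.
apply: outer_leS (outer_leU A1 (outer_leU A2 (outer_leU A3 (outer_leU A4 A5)))).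
- move=> w [x [y [og f1 f2]]]; apply: contrapT.
  move=> /not_orP[/contrapT inj /not_orP[/contrapT dir /not_orP[nspr /not_orP[nstr nfin]]]].
  have [/= xx yy xy] := og.
  have sx : spread (s ^+ 8) (r0 / (d%:R * lam ^+ 2)) x.
    apply: contrapT => nsx; apply: nspr; exists x; split => //; exact: le_trans deleta.
  have sy : b -> spread (s ^+ 8) (r0 / (d%:R * lam ^+ 2)) y.
    move=> bT; apply: contrapT => nsy; apply: nspr; exists y; split => //.
    by move: f2; rewrite bT => /le_trans; apply.
  apply: nfin; exists x, y; split => // k1 k2 kM; apply: contrapT => ng.
  by apply: nstr; exists x, y; split => //; exists k1, k2.
- have cN : expR (- N) <= expR (- (c * N)) by rewrite ler_expR lerN2 ler_piMl// ltW.
  (* The five events contribute 1 + 2 + 3 + 1 + 1 = 8 exponentials; half of the exponent absorbs the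
     8, since c N >= 16. *)
  apply: (@le_trans _ _ (8 * expR (- (c * N)))).
    by move: cN; set u := expR _; set v := expR _; clear; lra.
  rewrite -expRM_natl -NE'.
  have -> : N * - (c / 2) = - (c * N) + c * N / 2 by field.
  rewrite expRD mulrC ler_wpM2l ?expR_ge0//; apply: le_trans (expR_ge_id _).
  have : 16 <= c * N.
    have : 16 / c <= N by apply: le_trans q4 _; exact: le_trans S0s sNN.
    by rewrite ler_pdivrMr// mulrC.
  by clear; lra.
Qed.

(** * Measurability and the Jacobian *)

(* By compactness the infimum over [z] is attained, so that the event is a countable
   intersection over [j] of countable unions, over rational [z], of [G w z < j.+1%:R^-1]. *)
Lemma measurable_ex_le0 (R : realType) (disp : measure_display) (Om : measurableType disp) (N : nat)
  (G : Om -> 'rV[R]_N -> R) :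
  (forall z, measurable_fun setT (G ^~ z)) -> (forall w, continuous (G w)) ->
  (forall w z, G w z <= 0 -> forall i, `|z 0 i| <= 1) ->
  measurable [set w | exists z, G w z <= 0].
Proof.
move=> mG cG bG.
have aux (x y u : R) : x <= 0 -> `|x - y| < u -> y < u.
  by clear=> x0; rewrite ltr_norml => /andP[h _]; lra.
pose pt (p : nat * {ffun 'I_N -> int}) : 'rV[R]_N := \row_i ((p.2 i)%:~R / p.1.+1%:R).
(* The solutions have entries in [-1, 1]; the box is larger so that their rational approximations
   stay in it. *)
pose box : set 'rV[R]_N := [set z | forall i, (`[-2, 2]%classic : set R) (z ord0 i)].
have cbox : compact box by exact: (@rV_compact R N (fun=> `[-2, 2]%classic) (fun i => @segment_compact R _ _)).
have boxP z : box z <-> forall i, `|z 0 i| <= 2.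
  split=> h i; have := h i; rewrite /= in_itv/= ler_norml//.
have -> : [set w | exists z, G w z <= 0] =
  \bigcap_j \bigcup_p [set w | box (pt p) /\ G w (pt p) < j.+1%:R^-1].
  apply/seteqP; split=> [w [z Gz] j _|w Gw].
    have := cG w z; move=> /(@cvgrPdist_lt _ _ _ _ _ _) /(_ j.+1%:R^-1).
    rewrite invr_gt0 ltr0n => /(_ isT) /nbhs_ballP[e /= e0 he].
    have [k ke] : exists k, k.+1%:R^-1 < e.
      exists (Num.trunc e^-1); rewrite invf_plt ?posrE// ?ltr0n//.
      by apply: real_truncnS_gt; rewrite realV gtr0_real.
    have k0 : 0 < k.+1%:R :> R by rewrite ltr0n.
    exists (k, [ffun i => Num.floor (z 0 i * k.+1%:R)]) => //=.
    set p := (k, _).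
    have near i : `|z 0 i - pt p 0 i| <= k.+1%:R^-1.
      rewrite mxE/= ffunE.
      set F := Num.floor _; have -> : z 0 i - F%:~R / k.+1%:R = (z 0 i * k.+1%:R - F%:~R) / k.+1%:R.
        by field; rewrite gt_eqF.
      rewrite normrM [X in _ * X]ger0_norm ?invr_ge0 ?(ltW k0)//.
      rewrite ler_piMl ?invr_ge0 ?(ltW k0)//.
      have /andP[h1 h2] : F%:~R <= z 0 i * k.+1%:R < (F + 1)%:~R by exact: floor_itv.
      rewrite ger0_norm ?subr_ge0//; move: h2; rewrite intrD; clear; lra.
    split.
      apply/boxP => i; have h1 := bG _ _ Gz i; have h2 := near i.
      have h3 : k.+1%:R^-1 <= 1 :> R by rewrite invf_le1 ?ler1n.
      have -> : pt p 0 i = z 0 i - (z 0 i - pt p 0 i) by ring.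
      by apply: le_trans (ler_normB _ _) _; exact: lerD h1 (le_trans h2 h3).
    have /he : ball z e (pt p).
      by split => // i i'; rewrite ord1; exact: le_lt_trans (near i') ke.
    by move=> /= h; exact: aux Gz h.
  have [p0 _ [b0 _]] := Gw 0%N I.
  have wc : {within box, continuous (G w)} by apply: continuous_subspaceT.
  have [z zb zmin] := compact_EVT_min (ex_intro _ (pt p0) b0) cbox wc.
  exists z; rewrite leNgt; apply/negP => Gz0.
  have [p _ [pb pG]] := Gw (Num.trunc (G w z)^-1) I.
  have := zmin (pt p); rewrite inE => /(_ pb) h1; have := le_lt_trans h1 pG.
  apply/negP; rewrite -leNgt invf_ple ?posrE ?ltr0n//.
  by apply/ltW/real_truncnS_gt; rewrite realV gtr0_real.
apply: bigcap_measurable => // j _; apply: countable_bigcupT_measurable => // p.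
have [bp|nb] := pselect (box (pt p)); last first.
  have -> : [set w | box (pt p) /\ G w (pt p) < j.+1%:R^-1] = set0 by apply/seteqP; split => w [].
  exact: measurable0.
have -> : [set w | box (pt p) /\ G w (pt p) < j.+1%:R^-1] = setT `&` (G ^~ (pt p)) @^-1` `]-oo, j.+1%:R^-1[%classic.
  by apply/seteqP; split => w /=; rewrite in_itv/= => -[].
by apply: mG.
Qed.

Section TensorContinuity.
Context (R : realType) (Z : topologicalType) (I : finType).
Variables (x y : Z -> I -> R).
Hypothesis cx : forall i, continuous (x ^~ i).
Hypothesis cy : forall i, continuous (y ^~ i).

Lemma continuous_sum_fun (J : Type) (r : seq J) (F : J -> Z -> R) :
  (forall j, continuous (F j)) -> continuous (fun z => \sum_(j <- r) F j z).
Proof.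
move=> h; elim: r => [|j r IH] z; under eq_fun do rewrite ?big_nil ?big_cons.
  exact: cvg_cst.
by apply: cvgD; [exact: h|exact: IH].
Qed.

Lemma continuous_tU s : continuous (fun z => tU (x z) s).
Proof.
elim: s => [|i s IH] z; first by rewrite /tU; under eq_fun do rewrite big_nil; exact: cvg_cst.
rewrite /tU; under eq_fun do rewrite big_cons.
by apply: cvgM; [exact: cx|exact: IH].
Qed.

Lemma continuous_tV s : continuous (fun z => tV (x z) (y z) s).
Proof.
elim: s => [|i s IH] z /=; first exact: cvg_cst.
apply: cvgD; apply: cvgM; [exact: cx|exact: IH|exact: cy|exact: continuous_tU].
Qed.

Lemma continuous_dot : continuous (fun z => dot (x z) (y z)).
Proof. by apply: continuous_sum_fun => i z; apply: cvgM; [exact: cx|exact: cy]. Qed.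

End TensorContinuity.

Lemma measurable_app (R : realType) (disp : measure_display) (Om : measurableType disp)
  (P : probability Om R) (m d : nat) (I : finType) (a : 'I_m * d.-tuple I -> {RV P >-> R})
  (tau : seq I -> R) (l : 'I_m) : measurable_fun setT (fun w => app d (sysA a w) tau l).
Proof.
under eq_fun do rewrite app_sys /row.
by apply: measurable_sum => t; apply: measurable_funM => //; exact: measurable_cst.
Qed.

(** All conditions are merged into one continuous function of the pair, read as a point of R^(n+n):
    [O] vanishes exactly on orthonormal pairs, and u + |u| <= 0 exactly when u <= 0. *)
Lemma measurable_pair_event (R : realType) (disp : measure_display) (Om : measurableType disp)
  (P : probability Om R) (m d n : nat) (a : 'I_m * d.-tuple 'I_n -> {RV P >-> R})
  (T : ('I_n -> R) -> ('I_n -> R) -> seq 'I_n -> R) (c1 c2 : R) :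
  0 <= c1 -> 0 <= c2 ->
  (forall s, continuous (fun z : 'rV[R]_(n + n) => T (fun i => z 0 (lshift n i)) (fun i => z 0 (rshift n i)) s)) ->
  measurable [set w | exists x y : 'I_n -> R, [/\ orthonormal2 (x, y),
    nrm (app d (sysA a w) (tU x)) <= c1 & nrm (app d (sysA a w) (T x y)) <= c2]].
Proof.
move=> c10 c20 cT.
pose x (z : 'rV[R]_(n + n)) i := z 0 (lshift n i); pose y (z : 'rV[R]_(n + n)) i := z 0 (rshift n i).
have cx i : continuous (x ^~ i) by exact: coord_continuous.
have cy i : continuous (y ^~ i) by exact: coord_continuous.
pose F1 w z := dot (app d (sysA a w) (tU (x z))) (app d (sysA a w) (tU (x z))) - c1 ^+ 2.
pose F2 w z := dot (app d (sysA a w) (T (x z) (y z))) (app d (sysA a w) (T (x z) (y z))) - c2 ^+ 2.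
pose O z : R := (dot (x z) (x z) - 1) ^+ 2 + (dot (y z) (y z) - 1) ^+ 2 + dot (x z) (y z) ^+ 2.
pose G w z : R := O z + ((F1 w z + `|F1 w z|) + (F2 w z + `|F2 w z|)).
have pos (u : R) : 0 <= u + `|u| by have := ler_norm (- u); rewrite normrN; clear; lra.
have pos0 (u : R) : u + `|u| <= 0 -> u <= 0.
  by move=> h; rewrite leNgt; apply/negP => u0; move: h; rewrite gtr0_norm//; move: u0; clear; lra.
have O0 z : 0 <= O z by rewrite !addr_ge0 ?sqr_ge0.
have sq0 (u : R) : u ^+ 2 <= 0 -> u = 0.
  by move=> h; apply/eqP; rewrite -sqrf_eq0 eq_le h sqr_ge0.
have GP w z : G w z <= 0 -> [/\ orthonormal2 (x z, y z), F1 w z <= 0 & F2 w z <= 0].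
  rewrite /G => h; have h1 := O0 z; have h2 := pos (F1 w z); have h3 := pos (F2 w z).
  have : O z <= 0 by move: h h2 h3; clear; lra.
  have k1 : F1 w z + `|F1 w z| <= 0 by move: h h1 h3; clear; lra.
  have k2 : F2 w z + `|F2 w z| <= 0 by move: h h1 h2; clear; lra.
  rewrite /O => k3; have s1 := sqr_ge0 (dot (x z) (x z) - 1); have s2 := sqr_ge0 (dot (y z) (y z) - 1).
  have s3 := sqr_ge0 (dot (x z) (y z)).
  split; [split => /= | exact: pos0 | exact: pos0].
  - by apply/eqP; rewrite -subr_eq0; apply/eqP/sq0; move: k3 s2 s3; clear; lra.
  - by apply/eqP; rewrite -subr_eq0; apply/eqP/sq0; move: k3 s1 s3; clear; lra.
  - by apply/sq0; move: k3 s1 s2; clear; lra.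
have -> : [set w | exists x y : 'I_n -> R, [/\ orthonormal2 (x, y),
    nrm (app d (sysA a w) (tU x)) <= c1 & nrm (app d (sysA a w) (T x y)) <= c2]] =
  [set w | exists z, G w z <= 0].
  apply/seteqP; split => w /=; last first.
    move=> [z /GP[og f1 f2]]; exists (x z), (y z); split => //.
      by rewrite nrm_le_sq//; move: f1; rewrite /F1 subr_le0.
    by rewrite nrm_le_sq//; move: f2; rewrite /F2 subr_le0.
  move=> [x' [y' [[/= xx yy xy] f1 f2]]].
  exists (row_mx (\row_i x' i) (\row_i y' i)); set z := row_mx _ _.
  have -> : G w z = (F1 w z + `|F1 w z|) + (F2 w z + `|F2 w z|).
    have xz : x z = x' by apply/funext => i; rewrite /x /z row_mxEl mxE.
    have yz : y z = y' by apply/funext => i; rewrite /y /z row_mxEr mxE.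
    by rewrite /G /O xz yz xx yy xy subrr expr0n/= !add0r.
  have xz : x z = x' by apply/funext => i; rewrite /x /z row_mxEl mxE.
  have yz : y z = y' by apply/funext => i; rewrite /y /z row_mxEr mxE.
  have g1 : F1 w z <= 0 by rewrite /F1 xz subr_le0 -nrm_le_sq.
  have g2 : F2 w z <= 0 by rewrite /F2 xz yz subr_le0 -nrm_le_sq.
  by rewrite !ler0_norm// !subrr addr0.
apply: measurable_ex_le0.
- move=> z; apply: measurable_funD; first exact: measurable_cst.
  have mF tau c : measurable_fun setT (fun w : Om => dot (app d (sysA a w) tau) (app d (sysA a w) tau) - c).
    apply: measurable_funB; last exact: measurable_cst.
    by apply: measurable_sum => l; apply: measurable_funM; exact: measurable_app.
  have mP (F : Om -> R) : measurable_fun setT F -> measurable_fun setT (fun w => F w + `|F w|).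
    by move=> mF'; apply: measurable_funD => //; exact: measurableT_comp.
  by apply: measurable_funD; apply: mP; exact: mF.
- move=> w; have cP (F : 'rV[R]_(n + n) -> R) : continuous F -> continuous (fun z => F z + `|F z|).
    by move=> cF z; exact: (cvgD (cF z) (cvg_norm (cF z))).
  have cS (F : 'rV[R]_(n + n) -> R) : continuous F -> continuous (fun z => F z ^+ 2).
    by move=> cF z; under eq_fun do rewrite expr2; exact: (cvgM (cF z) (cF z)).
  have cC (F : 'rV[R]_(n + n) -> R) c : continuous F -> continuous (fun z => F z - c).
    by move=> cF z; exact: (cvgB (cF z) (cvg_cst c)).
  have cA tau : (forall s, continuous (fun z : 'rV[R]_(n + n) => tau z s)) ->
      forall l, continuous (fun z => app d (sysA a w) (tau z) l).
    move=> ct l; apply: continuous_sum_fun => t z.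
    exact: (cvgM (cvg_cst (sysA a w l t)) (ct (tval t) z)).
  have c12 : continuous (F1 w) /\ continuous (F2 w).
    split; apply: cC; apply: continuous_dot => l; apply: cA => s //; exact: continuous_tU.
  have [cF1 cF2] := c12.
  have dxx := continuous_dot cx cx; have dyy := continuous_dot cy cy; have dxy := continuous_dot cx cy.
  move=> z; exact: (cvgD (cvgD (cvgD (cS _ (cC _ 1 dxx) z) (cS _ (cC _ 1 dyy) z)) (cS _ dxy z))
    (cvgD (cP _ cF1 z) (cP _ cF2 z))).
- move=> w z /GP[[/= xx yy _] _ _] i.
  rewrite -[i]splitK; case: (fintype.split i) => j /=.
    by have := nrm_coord (x z) j; rewrite nrm1.
  by have := nrm_coord (y z) j; rewrite nrm1.
Qed.

Lemma is_derive_coord (R : realType) (n : nat) (i : 'I_n) (x v : 'cV[R]_n) :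
  is_derive x v (fun z : 'cV[R]_n => z i 0) (v i 0).
Proof.
suff h : (fun t : R => t^-1 *: ((t *: v + x) i 0 - x i 0)) @ 0^' --> (v i 0 : R).
  by apply: DeriveDef; [apply/cvg_ex; exists (v i 0)|exact: cvg_lim].
apply: (@cvg_trans _ ((fun=> v i 0) @ (0 : R)^')); last exact: cvg_cst.
apply: near_eq_cvg; near=> t; rewrite !mxE addrK /GRing.scale/= mulrA mulVf ?mul1r//.
by near: t; exact: nbhs_dnbhs_neq.
Unshelve. all: by end_near. Qed.

(** The product rule is the recursion that defines [tV]. *)
Lemma is_derive_tU (R : realType) (n : nat) (s : seq 'I_n) (x v : 'cV[R]_n) :
  is_derive x v (fun z : 'cV[R]_n => tU (fun i => z i 0) s) (tV (fun i => x i 0) (fun i => v i 0) s).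
Proof.
elim: s => [|i s IH] /=.
  by rewrite /tU; under eq_fun do rewrite big_nil; exact: is_derive_cst.
have -> : (fun z : 'cV[R]_n => tU (fun j => z j 0) (i :: s)) =
    (fun z : 'cV[R]_n => z i 0) * (fun z : 'cV[R]_n => tU (fun j => z j 0) s).
  by apply/funext => z; rewrite /tU big_cons.
apply: is_derive_eq; first exact: (is_deriveM (is_derive_coord i x v) IH).
by rewrite /GRing.scale/= [X in _ + X]mulrC.
Qed.

(** The columns of the Jacobian are derivatives along the basis vectors, and [tV] is linear in the
    direction. *)
Lemma jacobian_poly_system (R : realType) (m d n : nat) (A : 'I_m * d.-tuple 'I_n -> R)
  (x y : 'cV[R]_n) (l : 'I_m) :
  (jacobian_mx (poly_system A) x *m y) l 0 =
  \sum_(t : d.-tuple 'I_n) A (l, t) * tV (fun i => x i 0) (fun i => y i 0) t.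
Proof.
have D v : is_derive x v (fun z : 'cV[R]_n => poly_system A z l 0)
    (\sum_(t : d.-tuple 'I_n) A (l, t) * tV (fun i => x i 0) (fun i => v i 0) t).
  have -> : (fun z : 'cV[R]_n => poly_system A z l 0) =
     (fun z => \sum_(k < size (index_enum (d.-tuple 'I_n))) A (l, tnth (in_tuple (index_enum (d.-tuple 'I_n))) k)
        * tU (fun i => z i 0) (tnth (in_tuple (index_enum (d.-tuple 'I_n))) k)).
    apply/funext => z; rewrite mxE big_tnth; apply: eq_bigr => k _; congr (_ * _).
    by rewrite /tU big_tuple.
  rewrite big_tnth.
  have -> : (fun z : 'cV[R]_n => \sum_(k < size (index_enum (d.-tuple 'I_n)))
      A (l, tnth (in_tuple (index_enum (d.-tuple 'I_n))) k)
        * tU (fun i => z i 0) (tnth (in_tuple (index_enum (d.-tuple 'I_n))) k)) =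
    \sum_(k < size (index_enum (d.-tuple 'I_n))) A (l, tnth (in_tuple (index_enum (d.-tuple 'I_n))) k)
        \*: (fun z : 'cV[R]_n => tU (fun i => z i 0) (tnth (in_tuple (index_enum (d.-tuple 'I_n))) k)).
    by apply/funext => z; rewrite fct_sumE.
  by apply: is_derive_sum => k; apply: is_deriveZ; exact: is_derive_tU.
rewrite mxE; under eq_bigr do rewrite mxE (@derive_val _ _ _ _ _ _ _ (D _)).
have lin s : \sum_j tV (fun i => x i 0) (fun i => (delta_mx j 0 : 'cV[R]_n) i 0) s * y j 0 =
    tV (fun i => x i 0) (fun i => y i 0) s.
  elim: s => [|i s IH] /=; first by rewrite big1// => j _; rewrite mul0r.
  rewrite -IH mulr_sumr (eq_bigr (fun j => x i 0 * (tV (fun i => x i 0) (fun i => (delta_mx j 0 : 'cV[R]_n) i 0) s * y j 0)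
     + (i == j)%:R * (y j 0 * tU (fun i => x i 0) s))); last by move=> j _; rewrite mxE andbT; ring.
  rewrite big_split/=; congr (_ + _); rewrite (bigD1 i)//= eqxx mul1r big1 ?addr0// => j ji.
  by rewrite eq_sym (negPf ji) mul0r.
under eq_bigr do rewrite mulr_suml.
rewrite exchange_big/=; apply: eq_bigr => t _; rewrite -lin mulr_sumr.
by apply: eq_bigr => j _; rewrite mulrA.
Qed.

(** * Transfer to column vectors *)

Section PolySystem.
Context (R : realType).

Lemma norm2_nrm (n : nat) (u : 'cV[R]_n) : norm2 u = nrm (fun i => u i 0).
Proof. by rewrite /norm2 /nrm /dot; under eq_bigr do rewrite expr2. Qed.

Lemma norm2_le0 (n : nat) (u : 'cV[R]_n) : norm2 u <= 0 <-> u = 0.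
Proof.
rewrite norm2_nrm; split=> [u0|->]; last by rewrite /nrm /dot big1 ?sqrtr0// => i _; rewrite mxE mulr0.
apply/matrixP => i j; rewrite ord1 mxE.
by apply: (nrm_eq0 (u := fun i => u i 0)); apply/eqP; rewrite eq_le u0 nrm_ge0.
Qed.

Context (disp : measure_display) (Om : measurableType disp) (P : probability Om R).
Context (m d n : nat) (a : 'I_m * d.-tuple 'I_n -> {RV P >-> R}).

Lemma norm2_poly_system (w : Om) (x : 'cV[R]_n) :
  norm2 (poly_system (fun li => a li w) x) = nrm (app d (sysA a w) (tU (fun i => x i 0))).
Proof.
rewrite norm2_nrm; congr nrm; apply/funext => l; rewrite app_sys /row mxE.
by apply: eq_bigr => t _; rewrite mulrC /tU big_tuple.
Qed.

Lemma norm2_jacobian (w : Om) (x y : 'cV[R]_n) :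
  norm2 (jacobian_mx (poly_system (fun li => a li w)) x *m y) =
  nrm (app d (sysA a w) (tV (fun i => x i 0) (fun i => y i 0))).
Proof.
rewrite norm2_nrm; congr nrm; apply/funext => l; rewrite app_sys /row jacobian_poly_system.
by apply: eq_bigr => t _; rewrite mulrC.
Qed.

(** One event with two thresholds serves all parts: a threshold 0 expresses exact vanishing. *)
Definition pair_event (T : ('I_n -> R) -> ('I_n -> R) -> seq 'I_n -> R) (c1 c2 : R) : set Om :=
  [set w | exists x y : 'I_n -> R, [/\ orthonormal2 (x, y),
    nrm (app d (sysA a w) (tU x)) <= c1 & nrm (app d (sysA a w) (T x y)) <= c2]].

Lemma orthonormal2_cV (x y : 'cV[R]_n) :
  [/\ unit_sphere x, unit_sphere y & dotp x y = 0] <->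
  orthonormal2 (fun i => x i 0, fun i => y i 0).
Proof.
have us (z : 'cV[R]_n) : unit_sphere z <-> dot (fun i => z i 0) (fun i => z i 0) = 1.
  rewrite /unit_sphere/= norm2_nrm; split=> [h|]; last exact: nrm1.
  by rewrite -nrm_sq h expr1n.
by split=> -[/us hx /us hy xy].
Qed.

Lemma jacobian_pair_event (c1 c2 : R) :
  [set w | exists x y : 'cV[R]_n, [/\ unit_sphere x, unit_sphere y, dotp x y = 0,
     norm2 (poly_system (fun li => a li w) x) <= c1 &
     norm2 (jacobian_mx (poly_system (fun li => a li w)) x *m y) <= c2]] =
  pair_event (@tV R _) c1 c2.
Proof.
apply/seteqP; split => w.
  move=> [x [y [hx hy xy]]]; rewrite norm2_poly_system norm2_jacobian => f1 f2.
  by exists (fun i => x i 0), (fun i => y i 0); split => //; apply/orthonormal2_cV.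
move=> [x [y [og f1 f2]]]; pose x' : 'cV[R]_n := \col_i x i; pose y' : 'cV[R]_n := \col_i y i.
have xE : (fun i => x' i 0) = x by apply/funext => i; rewrite mxE.
have yE : (fun i => y' i 0) = y by apply/funext => i; rewrite mxE.
have /orthonormal2_cV[hx hy xy] : orthonormal2 (fun i => x' i 0, fun i => y' i 0) by rewrite xE yE.
by exists x', y'; rewrite norm2_poly_system norm2_jacobian xE yE.
Qed.

Lemma values_pair_event (c1 c2 : R) :
  [set w | exists x y : 'cV[R]_n, [/\ unit_sphere x, unit_sphere y, dotp x y = 0,
     norm2 (poly_system (fun li => a li w) x) <= c1 &
     norm2 (poly_system (fun li => a li w) y) <= c2]] =
  pair_event (fun _ y => tU y) c1 c2.
Proof.
apply/seteqP; split => w.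
  move=> [x [y [hx hy xy]]]; rewrite !norm2_poly_system => f1 f2.
  by exists (fun i => x i 0), (fun i => y i 0); split => //; apply/orthonormal2_cV.
move=> [x [y [og f1 f2]]]; pose x' : 'cV[R]_n := \col_i x i; pose y' : 'cV[R]_n := \col_i y i.
have xE : (fun i => x' i 0) = x by apply/funext => i; rewrite mxE.
have yE : (fun i => y' i 0) = y by apply/funext => i; rewrite mxE.
have /orthonormal2_cV[hx hy xy] : orthonormal2 (fun i => x' i 0, fun i => y' i 0) by rewrite xE yE.
by exists x', y'; rewrite !norm2_poly_system xE yE.
Qed.

Lemma measurable_pair_event_hat (b : bool) (c1 c2 : R) : 0 <= c1 -> 0 <= c2 ->
  measurable (pair_event (fun x y => if b then tU y else tV x y) c1 c2).
Proof.
move=> c10 c20; apply: measurable_pair_event => // s.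
by case: b; [apply: continuous_tU|apply: continuous_tV] => i; exact: coord_continuous.
Qed.

Lemma pair_event_sub_hat (b : bool) (c1 c2 del : R) : (0 < d)%N -> c1 <= del -> c2 <= del ->
  pair_event (fun x y => if b then tU y else tV x y) c1 c2 `<=`
  [set w | exists x y : 'I_n -> R, [/\ orthonormal2 (x, y),
    nrm (app d (sysA a w) (tU x)) <= del & nrm (app d (sysA a w) (hatV b d x y)) <= del]].
Proof.
move=> d0 h1 h2 w [x [y [og f1 f2]]]; exists x, y; split => //; first exact: le_trans h1.
apply: le_trans h2; apply: le_trans f2; case: b => //.
have -> : app d (sysA a w) (hatV false d x y) = fun l => (Num.sqrt d%:R)^-1 * app d (sysA a w) (tV x y) l.
  by apply/funext => l; rewrite !app_sys /row mulr_sumr; apply: eq_bigr => t _; rewrite /hatV; ring.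
rewrite nrmZ ger0_norm ?invr_ge0 ?sqrtr_ge0// ler_piMl ?nrm_ge0//.
have s1 : 1 <= Num.sqrt d%:R :> R by rewrite -[leLHS]sqrtr1 ler_wsqrtr// ler1n.
by rewrite invf_le1// (lt_le_trans ltr01).
Qed.

End PolySystem.

Theorem corollary1p14 (R : realType) (disp0 : measure_display)
    (Omega0 : measurableType disp0) (P0 : probability Omega0 R)
    (xi : {RV P0 >-> R})
    (xi_mean : ('E_P0[xi] = 0)%E) (xi_var : ('V_P0[xi] = 1)%E)
    (xi_tail : subgaussian_tail xi) :
  exists K0 c0 eps0 : R,
    [/\ 1 <= K0, 0 < c0 < 1, 0 < eps0 &
    exists N : nat, forall n : nat, (N <= n)%N ->
    forall d : nat, (2 <= d)%N -> d%:R <= n%:R `^ eps0 ->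
    forall eps : R, 0 < eps ->
    forall (disp : measure_display) (Omega : measurableType disp)
      (P : probability Omega R)
      (a : 'I_n.-1 * d.-tuple 'I_n -> {RV P >-> R}),
    iid_copies xi a ->
    let f (w : Omega) : 'cV[R]_n -> 'cV[R]_n.-1 :=
      poly_system (fun li => a li w) in
    let D (w : Omega) (x : 'cV[R]_n) : 'M[R]_(n.-1, n) :=
      jacobian_mx (f w) x in
    let double_root : set Omega :=
      [set w | exists x y : 'cV[R]_n,
        [/\ unit_sphere x, unit_sphere y, dotp x y = 0,
            f w x = 0 & D w x *m y = 0]] in
    let irregular_root : set Omega :=
      [set w | exists x y : 'cV[R]_n,
        [/\ unit_sphere x, unit_sphere y, dotp x y = 0, f w x = 0 &
            norm2 (D w x *m y) <= d%:R `^ (9 / 4) * Num.sqrt n%:R * eps]] in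
    let small_critical_value : set Omega :=
      [set w | exists x y : 'cV[R]_n,
        [/\ unit_sphere x, unit_sphere y, dotp x y = 0, D w x *m y = 0 &
            norm2 (f w x)
              <= d%:R `^ (9 / 8) * n%:R `^ (1 / 4) * eps ^+ 2]] in
    let simultaneous_vanishing : set Omega :=
      [set w | exists x y : 'cV[R]_n,
        [/\ unit_sphere x, unit_sphere y, dotp x y = 0,
            norm2 (f w x) <= (d%:R `^ (9 / 2) * n%:R) `^ (1 / 4) * eps &
            norm2 (f w y) <= (d%:R `^ (9 / 2) * n%:R) `^ (1 / 4) * eps]] in
    [/\ (P double_root <= (c0 ^+ n)%:E)%E,
        (maxe (P irregular_root) (P small_critical_value)
          <= (K0 ^+ n * d%:R `^ (9 * n%:R / 4) * eps + c0 ^+ n)%:E)%E &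
        (P simultaneous_vanishing
          <= (K0 ^+ n * d%:R `^ (9 * n%:R / 4) * eps `^ (1 / 2)
              + c0 ^+ n)%:E)%E]].
Proof.
have [K [c0 [S0 [K1 c0P S01 small]]]] := common_small_whp xi_tail xi_mean xi_var.
have /andP[c00 c01] := c0P.
(* Writing n as k + 2 turns the row type ['I_n.-1] into ['I_k.+1]. *)
have small' (disp : measure_display) (Om : measurableType disp) (P : probability Om R) (n d : nat)
    (a : 'I_n.-1 * d.-tuple 'I_n -> {RV P >-> R}) (b : bool) (lam s del : R) :
    iid_copies xi a -> (1 < n)%N -> 1 <= lam -> lam ^+ 24 = d%:R -> (1 < d)%N -> s ^+ 16 = n%:R ->
    S0 * d%:R ^+ 40 <= s -> 0 <= del -> del <= Num.sqrt n%:R * (d%:R ^+ 3 / (K * lam ^+ 54) ^+ n) ->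
    outer_le P [set w | exists x y : 'I_n -> R, [/\ orthonormal2 (x, y),
       nrm (app d (sysA a w) (tU x)) <= del & nrm (app d (sysA a w) (hatV b d x y)) <= del]] (c0 ^+ n).
  case: n a => [|[|k]] // a iid _ lam1 lamd d1 sn Ss del0 hdel.
  by apply: (small _ _ _ _ _ _ _ b k.+2%:R lam s) => //; rewrite card_ord.
(* With this exponent d^40 <= n^(1/32). As s = n^(1/16), one factor n^(1/32) of s pays for d^40 and
   the other for S0. *)
exists K, c0, ((32 * 40)^-1); split; [exact: K1|exact: c0P|by rewrite invr_gt0 mulr_gt0|].
(* This threshold gives both S0^32 <= n and n >= 3. *)
exists (Num.trunc (S0 ^+ 32)).+3 => n nN d d2 dn eps eps0 disp Omega P a iid f D.
pose Nn : R := n%:R.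
have S032 : S0 ^+ 32 <= Nn.
  apply: (@le_trans _ _ (Num.trunc (S0 ^+ 32)).+1%:R).
    by apply/ltW/real_truncnS_gt; rewrite ger0_real// exprn_ge0// (le_trans ler01).
  by rewrite ler_nat; exact: leq_trans (leq_trans (leqnSn _) (leqnSn _)) nN.
have n3 : (2 < n)%N by apply: leq_trans nN.
have Nn1 : 1 <= Nn by rewrite /Nn ler1n; exact: leq_trans n3.
have Nn0 : 0 < Nn by exact: lt_le_trans Nn1.
have pw (x e : R) k : 0 <= x -> x `^ e ^+ k = x `^ (e * k%:R).
  by move=> x0; rewrite -powR_mulrn ?powR_ge0// -powRrM.
have D1 : 1 <= d%:R :> R by rewrite ler1n; exact: leq_trans d2.
have D0 : 0 < d%:R :> R by exact: lt_le_trans D1.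
have d0 : (0 < d)%N by exact: leq_trans d2.
pose r : R := Nn `^ (32^-1).
have r32 : r ^+ 32 = Nn by rewrite /r pw ?(ltW Nn0)// mulVf// powRr1// ltW.
have r0 : 0 <= r by exact: powR_ge0.
have S0r : S0 <= r by rewrite -(@ler_pXn2r _ 32) ?nnegrE ?r32// (le_trans ler01).
have d40 : d%:R ^+ 40 <= r.
  have -> : r = (Nn `^ ((32 * 40)^-1)) ^+ 40 by rewrite pw ?(ltW Nn0)//; congr (_ `^ _); field.
  by apply: lerXn2r; rewrite ?nnegrE ?powR_ge0 ?(ltW D0).
pose s : R := r ^+ 2.
have sN : s ^+ 16 = Nn by rewrite -exprM.
have Ss : S0 * d%:R ^+ 40 <= s.
  by rewrite /s expr2; apply: ler_pM => //; exact: le_trans S01.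
pose lam : R := d%:R `^ (24^-1).
have lamd : lam ^+ 24 = d%:R by rewrite pw ?(ltW D0)// mulVf// powRr1// ltW.
have lam1 : 1 <= lam by rewrite -[leLHS](powRr0 d%:R) ler_powR.
have lam54 : lam ^+ 54 = d%:R `^ (9 / 4).
  by rewrite pw ?(ltW D0)//; congr (_ `^ _); field.
pose B : R := (K * lam ^+ 54) ^+ n.
have BE : K ^+ n * d%:R `^ (9 * n%:R / 4) = B.
  rewrite /B exprMn lam54 pw ?(ltW D0)//; congr (_ * _ `^ _); ring.
have B1 : 1 <= B by apply: exprn_ege1; apply: mulr_ege1 => //; exact: exprn_ege1.
have B0 : 0 < B by exact: lt_le_trans B1.
(* Each threshold of the theorem is 0 or at most Y times a power of eps. [core] asks for at most Y /
   B, so that the power of eps must be at most 1 / B. *)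
pose Y : R := d%:R `^ (9 / 4) * Num.sqrt Nn.
have sN0 : 0 <= Num.sqrt Nn by exact: sqrtr_ge0.
have Y0 : 0 <= Y by rewrite mulr_ge0// powR_ge0.
have c0n : 0 <= c0 ^+ n by rewrite exprn_ge0// ltW.
have core (b : bool) (c1 c2 : R) : 0 <= c1 -> 0 <= c2 -> c1 <= Y / B -> c2 <= Y / B ->
    (P (pair_event a (fun x y => if b then tU y else tV x y) c1 c2) <= (c0 ^+ n)%:E)%E.
  move=> c10 c20 h1 h2; apply: outer_leP; first exact: measurable_pair_event_hat.
  have YB0 : 0 <= Y / B by rewrite divr_ge0// ltW.
  apply: outer_leS (pair_event_sub_hat (a := a) (b := b) d0 h1 h2) (lexx _) _.
  (* The scale of [common_small_whp] has d^3 where Y has d^(9/4). *)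
  have hY : Y / B <= Num.sqrt Nn * (d%:R ^+ 3 / (K * lam ^+ 54) ^+ n).
    rewrite -/B mulrA ler_pM2r ?invr_gt0// /Y mulrC ler_wpM2l//.
    by rewrite -powR_mulrn ?(ltW D0)// ler_powR//; clear; lra.
  by apply: (small' _ _ _ _ _ a b lam s _ iid (ltnW n3)); rewrite // (le_trans hY).
(* The case of large eps: the first term of the right-hand side is already at least 1. *)
have triv (A : set Omega) (x : R) : measurable A -> 1 <= x -> (P A <= (x + c0 ^+ n)%:E)%E.
  move=> mA x1; apply: le_trans (probability_le1 P mA) _.
  by rewrite lee_fin; apply: le_trans x1 _; rewrite lerDl.
have weak (A : set Omega) (x : R) : 0 <= x -> (P A <= (c0 ^+ n)%:E)%E -> (P A <= (x + c0 ^+ n)%:E)%E.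
  by move=> x0 /le_trans; apply; rewrite lee_fin lerDr.
have jacE c1 c2 := jacobian_pair_event a c1 c2; have valE c1 c2 := values_pair_event a c1 c2.
have q4 : Nn `^ (1 / 4) <= Num.sqrt Nn.
  by rewrite -powR12_sqrt ?(ltW Nn0)// ler_powR//; clear; lra.
have y2 : d%:R `^ (9 / 8) * Nn `^ (1 / 4) <= Y.
  by apply: ler_pM; rewrite ?powR_ge0// ler_powR//; clear; lra.
have y3 : (d%:R `^ (9 / 2) * Nn) `^ (1 / 4) <= Y.
  rewrite powRM ?powR_ge0 ?(ltW Nn0)// -powRrM; apply: le_trans y2.
  by rewrite ler_wpM2r ?powR_ge0// ler_powR//; clear; lra.
have c1le (c t : R) : 0 <= t -> t * B <= 1 -> c <= Y -> c * t <= Y / B.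
  move=> t0 tB cY; apply: (@le_trans _ _ (Y * t)); first by rewrite ler_wpM2r.
  by rewrite ler_wpM2l// -[leRHS]mul1r ler_pdivlMr.
move=> dr ir sc sv.
have YB0 : 0 <= Y / B by rewrite divr_ge0// ltW.
have zP w x : norm2 (f w x) <= 0 <-> f w x = 0 by exact: norm2_le0.
have zD w x y : norm2 (D w x *m y) <= 0 <-> D w x *m y = 0 by exact: norm2_le0.
have drE : dr = pair_event a (@tV R _) 0 0.
  rewrite -jacE; apply/seteqP; split => w [x [y [h1 h2 h3 h4 h5]]]; exists x, y; split => //;
  by [apply/zP|apply/zD].
have irE : ir = pair_event a (@tV R _) 0 (Y * eps).
  by rewrite -jacE; apply/seteqP; split => w [x [y [h1 h2 h3 h4 h5]]]; exists x, y; split => //; apply/zP.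
have scE : sc = pair_event a (@tV R _) (d%:R `^ (9 / 8) * Nn `^ (1 / 4) * eps ^+ 2) 0.
  by rewrite -jacE; apply/seteqP; split => w [x [y [h1 h2 h3 h4 h5]]]; exists x, y; split => //; apply/zD.
have svE : sv = pair_event a (fun _ y => tU y) ((d%:R `^ (9 / 2) * Nn) `^ (1 / 4) * eps)
   ((d%:R `^ (9 / 2) * Nn) `^ (1 / 4) * eps) by rewrite -valE.
have mV c1 c2 : 0 <= c1 -> 0 <= c2 -> measurable (pair_event a (@tV R _) c1 c2) by exact: (measurable_pair_event_hat a false).
have coreV := core false; have coreU := core true.
have e20 : 0 <= eps ^+ 2 by exact: sqr_ge0.
have p1 : 0 <= Y * eps by rewrite mulr_ge0// ltW.
have p2 : 0 <= d%:R `^ (9 / 8) * Nn `^ (1 / 4) * eps ^+ 2 by rewrite mulr_ge0// mulr_ge0// powR_ge0.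
have p3 : 0 <= (d%:R `^ (9 / 2) * Nn) `^ (1 / 4) * eps by rewrite mulr_ge0 ?powR_ge0// ltW.
have small_eps : B * eps < 1 -> eps ^+ 2 * B <= 1 /\ eps * B <= 1.
  move=> h; have e1 : eps <= 1.
    by apply: le_trans (ltW h); rewrite ler_peMl// ltW.
  have h' : eps * B <= 1 by rewrite mulrC ltW.
  by split => //; apply: le_trans h'; rewrite ler_wpM2r ?(ltW B0)// expr2 ler_piMl// ltW.
split; rewrite ?BE.
- by rewrite drE; apply: coreV.
- rewrite ge_max; have [h|h] := leP 1 (B * eps).
    by apply/andP; split; apply: triv; rewrite ?irE ?scE//; exact: mV.
  have [h2 h1] := small_eps h.
  apply/andP; split; apply: weak; rewrite ?mulr_ge0 ?(ltW B0) ?(ltW eps0)//.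
    by rewrite irE; apply: coreV => //; apply: c1le => //; exact: ltW.
  by rewrite scE; apply: coreV => //; exact: c1le.
- have eh : eps `^ (1 / 2) = Num.sqrt eps by rewrite -powR12_sqrt ?(ltW eps0)// mul1r.
  have [h|h] := leP 1 (B * eps `^ (1 / 2)).
    by apply: triv => //; rewrite svE; exact: (measurable_pair_event_hat a true).
  apply: weak; first by rewrite mulr_ge0 ?powR_ge0// ltW.
  (* Write B eps as (B sqrt eps) sqrt eps; the second factor is at most 1 because B >= 1. *)
  have hB : B * eps <= 1.
    rewrite -[eps](sqr_sqrtr (ltW eps0)) expr2 mulrA -eh.
    have h0 : 0 <= eps `^ (1 / 2) by exact: powR_ge0.
    apply: le_trans (ltW h); rewrite ler_piMr ?mulr_ge0 ?(ltW B0)//.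
    by apply: le_trans (ltW h); rewrite ler_peMl.
  have eB : eps * B <= 1 by rewrite mulrC.
  by rewrite svE; apply: coreU => //; apply: c1le => //; exact: ltW.
Qed.
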